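(* Let $f\in\mathcal{P}_n$, let $0<p<1$ and let $N>n$ be an integer. Then $$|Z_p^{\diamondsuit}(f)|\le |Z_p^{\diamondsuit}(f^* )|.$$ Moreover, $$\mathbb{E}\,|\mathcal{Z}^{\diamondsuit}_{p,N}(f)|\le \mathbb{E}\,|\mathcal{Z}^{\diamondsuit}_{p,N}(f^* )|.$$
   Context: $\mathcal{P}_n$ denotes the set of measurable functions $f:\mathbb{R}^n\to[0,\infty)$ with $\int_{\mathbb{R}^n}f=1$ and finite essential supremum $\|f\|_\infty$. For a measurable set $A\subseteq\mathbb{R}^n$ of finite volume, $A^*$ is the open Euclidean ball centered at the origin with $|A^*|=|A|$; the symmetric decreasing rearrangement of $f$ is $f^*(x)=\int_0^\infty \chi_{\{f>t\}^*}(x)\,dt$. A set $K\subseteq\mathbb{R}^n$ is star-shaped if $0\in K$ and $\lambda x\in K$ whenever $x\in K$, $\lambda\in[0,1]$; its radial function is $\rho(K,u)=\sup\{\lambda\ge 0:\lambda u\in K\}\in[0,\infty]$, $u\in S^{n-1}$. Star-shaped sets below are specified through their radial functions (values $+\infty$ allowed), and their volume is $|K|=\omega_n\int_{S^{n-1}}\rho(K,u)^n\,d\sigma(u)\in[0,\infty]$, where $\sigma$ is the normalized rotation-invariant probability measure on $S^{n-1}$ and $\omega_n$ is the volume of the Euclidean unit ball. For $f\in\mathcal{P}_n$ and $p\in(0,1)$, $Z_p^\diamondsuit(f)$ is the star-shaped set with $\rho(Z_p^\diamondsuit(f),u)^{-p}=\int_{\mathbb{R}^n}|\langle x,u\rangle|^p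 f(x)\,dx$. For $N>n$, let $X_1,\dots,X_N$ be independent random vectors with density $f$; $\mathcal{Z}^\diamondsuit_{p,N}(f)$ is the random star-shaped set with $\rho(\mathcal{Z}^\diamondsuit_{p,N}(f),u)^{-p}=\frac1N\sum_{i=1}^N|\langle X_i,u\rangle|^p$. *)

(* Defs.v *)
(* All objects on R^n are built from an explicit
   Lebesgue outer measure on  I -> R  (I a finite index type; R^n = 'I_n -> R). *)
From HB Require Import structures.
From mathcomp Require Import all_boot all_order all_algebra.
From mathcomp Require Import all_classical all_reals all_analysis.
Set Implicit Arguments. Unset Strict Implicit. Unset Printing Implicit Defensive.
Import Order.TTheory GRing.Theory Num.Theory.
Import numFieldNormedType.Exports.
Local Open Scope classical_set_scope.
Local Open Scope ring_scope.

Definition dotp (R : realType) (I : finType) (x u : I -> R) : R :=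
  \sum_(i : I) x i * u i.
Definition enorm (R : realType) (I : finType) (x : I -> R) : R :=
  Num.sqrt (dotp x x).

Definition obox (R : realType) (I : finType) (a b : I -> R) : set (I -> R) :=
  [set x | forall i, a i < x i < b i].
Definition boxvol (R : realType) (I : finType) (a b : I -> R) : R :=
  \prod_(i : I) (b i - a i).

Definition leb_outer (R : realType) (I : finType) (A : set (I -> R)) : \bar R :=
  ereal_inf [set s : \bar R | exists a b : nat -> I -> R,
     [/\ forall k i, a k i <= b k i,
         A `<=` \bigcup_k obox (a k) (b k)
       & s = (\sum_(0 <= k <oo) (boxvol (a k) (b k))%:E)%E]].

Definition lmeasurable (R : realType) (I : finType) (A : set (I -> R)) : Prop :=
  forall B : set (I -> R),
    leb_outer B = (leb_outer (B `&` A) + leb_outer (B `&` ~` A))%E.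
Definition lmeasurable_fun (R : realType) (I : finType) (g : (I -> R) -> R) : Prop :=
  forall t : R, lmeasurable [set x | t < g x].

(* Lebesgue integral of a nonnegative function on I -> R (layer-cake formula) *)
Definition lint (R : realType) (I : finType) (g : (I -> R) -> \bar R) : \bar R :=
  (\int[lebesgue_measure]_(t in [set t : R | (0 < t)%R])
      leb_outer [set x | t%:E < g x])%E.

Definition Pdens (R : realType) (I : finType) (f : (I -> R) -> R) : Prop :=
  [/\ forall x, 0 <= f x,
      lmeasurable_fun f,
      lint (fun x => (f x)%:E) = 1%E
    & exists M : R, leb_outer [set x | M < f x] = 0%E].

Definition omega (R : realType) (I : finType) : \bar R :=
  leb_outer [set x : I -> R | enorm x < 1].

(* A^* : open ball centred at 0 with |A^*| = |A| *)
Definition ball_rearr (R : realType) (I : finType) (A : set (I -> R)) : set (I -> R) :=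
  [set x | (@omega R I * ((enorm x) ^+ #|I|)%:E < leb_outer A)%E].

Definition sdr (R : realType) (I : finType) (f : (I -> R) -> R) : (I -> R) -> R :=
  fun x => fine (\int[lebesgue_measure]_(t in [set t : R | (0 < t)%R])
                   (\1_(ball_rearr [set y | t < f y]) x)%:E)%E.

(* unit sphere and its normalized rotation-invariant (cone) measure *)
Definition sphere (R : realType) (I : finType) : set (I -> R) :=
  [set u | enorm u = 1].
Definition cone (R : realType) (I : finType) (A : set (I -> R)) : set (I -> R) :=
  [set x | exists t u, [/\ 0 < t <= 1, A u & x = (fun i => t * u i)]].
Definition sigma (R : realType) (I : finType) (A : set (I -> R)) : \bar R :=
  (leb_outer (cone (A `&` @sphere R I)) * ((fine (@omega R I))^-1)%:E)%E.

Definition sphint (R : realType) (I : finType) (h : (I -> R) -> \bar R) : \bar R :=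
  (\int[lebesgue_measure]_(t in [set t : R | (0 < t)%R])
      sigma [set u | t%:E < h u])%E.

(* volume of the star-shaped set with radial function rho *)
Definition starvol (R : realType) (I : finType) (rho : (I -> R) -> \bar R) : \bar R :=
  (@omega R I * sphint (fun u => rho u ^+ #|I|))%E.

(* radial value rho determined by rho^{-p} = m, m in [0,oo] *)
Definition rad_of (R : realType) (p : R) (m : \bar R) : \bar R :=
  match m with
  | EFin r => if r == 0 then +oo%E else (r `^ (- p^-1))%:E
  | +oo%E => 0%E
  | -oo%E => 0%E
  end.

Definition Zp_vol (R : realType) (I : finType) (p : R) (f : (I -> R) -> R) : \bar R :=
  starvol (fun u : I -> R =>
    rad_of p (lint (fun x => ((`|dotp x u| `^ p) * f x)%:E))).

(* |Z_{p,N}^diamond| for the sample X = (X_1,...,X_N), stored as a point of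
   R^{N x I}: the k-th vector is  fun i => X (k, i) *)
Definition row_of (R : realType) (I : finType) (N : nat)
  (X : ('I_N * I)%type -> R) (k : 'I_N) : I -> R := fun i => X (k, i).
Definition ZpN_vol (R : realType) (I : finType) (p : R) (N : nat)
    (X : ('I_N * I)%type -> R) : \bar R :=
  starvol (fun u : I -> R =>
    rad_of p ((N%:R^-1 * \sum_(k < N) `|dotp (row_of X k) u| `^ p)%:E)).

(* E |Z_{p,N}^diamond(f)| for X_1..X_N i.i.d. with density f *)
Definition EZpN_vol (R : realType) (I : finType) (p : R) (N : nat)
    (f : (I -> R) -> R) : \bar R :=
  lint (fun X : ('I_N * I)%type -> R =>
    (ZpN_vol p X * (\prod_(k < N) f (row_of X k))%:E)%E).

(* Main.v *)
Require Import Defs.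
From HB Require Import structures.
From mathcomp Require Import all_boot all_order all_algebra.
From mathcomp Require Import all_classical all_reals all_analysis.
From mathcomp Require Import measurable_realfun.
From mathcomp Require Import ring lra.
Set Implicit Arguments. Unset Strict Implicit. Unset Printing Implicit Defensive.
Import Order.TTheory GRing.Theory Num.Theory.
Import numFieldNormedType.Exports.
Local Open Scope classical_set_scope.
Local Open Scope ring_scope.

                                          

(** Both volumes are first turned into integrals of exponentials. If [M] is positively homogeneous
    of degree p on R^n, the star-shaped set with radial function [M^(-1/p)] has the volume of
    [{M < 1}] ([starvolE]), and integrating [exp(-M)] along its sublevel sets gives [Gamma(n/p + 1)]
    times that volume ([nexp_volume]). Taking for [M] the p-th moment of f, the volume of Z_p
    becomes, up to this constant, the integral over u of [exp(- int |<x,u>|^p f(x) dx)] ([Zp_volE]).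
    For the random set, independence and Tonelli give the integral over u of
    [(int f(x) exp(-|<x,u>|^p / N) dx)^N] ([EZpN_volE]).

    The second inequality therefore says that the integral over u of [(int f(x) phi(<x,u>) dx)^N]
    does not decrease when f is rearranged, for [phi(t) = exp(-c |t|^p)] ([stable_rearr]). The first
    is a limit of the same inequality along N = 2^k ([moment_rearr]): by Jensen the exponential of
    minus the moment of f is below the N-th power, and for the rearranged density the N-th power is
    below an exponential whose exponent converges to minus the moment.

    For p in (0,2) the profile [exp(-c |t|^p)] is a pointwise limit of mixtures of Gaussians
    [exp(-s t^2)], because [z^(p/2)] is a Bernstein function ([closure_stable]). Profiles satisfying
    the inequality, with a Gaussian weight in u, are stable under bounded pointwise limits
    ([adm_lim]). For a mixture, expanding the N-th power and writing f as a superposition of its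
    layers leaves a statement on sets ([gfun_rearr]): the integral over u of [exp(-de |u|^2)] times
    the product over k of [int_{A_k} exp(-s_k <x,u>^2) dx] does not decrease when every [A_k]
    becomes the centred ball of equal volume.

    This is an inequality of Brascamp-Lieb-Luttinger type, proved by Steiner symmetrization. With
    all coordinates other than the first frozen in the [x_k], and the first one frozen in u, the
    [A_k] become sets on the line and the kernel is even and log-concave jointly in the line
    variables and the rest of u. By Prekopa-Leindler, contracting the centres of intervals towards 0
    does not decrease the integral ([slide]); for finite unions one contracts until two intervals
    touch, merges them and repeats ([merge_families]); general sets follow by approximation
    ([bll1d]). Reflections carry this to every direction, and an infimum argument shows that
    suitable symmetrizations bring all sets simultaneously as close as desired to their balls
    ([symmetrization_sequence]). *)

Definition fvec d (T : measurableType d) (I : finType) : Type := I -> T.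
Definition fvec_display : measure_display -> measure_display. Proof. exact. Qed.

(** * Product sigma-algebras and iterated product measures on finite powers *)

Section fvec_measurable.
Context d (T : measurableType d) (I : finType).

(** [fvec T I] is convertible to [I -> T]; the alias only attaches the product sigma-algebra, so
    Borel arguments apply directly to the plain functions of the theorem. *)
Definition fvec_cyl : set (set (fvec T I)) :=
  [set A | exists i (B : set T), measurable B /\ A = [set x | B (x i)]].

HB.instance Definition _ := Pointed.on (fvec T I).

Let fvec0 : <<s fvec_cyl >> set0. Proof. exact: sigma_algebra0. Qed.
Let fvecC A : <<s fvec_cyl >> A -> <<s fvec_cyl >> (~` A).
Proof. exact: sigma_algebraC. Qed.
Let fvec_bigcup (F : _^nat) : (forall i, <<s fvec_cyl >> (F i)) ->
  <<s fvec_cyl >> (\bigcup_i (F i)).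
Proof. exact: sigma_algebra_bigcup. Qed.

HB.instance Definition _ := @isMeasurable.Build (fvec_display d) (fvec T I)
  <<s fvec_cyl >> fvec0 fvecC fvec_bigcup.

Lemma measurable_coord i : measurable_fun setT (fun x : fvec T I => x i).
Proof.
by move=> _ B mB; rewrite setTI; apply: sub_sigma_algebra; exists i, B.
Qed.

Lemma measurable_fvecP d' (S : measurableType d') (f : S -> fvec T I) :
  (forall i, measurable_fun setT (fun s => f s i)) -> measurable_fun setT f.
Proof.
move=> mf; apply: (@measurability _ _ _ _ _ _ fvec_cyl) => //.
move=> _ [_ [i [B [mB ->]]] <-].
exact: mf.
Qed.

End fvec_measurable.

Section vcons.
Context d (T : measurableType d).

(** Identifies T x T^n with T^(n+1), the head sitting at [ord0]; the inductions on the dimension go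
    through this identification. *)
Definition vcons n (z : T * fvec T 'I_n) : fvec T 'I_n.+1 :=
  fun i => if unlift ord0 i is Some j then z.2 j else z.1.
Definition vtail n (x : fvec T 'I_n.+1) : fvec T 'I_n :=
  fun j => x (lift ord0 j).

Lemma vcons0 n (z : T * fvec T 'I_n) : vcons z ord0 = z.1.
Proof. by rewrite /vcons unlift_none. Qed.
Lemma vconsS n (z : T * fvec T 'I_n) j : vcons z (lift ord0 j) = z.2 j.
Proof. by rewrite /vcons liftK. Qed.
Lemma vconsK n (x : fvec T 'I_n.+1) : vcons (x ord0, vtail x) = x.
Proof.
apply/funext => i; case: (unliftP ord0 i) => [j ->|->].
  by rewrite vconsS.
by rewrite vcons0.
Qed.
Lemma vtail_vcons n (z : T * fvec T 'I_n) : vtail (vcons z) = z.2.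
Proof. by apply/funext => j; rewrite /vtail vconsS. Qed.

Lemma measurable_vcons n : measurable_fun setT (@vcons n).
Proof.
apply: measurable_fvecP => i; case: (unliftP ord0 i) => [j ->|->].
  rewrite (_ : (fun _ => _) = (fun x : fvec T 'I_n => x j) \o snd).
    by apply: measurableT_comp => //; exact: measurable_coord.
  by apply/funext => z; rewrite vconsS.
rewrite (_ : (fun _ => _) = fst) //.
by apply/funext => z; rewrite vcons0.
Qed.

Lemma measurable_vtail n : measurable_fun setT (@vtail n).
Proof. by apply: measurable_fvecP => i; exact: measurable_coord. Qed.

End vcons.

Section pw_measure.
Context d (T : measurableType d) (R : realType).
Variable m : {sigma_finite_measure set T -> \bar R}.

Section step.
Variables (n : nat) (mu : {sigma_finite_measure set (fvec T 'I_n) -> \bar R}).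

Definition pwS (A : set (fvec T 'I_n.+1)) : \bar R :=
  (m \x mu)%E (@vcons _ T n @^-1` A).

Let mpre A : measurable A -> measurable (@vcons _ T n @^-1` A).
Proof. by move=> mA; rewrite -[X in measurable X]setTI; exact: measurable_vcons. Qed.

Let pwS0 : pwS set0 = 0%E.
Proof. by rewrite /pwS preimage_set0 measure0. Qed.

Let pwS_ge0 A : (0 <= pwS A)%E.
Proof. exact: measure_ge0. Qed.

Let pwS_sigma_additive : semi_sigma_additive pwS.
Proof.
move=> F mF tF mUF; rewrite /pwS preimage_bigcup.
apply: measure_semi_sigma_additive.
- by move=> k; exact: mpre.
- apply/trivIsetP => /= i j _ _ ij; rewrite -preimage_setI.
  by move/trivIsetP : tF => /(_ _ _ _ _ ij) ->//; rewrite preimage_set0.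
- by rewrite -preimage_bigcup; exact: mpre.
Qed.

HB.instance Definition _ := isMeasure.Build _ _ _ pwS pwS0 pwS_ge0 pwS_sigma_additive.

Let pwS_sigma_finite : sigma_finite setT pwS.
Proof.
have /sigma_finiteP[F [TF ndF Foo]] := sigma_finiteT m.
have /sigma_finiteP[G [TG ndG Goo]] := sigma_finiteT mu.
exists (fun k => [set x : fvec T 'I_n.+1 | F k (x ord0) /\ G k (vtail x)]).
  apply/seteqP; split => // x _.
  have : [set: T] (x ord0) by [].
  rewrite TF => -[i _ Fi].
  have : [set: fvec T 'I_n] (vtail x) by [].
  rewrite TG => -[j _ Gj].
  exists (maxn i j) => //; split.
  - by move: Fi; exact/subsetPset/ndF/leq_maxl.
  - by move: Gj; exact/subsetPset/ndG/leq_maxr.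
move=> k; have [mF fF] := Foo k; have [mG fG] := Goo k; split.
  apply: measurableI.
    rewrite -[X in measurable X]setTI; exact: (measurable_coord ord0).
  rewrite -[X in measurable X]setTI; exact: measurable_vtail.
rewrite /pwS (_ : _ @^-1` _ = F k `*` G k).
  by rewrite product_measure1E// lte_mul_pinfty// ge0_fin_numE.
by apply/seteqP; split => -[a b] /=; rewrite vcons0 vtail_vcons.
Qed.

HB.instance Definition _ := @Measure_isSigmaFinite.Build _ _ _ pwS pwS_sigma_finite.
End step.

(** Iterated binary products transported by [vcons], starting from the unit mass at the only point
    of the 0-th power. The recursion makes integration in one coordinate ([tonelli_pw])
    immediate. *)
Fixpoint pw (n : nat) : {sigma_finite_measure set (fvec T 'I_n) -> \bar R} :=
  if n is k.+1 then pwS (pw k) else dirac (point : fvec T 'I_0).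

Lemma tonelli_pw n (F : fvec T 'I_n.+1 -> \bar R) :
  measurable_fun setT F -> (forall x, 0 <= F x)%E ->
  (\int[pw n.+1]_x F x = \int[m]_t \int[pw n]_y F (vcons (t, y)))%E.
Proof.
move=> mF F0.
have -> : (\int[pw n.+1]_x F x = \int[m \x pw n]_z F (vcons z))%E.
  rewrite -(@ge0_integral_pushforward _ _ _ _ _ _ (@measurable_vcons _ T n) (m \x pw n)%E setT F) //.
rewrite fubini_tonelli1//.
by apply: measurableT_comp => //; exact: measurable_vcons.
Qed.

End pw_measure.

                                                 

                                                                                                          
(** * Lebesgue outer measure: Caratheodory measurability of Borel sets and uniqueness *)

Section leb_outer_measure.
Context (R : realType) (I : finType) (i0 : I).
Local Notation V := (fvec (measurableTypeR R) I).

(** A content defined on every set, infinite when no box contains it, so that [leb_outer] is the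
    standard outer extension [mu_ext] of it and inherits countable subadditivity. The index [i0]
    guarantees that a degenerate box has volume 0. *)
Definition box_content (X : set V) : \bar R :=
  ereal_inf [set s | exists a b : I -> R,
    [/\ forall i, a i <= b i, X `<=` obox a b & s = (boxvol a b)%:E]].

Lemma boxvol_ge0 (a b : I -> R) : (forall i, a i <= b i) -> 0 <= boxvol a b.
Proof. by move=> ab; apply: prodr_ge0 => i _; rewrite subr_ge0. Qed.

Lemma box_content_ge0 X : (0 <= box_content X)%E.
Proof.
by apply: le_ereal_inf_tmp => _ [a [b [ab _ ->]]]; rewrite lee_fin boxvol_ge0.
Qed.

Lemma box_content0 : box_content set0 = 0%E.
Proof.
apply/eqP; rewrite eq_le box_content_ge0 andbT; apply: ereal_inf_lbound.
exists (fun=> 0), (fun=> 0); split => //.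
by rewrite /boxvol (bigD1 i0)//= subrr mul0r.
Qed.

Lemma measurable_obox (a b : I -> R) : measurable (obox a b : set V).
Proof.
rewrite (_ : obox a b = \bigcap_(i in [set: I]) [set x : V | a i < x i < b i]).
  apply: fin_bigcap_measurable => [|i _]; first exact: finite_finset.
  rewrite (_ : [set _ | _] = setT `&` (fun x : V => x i) @^-1` `]a i, b i[%classic).
    by apply: measurable_coord => //; exact: measurable_itv.
  by apply/seteqP; split => x /=; rewrite in_itv/=; tauto.
by apply/seteqP; split => [x abx i _|x abx i]; [exact: abx|exact: abx].
Qed.

(** A cover by Borel sets becomes a cover by open boxes when the k-th set is put in a box exceeding
    its content by at most [e / 2^(k+1)]. Conversely, open boxes are Borel. *)
Lemma leb_outer_mu_ext (X : set V) : leb_outer X = mu_ext box_content X.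
Proof.
apply/eqP; rewrite eq_le; apply/andP; split.
  apply: le_ereal_inf_tmp => _ [A [mA XA] <-].
  have [[k koo]|] := pselect (exists k, box_content (A k) = +oo%E).
    rewrite (eseries_pinfty _ _ koo) ?leey// => n _.
    by rewrite -ltNye (lt_le_trans _ (box_content_ge0 _)).
  rewrite -forallNE => Aoo.
  apply/lee_addgt0Pr => e e0.
  rewrite (le_trans _ (epsilon_trick _ _ _))//; last first.
  - exact: ltW.
  - by move=> n; exact: box_content_ge0.
  have /choice[ab abP] : forall k, exists ab : (I -> R) * (I -> R),
      [/\ forall i, ab.1 i <= ab.2 i, A k `<=` obox ab.1 ab.2 &
      ((boxvol ab.1 ab.2)%:E <= box_content (A k) + (e / (2 ^ k.+1)%:R)%:E)%E].
    move=> k.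
    have fink : box_content (A k) \is a fin_num.
      by rewrite ge0_fin_numE ?box_content_ge0// ltey; apply/eqP; exact: Aoo.
    have ek : 0 < e / (2 ^ k.+1)%:R by rewrite divr_gt0// ltr0n expn_gt0.
    have [_ [a [b [ab1 ab2 ->]]] abe] := lb_ereal_inf_adherent ek fink.
    by exists (a, b); split => //; exact: ltW.
  apply: (@le_trans _ _ (\sum_(0 <= k <oo) (boxvol (ab k).1 (ab k).2)%:E)%E).
    apply: ereal_inf_lbound; exists (fun k => (ab k).1), (fun k => (ab k).2).
    split => //; first by move=> k; have [] := abP k.
    by apply: (subset_trans XA); apply: subset_bigcup => k _; have [] := abP k.
  apply: lee_nneseries => [k _|k _]; last by have [] := abP k.
  by rewrite lee_fin boxvol_ge0//; have [] := abP k.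
apply: le_ereal_inf_tmp => _ [a [b [ab Xab ->]]].
apply: (@le_trans _ _ (\sum_(0 <= k <oo) box_content (obox (a k) (b k)))%E).
  apply: ereal_inf_lbound; exists (fun k => obox (a k) (b k)) => //.
  by split => // k; exact: measurable_obox.
apply: lee_nneseries => [k *|k *]; first exact: box_content_ge0.
by apply: ereal_inf_lbound; exists (a k), (b k); split => //; exact: ab.
Qed.

Definition leb (X : set V) : \bar R := leb_outer X.

Let leb0 : leb set0 = 0%E.
Proof.
rewrite /leb leb_outer_mu_ext.
by apply: mu_ext0; [exact: box_content0|exact: box_content_ge0].
Qed.

Let leb_ge0 X : (0 <= leb X)%E.
Proof.
by rewrite /leb leb_outer_mu_ext; apply: mu_ext_ge0; exact: box_content_ge0.
Qed.

Lemma le_leb_outer (A B : set V) : A `<=` B -> (leb_outer A <= leb_outer B)%E.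
Proof. by move=> AB; rewrite !leb_outer_mu_ext; exact: le_mu_ext. Qed.

Let leb_sub : sigma_subadditive leb.
Proof.
move=> F; rewrite /leb leb_outer_mu_ext.
under eq_eseriesr do rewrite leb_outer_mu_ext.
by apply: mu_ext_sigma_subadditive; exact: box_content_ge0.
Qed.

HB.instance Definition _ := isOuterMeasure.Build R V leb leb0 leb_ge0
  le_leb_outer leb_sub.

Definition upd (a : I -> R) i v : I -> R := fun j => if j == i then v else a j.

Lemma boxvol_split (a b : I -> R) i :
  boxvol a b = (b i - a i) * \prod_(j | j != i) (b j - a j).
Proof. by rewrite /boxvol (bigD1 i). Qed.

Lemma boxvol_updl (a b : I -> R) i v :
  boxvol (upd a i v) b = (b i - v) * \prod_(j | j != i) (b j - a j).
Proof.
rewrite (boxvol_split _ _ i) /upd eqxx; congr (_ * _).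
by apply: eq_bigr => j /negbTE ->.
Qed.

Lemma boxvol_updr (a b : I -> R) i v :
  boxvol a (upd b i v) = (v - a i) * \prod_(j | j != i) (b j - a j).
Proof.
rewrite (boxvol_split _ _ i) /upd eqxx; congr (_ * _).
by apply: eq_bigr => j /negbTE ->.
Qed.

(** Each box of a cover is cut by the hyperplane. The upper half is again an open box; the lower
    half contains its cut face and must be thickened by [ep k], at a cost in volume of at most
    [e / 2^(k+1)]. *)
Lemma caratheodory_halfspace i r : leb.-caratheodory [set x : V | r < x i].
Proof.
apply: le_caratheodory_measurable => X; change (leb (X `&` [set x : V | (r < x i)%R]) + leb (X `&` ~` [set x : V | (r < x i)%R]) <= leb_outer X)%E.
apply: le_ereal_inf_tmp => _ [a [b [ab Xab ->]]].
apply/lee_addgt0Pr => e e0.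
pose P k := \prod_(j | j != i) (b k j - a k j).
have P0 k : 0 <= P k by apply: prodr_ge0 => j _; rewrite subr_ge0.
pose ek k := e / (2 ^ k.+1)%:R.
have ek0 k : 0 < ek k by rewrite divr_gt0// ltr0n expn_gt0.
(* Dividing by [1 + P k] keeps the thickening meaningful for a degenerate cross-section and still
   gives [ep k * P k <= ek k]. *)
pose ep k := ek k / (1 + P k).
have ep0 k : 0 < ep k by rewrite divr_gt0// ltr_pwDl.
(* The nested maxima and minima keep both pieces genuine boxes when the hyperplane misses the
   original one. *)
pose a' k := upd (a k) i (Num.max (a k i) (Num.min r (b k i))).
pose b' k := upd (b k) i (Num.min (b k i) (Num.max r (a k i) + ep k)).
have aa' k j : a' k j <= b k j.
  rewrite /a' /upd; case: eqP => [->|_]; last exact: ab.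
  by rewrite ge_max ab ge_min lexx orbT.
have bb' k j : a k j <= b' k j.
  rewrite /b' /upd; case: eqP => [->|_]; last exact: ab.
  by rewrite le_min ab ler_wpDr ?(ltW (ep0 k))// le_max lexx orbT.
have volE k : boxvol (a' k) (b k) + boxvol (a k) (b' k) <= boxvol (a k) (b k) + ek k.
  rewrite /a' /b' boxvol_updl boxvol_updr (boxvol_split _ _ i) -/(P k).
  have epP : ep k * P k <= ek k.
    rewrite /ep -mulrA ler_piMr ?(ltW (ek0 k))//.
    by rewrite ler_pdivrMl ?mulr1 ?lerDr// ltr_pwDl.
  apply: le_trans (lerD (lexx _) epP).
  rewrite -!mulrDl ler_wpM2r//.
  move: (ab k i) (ep0 k); move: (a k i) (b k i) (ep k) => u v w uv w0.
  by rewrite !maxEle !minEle; repeat case: ifPn; rewrite -?ltNge; lra.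
have XA : (leb (X `&` [set x : V | (r < x i)%R]) <=
    \sum_(0 <= k <oo) (boxvol (a' k) (b k))%:E)%E.
  apply: ereal_inf_lbound; exists a', b; split => //.
  move=> x [/Xab[k _ abx] rx]; exists k => // j.
  rewrite /a' /upd; case: eqP => [->|_]; last exact: abx.
  have /andP[ax bx] := abx i.
  by rewrite gt_max ax gt_min rx/= bx.
have XC : (leb (X `&` ~` [set x : V | (r < x i)%R]) <=
    \sum_(0 <= k <oo) (boxvol (a k) (b' k))%:E)%E.
  apply: ereal_inf_lbound; exists a, b'; split => //.
  move=> x [/Xab[k _ abx] /negP]; rewrite -leNgt => rx; exists k => // j.
  rewrite /b' /upd; case: eqP => [->|_]; last exact: abx.
  have /andP[ax bx] := abx i.
  rewrite ax lt_min bx/= (le_lt_trans rx)// ltr_pwDr//.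
  by rewrite le_max lexx.
apply: (le_trans (leeD XA XC)).
rewrite -nneseriesD; last 2 first.
- by move=> k _ _; rewrite lee_fin boxvol_ge0.
- by move=> k _ _; rewrite lee_fin boxvol_ge0.
rewrite (le_trans _ (epsilon_trick _ _ _))//; last first.
- exact: ltW.
- by move=> k; rewrite lee_fin boxvol_ge0.
apply: lee_nneseries => [k _|k _].
  by rewrite -EFinD lee_fin addr_ge0// boxvol_ge0.
by rewrite -!EFinD lee_fin.
Qed.

Lemma lmeasurable_borel (A : set V) : measurable A -> leb.-caratheodory A.
Proof.
move: A; apply: smallest_sub.
  split.
  - exact: caratheodory_measurable_set0.
  - by move=> B cB; rewrite setTD; exact: caratheodory_measurable_setC.
  - exact: caratheodory_measurable_bigcup.
move=> _ [i [B [mB ->]]].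
have mi : measurable_fun setT (fun x : caratheodory_type leb => x i : R).
  apply: (measurability _ (RGenOInfty.measurableE R)) => //.
  move=> _ [_ [r ->] <-]; rewrite setTI.
  rewrite (_ : _ @^-1` _ = [set x : V | r < x i]).
    exact: caratheodory_halfspace.
  by apply/seteqP; split => x /=; rewrite in_itv/= andbT.
by have := mi measurableT B mB; rewrite setTI.
Qed.

Section uniqueness.
Variable mu : {measure set V -> \bar R}.
Hypothesis mu_box : forall a b : I -> R, (forall i, a i <= b i) ->
  mu (obox a b) = (boxvol a b)%:E.

Lemma measure_le_leb (A : set V) : measurable A -> (mu A <= leb A)%E.
Proof.
move=> mA; apply: le_ereal_inf_tmp => _ [a [b [ab Aab ->]]].
rewrite (eq_eseriesr (g := fun k => mu (obox (a k) (b k)))); last first.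
  by move=> k _; rewrite mu_box.
apply: measure_sigma_subadditive => //.
by move=> k; exact: measurable_obox.
Qed.

Lemma leb_obox_le (a b : I -> R) : (forall i, a i <= b i) ->
  (leb (obox a b) <= (boxvol a b)%:E)%E.
Proof.
move=> ab; apply: ereal_inf_lbound.
exists (fun k => if k is 0%N then a else (fun=> 0)),
       (fun k => if k is 0%N then b else (fun=> 0)); split.
- by case.
- by move=> x abx; exists 0%N.
- rewrite nneseries_recl//; last by case => [|k]; rewrite lee_fin boxvol_ge0.
  rewrite eseries0 ?adde0// => -[//|k] _ _.
  by rewrite /boxvol (bigD1 i0)//= subrr mul0r.
Qed.

(** Inside the box [mu <= leb] holds for [A] and for its complement, while the total of [leb] is at
    most the finite total of [mu]; neither inequality can then be strict. *)
Lemma measure_eq_leb_box (a b : I -> R) (A : set V) : (forall i, a i <= b i) ->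
  measurable A -> mu (obox a b `&` A) = leb (obox a b `&` A).
Proof.
move=> ab mA.
have mK := measurable_obox a b.
have mKA := measurableI _ _ mK mA.
have mKC := measurableI _ _ mK (measurableC mA).
apply/eqP; rewrite eq_le measure_le_leb//=.
have := lmeasurable_borel mA (obox a b) => lE.
have muE : mu (obox a b) = (mu (obox a b `&` A) + mu (obox a b `&` ~` A))%E.
  rewrite -measureU//; first by rewrite -setIUr setUv setIT.
  by rewrite setIACA setICr setI0.
have le1 : (leb (obox a b) <= mu (obox a b))%E by rewrite mu_box// leb_obox_le.
have fin : mu (obox a b) \is a fin_num by rewrite mu_box.
rewrite lE muE in le1.
have fC : mu (obox a b `&` ~` A) \is a fin_num.
  by move: fin; rewrite muE fin_numD => /andP[].
rewrite -(leeD2rE _ _ fC); apply: le_trans le1.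
by rewrite leeD2l// measure_le_leb.
Qed.

(** Cut the space into the disjoint increments of growing boxes, on which the two agree: [leb] is
    countably subadditive and [mu] countably additive. *)
Lemma leb_outer_unique (A : set V) : measurable A -> leb_outer A = mu A.
Proof.
move=> mA; apply/eqP; rewrite eq_le -[leb_outer A]/(leb A) measure_le_leb// andbT.
pose K k : set V := obox (fun=> - k%:R) (fun=> k%:R).
have mK k : measurable (K k) by exact: measurable_obox.
have Kle k : forall i : I, (fun=> - k%:R) i <= (fun=> k%:R) i :> R.
  by move=> _ /=; rewrite (le_trans (y := 0))// oppr_le0.
have ndK : {homo K : m n / (m <= n)%N >-> (m <= n)%O}.
  move=> m n mn; apply/subsetPset => x Kx i; have /andP[x1 x2] := Kx i.
  rewrite (lt_le_trans x2) ?ler_nat// andbT (le_lt_trans _ x1)//.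
  by rewrite lerN2 ler_nat.
have Kcov : \bigcup_k K k = setT.
  apply/seteqP; split => // x _.
  exists (Num.truncn (\sum_i `|x i|)).+1 => // i.
  rewrite -ltr_norml.
  have := truncnS_gt (\sum_i `|x i|); apply: le_lt_trans.
  by rewrite (bigD1 i)//= lerDl sumr_ge0.
pose D := seqD K.
have mD k : measurable (D k) by case: k => [|k] /=; [exact: mK|exact: measurableD].
have AE : A = \bigcup_k (D k `&` A).
  by rewrite -setI_bigcupl (eq_bigcup_seqD K) Kcov setTI.
have le1 : (leb A <= \sum_(0 <= k <oo) leb (D k `&` A))%E.
  by rewrite {1}AE; exact: (outer_measure_sigma_subadditive leb).
have muE : (mu A = \sum_(0 <= k <oo) mu (D k `&` A))%E.
  have mDA k : [set: nat] k -> measurable (D k `&` A) by move=> _; exact: measurableI.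
  have tDA : trivIset setT (fun k => D k `&` A).
    by apply: trivIset_setIr; exact: trivIset_seqD.
  rewrite {1}AE (measure_bigcup mu _ _ mDA tDA).
  by apply: eq_eseriesl => k; rewrite in_setT.
rewrite (le_trans le1)// muE le_eqVlt; apply/orP; left; apply/eqP.
apply: eq_eseriesr => k _.
have DK : D k `<=` K k by case: k => [|k] //= x [].
have -> : D k `&` A = K k `&` (D k `&` A) by rewrite setIA (setIidr DK).
by apply/esym/measure_eq_leb_box; [exact: Kle|exact: measurableI].
Qed.

End uniqueness.
End leb_outer_measure.

(** * Lebesgue measure as a product measure *)

Section lebesgue_n.
Context (R : realType).
Local Notation mR := (measurableTypeR R).
Local Notation V n := (fvec (measurableTypeR R) 'I_n).

Definition mun n : {sigma_finite_measure set (V n) -> \bar R} :=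
  pw (@lebesgue_measure R) n.

Lemma mun_obox n (a b : 'I_n -> R) : (forall i, a i <= b i) ->
  mun n (obox a b) = (boxvol a b)%:E.
Proof.
elim: n a b => [|n ih] a b ab.
  rewrite /mun /= /boxvol big_ord0 diracE mem_set//.
  by move=> [].
rewrite /mun /= /pwS.
rewrite (_ : _ @^-1` _ = `]a ord0, b ord0[%classic `*`
    obox (fun j => a (lift ord0 j)) (fun j => b (lift ord0 j))); last first.
  apply/seteqP; split => -[t y] /=.
    move=> abx; split; first by have := abx ord0; rewrite vcons0/= in_itv.
    by move=> j /=; have := abx (lift ord0 j); rewrite vconsS.
  rewrite in_itv/= => -[ty abx] i; case: (unliftP ord0 i) => [j ->|->].
    by rewrite vconsS; exact: abx.
  by rewrite vcons0.
rewrite product_measure1E//; last exact: measurable_obox.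
transitivity (lebesgue_measure `]a ord0, b ord0[%classic *
  mun n (obox (fun j => a (lift ord0 j)) (fun j => b (lift ord0 j))))%E => //.
rewrite ih; last by move=> i; exact: ab.
rewrite lebesgue_measure_itv/= lte_fin.
rewrite /boxvol big_ord_recl EFinM; congr (_ * _)%E.
have := ab ord0; rewrite le_eqVlt => /orP[/eqP ->|->]; last by [].
by rewrite ltxx subrr.
Qed.

Lemma leb_outer_mun n (i0 : 'I_n) (A : set (V n)) : measurable A ->
  leb_outer A = mun n A.
Proof. by apply: leb_outer_unique => //; exact: mun_obox. Qed.

Definition uncur N n (X : fvec (V n) 'I_N) : fvec mR ('I_N * 'I_n)%type :=
  fun z => X z.1 z.2.

Lemma measurable_uncur N n : measurable_fun setT (@uncur N n).
Proof.
apply: measurable_fvecP => -[k i] /=; rewrite /uncur/=.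
rewrite (_ : (fun _ => _) = (fun x : V n => x i) \o (fun X : fvec (V n) 'I_N => X k))//.
by apply: measurableT_comp; exact: measurable_coord.
Qed.

Lemma pw_box d (T : measurableType d) (m : {sigma_finite_measure set T -> \bar R})
    N (B : 'I_N -> set T) : (forall k, measurable (B k)) ->
  pw m N [set X | forall k, B k (X k)] = (\prod_(k < N) m (B k))%E.
Proof.
elim: N B => [|N ih] B mB.
  rewrite /= big_ord0 diracE mem_set//.
  by move=> [].
rewrite /= /pwS.
rewrite (_ : _ @^-1` _ = B ord0 `*` [set X | forall k, B (lift ord0 k) (X k)]); last first.
  apply/seteqP; split => -[t y] /=.
    move=> abx; split; first by have := abx ord0; rewrite vcons0.
    by move=> j /=; have := abx (lift ord0 j); rewrite vconsS.
  move=> -[ty abx] i; case: (unliftP ord0 i) => [j ->|->].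
    by rewrite vconsS; exact: abx.
  by rewrite vcons0.
rewrite product_measure1E//; last first.
  rewrite (_ : [set _ | _] = \bigcap_(k in [set: 'I_N]) [set x : fvec T 'I_N | B (lift ord0 k) (x k)]).
    apply: fin_bigcap_measurable => [|i _]; first exact: finite_finset.
    rewrite -[X in measurable X]setTI.
    by apply: measurable_coord.
  by apply/seteqP; split => [x abx i _|x abx i]; exact: abx.
by rewrite [X in (_ * X)%E](ih (fun k => B (lift ord0 k)))// big_ord_recl.
Qed.

(** Lebesgue measure on R^(N x n) is the N-fold product of that on R^n, as both give boxes the same
    volume. This is where independence of the sample vectors enters. *)
Lemma leb_outer_pw N n (k0 : 'I_N) (i0 : 'I_n) (A : set (fvec mR ('I_N * 'I_n)%type)) :
  measurable A -> leb_outer A = pw (mun n) N (@uncur N n @^-1` A).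
Proof.
move=> mA.
have mu := @measurable_uncur N n.
rewrite (@leb_outer_unique _ _ (k0, i0)
  (@pushforward _ _ _ _ _ (pw (mun n) N) (@uncur N n)) _ _ mA)//.
move=> a b ab; change (pw (mun n) N (@uncur N n @^-1` obox a b) = (boxvol a b)%:E).
rewrite (_ : _ @^-1` _ = [set X | forall k, (obox (fun i => a (k, i)) (fun i => b (k, i)) : set (V n)) (X k)]); last first.
  apply/seteqP; split => X /= h.
    by move=> k i; exact: (h (k, i)).
  by move=> [k i]; exact: h.
rewrite [LHS](@pw_box _ _ (mun n) N (fun k => obox (fun i => a (k, i)) (fun i => b (k, i))));
  last by move=> k; exact: measurable_obox.
rewrite (eq_bigr (fun k => (boxvol (fun i => a (k, i)) (fun i => b (k, i)))%:E)); last first.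
  by move=> k _; rewrite mun_obox.
rewrite prodEFin; congr EFin.
by rewrite /boxvol pair_big; apply: eq_bigr => -[].
Qed.

End lebesgue_n.

(** * Invariance of Lebesgue measure under translations, dilations and reflections *)

Section invariance.
Context (R : realType).
Local Notation mR := (measurableTypeR R).
Local Notation V n := (fvec (measurableTypeR R) 'I_n).

Lemma fvec_eq0 d (T : measurableType d) (x y : fvec T 'I_0) : x = y.
Proof. by apply/funext => -[]. Qed.

Lemma mun_unique n (mu : {measure set (V n) -> \bar R}) :
  (forall a b : 'I_n -> R, (forall i, a i <= b i) ->
    mu (obox a b) = (boxvol a b)%:E) ->
  forall A, measurable A -> mu A = mun R n A.
Proof.
case: n mu => [|n] mu hb A mA; last first.
  by rewrite -(leb_outer_mun ord0 mA) (leb_outer_unique ord0 hb mA).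
have T1 : mu setT = 1%E.
  have := hb (fun=> 0) (fun=> 0) (fun=> lexx _).
  rewrite /boxvol big_ord0 => <-; congr (mu _).
  by apply/seteqP; split => // x _ [].
have [[x Ax]|A0] := pselect (A !=set0).
  have -> : A = setT by apply/seteqP; split => // y _; rewrite (fvec_eq0 y x).
  by rewrite T1 /mun /= diracT.
move/set0P/negP/negPn/eqP: A0 => ->.
by rewrite !measure0.
Qed.

Definition vadd n (x h : V n) : V n := fun i => x i + h i.
Definition vscale n (c : R) (x : V n) : V n := fun i => c * x i.

Lemma measurable_vadd n : measurable_fun setT (fun z : V n * V n => vadd z.1 z.2).
Proof.
apply: measurable_fvecP => i; apply: measurable_funD.
  by apply: (@measurableT_comp _ _ _ _ _ _ (fun x : V n => x i)) => //; exact: measurable_coord.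
by apply: (@measurableT_comp _ _ _ _ _ _ (fun x : V n => x i)) => //; exact: measurable_coord.
Qed.

Lemma measurable_fun_vadd d (T : measurableType d) n (f g : T -> V n) :
  measurable_fun setT f -> measurable_fun setT g ->
  measurable_fun setT (fun z => vadd (f z) (g z)).
Proof.
move=> mf mg; apply: (@measurableT_comp _ _ _ _ _ _ (fun z : V n * V n => vadd z.1 z.2) _ (fun z => (f z, g z))).
  exact: measurable_vadd.
exact: measurable_fun_pair.
Qed.

Lemma measurable_vaddr n (h : V n) : measurable_fun setT (fun x : V n => vadd x h).
Proof.
apply: measurable_fvecP => i; apply: measurable_funD => //.
exact: measurable_coord.
Qed.

Lemma measurable_vscale n c : measurable_fun setT (@vscale n c).
Proof.
apply: measurable_fvecP => i; apply: measurable_funM => //.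
exact: measurable_coord.
Qed.

Lemma mun_vadd n (h : V n) A : measurable A ->
  mun R n ((fun x => vadd x h) @^-1` A) = mun R n A.
Proof.
have mh := measurable_vaddr h.
apply: (@mun_unique n (@pushforward _ _ _ _ _ (mun R n) (fun x => vadd x h))).
move=> a b ab.
change (mun R n ((fun x => vadd x h) @^-1` (obox a b)) = (boxvol a b)%:E).
rewrite (_ : _ @^-1` _ = obox (fun i => a i - h i) (fun i => b i - h i)).
  rewrite mun_obox; last by move=> i; rewrite lerD2r.
  by congr EFin; apply: eq_bigr => i _; lra.
apply/seteqP; split => x /= hx i; have := hx i; rewrite /vadd.
  by rewrite ltrBlDr ltrBrDr.
by rewrite ltrBlDr ltrBrDr.
Qed.

Lemma integral_vadd n (h : V n) (F : V n -> \bar R) :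
  measurable_fun setT F -> (forall x, 0 <= F x)%E ->
  (\int[mun R n]_x F (vadd x h) = \int[mun R n]_x F x)%E.
Proof.
move=> mF F0.
have mh := measurable_vaddr h.
rewrite -(@ge0_integral_pushforward _ _ _ _ _ _ mh (mun R n) setT F)//.
by apply: eq_measure_integral => A mA _; exact: mun_vadd.
Qed.

Lemma mun_vscale n (c : R) A : 0 < c -> measurable A ->
  mun R n (@vscale n c @^-1` A) = ((c ^- n)%:E * mun R n A)%E.
Proof.
move=> c0 mA.
have mc := @measurable_vscale n c.
have cn0 : 0 <= c ^+ n by rewrite exprn_ge0// ltW.
pose nu' : {measure set (V n) -> \bar R} := @pushforward _ _ _ _ _ (mun R n) (@vscale n c).
pose nu := nu' mc.
have : mscale (NngNum cn0) nu A = mun R n A.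
  apply: (@mun_unique n (mscale (NngNum cn0) nu)) => // a b ab.
  change ((c ^+ n)%:E * mun R n (@vscale n c @^-1` obox a b) = (boxvol a b)%:E)%E.
  rewrite (_ : _ @^-1` _ = obox (fun i => a i / c) (fun i => b i / c)).
    rewrite mun_obox; last by move=> i; rewrite ler_pM2r// invr_gt0.
    rewrite -EFinM; congr EFin; rewrite /boxvol.
    under eq_bigr do rewrite -mulrBl.
    rewrite big_split/= prodr_const card_ord mulrCA -exprMn mulfV ?gt_eqF//.
    by rewrite expr1n mulr1.
  apply/seteqP; split => x /= hx i; have := hx i; rewrite /vscale.
    by rewrite ltr_pdivrMr// ltr_pdivlMr// mulrC.
  by rewrite ltr_pdivrMr// ltr_pdivlMr// mulrC.
move=> <-; change (nu A = (c ^- n)%:E * ((c ^+ n)%:E * nu A))%E.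
by rewrite muleA -EFinM mulVf ?mul1e// expf_neq0// gt_eqF.
Qed.

(** The isometries used are all involutions, so that [O] serves as its own inverse. *)
Definition lin_isometry n (O : V n -> V n) :=
  [/\ measurable_fun setT O, (forall x h, O (vadd x h) = vadd (O x) (O h)),
   (forall x, O (O x) = x) & (forall x, dotp (O x) (O x) = dotp x x)].

Lemma measurable_dotp n : measurable_fun setT (fun z : V n * V n => dotp z.1 z.2).
Proof.
apply: measurable_sum => i; apply: measurable_funM.
  by apply: (@measurableT_comp _ _ _ _ _ _ (fun x : V n => x i)) => //; exact: measurable_coord.
by apply: (@measurableT_comp _ _ _ _ _ _ (fun x : V n => x i)) => //; exact: measurable_coord.
Qed.

Lemma measurable_dotpl n (u : V n) : measurable_fun setT (fun x : V n => dotp x u).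
Proof.
apply: measurable_sum => i; apply: measurable_funM => //.
exact: measurable_coord.
Qed.

Lemma measurable_dotpp n : measurable_fun setT (fun x : V n => dotp x x).
Proof.
by apply: measurable_sum => i; apply: measurable_funM; exact: measurable_coord.
Qed.

Definition sqball n (r : R) : set (V n) := [set x | dotp x x < r].

Lemma measurable_sqball n r : measurable (@sqball n r).
Proof.
rewrite (_ : sqball _ = setT `&` (fun x : V n => dotp x x) @^-1` `]-oo, r[%classic).
  by apply: measurable_dotpp => //; exact: measurable_itv.
by rewrite setTI; apply/seteqP; split => x; rewrite /= in_itv.
Qed.

Lemma sqball_sub_box n r : @sqball n r `<=` obox (fun=> - (1 + r)) (fun=> 1 + r).
Proof.
move=> x; rewrite /sqball/= => xr i; rewrite -ltr_norml.
have xi : x i ^+ 2 < r.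
  apply: le_lt_trans xr; rewrite /dotp (bigD1 i)//= -expr2 lerDl sumr_ge0// => j _.
  by rewrite -expr2 sqr_ge0.
have r0 : 0 < r := le_lt_trans (sqr_ge0 _) xi.
rewrite -(@ltr_pXn2r _ 2)// ?nnegrE//; last lra.
by rewrite real_normK ?num_real//; nra.
Qed.

Lemma sqball_fin n r : (mun R n (@sqball n r) < +oo)%E.
Proof.
have [r0|r0] := leP r 0.
  rewrite (_ : sqball _ = set0) ?measure0//.
  apply/seteqP; split => // x; rewrite /sqball/= => xr.
  have : 0 <= dotp x x by apply: sumr_ge0 => i _; rewrite -expr2 sqr_ge0.
  by move=> /(lt_le_trans (lt_le_trans xr r0)); rewrite ltxx.
apply: (@le_lt_trans _ _ (mun R n (obox (fun=> - (1 + r)) (fun=> 1 + r)))).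
  apply: le_measure; rewrite ?inE; [exact: measurable_sqball|exact: measurable_obox|].
  exact: sqball_sub_box.
by rewrite mun_obox ?ltry// => i; lra.
Qed.

Lemma sqball_gt0 n r : 0 < r -> (0 < mun R n (@sqball n r))%E.
Proof.
move=> r0.
pose e := Num.min 1 (r / n.+1%:R).
have e0 : 0 < e by rewrite lt_min ltr01 divr_gt0.
apply: (@lt_le_trans _ _ (mun R n (obox (fun=> - e) (fun=> e)))).
  rewrite mun_obox; last by move=> i; lra.
  by rewrite lte_fin prodr_gt0// => i _; lra.
apply: le_measure; rewrite ?inE; [exact: measurable_obox|exact: measurable_sqball|].
move=> x ex; rewrite /sqball/=.
apply: (@le_lt_trans _ _ (\sum_(i < n) e)).
  apply: ler_sum => i _.
  have := ex i; rewrite -ltr_norml => xi.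
  have e1 : e <= 1 by rewrite ge_min lexx.
  rewrite -expr2 -real_normK ?num_real//.
  have : 0 <= `|x i| by []. nra.
rewrite sumr_const card_ord -mulr_natl.
have : n%:R * e <= n%:R * (r / n.+1%:R).
  by rewrite ler_wpM2l// ge_min lexx orbT.
move/le_lt_trans; apply.
rewrite mulrCA gtr_pMr// ltr_pdivrMr// mul1r ltr_nat//.
Qed.

                                                                                                 
(** With [A] the unit ball, Tonelli and translation invariance show
    [mu B * mu (O^-1 A) = mu (O^-1 B) * mu A]. Since [O^-1 A = A] has positive finite measure, it
    cancels. *)
Lemma mun_isometry n (O : V n -> V n) : lin_isometry O -> forall B, measurable B ->
  mun R n (O @^-1` B) = mun R n B.
Proof.
move=> [mO Oadd OO Oiso] B mB.
pose mu := mun R n; pose A := @sqball n 1.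
have mA : measurable A := measurable_sqball 1.
pose neg (x : V n) : V n := vscale (-1) x.
have mneg : measurable_fun setT neg := measurable_vscale (-1).
have mind d (T : measurableType d) (f : T -> V n) (C : set (V n)) :
    measurable_fun setT f -> measurable C ->
    measurable_fun setT (fun z : T => (\1_C (f z))%:E : \bar R).
  move=> mf mC; apply/measurable_EFinP.
  by apply: (@measurableT_comp _ _ _ _ _ _ (\1_C : V n -> R)).
have indA x : \1_A (neg x) = \1_A x :> R.
  rewrite !indicE; congr (_ %:R); congr nat_of_bool; apply/idP/idP.
    rewrite !inE /A /sqball /neg/= => h; move: h; congr (_ < _).
    by apply: eq_bigr => i _; rewrite /vscale; lra.
  rewrite !inE /A /sqball /neg/= => h; move: h; congr (_ < _).
  by apply: eq_bigr => i _; rewrite /vscale; lra.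
have intI C : measurable C -> (\int[mu]_x (\1_C x)%:E = mu C)%E.
  by move=> mC; rewrite integral_indic// setIT.
have intO C : measurable C -> (\int[mu]_x (\1_C (O x))%:E = mu (O @^-1` C))%E.
  move=> mC; rewrite -(intI (O @^-1` C))//.
  by rewrite -[X in measurable X]setTI; exact: mO.
have OA : mu (O @^-1` A) = mu A.
  by congr (mu _); apply/seteqP; split => x; rewrite /A /sqball/= Oiso.
have key : (mu B * mu (O @^-1` A) = mu (O @^-1` B) * mu A)%E.
  transitivity (\int[mu]_y \int[mu]_x ((\1_A (O y))%:E * (\1_B x)%:E))%E.
    under eq_integral => y _.
      rewrite ge0_integralZl//; last exact: mind.
      rewrite intI//; over.
    rewrite ge0_integralZr//; [by rewrite intO// muleC|exact: mind].
  transitivity (\int[mu]_y \int[mu]_x ((\1_A (O y))%:E * (\1_B (vadd x (O y)))%:E))%E.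
    apply: eq_integral => y _.
    rewrite -(@integral_vadd n (O y) (fun x => (\1_A (O y))%:E * (\1_B x)%:E)%E)//.
    by apply: emeasurable_funM => //; exact: mind.
  transitivity (\int[mu]_x \int[mu]_y ((\1_A (O y))%:E * (\1_B (vadd x (O y)))%:E))%E.
    rewrite -(@fubini_tonelli _ _ _ _ _ mu mu (fun z : V n * V n => (\1_A (O z.2))%:E * (\1_B (vadd z.1 (O z.2)))%:E))%E//.
      apply: emeasurable_funM; apply: mind => //.
        exact: measurableT_comp.
      by apply: measurable_fun_vadd => //; exact: measurableT_comp.
  (* Translate [y] by [O (neg x)]: as [O] is an additive involution, [O (y + O (- x)) = O y - x],
     which removes [x] from the argument of [\1_B]. *)
  transitivity (\int[mu]_x \int[mu]_y ((\1_A (vadd (O y) (neg x)))%:E * (\1_B (O y))%:E))%E.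
    apply: eq_integral => x _.
    rewrite -[LHS](@integral_vadd n (O (neg x)) (fun y => (\1_A (O y))%:E * (\1_B (vadd x (O y)))%:E)%E)//.
      apply: eq_integral => y _; rewrite Oadd OO.
      congr (_ * (\1_B _)%:E)%E; apply/funext => i; rewrite /vadd /neg /vscale; lra.
    apply: emeasurable_funM; apply: mind => //.
    exact: measurable_fun_vadd.
  transitivity (\int[mu]_y \int[mu]_x ((\1_A (vadd (O y) (neg x)))%:E * (\1_B (O y))%:E))%E.
    rewrite (@fubini_tonelli _ _ _ _ _ mu mu (fun z : V n * V n => (\1_A (vadd (O z.2) (neg z.1)))%:E * (\1_B (O z.2))%:E))%E//.
      apply: emeasurable_funM; apply: mind => //; last exact: measurableT_comp.
      by apply: measurable_fun_vadd => //; exact: measurableT_comp.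
  rewrite -intO// -ge0_integralZr//; last exact: mind.
  apply: eq_integral => y _.
  under eq_integral do rewrite muleC.
  rewrite ge0_integralZl//; last first.
    apply: mind => //.
    exact: measurable_fun_vadd.
  congr (_ * _)%E.
  under eq_integral do rewrite -indA.
  rewrite -[RHS]intI// -(@integral_vadd n (neg (O y)) (fun x => (\1_A x)%:E)%E)//.
  - apply: eq_integral => x _; congr (\1_A _)%:E.
    by apply/funext => i; rewrite /neg /vadd /vscale; lra.
  - exact: mind.
have A0 : mu A != 0%E by rewrite gt_eqF// sqball_gt0.
have Af : mu A \is a fin_num by rewrite ge0_fin_numE// sqball_fin.
have fA0 : fine (mu A) != 0 by rewrite fine_eq0.
have canc (x : \bar R) : x = (x * mu A * ((fine (mu A))^-1)%:E)%E.
  by rewrite -muleA -{1}(fineK Af) -EFinM mulfV// mule1.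
by move: key; rewrite OA => key; rewrite [LHS]canc -key -canc.
Qed.

Lemma integral_isometry n (O : V n -> V n) (F : V n -> \bar R) : lin_isometry O ->
  measurable_fun setT F -> (forall x, 0 <= F x)%E ->
  (\int[mun R n]_x F (O x) = \int[mun R n]_x F x)%E.
Proof.
move=> hO mF F0; have [mO _ _ _] := hO.
rewrite -(@ge0_integral_pushforward _ _ _ _ _ _ mO (mun R n) setT F)//.
by apply: eq_measure_integral => A mA _; exact: mun_isometry.
Qed.

End invariance.

                                                           

(** * Layer cake, one-dimensional Brunn-Minkowski and Prekopa-Leindler *)

Section layer_cake.
Context (R : realType) d (T : measurableType d).
Variable mu : {sigma_finite_measure set T -> \bar R}.
Local Notation mR := (measurableTypeR R).

Lemma measurable_superlevel d' (S : measurableType d') (f g : S -> \bar R) :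
  measurable_fun setT f -> measurable_fun setT g ->
  measurable [set x | (f x < g x)%E].
Proof.
move=> mf mg; rewrite -[X in measurable X]setTI.
exact: emeasurable_fun_lt.
Qed.

Lemma lebesgue_measure_0e (y : \bar R) : (0 <= y)%E ->
  lebesgue_measure [set t : R | 0 < t /\ (t%:E < y)%E] = y.
Proof.
case: y => [r| |//] r0.
  rewrite (_ : [set _ | _] = `]0, r[%classic).
    rewrite lebesgue_measure_itv/= lte_fin; move: r0; rewrite lee_fin le_eqVlt.
    by move=> /orP[/eqP <-|->]; rewrite ?ltxx ?oppr0 ?adde0// sube0.
  by apply/seteqP; split => t /=; rewrite in_itv/= lte_fin; [case=> -> ->|case/andP].
rewrite (_ : [set _ | _] = `]0, +oo[%classic); first by rewrite lebesgue_measure_itv/= ltry.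
by apply/seteqP; split => t /=; rewrite in_itv/= andbT ltry; [case|split].
Qed.

(** Tonelli on the region under the graph. It links [lint], defined through superlevel sets, with
    the usual integral. *)
Lemma layer_cake (h : T -> \bar R) : measurable_fun setT h -> (forall x, 0 <= h x)%E ->
  (\int[mu]_x h x =
   \int[lebesgue_measure]_(t in [set t : R | (0 < t)%R]) mu [set x | t%:E < h x])%E.
Proof.
move=> mh h0.
pose E := [set z : mR * T | 0 < z.1 /\ (z.1%:E < h z.2)%E].
have mE : measurable E.
  apply: measurableI.
    rewrite -[X in measurable X]setTI.
    by apply: measurable_fun_ltr => //; exact: measurable_cst.
  apply: measurable_superlevel; first by apply/measurable_EFinP.
  exact: measurableT_comp.
pose F (z : mR * T) : \bar R := (\1_E z)%:E.
have mF : measurable_fun setT F by apply/measurable_EFinP.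
have F0 z : (0 <= F z)%E by rewrite lee_fin.
have := @fubini_tonelli _ _ _ _ _ (@lebesgue_measure R) mu F mF F0.
move=> tE; rewrite [RHS]integral_mkcond.
transitivity (\int[mu]_y \int[lebesgue_measure]_x F (x, y))%E.
  apply: eq_integral => x _.
  rewrite -[LHS](lebesgue_measure_0e (h0 x)).
  have mS : measurable ([set t : R | 0 < t /\ (t%:E < h x)%E] : set mR).
    apply: measurableI; last by apply: measurable_superlevel; [exact/measurable_EFinP|exact: measurable_cst].
    rewrite [X in measurable X](_ : _ = `]0, +oo[%classic); first exact: measurable_itv.
    by apply/seteqP; split => t /=; rewrite in_itv/= andbT.
  transitivity (\int[lebesgue_measure]_t (\1_[set t : R | 0 < t /\ (t%:E < h x)%E] t)%:E)%E.
    by rewrite integral_indic// setIT.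
  by apply: eq_integral => t _; rewrite /F !indicE.
rewrite -tE; apply: eq_integral => t _; rewrite patchE.
case: ifPn => [|].
  rewrite inE/= => t0.
  have mS : measurable [set x | (t%:E < h x)%E] by exact: measurable_superlevel.
  transitivity (\int[mu]_x (\1_[set x | (t%:E < h x)%E] x)%:E)%E; last first.
    by rewrite integral_indic// setIT.
  apply: eq_integral => x _.
  rewrite /F !indicE; congr (_%:R%:E); congr nat_of_bool.
  by apply/idP/idP; rewrite !inE /E/=; tauto.
rewrite notin_setE/= => t0; apply: integral0_eq => x _.
by rewrite /F indicE memNset// => -[].
Qed.

End layer_cake.

Section brunn_minkowski1.
Context (R : realType).
Local Notation mR := (measurableTypeR R).
Local Notation leb := (@lebesgue_measure R).

Lemma lebesgue_affine (a c : R) (A : set mR) : 0 < a -> measurable A ->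
  leb ((fun x => a * x + c) @^-1` A) = ((a^-1)%:E * leb A)%E.
Proof.
move=> a0 mA.
have mf : measurable_fun setT (fun x : mR => a * x + c : mR).
  by apply: measurable_funD => //; exact: measurable_funM.
have a0' : 0 <= a by exact: ltW.
pose nu' : {measure set mR -> \bar R} := @pushforward _ _ _ _ _ leb (fun x : mR => a * x + c : mR).
pose nu := nu' mf.
have : leb A = mscale (NngNum a0') nu A.
  apply: (@lebesgue_measure_unique _ (mscale (NngNum a0') nu)) => // _ [[u v] uv <-].
  change (leb `]u, v] = a%:E * leb ((fun x => (a * x + c)%R) @^-1` `]u, v]))%E.
  rewrite (_ : _ @^-1` _ = `](u - c) / a, (v - c) / a]%classic).
    rewrite !lebesgue_measure_itv/= !lte_fin ltr_pM2r ?invr_gt0// ltrD2r.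
    case: ifP => _; last by rewrite mule0.
    rewrite -EFinB -EFinB -EFinM -mulrBl mulrCA mulfV ?gt_eqF// mulr1.
    by congr EFin; lra.
  apply/seteqP; split => x /=; rewrite !in_itv/= ltr_pdivrMr// ler_pdivlMr//.
    by rewrite ltrBlDr lerBrDr mulrC.
  by rewrite ltrBlDr lerBrDr mulrC.
move=> ->; change (nu A = (a^-1)%:E * (a%:E * nu A))%E.
by rewrite muleA -EFinM mulVf ?mul1e// gt_eqF.
Qed.

(** [C] contains [al A + be b0] and [al a0 + be B], with [a0] near the supremum of [A] and [b0] near
    the infimum of [B]; up to small tails these copies lie on opposite sides of [al a0 + be b0].
    Taking any measurable [C] that contains the combinations bypasses measurability of the sum
    set. *)
Lemma brunn_minkowski1_bounded (al be M : R) (A B C : set mR) : 0 < al -> 0 < be ->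
  measurable A -> measurable B -> measurable C -> A !=set0 -> B !=set0 ->
  A `<=` `[- M, M]%classic -> B `<=` `[- M, M]%classic ->
  (forall a b, A a -> B b -> C (al * a + be * b)) ->
  (al%:E * leb A + be%:E * leb B <= leb C)%E.
Proof.
move=> al0 be0 mA mB mC A0 B0 AM BM ABC.
have supA : has_sup A.
  by split => //; exists M => x /AM; rewrite /= in_itv/= => /andP[].
have infB : has_inf B.
  by split => //; exists (- M) => x /BM; rewrite /= in_itv/= => /andP[].
apply/lee_addgt0Pr => e e0.
pose e' := e / (al + be).
have e'0 : 0 < e' by rewrite divr_gt0// addr_gt0.
have [a0 Aa0 a0s] := sup_adherent e'0 supA.
have [b0 Bb0 b0s] := inf_adherent e'0 infB.
(* Each cut loses at most [e'], since [a0] and [b0] are within [e'] of the extremes; strict on one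
   side and large on the other, the cuts make the two copies disjoint. *)
pose A1 := A `&` `]-oo, a0[%classic; pose B1 := B `&` `[b0, +oo[%classic.
have mA1 : measurable A1 by apply: measurableI => //; exact: measurable_itv.
have mB1 : measurable B1 by apply: measurableI => //; exact: measurable_itv.
have lA : (leb A <= leb A1 + e'%:E)%E.
  apply: (@le_trans _ _ (leb (A1 `|` `[a0, a0 + e']%classic))).
    apply: le_measure; rewrite ?inE//; first exact: measurableU.
    move=> x Ax; rewrite /A1/= !in_itv/=; case: (ltP x a0) => xa; first by left.
    right; rewrite /=.
    have := sup_upper_bound supA Ax; lra.
  apply: le_trans (measureU2 _ _ _) _ => //.
  apply: leeD2l; change (leb `[a0, (a0 + e')%R]%classic <= e'%:E)%E.
  rewrite lebesgue_measure_itv/= lte_fin ltrDl e'0 -EFinD lee_fin; lra.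
have lB : (leb B <= leb B1 + e'%:E)%E.
  apply: (@le_trans _ _ (leb (B1 `|` `[b0 - e', b0]%classic))).
    apply: le_measure; rewrite ?inE//; first exact: measurableU.
    move=> x Bx; rewrite /B1/= !in_itv/=; case: (leP b0 x) => xb; first by left.
    right; rewrite /=.
    have := ge_inf infB.2 Bx; lra.
  apply: le_trans (measureU2 _ _ _) _ => //.
  apply: leeD2l; change (leb `[(b0 - e')%R, b0]%classic <= e'%:E)%E.
  rewrite lebesgue_measure_itv/= lte_fin ltrBlDr ltrDl e'0 -EFinD lee_fin; lra.
pose A2 : set mR := (fun x => al^-1 * x + (- (be * b0) / al)) @^-1` A1.
pose B2 : set mR := (fun x => be^-1 * x + (- (al * a0) / be)) @^-1` B1.
have mA2 : measurable A2.
  rewrite -[X in measurable X]setTI.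
  have mf : measurable_fun setT (fun x : mR => al^-1 * x + (- (be * b0) / al) : mR).
    by apply: measurable_funD => //; exact: measurable_funM.
  exact: mf.
have mB2 : measurable B2.
  rewrite -[X in measurable X]setTI.
  have mf : measurable_fun setT (fun x : mR => be^-1 * x + (- (al * a0) / be) : mR).
    by apply: measurable_funD => //; exact: measurable_funM.
  exact: mf.
have l2 : (al%:E * leb A1 + be%:E * leb B1 <= leb C)%E.
  have -> : (al%:E * leb A1 = leb A2)%E by rewrite lebesgue_affine ?invr_gt0// invrK.
  have -> : (be%:E * leb B1 = leb B2)%E by rewrite lebesgue_affine ?invr_gt0// invrK.
  rewrite -measureU//.
    apply: le_measure; rewrite ?inE//; first exact: measurableU.
    move=> x [[Ax _]|[Bx _]].
      have := ABC _ _ Ax Bb0; congr C.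
      by field; rewrite gt_eqF.
    have := ABC _ _ Aa0 Bx; congr C.
    by field; rewrite gt_eqF.
  apply/seteqP; split => // x [[_ +] [_ +]]; rewrite /= !in_itv/= andbT => h1 h2.
  have {}h1 : x < al * a0 + be * b0.
    have : al * (al^-1 * x + - (be * b0) / al) < al * a0 by rewrite ltr_pM2l.
    have -> : al * (al^-1 * x + - (be * b0) / al) = x - be * b0 by field; rewrite gt_eqF.
    lra.
  have {}h2 : al * a0 + be * b0 <= x.
    have : be * b0 <= be * (be^-1 * x + - (al * a0) / be) by rewrite ler_pM2l.
    have -> : be * (be^-1 * x + - (al * a0) / be) = x - al * a0 by field; rewrite gt_eqF.
    lra.
  by move: (lt_le_trans h1 h2); rewrite ltxx.
have -> : e%:E = (al%:E * e'%:E + be%:E * e'%:E)%E.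
  rewrite -!EFinM -EFinD -mulrDl /e' mulrCA mulfV ?mulr1//.
  by rewrite gt_eqF// addr_gt0.
apply: (@le_trans _ _ (al%:E * (leb A1 + e'%:E) + be%:E * (leb B1 + e'%:E)))%E.
  by apply: leeD; apply: lee_pmul => //; rewrite lee_fin ltW.
have e'0' : (0 <= e'%:E)%E by rewrite lee_fin ltW.
rewrite (ge0_muleDr al%:E (measure_ge0 leb A1) e'0').
rewrite (ge0_muleDr be%:E (measure_ge0 leb B1) e'0') addeACA.
by rewrite leeD2r.
Qed.

Lemma brunn_minkowski1 (al be : R) (A B C : set mR) : 0 < al -> 0 < be ->
  measurable A -> measurable B -> measurable C -> A !=set0 -> B !=set0 ->
  (forall a b, A a -> B b -> C (al * a + be * b)) ->
  (al%:E * leb A + be%:E * leb B <= leb C)%E.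
Proof.
move=> al0 be0 mA mB mC [a Aa] [b Bb] ABC.
pose K (k : nat) : set mR := `[- k%:R, k%:R]%classic.
have mK k : measurable (K k) by exact: measurable_itv.
have ndK : {homo K : m n / (m <= n)%N >-> (m <= n)%O}.
  move=> m n mn; apply/subsetPset => x; rewrite /K/= !in_itv/= => /andP[x1 x2].
  rewrite (le_trans x2) ?ler_nat// andbT (le_trans _ x1)//.
  by rewrite lerN2 ler_nat.
have Kcov : \bigcup_k K k = setT.
  apply/seteqP; split => // x _; exists (Num.truncn `|x|).+1 => //.
  rewrite /K/= in_itv/= -ler_norml ltW//; exact: truncnS_gt.
have cvgK (D : set mR) : measurable D -> leb (D `&` K k) @[k --> \oo] --> leb D.
  move=> mD; rewrite -[X in _ --> leb X](setIT D) -Kcov setI_bigcupr.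
  apply: nondecreasing_cvg_mu => //.
  - by move=> k; exact: measurableI.
  - by apply: bigcup_measurable => k _; exact: measurableI.
  - by move=> m n mn; apply/subsetPset; apply: setIS; apply/subsetPset; exact: ndK.
have cA := cvgK _ mA; have cB := cvgK _ mB.
have cAB : (al%:E * leb (A `&` K k) + be%:E * leb (B `&` K k))%E @[k --> \oo]
    --> (al%:E * leb A + be%:E * leb B)%E.
  apply: cvgeD; [|exact: cvgeZl|exact: cvgeZl].
  by rewrite ge0_adde_def// inE mule_ge0// lee_fin ltW.
rewrite -(cvg_lim (@ereal_hausdorff R) cAB).
apply: lime_le; first by apply/cvg_ex; eexists; exact: cAB.
near=> k.
apply: (@brunn_minkowski1_bounded al be k%:R) => //.
- exact: measurableI.
- exact: measurableI.
- exists a; split => //; rewrite /K/= in_itv/= -ler_norml.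
  near: k; exact: nbhs_infty_ger.
- exists b; split => //; rewrite /K/= in_itv/= -ler_norml.
  near: k; exact: nbhs_infty_ger.
- by move=> a' b' [? _] [? _]; exact: ABC.
Unshelve. all: by end_near. Qed.

End brunn_minkowski1.

Section tail.
Context (R : realType) d (T : measurableType d).
Variable mu : {sigma_finite_measure set T -> \bar R}.
Local Notation mR := (measurableTypeR R).

Lemma measurable_tail (h : T -> \bar R) : measurable_fun setT h ->
  measurable_fun setT (fun t : mR => mu [set x | (t%:E < h x)%E]).
Proof.
move=> mh.
pose E := [set z : mR * T | (z.1%:E < h z.2)%E].
have mE : measurable E.
  by apply: measurable_superlevel; [apply/measurable_EFinP|exact: measurableT_comp].
rewrite (_ : (fun t : mR => _) = mu \o xsection E); first exact: measurable_fun_xsection.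
apply/funext => t /=; congr (mu _); apply/seteqP; split => x /=.
  by move=> tx; rewrite /xsection/= inE.
by rewrite /xsection/= inE.
Qed.

End tail.

Section prekopa_leindler.
Context (R : realType).
Local Notation mR := (measurableTypeR R).
Local Notation V n := (fvec (measurableTypeR R) 'I_n).
Local Notation leb := (@lebesgue_measure R).
Variables (al be : R).
Hypotheses (al0 : 0 < al) (be0 : 0 < be) (albe : al + be = 1).

                                                                                   
                          
(** The hypothesis [f(x)^al g(y)^be <= h], stated through positive reals strictly below [f x] and
    [g y]: powers of 0 and of infinity never occur. The conclusion of the inequality has the same
    shape, so an induction on the dimension can feed it back as a hypothesis. *)
Definition pl_rel (T : Type) (comb : T -> T -> T) (f g h : T -> \bar R) :=
  forall x y a b, 0 < a -> 0 < b -> (a%:E < f x)%E -> (b%:E < g y)%E ->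
  ((a `^ al * b `^ be)%:E <= h (comb x y))%E.

Lemma powR_amgm (a b : R) : 0 < a -> 0 < b -> a `^ al * b `^ be <= al * a + be * b.
Proof.
move=> a0 b0; rewrite /powR !gt_eqF// -expRD.
rewrite -{2}(lnK (x := a))// -{2}(lnK (x := b))//.
move: (ln a) (ln b) => x y; set m := al * x + be * y.
have h z : expR m * (1 + (z - m)) <= expR z.
  have -> : expR z = expR m * expR (z - m) by rewrite -expRD; congr expR; lra.
  by rewrite ler_pM2l ?expR_gt0// expR_ge1Dx.
have := lerD (ler_wpM2l (ltW al0) (h x)) (ler_wpM2l (ltW be0) (h y)).
apply: le_trans.
have -> : al * (expR m * (1 + (x - m))) + be * (expR m * (1 + (y - m))) =
  expR m * ((al + be) + (m - (al + be) * m)) by rewrite /m; lra.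
by rewrite albe mul1r subrr addr0 mulr1.
Qed.

Lemma powR_scale (t S S' : R) : 0 < t -> 0 < S -> 0 < S' ->
  (t * S) `^ al * (t * S') `^ be = t * (S `^ al * S' `^ be).
Proof.
move=> t0 S0 S0'; rewrite !powRM ?ltW//.
rewrite mulrACA -powRD; first by rewrite albe powRr1// ltW.
by rewrite albe oner_eq0.
Qed.

(** By monotone convergence a truncation keeps the integral above [a]. Bounded functions are wanted
    so that their suprema can be normalised to 1 and all lower levels are nonempty, as
    Brunn-Minkowski requires. *)
Lemma truncated_integral (f : mR -> \bar R) (a : R) : measurable_fun setT f ->
  (forall x, 0 <= f x)%E -> 0 < a -> (a%:E < \int[leb]_x f x)%E ->
  exists fM : mR -> R, exists S, [/\ measurable_fun setT fM,
    (forall x, 0 <= fM x <= S /\ ((fM x)%:E <= f x)%E), 0 < S,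
    (forall t, t < S -> exists x, t < fM x) & (a%:E < \int[leb]_x (fM x)%:E)%E].
Proof.
move=> mf f0 a0 af.
pose g k x := mine (f x) k%:R%:E.
have mg k : measurable_fun setT (g k) by apply: measurable_mine.
have g0 k x : (0 <= g k x)%E by rewrite /g le_min f0 lee_fin ler0n.
have ndg x : {homo g^~ x : m n / (m <= n)%N >-> (m <= n)%E}.
  by move=> m n mn; rewrite /g le_min !ge_min lexx/= lee_fin ler_nat mn orbT.
have cg : (\int[leb]_x g k x)%E @[k --> \oo] --> (\int[leb]_x f x)%E.
  rewrite [X in _ --> X](_ : _ = \int[leb]_x limn (g^~ x))%E.
    exact: cvg_monotone_convergence.
  apply: eq_integral => x _; apply/esym/cvg_lim; first exact: ereal_hausdorff.
  have := f0 x; rewrite /g; case: (f x) => [r| |//] r0.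
    apply: cvg_near_cst; near=> k; apply/min_idPl.
    rewrite lee_fin; near: k; exact: nbhs_infty_ger.
  rewrite (_ : (fun k => _) = (fun k => k%:R%:E)); last first.
    by apply/funext => k; apply/min_idPr; rewrite leey.
  by apply/cvgenyP.
have [k ak] : exists k, (a%:E < \int[leb]_x g k x)%E.
  apply: contrapT => /forallNP nk.
  suff : (\int[leb]_x f x <= a%:E)%E by rewrite leNgt af.
  rewrite -(cvg_lim (@ereal_hausdorff R) cg); apply: lime_le.
    by apply/cvg_ex; eexists; exact: cg.
  by apply: nearW => k; rewrite leNgt; apply/negP/nk.
pose fM x := fine (g k x).
have gfin x : g k x \is a fin_num.
  by rewrite ge0_fin_numE// (le_lt_trans _ (ltry k%:R))// ge_min lexx orbT.
have fME x : (fM x)%:E = g k x by rewrite fineK.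
pose S := sup (range fM).
have hS : has_sup (range fM).
  split; first by exists (fM 0), 0.
  by exists k%:R => _ [x _ <-]; rewrite -lee_fin fME ge_min lexx orbT.
have fM0 x : 0 <= fM x by rewrite -lee_fin fME.
have fMS x : fM x <= S by apply: sup_upper_bound => //; exists x.
have S0 : 0 < S.
  rewrite lt_neqAle (le_trans (fM0 0) (fMS 0)) andbT; apply/eqP => S0.
  have : (a%:E < 0)%E.
    apply: (lt_le_trans ak); rewrite le_eqVlt integral0_eq ?eqxx// => x _.
    by rewrite -fME; congr EFin; apply/eqP; rewrite eq_le fM0 andbT S0.
  by rewrite lte_fin ltNge ltW.
exists fM, S; split => //.
- by apply/measurable_EFinP; rewrite (_ : _ \o _ = g k)//; apply/funext => x /=.
- by move=> x; rewrite fM0 fMS fME ge_min lexx.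
- move=> t tS; have e0 : 0 < S - t by rewrite subr_gt0.
  by have [_ [x _ <-]] := sup_adherent e0 hS; rewrite opprB addrCA subrr addr0 => ?; exists x.
- by under eq_integral do rewrite fME.
Unshelve. all: by end_near. Qed.

(** With both suprema normalised to 1, the superlevel sets of [f1] and [g1] are nonempty for the
    same levels t < 1, and Brunn-Minkowski bounds the level set of [h1] from below. Integrating over
    t gives an arithmetic mean of the integrals, which dominates the geometric mean. *)
Lemma prekopa_leindler1 (f g h : mR -> \bar R) (a b : R) :
  measurable_fun setT f -> measurable_fun setT g -> measurable_fun setT h ->
  (forall x, 0 <= f x)%E -> (forall x, 0 <= g x)%E -> (forall x, 0 <= h x)%E ->
  pl_rel (fun x y : R => al * x + be * y) f g h ->
  0 < a -> 0 < b -> (a%:E < \int[leb]_x f x)%E -> (b%:E < \int[leb]_x g x)%E ->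
  ((a `^ al * b `^ be)%:E <= \int[leb]_x h x)%E.
Proof.
move=> mf mg mh f0 g0 h0 fgh a0 b0 af bg.
have [fM [S [mfM fMS' S0 fMa {}af]]] := truncated_integral mf f0 a0 af.
have [gM [S' [mgM gMS' S0' gMa {}bg]]] := truncated_integral mg g0 b0 bg.
have fMS x : 0 <= fM x <= S by have [] := fMS' x.
have gMS x : 0 <= gM x <= S' by have [] := gMS' x.
have fMf x : ((fM x)%:E <= f x)%E by have [] := fMS' x.
have gMg x : ((gM x)%:E <= g x)%E by have [] := gMS' x.
pose K := S `^ al * S' `^ be.
have K0 : 0 < K by rewrite mulr_gt0// powR_gt0.
pose f1 x := (fM x / S)%:E; pose g1 x := (gM x / S')%:E.
pose h1 x := ((K^-1)%:E * h x)%E.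
have mf1 : measurable_fun setT f1 by apply/measurable_EFinP; apply: measurable_funM.
have mg1 : measurable_fun setT g1 by apply/measurable_EFinP; apply: measurable_funM.
have mh1 : measurable_fun setT h1 by apply: emeasurable_funM.
have f10 x : (0 <= f1 x)%E by rewrite lee_fin; apply: divr_ge0; [have /andP[] := fMS x|exact: ltW].
have g10 x : (0 <= g1 x)%E by rewrite lee_fin; apply: divr_ge0; [have /andP[] := gMS x|exact: ltW].
have h10 x : (0 <= h1 x)%E by rewrite mule_ge0// lee_fin invr_ge0 ltW.
have lvl (t : R) : 0 < t ->
    (al%:E * leb [set x | (t%:E < f1 x)%E] + be%:E * leb [set x | (t%:E < g1 x)%E]
     <= leb [set x | (t%:E < h1 x)%E])%E.
  move=> t0; have [t1|t1] := leP 1 t.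
    rewrite (_ : [set x | (t%:E < f1 x)%E] = set0); last first.
      apply/seteqP; split => // x /=; rewrite lte_fin ltr_pdivlMr// => tf.
      have /andP[_ fS] := fMS x; have := lt_le_trans tf fS.
      by rewrite ltNge ler_peMl// ltW.
    rewrite (_ : [set x | (t%:E < g1 x)%E] = set0); last first.
      apply/seteqP; split => // x /=; rewrite lte_fin ltr_pdivlMr// => tf.
      have /andP[_ fS] := gMS x; have := lt_le_trans tf fS.
      by rewrite ltNge ler_peMl// ltW.
    by rewrite measure0 !mule0 adde0.
  apply: brunn_minkowski1 => //.
  - exact: measurable_superlevel.
  - exact: measurable_superlevel.
  - exact: measurable_superlevel.
  - have [|x tx] := fMa (t * S); first by rewrite gtr_pMl.
    by exists x; rewrite /= lte_fin ltr_pdivlMr.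
  - have [|x tx] := gMa (t * S'); first by rewrite gtr_pMl.
    by exists x; rewrite /= lte_fin ltr_pdivlMr.
  - move=> x y /=; rewrite !lte_fin !ltr_pdivlMr// => tx ty.
    (* Points strictly between the level and the value: [pl_rel] asks for strict lower bounds, and
       strictness above [t * S] makes the level of [h1] strict as well. *)
    pose a1 := (t * S + fM x) / 2; pose b1 := (t * S' + gM y) / 2.
    have tS : 0 < t * S by rewrite mulr_gt0.
    have tS' : 0 < t * S' by rewrite mulr_gt0.
    have ta : t * S < a1 by rewrite /a1; lra.
    have tb : t * S' < b1 by rewrite /b1; lra.
    have hl : ((a1 `^ al * b1 `^ be)%:E <= h (al * x + be * y)%R)%E.
      apply: fgh.
      - exact: lt_trans ta.
      - exact: lt_trans tb.
      - by apply: lt_le_trans (fMf x); rewrite lte_fin /a1; lra.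
      - by apply: lt_le_trans (gMg y); rewrite lte_fin /b1; lra.
    apply: (@lt_le_trans _ _ (K^-1 * (a1 `^ al * b1 `^ be))%:E).
      rewrite lte_fin ltr_pdivlMl// mulrC -powR_scale//.
      apply: ltr_pM; rewrite ?powR_ge0//.
        by rewrite gt0_ltr_powR// nnegrE ltW// (lt_trans tS).
      by rewrite gt0_ltr_powR// nnegrE ltW// (lt_trans tS').
    by rewrite EFinM /h1 lee_pmul2l// lte_fin invr_gt0.
have il : (al%:E * \int[leb]_x f1 x + be%:E * \int[leb]_x g1 x <= \int[leb]_x h1 x)%E.
  rewrite (layer_cake leb mf1 f10) (layer_cake leb mg1 g10) (layer_cake leb mh1 h10).
  have mP : measurable [set t : mR | (0 < t)%R].
    rewrite [X in measurable X](_ : _ = `]0, +oo[%classic); first exact: measurable_itv.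
    by apply/seteqP; split => t /=; rewrite in_itv/= andbT.
  have mt q : measurable_fun setT q ->
      measurable_fun [set t : mR | (0 < t)%R] (fun t : mR => leb [set x | (t%:E < q x)%E]).
    by move=> mq; apply: measurable_funTS; exact: measurable_tail.
  rewrite -ge0_integralZl//; [|exact: mt|by rewrite lee_fin ltW].
  rewrite -ge0_integralZl//; [|exact: mt|by rewrite lee_fin ltW].
  have mtf := mt _ mf1; have mtg := mt _ mg1; have mth := mt _ mh1.
  rewrite -ge0_integralD//; last first.
  - by apply: emeasurable_funM.
  - by move=> t _; rewrite mule_ge0// lee_fin ltW.
  - by apply: emeasurable_funM.
  - by move=> t _; rewrite mule_ge0// lee_fin ltW.
  apply: ge0_le_integral => //.
  - by move=> t _; rewrite adde_ge0// mule_ge0// lee_fin ltW.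
  - by apply: emeasurable_funD; apply: emeasurable_funM.
have {}af : ((a / S)%:E < \int[leb]_x f1 x)%E.
  rewrite /f1; under eq_integral do rewrite mulrC EFinM.
  rewrite ge0_integralZl//; last 3 first.
  - exact/measurable_EFinP.
  - by move=> x _; rewrite lee_fin; have /andP[] := fMS x.
  - by rewrite lee_fin invr_ge0 ltW.
  by rewrite mulrC EFinM lte_pmul2l// lte_fin invr_gt0.
have {}bg : ((b / S')%:E < \int[leb]_x g1 x)%E.
  rewrite /g1; under eq_integral do rewrite mulrC EFinM.
  rewrite ge0_integralZl//; last 3 first.
  - exact/measurable_EFinP.
  - by move=> x _; rewrite lee_fin; have /andP[] := gMS x.
  - by rewrite lee_fin invr_ge0 ltW.
  by rewrite mulrC EFinM lte_pmul2l// lte_fin invr_gt0.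
have hE : (\int[leb]_x h x = K%:E * \int[leb]_x h1 x)%E.
  rewrite /h1 ge0_integralZl//; last by rewrite lee_fin invr_ge0 ltW.
  by rewrite muleA -EFinM mulfV ?mul1e// gt_eqF.
rewrite hE.
have -> : a `^ al * b `^ be = K * ((a / S) `^ al * (b / S') `^ be).
  rewrite /K mulrACA -!powRM ?ltW ?divr_gt0//.
  by congr (_ `^ _ * _ `^ _); field; rewrite gt_eqF.
rewrite EFinM lee_pmul2l//; apply: le_trans il.
apply: (@le_trans _ _ (al * (a / S) + be * (b / S'))%:E).
  by rewrite lee_fin powR_amgm// divr_gt0.
by rewrite EFinD !EFinM leeD// lee_pmul2l ?lte_fin// ltW.
Qed.

Definition vcomb n (x y : V n) : V n := vadd (vscale al x) (vscale be y).

Lemma vcomb_vcons n t s (x y : V n) :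
  vcomb (vcons (t, x) : V n.+1) (vcons (s, y)) = vcons (al * t + be * s : mR, vcomb x y).
Proof.
apply/funext => i; rewrite /vcomb /vadd /vscale.
by case: (unliftP ord0 i) => [j ->|->]; rewrite ?vconsS ?vcons0.
Qed.

(** The one-dimensional case is applied to the integrals over fibres, whose [pl_rel] is exactly the
    induction hypothesis. *)
Lemma prekopa_leindler n (f g h : V n -> \bar R) (a b : R) :
  measurable_fun setT f -> measurable_fun setT g -> measurable_fun setT h ->
  (forall x, 0 <= f x)%E -> (forall x, 0 <= g x)%E -> (forall x, 0 <= h x)%E ->
  pl_rel (@vcomb n) f g h ->
  0 < a -> 0 < b -> (a%:E < \int[mun R n]_x f x)%E -> (b%:E < \int[mun R n]_x g x)%E ->
  ((a `^ al * b `^ be)%:E <= \int[mun R n]_x h x)%E.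
Proof.
elim: n f g h a b => [|n ih] f g h a b mf mg mh f0 g0 h0 fgh a0 b0.
  rewrite /mun /= !integral_dirac// !diracT !mul1e => af bg.
  by rewrite (fvec_eq0 point (vcomb point point)); exact: fgh.
have mc (q : V n.+1 -> \bar R) : measurable_fun setT q ->
    measurable_fun setT (fun z : mR * V n => q (vcons z)).
  by move=> mq; apply: measurableT_comp => //; exact: measurable_vcons.
have mc2 (q : V n.+1 -> \bar R) t : measurable_fun setT q ->
    measurable_fun setT (fun z : V n => q (vcons (t : mR, z))).
  by move=> mq; apply: (measurableT_comp (mc _ mq)); exact: pair1_measurable.
have mF (q : V n.+1 -> \bar R) : measurable_fun setT q -> (forall x, 0 <= q x)%E ->
    measurable_fun setT (fun t : mR => \int[mun R n]_y q (vcons (t, y)))%E.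
  move=> mq q0; apply: (@measurable_fun_fubini_tonelli_F _ _ _ _ _ (mun R n) (fun z => q (vcons z))) => //.
  exact: mc.
rewrite !tonelli_pw// => af bg.
apply: prekopa_leindler1 af bg => //.
- exact: mF.
- exact: mF.
- exact: mF.
- by move=> t; apply: integral_ge0.
- by move=> t; apply: integral_ge0.
- by move=> t; apply: integral_ge0.
move=> t s a1 b1 a10 b10 af bg.
apply: ih a10 b10 af bg => //.
- exact: mc2.
- exact: mc2.
- exact: mc2.
by move=> x y a2 b2 a20 b20 af bg; rewrite -vcomb_vcons; exact: fgh.
Qed.

End prekopa_leindler.

                                              

(** * Multilinear replacement, Lipschitz bounds for products, kernels and the Gaussian weight *)

Lemma measurable_prod_cond (R : realType) d (T : measurableType d) (I : eqType) (r : seq I)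
    (P : pred I) (h : I -> T -> R) : (forall i, measurable_fun setT (h i)) ->
  measurable_fun setT (fun x => \prod_(i <- r | P i) h i x).
Proof.
move=> mh; under eq_fun do rewrite -big_filter.
by apply: measurable_prod => i _.
Qed.

                                                                                                      
Section slots.
Context (R : realType) d (T : measurableType d) (mu : {measure set T -> \bar R}).
Context (N : nat) (Z : Type).
Variables (a b : 'I_N -> Z -> T -> R) (A B : 'I_N -> T -> R).
Hypothesis a0 : forall k z v, 0 <= a k z v.
Hypothesis b0 : forall k z v, 0 <= b k z v.
Hypothesis A0 : forall k v, 0 <= A k v.
Hypothesis B0 : forall k v, 0 <= B k v.
Hypothesis ma : forall k z, measurable_fun setT (a k z).
Hypothesis mb : forall k z, measurable_fun setT (b k z).
Hypothesis mA : forall k, measurable_fun setT (A k).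
Hypothesis mB : forall k, measurable_fun setT (B k).
Hypothesis slot : forall k (W W' : T -> R),
  measurable_fun setT W -> measurable_fun setT W' ->
  (forall v, 0 <= W v) -> (forall v, 0 <= W' v) ->
  (forall z, \int[mu]_v (W v * a k z v)%:E <= \int[mu]_v (W' v * b k z v)%:E)%E ->
  (\int[mu]_v (W v * A k v)%:E <= \int[mu]_v (W' v * B k v)%:E)%E.

(** [A k] and [B k] are thought of as superpositions of pieces [a k z] and [b k z]: by [slot], an
    inequality known for all pieces, with fixed weights, passes to the superpositions. The factors
    are replaced one at a time, the remaining ones being absorbed into the weights; this is why
    [slot] allows different weights on the two sides. *)
Lemma slots (W : T -> R) : measurable_fun setT W -> (forall v, 0 <= W v) ->
  (forall z : 'I_N -> Z, \int[mu]_v (W v * \prod_k a k (z k) v)%:E <=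
     \int[mu]_v (W v * \prod_k b k (z k) v)%:E)%E ->
  (\int[mu]_v (W v * \prod_k A k v)%:E <= \int[mu]_v (W v * \prod_k B k v)%:E)%E.
Proof.
move=> mW W0 hz.
have [/existsP[k _]|] := boolP [exists k : 'I_N, true]; last first.
  move=> /existsPn nk.
  have E (F : 'I_N -> T -> R) v : \prod_k F k v = 1 by rewrite big1// => k; have := nk k.
  by under eq_integral do rewrite E; under [leRHS]eq_integral do rewrite E.
(* Without any piece the premise of [slot] is vacuous, and one application to some factor
   concludes. *)
have [[z0]|nZ] := pselect (inhabited Z); last first.
  have h0 (W1 W2 : T -> R) : measurable_fun setT W1 -> measurable_fun setT W2 ->
      (forall v, 0 <= W1 v) -> (forall v, 0 <= W2 v) ->
      (\int[mu]_v (W1 v * A k v)%:E <= \int[mu]_v (W2 v * B k v)%:E)%E.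
    by move=> *; apply: slot => // z; have := nZ (inhabits z).
  under eq_integral do rewrite (bigD1 k)//= mulrCA mulrC.
  under [leRHS]eq_integral do rewrite (bigD1 k)//= mulrCA mulrC.
  apply: h0.
  - by apply: measurable_funM => //; exact: measurable_prod_cond.
  - by apply: measurable_funM => //; exact: measurable_prod_cond.
  - by move=> v; rewrite mulr_ge0// prodr_ge0.
  - by move=> v; rewrite mulr_ge0// prodr_ge0.
have key (j : nat) : forall z : 'I_N -> Z,
    (\int[mu]_v (W v * \prod_(k < N) (if (k < j)%N then A k v else a k (z k) v))%:E <=
     \int[mu]_v (W v * \prod_(k < N) (if (k < j)%N then B k v else b k (z k) v))%:E)%E.
  elim: j => [|j ih] z; first exact: hz.
  have [jN|Nj] := ltnP j N; last first.
    have E (F G : 'I_N -> T -> R) v : \prod_(k < N) (if (k < j.+1)%N then F k v else G k v) =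
        \prod_(k < N) (if (k < j)%N then F k v else G k v).
      by apply: eq_bigr => i _; rewrite !(leq_trans (ltn_ord i))// ltnW.
    under eq_integral do rewrite (E A (fun k => a k (z k))).
    under [leRHS]eq_integral do rewrite (E B (fun k => b k (z k))).
    exact: ih.
  pose jo := Ordinal jN.
  pose P (F G : 'I_N -> T -> R) v := \prod_(k < N | k != jo) (if (k < j)%N then F k v else G k v).
  have E (F G : 'I_N -> T -> R) v : \prod_(k < N) (if (k < j.+1)%N then F k v else G k v) =
      F jo v * P F G v.
    rewrite (bigD1 jo)//= ltnSn; congr (_ * _); apply: eq_bigr => i ij.
    rewrite ltnS leq_eqVlt (_ : (i == j :> nat) = false)//.
    by apply/negbTE; apply: contra ij => /eqP h; apply/eqP/val_inj.
  have mP F G : (forall k, measurable_fun setT (F k)) -> (forall k, measurable_fun setT (G k)) ->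
      measurable_fun setT (P F G).
    move=> mF mG; rewrite /P; apply: (@measurable_prod_cond _ _ _ _ _ _ (fun (i : 'I_N) v => if (i < j)%N then F i v else G i v)) => i.
    by case: (i < j)%N.
  have P0 F G v : (forall k, 0 <= F k v) -> (forall k, 0 <= G k v) -> 0 <= P F G v.
    by move=> F0 G0; apply: prodr_ge0 => i _; case: ifP.
  under eq_integral do rewrite (E A (fun k => a k (z k))) mulrCA mulrC.
  under [leRHS]eq_integral do rewrite (E B (fun k => b k (z k))) mulrCA mulrC.
  apply: slot.
  - by apply: measurable_funM => //; exact: mP.
  - by apply: measurable_funM => //; exact: mP.
  - by move=> v; rewrite mulr_ge0// P0.
  - by move=> v; rewrite mulr_ge0// P0.
  move=> z'.
  pose z1 k := if k == jo then z' else z k.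
  have E1 (F : 'I_N -> T -> R) (G : 'I_N -> Z -> T -> R) v :
      \prod_(k < N) (if (k < j)%N then F k v else G k (z1 k) v) =
      G jo z' v * P F (fun k => G k (z k)) v.
    rewrite (bigD1 jo)//= ltnn /z1 eqxx; congr (_ * _); apply: eq_bigr => i /negbTE ->.
    by [].
  have := ih z1.
  under eq_integral do rewrite (E1 A a) mulrCA mulrC.
  by under [leRHS]eq_integral do rewrite (E1 B b) mulrCA mulrC.
have := key N (fun=> z0).
under eq_integral => v _ do under eq_bigr => i _ do rewrite ltn_ord.
by under [leRHS]eq_integral => v _ do under eq_bigr => i _ do rewrite ltn_ord.
Qed.

End slots.

Section lipschitz.
Context (R : realType).

(** Telescoping: changing the factor k costs at most [e k] times a product of factors bounded by
    [C], and [1 <= C] allows the uniform constant [C ^+ N]. *)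
Lemma prod_lip (N : nat) (C : R) (x y e : 'I_N -> R) : 1 <= C ->
  (forall k, 0 <= x k <= C) -> (forall k, 0 <= y k <= C) -> (forall k, 0 <= e k) ->
  (forall k, x k <= y k + e k) ->
  \prod_k x k <= \prod_k y k + C ^+ N * \sum_k e k.
Proof.
move=> C1; have C0 : 0 <= C by apply: le_trans C1.
elim: N x y e => [|N ih] x y e hx hy e0 xy.
  by rewrite !big_ord0 mulr0 addr0.
rewrite !big_ord_recl.
have {}ih := ih (fun k => x (lift ord0 k)) (fun k => y (lift ord0 k)) (fun k => e (lift ord0 k))
  (fun k => hx _) (fun k => hy _) (fun k => e0 _) (fun k => xy _).
set X := \prod_(i < N) _ in ih *; set Y := \prod_(i < N) _ in ih *.
set S := \sum_(i < N) _ in ih *.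
have X0 : 0 <= X by apply: prodr_ge0 => i _; have /andP[] := hx (lift ord0 i).
have Y0 : 0 <= Y by apply: prodr_ge0 => i _; have /andP[] := hy (lift ord0 i).
have YC : Y <= C ^+ N.
  rewrite -[N in _ ^+ N]card_ord -prodr_const; apply: ler_prod => i _; exact: hy.
have S0 : 0 <= S by apply: sumr_ge0 => i _.
have CN : C ^+ N <= C ^+ N.+1 by rewrite ler_weXn2l.
have CN0 : 0 <= C ^+ N by rewrite exprn_ge0.
have /andP[x0 xC] := hx ord0; have /andP[y0 yC] := hy ord0.
have h1 : x ord0 * X <= x ord0 * Y + C * (C ^+ N * S).
  apply: (@le_trans _ _ (x ord0 * (Y + C ^+ N * S))); first by rewrite ler_wpM2l.
  by rewrite mulrDr lerD2l ler_wpM2r// mulr_ge0.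
have h2 : x ord0 * Y <= y ord0 * Y + e ord0 * C ^+ N.+1.
  apply: (@le_trans _ _ ((y ord0 + e ord0) * Y)); first by rewrite ler_wpM2r.
  by rewrite mulrDl lerD2l ler_wpM2l// (le_trans YC).
apply: (le_trans h1); apply: (le_trans (lerD h2 (lexx _))).
by rewrite mulrA -exprS mulrDr; lra.
Qed.

End lipschitz.

Section integral_lip.
Context (R : realType) d (T : measurableType d) (mu : {measure set T -> \bar R}).

Lemma integral_prod_lip (N : nat) (C : R) (W : T -> R) (x y : 'I_N -> T -> R) (e : 'I_N -> R) :
  1 <= C -> measurable_fun setT W -> (forall v, 0 <= W v) ->
  (forall k, measurable_fun setT (x k)) -> (forall k, measurable_fun setT (y k)) ->
  (forall k v, 0 <= x k v <= C) -> (forall k v, 0 <= y k v <= C) -> (forall k, 0 <= e k) ->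
  (forall k v, x k v <= y k v + e k) ->
  (\int[mu]_v (W v * \prod_k x k v)%:E <= \int[mu]_v (W v * \prod_k y k v)%:E +
    (C ^+ N * \sum_k e k)%:E * \int[mu]_v (W v)%:E)%E.
Proof.
move=> C1 mW W0 mx my hx hy e0 xy.
have C0 : 0 <= C by apply: le_trans C1.
have e1 : 0 <= C ^+ N * \sum_k e k by rewrite mulr_ge0 ?exprn_ge0 ?sumr_ge0.
have y0 v : 0 <= \prod_k y k v by apply: prodr_ge0 => k _; have /andP[] := hy k v.
have x0 v : 0 <= \prod_k x k v by apply: prodr_ge0 => k _; have /andP[] := hx k v.
have mX : measurable_fun setT (fun v => W v * \prod_k x k v).
  by apply: measurable_funM => //; exact: measurable_prod_cond.
have mY : measurable_fun setT (fun v => W v * \prod_k y k v).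
  by apply: measurable_funM => //; exact: measurable_prod_cond.
rewrite -ge0_integralZl//; last 2 first.
- exact/measurable_EFinP.
- by move=> v _; rewrite lee_fin.
rewrite -ge0_integralD//; last first.
- by apply: emeasurable_funM => //; exact/measurable_EFinP.
- by move=> v _; rewrite mule_ge0// lee_fin.
- exact/measurable_EFinP.
- by move=> v _; rewrite lee_fin mulr_ge0.
apply: ge0_le_integral => //.
- by move=> v _; rewrite lee_fin mulr_ge0.
- exact/measurable_EFinP.
- by apply: emeasurable_funD; [exact/measurable_EFinP|apply: emeasurable_funM => //; exact/measurable_EFinP].
move=> v _; rewrite -EFinM -EFinD lee_fin [X in _ + X]mulrC -mulrDr ler_wpM2l//.
exact: prod_lip.
Qed.

End integral_lip.

Section kernel_integral.
Context (R : realType) d1 d2 (X : measurableType d1) (T : measurableType d2).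
Variable (mu : {sigma_finite_measure set X -> \bar R}) (k : X * T -> R).
Hypothesis mk : measurable_fun setT k.
Hypothesis k01 : forall z, 0 <= k z <= 1.

(** For [A] of finite measure the value is finite, since the kernel lies between 0 and 1, and it
    varies with [A] in a Lipschitz way for the measure of differences ([kint_lip]). All
    approximations of sets rest on this. *)
Definition kint (A : set X) (v : T) : R := fine (\int[mu]_x (\1_A x * k (x, v))%:E)%E.

Let k0 z : 0 <= k z. Proof. by have /andP[] := k01 z. Qed.
Let k1 z : k z <= 1. Proof. by have /andP[] := k01 z. Qed.

Lemma measurable_ksec v : measurable_fun setT (fun x => k (x, v)).
Proof. by apply: measurableT_comp => //; exact: pair2_measurable. Qed.

Lemma measurable_kind A v : measurable A ->
  measurable_fun setT (fun x => (\1_A x * k (x, v))%:E).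
Proof.
by move=> mA; apply/measurable_EFinP/measurable_funM => //; exact: measurable_ksec.
Qed.

Lemma kint_int_ge0 A v : (0 <= \int[mu]_x (\1_A x * k (x, v))%:E)%E.
Proof. by apply: integral_ge0 => x _; rewrite lee_fin mulr_ge0. Qed.

Lemma kint_int_le A v : measurable A ->
  (\int[mu]_x (\1_A x * k (x, v))%:E <= mu A)%E.
Proof.
move=> mA; rewrite -[X in mu X]setIT -integral_indic//.
apply: ge0_le_integral => //.
- by move=> x _; rewrite lee_fin mulr_ge0.
- exact: measurable_kind.
- exact/measurable_EFinP.
- by move=> x _; rewrite lee_fin ler_piMr.
Qed.

Lemma kintE A v : measurable A -> (mu A < +oo)%E ->
  (kint A v)%:E = (\int[mu]_x (\1_A x * k (x, v))%:E)%E.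
Proof.
move=> mA Aoo; rewrite fineK// ge0_fin_numE ?kint_int_ge0//.
exact: le_lt_trans (kint_int_le v mA) Aoo.
Qed.

Lemma kint_ge0 A v : 0 <= kint A v.
Proof. by apply: fine_ge0; exact: kint_int_ge0. Qed.

Lemma kint_le A v : measurable A -> (mu A < +oo)%E -> kint A v <= fine (mu A).
Proof.
move=> mA Aoo; rewrite -lee_fin kintE// fineK ?kint_int_le//.
by rewrite ge0_fin_numE.
Qed.

Lemma measurable_kint A : measurable A -> measurable_fun setT (kint A).
Proof.
move=> mA; apply: (@measurableT_comp _ _ _ _ _ _ (@fine R)) => //.
apply: (@measurable_fun_fubini_tonelli_G _ _ _ _ _ mu (fun z => (\1_A z.1 * k z)%:E)).
  apply/measurable_EFinP/measurable_funM => //.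
  by apply: (@measurableT_comp _ _ _ _ _ _ (\1_A : X -> R)).
by move=> z; rewrite lee_fin mulr_ge0.
Qed.

Lemma kint_subset A B v : measurable A -> measurable B -> (mu B < +oo)%E -> A `<=` B ->
  kint A v <= kint B v.
Proof.
move=> mA mB Boo AB.
have Aoo : (mu A < +oo)%E by apply: le_lt_trans Boo; apply: le_measure; rewrite ?inE.
rewrite -lee_fin !kintE//; apply: ge0_le_integral => //.
- by move=> x _; rewrite lee_fin mulr_ge0.
- exact: measurable_kind.
- exact: measurable_kind.
move=> x _; rewrite lee_fin ler_wpM2r// !indicE ler_nat.
by case: (boolP (x \in A)) => // /set_mem/AB/mem_set ->.
Qed.

Lemma kintU A B v : measurable A -> measurable B -> (mu A < +oo)%E -> (mu B < +oo)%E ->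
  A `&` B = set0 -> kint (A `|` B) v = kint A v + kint B v.
Proof.
move=> mA mB Aoo Boo AB.
have mAB := measurableU _ _ mA mB.
have ABoo : (mu (A `|` B) < +oo)%E by rewrite measureU// lte_add_pinfty.
apply: EFin_inj; rewrite EFinD !kintE// -ge0_integralD//; last first.
- exact: measurable_kind.
- by move=> x _; rewrite lee_fin mulr_ge0.
- exact: measurable_kind.
- by move=> x _; rewrite lee_fin mulr_ge0.
apply: eq_integral => x _; rewrite -EFinD -mulrDl; congr (_ * _)%:E.
rewrite !indicE in_setU.
have [xA|xA] := boolP (x \in A); have [xB|xB] := boolP (x \in B); rewrite ?addr0 ?add0r//=.
have : (A `&` B) x by split; exact: set_mem.
by rewrite AB.
Qed.

Lemma kint_null A v : measurable A -> mu A = 0%E -> kint A v = 0.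
Proof.
move=> mA A0; apply/eqP; rewrite eq_le kint_ge0 andbT.
by have := @kint_le A v mA; rewrite A0 => ->.
Qed.

Lemma kint_lip A B v : measurable A -> measurable B -> (mu A < +oo)%E -> (mu B < +oo)%E ->
  kint A v <= kint B v + fine (mu (A `\` B)).
Proof.
move=> mA mB Aoo Boo.
have mD := measurableD mA mB.
have mI := measurableI _ _ mA mB.
have Doo : (mu (A `\` B) < +oo)%E by apply: le_lt_trans Aoo; apply: le_measure; rewrite ?inE.
have Ioo : (mu (A `&` B) < +oo)%E by apply: le_lt_trans Aoo; apply: le_measure; rewrite ?inE.
rewrite -{1}(setUIDK A B) kintU//; last by rewrite setDE setIACA setICr setI0.
by apply: lerD; [exact: kint_subset|exact: kint_le].
Qed.

Lemma kint_subU A B C v : measurable A -> measurable B -> measurable C ->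
  (mu A < +oo)%E -> (mu B < +oo)%E -> C `<=` A `|` B -> kint C v <= kint A v + kint B v.
Proof.
move=> mA mB mC Aoo Boo CAB.
have mD := measurableD mB mA.
have Doo : (mu (B `\` A) < +oo)%E by apply: le_lt_trans Boo; apply: le_measure; rewrite ?inE.
apply: (@le_trans _ _ (kint (A `|` (B `\` A)) v)).
  apply: kint_subset => //; first exact: measurableU.
    by rewrite measureU ?lte_add_pinfty// setDE setICA setICr setI0.
  by move=> x /CAB[Ax|Bx]; [left|have [?|?] := pselect (A x); [left|right]].
rewrite kintU//; last by rewrite setDE setICA setICr setI0.
by rewrite lerD2l; apply: kint_subset.
Qed.

End kernel_integral.

Section gauss_weight.
Context (R : realType).
Local Notation mR := (measurableTypeR R).
Local Notation V n := (fvec (measurableTypeR R) 'I_n).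
Local Notation leb := (@lebesgue_measure R).

(** A weight of finite mass that is at once even, log-concave, invariant under isometries and a
    product over coordinates. It disappears in [gw_le] by letting [de] tend to 0. *)
Definition gw n (de : R) (v : V n) : R := expR (- (de * dotp v v)).

Lemma gw_ge0 n de v : 0 <= @gw n de v. Proof. exact: expR_ge0. Qed.

Lemma measurable_gw n de : measurable_fun setT (@gw n de).
Proof.
apply: (@measurableT_comp _ _ _ _ _ _ (@expR R)) => //.
apply: measurableT_comp => //; apply: measurable_funM => //.
exact: measurable_dotpp.
Qed.

Lemma dotp_vcons n (t s : R) (x y : V n) :
  dotp (vcons (t : mR, x)) (vcons (s : mR, y)) = t * s + dotp x y.
Proof.
rewrite /dotp big_ord_recl !vcons0; congr (_ + _).
by apply: eq_bigr => i _; rewrite !vconsS.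
Qed.

Lemma gw_vcons n de (t : R) (y : V n) :
  gw de (vcons (t : mR, y)) = expR (- (de * t ^+ 2)) * gw de y.
Proof. by rewrite /gw dotp_vcons -expRD; congr expR; lra. Qed.

Lemma gauss_fin (de : R) : 0 < de -> (\int[leb]_t (expR (- (de * t ^+ 2)))%:E < +oo)%E.
Proof.
move=> de0.
pose c := Num.sqrt de.
have c0 : 0 < c by rewrite sqrtr_gt0.
have mf : measurable_fun setT (fun x : mR => c * x + 0 : mR).
  by apply: measurable_funD => //; exact: measurable_funM.
have c0' : 0 <= c^-1 by rewrite invr_ge0 ltW.
have -> : (\int[leb]_t (expR (- (de * t ^+ 2)))%:E = c^-1%:E * \int[leb]_t (gauss_fun t)%:E)%E.
  have mG : measurable_fun setT (fun t : mR => (gauss_fun t)%:E).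
    by apply/measurable_EFinP; exact: measurable_gauss_fun.
  have G0 (x : mR) : (0 <= (gauss_fun x)%:E)%E by rewrite lee_fin gauss_fun_ge0.
  rewrite -(@ge0_integral_mscale _ _ _ leb setT measurableT (NngNum c0') (fun t => (gauss_fun t)%:E))//.
  transitivity (\int[pushforward leb (fun x : mR => (c * x + 0)%R : mR)]_t (gauss_fun t)%:E)%E.
    rewrite ge0_integral_pushforward// preimage_setT; apply: eq_integral => t _ /=.
    by rewrite /gauss_fun addr0 exprMn sqr_sqrtr// ltW.
  by apply: eq_measure_integral => A mA _; exact: lebesgue_affine.
by rewrite integralT_gauss -EFinM ltry.
Qed.

Lemma gw_fin n de : 0 < de -> (\int[mun R n]_v (gw de v)%:E < +oo)%E.
Proof.
move=> de0; elim: n => [|n ih].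
  by rewrite /mun /= integral_dirac ?diracT ?mul1e ?ltry//; apply/measurable_EFinP; exact: measurable_gw.
rewrite tonelli_pw; last 2 first.
- by apply/measurable_EFinP; exact: measurable_gw.
- by move=> x; rewrite lee_fin gw_ge0.
have me : measurable_fun setT (fun t : mR => (expR (- (de * t ^+ 2)))%:E).
  apply/measurable_EFinP/measurableT_comp => //; apply: measurableT_comp => //.
  by apply: measurable_funM => //; exact: measurable_funX.
have mW : measurable_fun setT (fun v : V n => (gw de v)%:E).
  by apply/measurable_EFinP; exact: measurable_gw.
have W0 (v : V n) : (0 <= (gw de v)%:E)%E by rewrite lee_fin gw_ge0.
have e0 (t : mR) : (0 <= (expR (- (de * t ^+ 2)))%:E)%E by rewrite lee_fin expR_ge0.
have ie0 : (0 <= \int[leb]_t (expR (- (de * t ^+ 2)))%:E)%E by exact: integral_ge0.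
have iW0 : (0 <= \int[mun R n]_v (gw de v)%:E)%E by exact: integral_ge0.
rewrite (eq_integral (fun t : mR => (expR (- (de * t ^+ 2)))%:E * \int[mun R n]_v (gw de v)%:E)%E).
  by rewrite ge0_integralZr// lte_mul_pinfty// ?gauss_fin// ge0_fin_numE// gauss_fin.
move=> t _; under eq_integral do rewrite gw_vcons EFinM.
by rewrite ge0_integralZl.
Qed.

End gauss_weight.

                                                     

(** * Contracting the centres of intervals, by log-concavity and evenness *)

Section anderson.
Context (R : realType).
Local Notation mR := (measurableTypeR R).
Local Notation V n := (fvec (measurableTypeR R) 'I_n).
Local Notation leb := (@lebesgue_measure R).

Lemma integral_opp (f : mR -> \bar R) : measurable_fun setT f -> (forall t, 0 <= f t)%E ->
  (\int[leb]_t f (- t)%R = \int[leb]_t f t)%E.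
Proof.
move=> mf f0.
transitivity (\int[pushforward leb (-%R : mR -> mR)]_t f t)%E.
  by rewrite ge0_integral_pushforward//; exact: measurable_oppr.
by apply: eq_measure_integral => A mA _; exact: lebesgue_measureN.
Qed.

Lemma integral_vopp n (F : V n -> \bar R) : measurable_fun setT F -> (forall x, 0 <= F x)%E ->
  (\int[mun R n]_x F (vscale (-1) x) = \int[mun R n]_x F x)%E.
Proof.
move=> mF F0; apply: integral_isometry => //; split.
- exact: measurable_vscale.
- by move=> x h; apply/funext => i; rewrite /vscale /vadd mulrDr.
- by move=> x; apply/funext => i; rewrite /vscale mulrA mulrNN mulr1 mul1r.
- by move=> x; apply: eq_bigr => i _; rewrite /vscale; lra.
Qed.

(** Passes from strict lower bounds to the values themselves: shrinking [X] and [Y] by a factor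
    [q < 1] multiplies the weighted geometric mean by [q]. *)
Lemma pl_limit (al be X Y Z : R) : 0 < al -> 0 < be -> al + be = 1 ->
  0 <= X -> 0 <= Y -> 0 <= Z ->
  (forall a b, 0 < a -> 0 < b -> a < X -> b < Y -> a `^ al * b `^ be <= Z) ->
  X `^ al * Y `^ be <= Z.
Proof.
move=> al0 be0 albe X0 Y0 Z0 h.
have [->|XN0] := eqVneq X 0; first by rewrite powR0 ?mul0r// gt_eqF.
have [->|YN0] := eqVneq Y 0; first by rewrite (powR0 (x := be)) ?mulr0// gt_eqF.
have {}X0 : 0 < X by rewrite lt_neqAle eq_sym XN0.
have {}Y0 : 0 < Y by rewrite lt_neqAle eq_sym YN0.
set P := X `^ al * Y `^ be.
have P0 : 0 < P by rewrite mulr_gt0// powR_gt0.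
have hq q : 0 < q -> q < 1 -> q * P <= Z.
  move=> q0 q1; rewrite -powR_scale//.
  by apply: h; rewrite ?mulr_gt0// gtr_pMl.
rewrite leNgt; apply/negP => ZP.
pose q := (Z / P + 1) / 2.
have ZP1 : Z / P < 1 by rewrite ltr_pdivrMr// mul1r.
have ZP0 : 0 <= Z / P by rewrite divr_ge0// ltW.
have q0 : 0 < q by rewrite /q; lra.
have q1 : q < 1 by rewrite /q; lra.
have := hq _ q0 q1; rewrite -ler_pdivlMr// /q; lra.
Qed.

Lemma ler_powR2 (al be a b A B : R) : 0 < al -> 0 < be -> 0 < a -> 0 < b ->
  a < A -> b < B -> a `^ al * b `^ be <= A `^ al * B `^ be.
Proof.
move=> al0 be0 a0 b0 aA bB; apply: ler_pM; rewrite ?powR_ge0//.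
  by apply: ge0_ler_powR; rewrite ?nnegrE ?ltW// (lt_trans a0).
by apply: ge0_ler_powR; rewrite ?nnegrE ?ltW// (lt_trans b0).
Qed.

Lemma expR_powR (x a : R) : expR x `^ a = expR (a * x).
Proof. by rewrite /powR gt_eqF ?expR_gt0// expRK. Qed.

Lemma powR_prod (I : Type) (r : seq I) (x : I -> R) a : (forall i, 0 <= x i) ->
  (\prod_(i <- r) x i) `^ a = \prod_(i <- r) (x i `^ a).
Proof.
move=> x0; elim: r => [|i r ih]; first by rewrite !big_nil powR1.
by rewrite !big_cons powRM ?ih// prodr_ge0.
Qed.

Variables (m N : nat) (de : R) (s : 'I_N -> R) (w : R) (y : 'I_N -> V m).
Hypotheses (de0 : 0 < de) (s0 : forall k, 0 <= s k).

(** The kernel [exp(- s_k <x,u>^2)] at [x = (t, y_k)] and [u = (w, v)] with [w] and [y_k] frozen.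
    Two properties drive the sliding argument: joint log-concavity in [(t, v)] and invariance under
    [(t, v) -> (- t, - v)]. *)
Definition bker k (z : mR * V m) : R := expR (- (s k * (z.1 * w + dotp (y k) z.2) ^+ 2)).

Lemma measurable_bker k : measurable_fun setT (bker k).
Proof.
apply: (@measurableT_comp _ _ _ _ _ _ (@expR R)) => //.
apply: measurableT_comp => //; apply: measurable_funM => //.
apply: measurable_funX; apply: measurable_funD.
  by apply: measurable_funM => //.
apply: (@measurableT_comp _ _ _ _ _ _ (fun v : V m => dotp (y k) v)) => //.
rewrite (_ : (fun v => _) = (fun v : V m => dotp v (y k))); first exact: measurable_dotpl.
by apply/funext => v; apply: eq_bigr => i _; rewrite mulrC.
Qed.

Lemma bker01 k z : 0 <= bker k z <= 1.
Proof.
rewrite expR_ge0/= -expR0 ler_expR oppr_le0.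
by rewrite mulr_ge0// sqr_ge0.
Qed.

Definition itv (c r : R) : set mR := `[c - r, c + r]%classic.

Lemma measurable_itvcr c r : measurable (itv c r).
Proof. exact: measurable_itv. Qed.

Lemma leb_itv c r : 0 <= r -> leb (itv c r) = (2 * r)%:E.
Proof.
move=> r0; rewrite /itv lebesgue_measure_itv/= lte_fin.
case: ltP => h; first by rewrite -EFinB; congr EFin; lra.
by congr EFin; lra.
Qed.

Lemma leb_itv_fin c r : (leb (itv c r) < +oo)%E.
Proof.
by rewrite /itv lebesgue_measure_itv/=; case: ifP => _; rewrite ?ltry// -EFinB ltry.
Qed.

Definition psi k E v := kint leb (bker k) E v.

Lemma psi_opp k c r v : psi k (itv (- c) r) v = psi k (itv c r) (vscale (-1) v).
Proof.
rewrite /psi /kint; congr fine.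
rewrite -[LHS]integral_opp; last 2 first.
- by apply: measurable_kind; [exact: measurable_bker|exact: measurable_itvcr].
- by move=> t; rewrite lee_fin mulr_ge0// expR_ge0.
apply: eq_integral => t _; congr (_ * _)%:E.
  rewrite !indicE; congr (_%:R); congr nat_of_bool.
  by apply/idP/idP; rewrite !inE /itv/= !in_itv/= => /andP[? ?]; apply/andP; split; lra.
rewrite /bker/=; congr expR; congr (- _); congr (_ * _).
have -> : dotp (y k) (vscale (-1) v) = - dotp (y k) v.
  by rewrite /dotp -sumrN; apply: eq_bigr => i _; rewrite /vscale; lra.
by rewrite -sqrrN; congr (_ ^+ 2); lra.
Qed.

Section convex_combination.
Variables (al be : R).
Hypotheses (al0 : 0 < al) (be0 : 0 < be) (albe : al + be = 1).

Lemma sqr_convex (a b : R) : (al * a + be * b) ^+ 2 <= al * a ^+ 2 + be * b ^+ 2.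
Proof.
have -> : al * a ^+ 2 + be * b ^+ 2 = (al * a + be * b) ^+ 2 + al * be * (a - b) ^+ 2.
  have -> : be = 1 - al by rewrite -albe addrAC subrr add0r.
  ring.
by rewrite lerDl mulr_ge0 ?sqr_ge0// mulr_ge0// ltW.
Qed.

Lemma dotp_vcomb (u x z : V m) : dotp u (vcomb al be x z) = al * dotp u x + be * dotp u z.
Proof.
rewrite /dotp !mulr_sumr -big_split; apply: eq_bigr => i _ /=.
rewrite /vcomb /vadd /vscale; lra.
Qed.

Lemma bker_logconcave k t t' x z :
  bker k (t, x) `^ al * bker k (t', z) `^ be <= bker k (al * t + be * t', vcomb al be x z).
Proof.
rewrite /bker/= !expR_powR -expRD ler_expR dotp_vcomb.
have -> : (al * t + be * t') * w + (al * dotp (y k) x + be * dotp (y k) z) =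
   al * (t * w + dotp (y k) x) + be * (t' * w + dotp (y k) z) by lra.
have := sqr_convex (t * w + dotp (y k) x) (t' * w + dotp (y k) z).
by move=> /(ler_wpM2l (s0 k)); lra.
Qed.

(** Prekopa-Leindler in [t], for the interval centred at [c] and, through evenness, its mirror image
    centred at [- c]. Their combination is the interval of the same half-length centred at
    [(al - be) c]. *)
Lemma psi_logconcave k c r x z :
  psi k (itv c r) x `^ al * psi k (itv c r) (vscale (-1) z) `^ be <=
  psi k (itv ((al - be) * c) r) (vcomb al be x z).
Proof.
rewrite -psi_opp.
have psi0 E v : 0 <= psi k E v by apply: kint_ge0 => u; exact: bker01.
apply: (pl_limit al0 be0 albe (psi0 _ _) (psi0 _ _) (psi0 _ _)) => a b a0 b0.
have mkk := measurable_bker k.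
have kk01 := bker01 k.
have mI := measurable_itvcr; have fI := leb_itv_fin.
have pE c' v : (psi k (itv c' r) v)%:E = (\int[leb]_t (\1_(itv c' r) t * bker k (t, v))%:E)%E.
  exact: (kintE mkk kk01 v (mI c' r) (fI c' r)).
have pm c' v : measurable_fun setT (fun t => (\1_(itv c' r) t * bker k (t, v))%:E).
  exact: (measurable_kind mkk v (mI c' r)).
have p0 c' v t : (0 <= (\1_(itv c' r) t * bker k (t, v))%:E)%E.
  by rewrite lee_fin mulr_ge0// expR_ge0.
rewrite -(lte_fin a) -(lte_fin b) -lee_fin !pE.
apply: (prekopa_leindler1 al0 be0 albe (pm _ _) (pm _ _) (pm _ _) (p0 _ _) (p0 _ _) (p0 _ _) _ a0 b0).
move=> t t' a1 b1 a10 b10; rewrite !lte_fin !indicE.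
have [tI|] := boolP (t \in itv c r); last by rewrite mul0r => _ /(lt_trans a10); rewrite ltxx.
have [tI'|] := boolP (t' \in itv (- c) r); last by move=> _ _; rewrite mul0r => /(lt_trans b10); rewrite ltxx.
rewrite !mul1r => at1 bt1.
rewrite mem_set; last first.
  move: tI tI'; rewrite !inE /itv/= !in_itv/= => /andP[h1 h2] /andP[h3 h4].
  have h1' := ler_wpM2l (ltW al0) h1; have h2' := ler_wpM2l (ltW al0) h2.
  have h3' := ler_wpM2l (ltW be0) h3; have h4' := ler_wpM2l (ltW be0) h4.
  have E : r = al * r + be * r by rewrite -mulrDl albe mul1r.
  by apply/andP; split; lra.
rewrite mul1r lee_fin; apply: le_trans (bker_logconcave k t t' x z).
exact: (ler_powR2 al0 be0 a10 b10 at1 bt1).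
Qed.

Lemma gw_logconcave x z : @gw R m de x `^ al * gw de z `^ be <= gw de (vcomb al be x z).
Proof.
rewrite /gw !expR_powR -expRD ler_expR.
suff : dotp (vcomb al be x z) (vcomb al be x z) <= al * dotp x x + be * dotp z z.
  by move/(ler_wpM2l (ltW de0)); lra.
rewrite /dotp !mulr_sumr -big_split; apply: ler_sum => i _ /=.
have := sqr_convex (x i) (z i); rewrite /vcomb /vadd /vscale; lra.
Qed.

                                                                                                         
                                                                          
(** Let I(c) be the integral as a function of the centres. Prekopa-Leindler in [v], applied to the
    integrand at [v] and at [- v], gives [I(c)^al I(c)^be <= I((al - be) c)], in the spirit of
    Anderson's theorem: a common contraction of the centres does not decrease I. *)
Lemma slide_combination (c r : 'I_N -> R) :
  (\int[mun R m]_v (gw de v * \prod_k psi k (itv (c k) (r k)) v)%:E <=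
   \int[mun R m]_v (gw de v * \prod_k psi k (itv ((al - be) * c k) (r k)) v)%:E)%E.
Proof.
pose F (c' : 'I_N -> R) (v : V m) := gw de v * \prod_k psi k (itv (c' k) (r k)) v.
have psi0 k E v : 0 <= psi k E v by apply: kint_ge0 => u; exact: bker01.
have F0 c' v : 0 <= F c' v by rewrite mulr_ge0 ?gw_ge0// prodr_ge0.
have mF c' : measurable_fun setT (F c').
  apply: measurable_funM; first exact: measurable_gw.
  apply: measurable_prod_cond => k; apply: measurable_kint.
  - exact: measurable_bker.
  - by move=> u; exact: bker01.
  - exact: measurable_itvcr.
have mFe c' : measurable_fun setT (fun v => (F c' v)%:E) by exact/measurable_EFinP.
have mFo c' : measurable_fun setT (fun v => (F c' (vscale (-1) v))%:E).
  by apply: (@measurableT_comp _ _ _ _ _ _ (fun v => (F c' v)%:E)) => //; exact: measurable_vscale.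
(* Prekopa-Leindler only speaks of reals strictly below an integral; comparing the two possibly
   infinite integrals is postponed to the end of the proof. *)
have key (a : R) : 0 < a -> (a%:E < \int[mun R m]_v (F c v)%:E)%E ->
    (a%:E <= \int[mun R m]_v (F (fun k => ((al - be) * c k)%R) v)%:E)%E.
  move=> a0 af.
  have -> : a = a `^ al * a `^ be.
    by rewrite -powRD ?albe ?powRr1 ?oner_eq0// ltW.
  have Fe0 c' v : (0 <= (F c' v)%:E)%E by rewrite lee_fin.
  have af' : (a%:E < \int[mun R m]_v (F c (vscale (-1) v))%:E)%E.
    by rewrite (integral_vopp (mFe c) (Fe0 c)).
  refine (@prekopa_leindler R al be al0 be0 albe m _ _ (fun v => (F (fun k => (al - be) * c k) v)%:E) a a (mFe c) (mFo c) (mFe _) (Fe0 c) (fun v => Fe0 c _) (Fe0 _) _ a0 a0 af af').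
    move=> x z a1 b1 a10 b10; rewrite !lte_fin lee_fin => ax bz.
    apply: (@le_trans _ _ (F c x `^ al * F c (vscale (-1) z) `^ be)).
      exact: (ler_powR2 al0 be0 a10 b10 ax bz).
    have P0 v : 0 <= \prod_k psi k (itv (c k) (r k)) v by apply: prodr_ge0 => k _; exact: psi0.
    rewrite /F (powRM _ (gw_ge0 _ _) (P0 _)) (powRM _ (gw_ge0 _ _) (P0 _)) mulrACA.
    apply: ler_pM.
    - by rewrite mulr_ge0// powR_ge0.
    - by rewrite mulr_ge0// powR_ge0.
    - have -> : gw de (vscale (-1) z) = gw de z.
        by rewrite /gw; congr expR; congr (- (_ * _)); apply: eq_bigr => i _; rewrite /vscale; lra.
      exact: gw_logconcave.
    - have pk v k : 0 <= psi k (itv (c k) (r k)) v by exact: psi0.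
      rewrite (powR_prod _ _ (pk _)) (powR_prod _ _ (pk _)) -big_split; apply: ler_prod => k _ /=.
      by rewrite mulr_ge0 ?powR_ge0//= psi_logconcave.
have I0 c' : (0 <= \int[mun R m]_v (F c' v)%:E)%E.
  by apply: integral_ge0 => v _; rewrite lee_fin.
rewrite leNgt; apply/negP => lt.
have {}lt : (\int[mun R m]_v (F (fun k => ((al - be) * c k)%R) v)%:E < \int[mun R m]_v (F c v)%:E)%E.
  exact: lt.
move: key (I0 (fun k => (al - be) * c k)) lt.
move: (\int[mun R m]_v (F (fun k => ((al - be) * c k)%R) v)%:E)%E => J.
move: (\int[mun R m]_v (F c v)%:E)%E => I key J0 lt.
have Jfin : J \is a fin_num by rewrite ge0_fin_numE// (lt_le_trans lt)// leey.
move: J0 lt key; rewrite -(fineK Jfin); move: (fine J) => j; rewrite lee_fin => j0.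
case: I => [i| |] //.
  rewrite lte_fin => ji /(_ ((j + i) / 2)); rewrite lte_fin lee_fin => h.
  have := h _ _; lra.
move=> _ /(_ (j + 1)); rewrite ltry lee_fin => h.
have := h _ isT; lra.
Qed.

End convex_combination.

Lemma slide (la : R) (c r : 'I_N -> R) : 0 <= la <= 1 ->
  (\int[mun R m]_v (gw de v * \prod_k psi k (itv (c k) (r k)) v)%:E <=
   \int[mun R m]_v (gw de v * \prod_k psi k (itv (la * c k) (r k)) v)%:E)%E.
Proof.
move=> /andP[la0]; rewrite le_eqVlt => /orP[/eqP ->|la1].
  by under [leRHS]eq_integral => v _ do under eq_bigr => k _ do rewrite mul1r.
(* These weights sum to 1 and differ by [la]. They must be positive, which is why [la = 1] was set
   apart. *)
have := @slide_combination ((1 + la) / 2) ((1 - la) / 2).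
have -> : (1 + la) / 2 - (1 - la) / 2 = la by lra.
apply; lra.
Qed.

End anderson.

(** * Finite families of non-overlapping intervals *)

Section families.
Context (R : realType).
Local Notation mR := (measurableTypeR R).
Local Notation V n := (fvec (measurableTypeR R) 'I_n).
Local Notation leb := (@lebesgue_measure R).

                                                                                        
(** Intervals are coded as (centre, half-length). Interiors are disjoint, but endpoints may touch:
    contact is the moment at which intervals are merged. *)
Definition fam_ok (l : seq (R * R)) := [/\ uniq l, (forall p, p \in l -> 0 < p.2) &
  (forall p q, p \in l -> q \in l -> p != q -> p.2 + q.2 <= `|p.1 - q.1|)].

Lemma fam_ok_perm l l' : perm_eq l l' -> fam_ok l -> fam_ok l'.
Proof.
move=> ll [ul l0 lpq]; split.
- by rewrite -(perm_uniq ll).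
- by move=> p; rewrite -(perm_mem ll); exact: l0.
- by move=> p q; rewrite -!(perm_mem ll); exact: lpq.
Qed.

Lemma fam_ok_cons p l : fam_ok l -> 0 < p.2 ->
  (forall q, q \in l -> p.2 + q.2 <= `|p.1 - q.1|) -> fam_ok (p :: l).
Proof.
move=> [ul l0 lpq] p0 pl; split.
- rewrite /= ul andbT; apply/negP => pinl; have := pl _ pinl.
  by rewrite subrr normr0 leNgt addr_gt0.
- by move=> q; rewrite inE => /orP[/eqP ->//|]; exact: l0.
- move=> q q'; rewrite !inE => /orP[/eqP ->|ql] /orP[/eqP ->|ql'].
  + by rewrite eqxx.
  + by move=> _; exact: pl.
  + by move=> _; rewrite addrC distrC; exact: pl.
  + exact: lpq.
Qed.

Lemma fam_ok_behead p l : fam_ok (p :: l) -> fam_ok l.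
Proof.
move=> [/= /andP[_ ul] l0 lpq]; split => //.
- by move=> q ql; apply: l0; rewrite inE ql orbT.
- by move=> q q' ql ql'; apply: lpq; rewrite inE ?ql ?ql' orbT.
Qed.

Lemma seq_max (l : seq R) : l != [::] -> exists2 x, x \in l & forall y, y \in l -> y <= x.
Proof.
elim: l => // a [|b l] ih _.
  by exists a; rewrite ?mem_head// => y; rewrite inE => /eqP ->.
have [//|x xl hx] := ih _.
have [ax|xa] := leP a x.
  exists x; first by rewrite inE xl orbT.
  by move=> z; rewrite inE => /orP[/eqP ->//|]; exact: hx.
exists a; first exact: mem_head.
move=> z; rewrite inE => /orP[/eqP ->//|/hx zx].
exact: le_trans (ltW xa).
Qed.

(** If [p] overlaps some [q], both are replaced by their hull, whose half-length is at most the sum,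
    and the hull is inserted into the shorter family. Otherwise [p] is simply added. *)
Lemma family_cover1 (l : seq (R * R)) (p : R * R) : fam_ok l -> 0 < p.2 ->
  exists l', [/\ fam_ok l',
    \bigcup_(q in [set` p :: l]) itv q.1 q.2 `<=` \bigcup_(q in [set` l']) itv q.1 q.2 &
    \sum_(q <- l') q.2 <= p.2 + \sum_(q <- l) q.2].
Proof.
elim: {l}(size l) {-2}l (leqnn (size l)) p => [|n ih] l ln p okl p0.
  move: ln; rewrite leqn0 size_eq0 => /eqP l0; exists [:: p]; split => //.
  - by apply: fam_ok_cons => //; split.
  - by rewrite l0.
  - by rewrite l0 !big_cons big_nil.
have [/hasP[q ql qp]|] := boolP (has (fun q => `|p.1 - q.1| < p.2 + q.2) l); last first.
  move=> /hasPn nh; exists (p :: l); split => //.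
  - by apply: fam_ok_cons => // q ql; rewrite leNgt; exact: nh.
  - by rewrite big_cons.
have pl := perm_to_rem ql.
have okr := fam_ok_perm pl okl.
have q0 : 0 < q.2 by have [_ h _] := okl; exact: h.
pose a := Num.min (p.1 - p.2) (q.1 - q.2).
pose b := Num.max (p.1 + p.2) (q.1 + q.2).
have ab : 0 < b - a.
  rewrite subr_gt0; apply: (@le_lt_trans _ _ (p.1 - p.2)); first by rewrite ge_min lexx.
  by apply: (@lt_le_trans _ _ (p.1 + p.2)); [lra|rewrite le_max lexx].
have bale : (b - a) / 2 <= p.2 + q.2.
  move: qp; rewrite /a /b ltr_norml => /andP[h1 h2].
  by rewrite minEle maxEle; case: ifP => _; case: ifP => _; lra.
have srl : (size (rem q l) <= n)%N by rewrite size_rem// -ltnS; case: (l) ql ln.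
have [|l' [okl' cl' sl']] := ih (rem q l) srl ((a + b) / 2, (b - a) / 2) (fam_ok_behead okr).
  by rewrite divr_gt0.
exists l'; split => //.
  apply: subset_trans cl' => t [u ul tu].
  have [uE|uE] := boolP ((u == p) || (u == q)).
    exists ((a + b) / 2, (b - a) / 2); first by rewrite /= mem_head.
    move: tu; rewrite /itv/= !in_itv/= => /andP[h1 h2].
    have ap : a <= p.1 - p.2 by rewrite ge_min lexx.
    have aq : a <= q.1 - q.2 by rewrite ge_min lexx orbT.
    have bp : p.1 + p.2 <= b by rewrite le_max lexx.
    have bq : q.1 + q.2 <= b by rewrite le_max lexx orbT.
    by case/orP: uE h1 h2 => /eqP -> h1 h2; apply/andP; split; lra.
  move: uE; rewrite negb_or => /andP[up uq].
  exists u => //=; rewrite inE; apply/orP; right.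
  move: ul; rewrite /= inE (negbTE up)/= (perm_mem pl) inE (negbTE uq)//.
apply: (le_trans sl') => /=.
by rewrite (perm_big _ pl)/= big_cons; lra.
Qed.

Lemma family_cover (l : seq (R * R)) : (forall p, p \in l -> 0 < p.2) ->
  exists l', [/\ fam_ok l',
    \bigcup_(q in [set` l]) itv q.1 q.2 `<=` \bigcup_(q in [set` l']) itv q.1 q.2 &
    \sum_(q <- l') q.2 <= \sum_(q <- l) q.2].
Proof.
elim: l => [|p l ih] l0.
  by exists [::]; split => //; split.
have [|l1 [ok1 c1 s1]] := ih.
  by move=> q ql; apply: l0; rewrite inE ql orbT.
have [|l' [ok' c' s']] := family_cover1 ok1 (l0 p _); first exact: mem_head.
exists l'; split => //.
  apply: subset_trans c' => t [q qpl tq].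
  move: qpl; rewrite /= inE => /orP[/eqP qE|ql].
    by exists q => //=; rewrite inE qE eqxx.
  have [|u ul tu] := c1 t; first by exists q.
  by exists u => //=; rewrite inE ul orbT.
by rewrite big_cons (le_trans s')// lerD2l.
Qed.

Lemma measurable_family (l : seq (R * R)) :
  measurable (\bigcup_(q in [set` l]) itv q.1 q.2 : set mR).
Proof.
by apply: fin_bigcup_measurable => // q _; exact: measurable_itvcr.
Qed.

Lemma family_nil : \bigcup_(q in [set` [::]]) itv q.1 q.2 = set0 :> set mR.
Proof. by apply/seteqP; split => // x []. Qed.

Lemma family_cons (p : R * R) l : \bigcup_(q in [set` p :: l]) itv q.1 q.2 =
  itv p.1 p.2 `|` \bigcup_(q in [set` l]) itv q.1 q.2 :> set mR.
Proof.
apply/seteqP; split => x.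
  by move=> [q] /=; rewrite inE => /orP[/eqP ->|ql] xq; [left|right; exists q].
move=> [xp|[q /= ql xq]]; first by exists p => //=; rewrite mem_head.
by exists q => //=; rewrite inE ql orbT.
Qed.

Lemma leb_family_fin (l : seq (R * R)) :
  (leb (\bigcup_(q in [set` l]) itv q.1 q.2) < +oo)%E.
Proof.
elim: l => [|p l ih].
  by rewrite family_nil measure0.
rewrite family_cons.
apply: le_lt_trans (measureU2 _ _ _) _; [exact: measurable_itvcr|exact: measurable_family|].
by rewrite lte_add_pinfty// leb_itv_fin.
Qed.

(** Take an almost optimal cover of [E] by half-open intervals, keep finitely many so that the tail
    is below [e], and make them non-overlapping without increasing the total length. *)
Lemma interval_approximation (E : set mR) (e : R) : measurable E -> (leb E < +oo)%E -> 0 < e ->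
  exists l, [/\ fam_ok l, (leb (E `\` \bigcup_(q in [set` l]) itv q.1 q.2) <= e%:E)%E &
    2 * \sum_(q <- l) q.2 <= fine (leb E) + e].
Proof.
move=> mE Eoo e0.
have Efin : leb E \is a fin_num by rewrite ge0_fin_numE.
have e30 : 0 < e / 2 by rewrite divr_gt0.
have [_ [A [mA EA] <-] Ae] := lb_ereal_inf_adherent e30 Efin.
have /choice[ab abE] : forall k, exists ab : R * R, A k = `]ab.1, ab.2]%classic.
  by move=> k; have [ab _ <-] := mA k; exists ab.
have AkE k : leb (A k) = (Num.max 0 ((ab k).2 - (ab k).1))%:E.
  rewrite abE lebesgue_measure_itv/= lte_fin.
  by case: ltP => h; rewrite -?EFinB; congr EFin; rewrite maxEle; case: ifP; rewrite ?subr_ge0 => //; lra.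
have mAk k : measurable (A k : set mR) by rewrite abE; exact: measurable_itv.
have {}Ae : (\sum_(0 <= k <oo) leb (A k) < leb E + (e / 2)%:E)%E.
  have wE k : wlength idfun (A k) = leb (A k).
    rewrite AkE abE wlength_itv/= lte_fin; case: ltP => h; rewrite -?EFinB; congr EFin;
      rewrite maxEle; case: ifP; rewrite ?subr_ge0 => //; lra.
  apply: le_lt_trans Ae; rewrite le_eqVlt; apply/orP; left; apply/eqP.
  by apply: eq_eseriesr => k _; rewrite -wE.
have Sfin : (\sum_(0 <= k <oo) leb (A k) < +oo)%E.
  by apply: lt_trans Ae _; rewrite -(fineK Efin) -EFinD ltry.
have [M tailM] : exists M, (\sum_(M <= k <oo) leb (A k) < e%:E)%E.
  have /(_ (fun k _ => measure_ge0 leb (A k))) := nneseries_tail_cvg Sfin.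
  move=> /fine_cvgP[f1 /cvgrPdist_lt/(_ _ e0)[M1 _ h1]].
  have [M2 _ h2] := f1.
  exists (maxn M1 M2); have := h1 (maxn M1 M2) (leq_maxl _ _).
  rewrite /= sub0r normrN => /(le_lt_trans (ler_norm _)).
  by rewrite -lte_fin fineK//; exact: (h2 (maxn M1 M2) (leq_maxr _ _)).
pose good k := (ab k).1 < (ab k).2.
(* Empty intervals are filtered out, since [fam_ok] asks for positive half-lengths. *)
pose l0 := [seq (((ab k).1 + (ab k).2) / 2, ((ab k).2 - (ab k).1) / 2) | k <- iota 0 M & good k].
have l00 p : p \in l0 -> 0 < p.2.
  by move=> /mapP[k]; rewrite mem_filter /good => /andP[gk _] -> /=; rewrite divr_gt0// subr_gt0.
have [l [okl cl sl]] := family_cover l00.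
exists l; split => //.
  apply: le_trans (ltW tailM); apply: measure_sigma_subadditive_tail => //.
    by apply: measurableD => //; exact: measurable_family.
  move=> x [/EA[k _ Akx] nx]; exists k => //= kM; apply: nx; apply: cl.
  exists (((ab k).1 + (ab k).2) / 2, ((ab k).2 - (ab k).1) / 2) => /=.
    apply/mapP; exists k => //; rewrite mem_filter mem_iota/= add0n kM andbT /good.
    by move: Akx; rewrite abE/= in_itv/= => /andP[/lt_le_trans] h /h.
  by move: Akx; rewrite abE /itv/= !in_itv/= => /andP[h1 h2]; apply/andP; split; lra.
have sE : (2 * \sum_(q <- l0) q.2)%:E = (\sum_(0 <= k < M) leb (A k))%E.
  rewrite /l0 big_map big_filter mulr_sumr -sumEFin big_mkcond/= /index_iota subn0.
  apply: eq_bigr => k _; rewrite AkE /good; case: ltP => h; congr EFin.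
    by rewrite maxEle ifT; lra.
  by rewrite maxEle; case: ifP; lra.
apply: (@le_trans _ _ (2 * \sum_(q <- l0) q.2)); first by rewrite ler_pM2l.
rewrite -lee_fin sE EFinD fineK//.
apply: (@le_trans _ _ (\sum_(0 <= k <oo) leb (A k))%E).
  by apply: nneseries_lim_ge => k _ _.
by rewrite (le_trans (ltW Ae))// leeD2l// lee_fin; lra.
Qed.

End families.

(** * The one-dimensional rearrangement inequality *)

Lemma lee_sum_seq (R : realType) (I : eqType) (l : seq I) (f g : I -> \bar R) :
  (forall i, i \in l -> f i <= g i)%E -> (\sum_(i <- l) f i <= \sum_(i <- l) g i)%E.
Proof. by move=> fg; rewrite big_seq [leRHS]big_seq; apply: lee_sum. Qed.

Section bll1d.
Context (R : realType).
Local Notation mR := (measurableTypeR R).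
Local Notation V n := (fvec (measurableTypeR R) 'I_n).
Local Notation leb := (@lebesgue_measure R).
Variables (m N : nat) (de : R) (s : 'I_N -> R) (w : R) (y : 'I_N -> V m).
Hypotheses (de0 : 0 < de) (s0 : forall k, 0 <= s k).

Local Notation psi k E v := (@psi R m N s w y k E v).

Definition fsum k (l : seq (R * R)) (v : V m) : R := \sum_(p <- l) psi k (itv p.1 p.2) v.

Let psi0 k E v : 0 <= psi k E v.
Proof. by apply: kint_ge0 => u; exact: bker01. Qed.

Let mpsi k E : measurable E -> measurable_fun setT (fun v => psi k E v).
Proof.
by move=> mE; apply: measurable_kint => //; [exact: measurable_bker|move=> u; exact: bker01].
Qed.

Let mitv c r := @measurable_itvcr R c r.

Let fsum0 k l v : 0 <= fsum k l v.
Proof. by apply: sumr_ge0 => p _; exact: psi0. Qed.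

Let mfsum k l : measurable_fun setT (fsum k l).
Proof. by apply: measurable_sum => p; exact: mpsi. Qed.

Lemma measurable_W : measurable_fun setT (@gw R m de).
Proof. exact: measurable_gw. Qed.

(** Expanding the product of sums leaves one interval per factor, where [slide] applies. The
    contraction factor is common to all intervals of all families. *)
Lemma slide_family (la : R) (F : 'I_N -> seq (R * R)) : 0 <= la <= 1 ->
  (\int[mun R m]_v (gw de v * \prod_k fsum k (F k) v)%:E <=
   \int[mun R m]_v (gw de v * \prod_k fsum k [seq (la * p.1, p.2) | p <- F k] v)%:E)%E.
Proof.
move=> la01.
(* [slots] wants one index type for all factors, so a pair outside the family of [k] contributes the
   zero function. *)
pose a k (z : R * R) v := if z \in F k then psi k (itv z.1 z.2) v else 0.
pose b k (z : R * R) v := if z \in F k then psi k (itv (la * z.1) z.2) v else 0.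
have a0 k z v : 0 <= a k z v by rewrite /a; case: ifP => _ //; exact: psi0.
have b0 k z v : 0 <= b k z v by rewrite /b; case: ifP => _ //; exact: psi0.
have ma k z : measurable_fun setT (a k z).
  by rewrite /a; case: (z \in F k); [exact: mpsi|exact: measurable_cst].
have mb k z : measurable_fun setT (b k z).
  by rewrite /b; case: (z \in F k); [exact: mpsi|exact: measurable_cst].
apply: (@slots R _ (V m) (mun R m) N (R * R)%type a b (fun k => fsum k (F k))
  (fun k => fsum k [seq (la * p.1, p.2) | p <- F k]) a0 b0
  (fun k => fsum0 _ _) (fun k => fsum0 _ _) ma mb (fun k => mfsum _ _) (fun k => mfsum _ _)).
- move=> k W W' mW mW' W0 W0' h.
  have E (U : V m -> R) (g : R * R -> V m -> R) : measurable_fun setT U -> (forall v, 0 <= U v) ->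
      (forall p, measurable_fun setT (g p)) -> (forall p v, 0 <= g p v) ->
      (\int[mun R m]_v (U v * \sum_(p <- F k) g p v)%:E =
       \sum_(p <- F k) \int[mun R m]_v (U v * g p v)%:E)%E.
    move=> mU U0 mg g0; rewrite -ge0_integral_sum; [|exact: measurableT| |].
    - by apply: eq_integral => v _; rewrite mulr_sumr sumEFin.
    - by move=> p; apply/measurable_EFinP/measurable_funM.
    - by move=> p v _; rewrite lee_fin; exact: mulr_ge0.
  rewrite /fsum (E W (fun p v => psi k (itv p.1 p.2) v) mW W0 (fun p => mpsi k (mitv _ _)) (fun p v => psi0 _ _ _)).
  under [leRHS]eq_integral do rewrite big_map.
  rewrite (E W' (fun p v => psi k (itv (la * p.1) p.2) v) mW' W0' (fun p => mpsi k (mitv _ _)) (fun p v => psi0 _ _ _)).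
  apply: lee_sum_seq => p pF.
  by have := h p; rewrite /a /b pF.
- exact: measurable_W.
- by move=> v; exact: gw_ge0.
move=> z; have [/forallP zF|/forallPn[k kF]] := boolP [forall k, z k \in F k]; last first.
  under eq_integral do rewrite (bigD1 k)//= /a (negbTE kF) mul0r mulr0.
  rewrite integral0; apply: integral_ge0 => v _.
  by rewrite lee_fin; apply: mulr_ge0; [exact: gw_ge0|apply: prodr_ge0 => i _; exact: b0].
have aE v : \prod_k a k (z k) v = \prod_k psi k (itv (z k).1 (z k).2) v.
  by apply: eq_bigr => k _; rewrite /a zF.
have bE v : \prod_k b k (z k) v = \prod_k psi k (itv (la * (z k).1) (z k).2) v.
  by apply: eq_bigr => k _; rewrite /b zF.
under eq_integral do rewrite aE.
under [leRHS]eq_integral do rewrite bE.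
exact: slide.
Qed.

(** Two touching intervals form one interval, overlapping in a single point of measure 0. An
    interval that avoids both cannot fit inside the union, hence avoids it; this preserves
    [fam_ok]. *)
Lemma merge_pair k (p q : R * R) : 0 < p.2 -> 0 < q.2 -> `|p.1 - q.1| = p.2 + q.2 ->
  exists c, (forall v, psi k (itv p.1 p.2) v + psi k (itv q.1 q.2) v <=
                psi k (itv c (p.2 + q.2)) v) /\
    (forall u : R * R, 0 < u.2 -> u.2 + p.2 <= `|u.1 - p.1| -> u.2 + q.2 <= `|u.1 - q.1| ->
       p.2 + q.2 + u.2 <= `|c - u.1|).
Proof.
wlog pq : p q / p.1 <= q.1.
  move=> hw p0 q0 pqE; have [pq|qp] := leP p.1 q.1; first exact: hw.
  have pqE' : `|q.1 - p.1| = q.2 + p.2 by rewrite distrC pqE addrC.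
  have [c [c1 c2]] := hw q p (ltW qp) q0 p0 pqE'.
  exists c; split; first by move=> v; rewrite addrC [p.2 + _]addrC; exact: c1.
  by move=> u u0 up uq; rewrite [p.2 + _]addrC; exact: c2.
move=> p0 q0; rewrite ler0_norm ?subr_le0// => pqE.
(* The midpoint of the union, because [q.1 = p.1 + p.2 + q.2]. *)
exists (p.1 + q.2); split => [v|u u0].
  have mP := mitv p.1 p.2; have mQ := mitv q.1 q.2.
  have mD := measurableD mQ mP.
  have PP := leb_itv_fin p.1 p.2; have QQ := leb_itv_fin q.1 q.2.
  have DD : (leb (itv q.1 q.2 `\` itv p.1 p.2) < +oo)%E.
    by apply: le_lt_trans QQ; apply: le_measure; rewrite ?inE.
  have mk := @measurable_bker R m N s w y k.
  have k01 := @bker01 R m N s w y s0 k.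
  have h : psi k (itv q.1 q.2) v <= psi k (itv q.1 q.2 `\` itv p.1 p.2) v.
    have n0 : leb (itv q.1 q.2 `\` (itv q.1 q.2 `\` itv p.1 p.2)) = 0%E.
      have mQD := measurableD mQ mD.
      apply: (subset_measure0 mQD (measurable_set1 (q.1 - q.2))); last exact: lebesgue_measure_set1.
      move=> t [+ nD]; rewrite /itv/= in_itv/= => /andP[t1 t2].
      apply/eqP; rewrite eq_le t1 andbT leNgt; apply/negP => t3.
      apply: nD; split; rewrite /itv/= !in_itv/= ?t1 ?t2//.
      by move=> /andP[_ t4]; lra.
    apply: (le_trans (kint_lip mk k01 v mQ mD QQ DD)).
    have aux (x z : R) : z = 0 -> x + z <= x by move=> ->; rewrite addr0.
    exact: (aux _ _ (congr1 fine n0)).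
  apply: (le_trans (lerD (lexx _) h)).
  rewrite -(kintU mk k01 v mP mD PP DD); last by rewrite setDE setICA setICr setI0.
  apply: (kint_subset mk k01 v (measurableU _ _ mP mD) (mitv _ _) (leb_itv_fin _ _)).
  move=> t [|[+ _]]; rewrite /itv/= !in_itv/= => /andP[h1 h2]; apply/andP; split; lra.
move=> up uq; move: up uq.
by case: (ger0P (u.1 - p.1)) => h1; case: (ger0P (u.1 - q.1)) => h2;
  case: (ger0P (p.1 + q.2 - u.1)) => h3; lra.
Qed.

(** Contract all centres by a common factor until two intervals of one family touch for the first
    time, then merge them: the total number of intervals drops and each total length is preserved.
    Once every family has at most one interval, contract to centre 0. *)
Lemma merge_families (n : nat) (F : 'I_N -> seq (R * R)) : (\sum_k size (F k) <= n)%N ->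
  (forall k, fam_ok (F k)) ->
  (\int[mun R m]_v (gw de v * \prod_k fsum k (F k) v)%:E <=
   \int[mun R m]_v (gw de v * \prod_k psi k (itv 0 (\sum_(p <- F k) p.2)) v)%:E)%E.
Proof.
have intle (f g : 'I_N -> V m -> R) : (forall k, measurable_fun setT (f k)) ->
    (forall k, measurable_fun setT (g k)) -> (forall k v, 0 <= f k v) ->
    (forall k v, f k v <= g k v) ->
    (\int[mun R m]_v (gw de v * \prod_k f k v)%:E <=
     \int[mun R m]_v (gw de v * \prod_k g k v)%:E)%E.
  move=> mf mg f0 fg; apply: ge0_le_integral; first exact: measurableT.
  - by move=> v _; rewrite lee_fin; apply: mulr_ge0; [exact: gw_ge0|exact: prodr_ge0].
  - by apply/measurable_EFinP/measurable_funM; [exact: measurable_gw|exact: measurable_prod_cond].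
  - by apply/measurable_EFinP/measurable_funM; [exact: measurable_gw|exact: measurable_prod_cond].
  - move=> v _; rewrite lee_fin; apply: ler_wpM2l; first exact: gw_ge0.
    by apply: ler_prod => k _; rewrite f0 fg.
elim: n F => [|n ih] F sF okF.
  have F0 k : F k = [::].
    by apply/nilP; rewrite /nilp -leqn0 (leq_trans _ sF)// (bigD1 k)//= leq_addr.
  apply: intle => //; first by move=> k; exact: mpsi.
  by move=> k v; rewrite F0 /fsum big_nil.
(* The factors at which two intervals of one family would come into contact. The largest is the
   first contact reached from 1; being at least every other ratio, it creates no overlap. *)
pose ratios := flatten [seq flatten [seq [seq (p.2 + q.2) / `|p.1 - q.1| |
  q <- F k & q != p] | p <- F k] | k <- enum 'I_N].
have ratP x : reflect (exists k p q, [/\ p \in F k, q \in F k, p != q &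
    x = (p.2 + q.2) / `|p.1 - q.1|]) (x \in ratios).
  apply: (iffP idP).
    move=> /flatten_mapP[k _ /flatten_mapP[p pF /mapP[q]]].
    rewrite mem_filter => /andP[qp qF ->]; exists k, p, q; split => //.
    by rewrite eq_sym.
  move=> [k [p [q [pF qF pq ->]]]]; apply/flatten_mapP; exists k; first by rewrite mem_enum.
  apply/flatten_mapP; exists p => //; apply/mapP; exists q => //.
  by rewrite mem_filter qF eq_sym pq.
have [r0|rN0] := eqVneq ratios [::].
  have s1 k : (size (F k) <= 1)%N.
    rewrite leqNgt; apply/negP => s2.
    have [uF _ _] := okF k.
    case EF : (F k) s2 uF => [//|p [//|q l]] _ /=; rewrite inE negb_or => /andP[/andP[pq _] _].
    have : (p.2 + q.2) / `|p.1 - q.1| \in ratios.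
      by apply/ratP; exists k, p, q; rewrite EF !inE !eqxx orbT.
    by rewrite r0.
  apply: (le_trans (slide_family F (la := 0) _)); first by rewrite lexx ler01.
  apply: intle => [k|k|k v|k v]; [exact: mfsum|exact: mpsi|exact: fsum0|].
  rewrite /fsum big_map; case: (F k) (s1 k) => [|p [|//]] _.
    by rewrite big_nil; exact: psi0.
  by rewrite !big_cons !big_nil mul0r !addr0.
have [la /ratP[k0 [p [q [pF qF pq laE]]]] lamax] := seq_max rN0.
have dpos k p' q' : p' \in F k -> q' \in F k -> p' != q' -> 0 < `|p'.1 - q'.1|.
  have [_ F0 F1] := okF k => p'F q'F pq'.
  by apply: lt_le_trans (F1 _ _ p'F q'F pq'); rewrite addr_gt0// F0.
have [uk0 pos0 sep0] := okF k0.
have p0 := pos0 _ pF; have q0 := pos0 _ qF.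
have la0 : 0 < la by rewrite laE divr_gt0 ?addr_gt0//; exact: dpos pF qF pq.
have la1 : la <= 1.
  by rewrite laE ler_pdivrMr ?mul1r; [exact: sep0|exact: dpos pF qF pq].
apply: (le_trans (slide_family F (la := la) _)); first by rewrite ltW.
pose sc (p : R * R) := (la * p.1, p.2).
pose F' k := [seq sc p | p <- F k].
have sc_inj : injective sc.
  move=> [c1 r1] [c2 r2] [] /(mulfI (lt0r_neq0 la0)) -> -> //.
have okF' k : fam_ok (F' k).
  have [uF F0 F1] := okF k; split.
  - by rewrite map_inj_uniq.
  - by move=> _ /mapP[u uk ->]; exact: (F0 u uk).
  - move=> _ _ /mapP[u uk ->] /mapP[u' uk' ->] uu'.
    have uu : u != u' by apply: contraNneq uu' => ->.
    rewrite /sc/= -mulrBr normrM (gtr0_norm la0) -ler_pdivrMr; last exact: dpos uk uk' uu.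
    by apply: lamax; apply/ratP; exists k, u, u'.
have pq' : `|(sc p).1 - (sc q).1| = (sc p).2 + (sc q).2.
  rewrite /sc/= -mulrBr normrM (gtr0_norm la0) laE divfK// gt_eqF//.
  exact: dpos pF qF pq.
have [c [cle csep]] := @merge_pair k0 (sc p) (sc q) p0 q0 pq'.
have pl1 : perm_eq (F' k0) (sc p :: rem (sc p) (F' k0)) by apply: perm_to_rem; exact: map_f.
have qin : sc q \in rem (sc p) (F' k0).
  have : sc q \in F' k0 by exact: map_f.
  rewrite (perm_mem pl1) inE => /orP[/eqP/sc_inj qp|//].
  by rewrite qp eqxx in pq.
have pl2 := perm_to_rem qin.
set l := rem (sc q) (rem (sc p) (F' k0)) in pl2.
have pl : perm_eq (F' k0) [:: sc p, sc q & l].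
  by apply: (perm_trans pl1); rewrite perm_cons.
have okpl := fam_ok_perm pl (okF' k0).
have okl := fam_ok_behead (fam_ok_behead okpl).
pose G k := if k == k0 then (c, p.2 + q.2) :: l else F' k.
have okG k : fam_ok (G k).
  rewrite /G; case: eqP => _; last exact: okF'.
  apply: fam_ok_cons => //=; first by rewrite addr_gt0.
  have [upl pospl seppl] := okpl.
  move=> u ul.
  have uin : u \in [:: sc p, sc q & l] by rewrite !inE ul !orbT.
  have upN : u != sc p.
    by apply: contraTneq upl => <-; rewrite /= inE ul orbT.
  have uqN : u != sc q.
    by apply: contraTneq upl => <-; rewrite /= ul andbF.
  apply: csep; first exact: pospl.
  - by apply: seppl => //; rewrite mem_head.
  - by apply: seppl => //; rewrite !inE eqxx orbT.
have szF' k : size (F' k) = size (F k) by rewrite size_map.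
have szG : (\sum_k size (G k) <= n)%N.
  rewrite -ltnS; apply: leq_trans sF; rewrite (bigD1 k0)//= [leqRHS](bigD1 k0)//=.
  rewrite -addSn leq_add//; last by apply: leq_sum => k kk0; rewrite /G (negbTE kk0) szF'.
  by rewrite /G eqxx/= -szF' (perm_size pl).
apply: (@le_trans _ _ (\int[mun R m]_v (gw de v * \prod_k fsum k (G k) v)%:E)%E).
  apply: intle => [k|k|k v|k v]; [exact: mfsum|exact: mfsum|exact: fsum0|].
  rewrite /G; case: eqP => [->|_]; last exact: lexx.
  rewrite /fsum (perm_big _ pl)/= !big_cons addrA lerD2r.
  exact: cle.
apply: (le_trans (ih _ szG okG)).
rewrite le_eqVlt; apply/orP; left; apply/eqP; apply: eq_integral => v _.
congr (_ * _)%:E; apply: eq_bigr => k _; 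
have -> // : \sum_(u <- G k) u.2 = \sum_(u <- F k) u.2.
have -> : \sum_(u <- F k) u.2 = \sum_(u <- F' k) u.2 by rewrite /F' big_map.
rewrite /G; case: eqP => [->|_]; last by [].
by rewrite (perm_big _ pl)/= !big_cons/= addrA.
Qed.

End bll1d.

Section bll.
Context (R : realType).
Local Notation mR := (measurableTypeR R).
Local Notation V n := (fvec (measurableTypeR R) 'I_n).
Local Notation leb := (@lebesgue_measure R).
Variables (m N : nat) (de : R) (s : 'I_N -> R) (w : R) (y : 'I_N -> V m).
Hypotheses (de0 : 0 < de) (s0 : forall k, 0 <= s k).

Local Notation psi k E v := (@psi R m N s w y k E v).

Let psi0 k E v : 0 <= psi k E v.
Proof. by apply: kint_ge0 => u; exact: bker01. Qed.

Let mpsi k E : measurable E -> measurable_fun setT (fun v => psi k E v).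
Proof.
by move=> mE; apply: measurable_kint => //; [exact: measurable_bker|move=> u; exact: bker01].
Qed.

Lemma psi_family_le k l v :
  psi k (\bigcup_(q in [set` l]) itv q.1 q.2) v <= fsum s w y k l v.
Proof.
have mk := @measurable_bker R m N s w y k.
have k01 := @bker01 R m N s w y s0 k.
elim: l => [|p l ih].
  rewrite family_nil /fsum big_nil.
  have z : kint leb (bker s w y k) set0 v = 0 := kint_null mk k01 v measurable0 (measure0 leb).
  by have -> : psi k set0 v = 0 by exact: z.
rewrite /fsum big_cons family_cons.
apply: (le_trans (kint_subU mk k01 v (measurable_itvcr _ _) (measurable_family l) _
  (leb_itv_fin _ _) (leb_family_fin _) (@subset_refl _ _))).
  by apply: measurableU; [exact: measurable_itvcr|exact: measurable_family].
by rewrite lerD2l.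
Qed.

Lemma fsum_le k l v : fam_ok l -> fsum s w y k l v <= 2 * \sum_(p <- l) p.2.
Proof.
move=> [_ l0 _].
have mk := @measurable_bker R m N s w y k.
have k01 := @bker01 R m N s w y s0 k.
rewrite /fsum mulr_sumr big_seq [leRHS]big_seq; apply: ler_sum => p pl.
apply: (le_trans (kint_le mk k01 v (measurable_itvcr _ _) (leb_itv_fin _ _))).
by rewrite [X in fine X](leb_itv p.1 (ltW (l0 _ pl))).
Qed.

Lemma psi_itv_lip k (r r' e : R) v : 0 <= r -> 0 <= r' -> 0 <= e -> 2 * r' <= 2 * r + e ->
  psi k (itv 0 r') v <= psi k (itv 0 r) v + e.
Proof.
move=> r0 r'0 e0 rr.
have mk := @measurable_bker R m N s w y k.
have k01 := @bker01 R m N s w y s0 k.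
have mI := @measurable_itvcr R; have fI := @leb_itv_fin R.
have sub : itv 0 r `<=` itv 0 (r + e / 2).
  by move=> t; rewrite /itv/= !in_itv/= => /andP[h1 h2]; apply/andP; split; lra.
have sub' : itv 0 r' `<=` itv 0 (r + e / 2).
  by move=> t; rewrite /itv/= !in_itv/= => /andP[h1 h2]; apply/andP; split; lra.
apply: (le_trans (kint_subset mk k01 v (mI _ _) (mI _ _) (fI _ _) sub')).
apply: (le_trans (kint_lip mk k01 v (mI _ _) (mI 0 r) (fI _ _) (fI _ _))).
have dE : leb (itv 0 (r + e / 2) `\` itv 0 r) = e%:E.
  rewrite measureD; [|exact: mI|exact: mI|exact: fI].
  rewrite (setIidr sub); have re : 0 <= r + e / 2 by rewrite addr_ge0// divr_ge0.
  transitivity ((2 * (r + e / 2))%:E - (2 * r)%:E)%E; last by rewrite -EFinB; congr EFin; lra.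
  by congr (_ - _)%E; exact: leb_itv.
have aux (x z z' : R) : z = z' -> x + z <= x + z' by move=> ->.
exact: (aux _ _ _ (congr1 fine dE)).
Qed.

(** A Brascamp-Lieb-Luttinger inequality on the line for this kernel. The sets are approximated by
    interval families, merged to centred intervals whose lengths are then adjusted; both
    approximation errors are bounded by [integral_prod_lip]. *)
Lemma bll1d (E : 'I_N -> set mR) : (forall k, measurable (E k)) ->
  (forall k, leb (E k) < +oo)%E ->
  (\int[mun R m]_v (gw de v * \prod_k psi k (E k) v)%:E <=
   \int[mun R m]_v (gw de v * \prod_k psi k (itv 0 (fine (leb (E k)) / 2)) v)%:E)%E.
Proof.
move=> mE Eoo; apply/lee_addgt0Pr => eta eta0.
pose e k := fine (leb (E k)).
have e0 k : 0 <= e k by apply: fine_ge0.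
pose C := 1 + \sum_k (e k + 1).
have S0 : 0 <= \sum_k (e k + 1) by apply: sumr_ge0 => k _; rewrite addr_ge0.
have C1 : 1 <= C by rewrite lerDl.
have eC k : e k + 1 <= C.
  rewrite /C (bigD1 k)//= addrCA lerDl addr_ge0// sumr_ge0// => i _.
  by rewrite addr_ge0.
have C0 : 0 <= C := le_trans ler01 C1.
pose I := fine (\int[mun R m]_v (gw de v)%:E)%E.
have Ige : (0 <= \int[mun R m]_v (gw de v)%:E)%E.
  by apply: integral_ge0 => v _; rewrite lee_fin; exact: gw_ge0.
have IE : (\int[mun R m]_v (gw de v)%:E)%E = I%:E.
  by rewrite fineK// ge0_fin_numE//; exact: gw_fin.
have I0 : 0 <= I by exact: fine_ge0.
pose K := C ^+ N * N%:R * I.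
have K0 : 0 <= K by rewrite !mulr_ge0// exprn_ge0.
(* Makes the sum of the two errors [ep * K] at most [eta]; the bound [ep <= 1] keeps every factor
   below [C]. *)
pose ep := Num.min 1 (eta / (2 * (K + 1))).
have ep0 : 0 < ep by rewrite lt_min ltr01/= divr_gt0// mulr_gt0// ltr_pwDr.
have ep1 : ep <= 1 by rewrite ge_min lexx.
have epK : ep * K * 2 <= eta.
  have : ep <= eta / (2 * (K + 1)) by rewrite ge_min lexx orbT.
  rewrite ler_pdivlMr; last by rewrite mulr_gt0// ltr_pwDr.
  by move=> h; apply: le_trans h; rewrite -mulrA (mulrC K) ler_wpM2l// ?ltW//; lra.
have /choice[l lP] := fun k => interval_approximation (mE k) (Eoo k) ep0.
have okl k : fam_ok (l k) by have [] := lP k.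
have sl k : 2 * \sum_(q <- l k) q.2 <= e k + ep by have [] := lP k.
have sl0 k : 0 <= \sum_(q <- l k) q.2.
  by rewrite big_seq; apply: sumr_ge0 => q ql; have [_ /(_ _ ql) /ltW] := okl k.
have mk k := @measurable_bker R m N s w y k.
have k01 k := @bker01 R m N s w y s0 k.
have W0 v : 0 <= @gw R m de v by exact: gw_ge0.
have mW := @measurable_gw R m de.
have mf k : measurable_fun setT (fsum s w y k (l k)).
  by apply: measurable_sum => q; apply: mpsi; exact: measurable_itvcr.
have f0 k v : 0 <= fsum s w y k (l k) v by apply: sumr_ge0 => q _; exact: psi0.
have fC k v : fsum s w y k (l k) v <= C.
  by apply: (le_trans (fsum_le k v (okl k))); have := sl k; have := eC k; lra.
have pEC k v : psi k (E k) v <= C.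
  apply: (le_trans (kint_le (mk k) (k01 k) v (mE k) (Eoo k))).
  by apply: le_trans (eC k); rewrite lerDl.
have pIC k r v : 0 <= r -> 2 * r <= e k + ep -> psi k (itv 0 r) v <= C.
  move=> r0 rE.
  apply: (le_trans (kint_le (mk k) (k01 k) v (measurable_itvcr _ _) (leb_itv_fin _ _))).
  by rewrite [X in fine X](leb_itv 0 r0)/=; have := eC k; lra.
have errE : ((C ^+ N * \sum_(k < N) ep)%:E * I%:E = (ep * K)%:E)%E.
  rewrite -EFinM; congr EFin; rewrite sumr_const card_ord -mulr_natl /K; ring.
have step1 : (\int[mun R m]_v (gw de v * \prod_k psi k (E k) v)%:E <=
    \int[mun R m]_v (gw de v * \prod_k fsum s w y k (l k) v)%:E + (ep * K)%:E)%E.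
  rewrite -errE -IE.
  apply: (@integral_prod_lip R _ (V m) (mun R m) N C (gw de) (fun k v => psi k (E k) v)
    (fun k => fsum s w y k (l k)) (fun=> ep) C1 mW W0) => //.
  - by move=> k; exact: mpsi.
  - by move=> k v; rewrite psi0 pEC.
  - by move=> k v; rewrite f0 fC.
  - by move=> _; exact: ltW.
  move=> k v.
  apply: (le_trans (kint_lip (mk k) (k01 k) v (mE k) (measurable_family (l k)) (Eoo k) (leb_family_fin _))).
  apply: lerD; first exact: psi_family_le.
  have [_ h _] := lP k.
  rewrite -lee_fin fineK; first exact: h.
  by rewrite ge0_fin_numE//; apply: (le_lt_trans h); rewrite ltry.
have step2 := merge_families w y de0 s0 (leqnn _) okl.
have step3 : (\int[mun R m]_v (gw de v * \prod_k psi k (itv 0 (\sum_(p <- l k) p.2)) v)%:E <=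
    \int[mun R m]_v (gw de v * \prod_k psi k (itv 0 (e k / 2)) v)%:E + (ep * K)%:E)%E.
  rewrite -errE -IE.
  apply: (@integral_prod_lip R _ (V m) (mun R m) N C (gw de) (fun k v => psi k (itv 0 (\sum_(p <- l k) p.2)) v)
    (fun k v => psi k (itv 0 (e k / 2)) v) (fun=> ep) C1 mW W0).
  - by move=> k; apply: mpsi; exact: measurable_itvcr.
  - by move=> k; apply: mpsi; exact: measurable_itvcr.
  - by move=> k v; rewrite psi0 pIC.
  - by move=> k v; rewrite psi0/= pIC//; have := e0 k; lra.
  - by move=> _; exact: ltW.
  move=> k v; apply: psi_itv_lip; [by rewrite divr_ge0|exact: sl0|exact: ltW|].
  by have := sl k; lra.
apply: (le_trans step1).
apply: (le_trans (leeD (le_trans step2 step3) (lexx _))).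
rewrite -addeA -EFinD leeD2l// lee_fin; lra.
Qed.

End bll.

                               

(** * Steiner symmetrization does not decrease the Gaussian functional *)

Section slot_tonelli.
Context (R : realType) dY dT (Y : measurableType dY) (T : measurableType dT).
Variables (nu : {sigma_finite_measure set Y -> \bar R}) (mu : {sigma_finite_measure set T -> \bar R}).
Variables (a : Y * T -> R) (A : T -> R).
Hypothesis ma : measurable_fun setT a.
Hypothesis a0 : forall z, 0 <= a z.
Hypothesis AE : forall v, (A v)%:E = (\int[nu]_y (a (y, v))%:E)%E.

Lemma slot_tonelliE (W : T -> R) : measurable_fun setT W -> (forall v, 0 <= W v) ->
  (\int[mu]_v (W v * A v)%:E = \int[nu]_y \int[mu]_v (W v * a (y, v))%:E)%E /\
  measurable_fun setT (fun y => \int[mu]_v (W v * a (y, v))%:E)%E.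
Proof.
move=> mW W0.
pose F (z : Y * T) := (W z.2 * a z)%:E.
have mF : measurable_fun setT F.
  apply/measurable_EFinP/measurable_funM => //.
  exact: measurableT_comp.
have F0 z : (0 <= F z)%E by rewrite lee_fin mulr_ge0.
split; last exact: (@measurable_fun_fubini_tonelli_F _ _ _ _ _ mu F mF F0).
rewrite (@fubini_tonelli _ _ _ _ _ nu mu F mF F0).
apply: eq_integral => v _; rewrite EFinM AE -ge0_integralZl//.
- by apply/measurable_EFinP; apply: measurableT_comp => //; exact: pair2_measurable.
- by move=> y _; rewrite lee_fin.
- by rewrite lee_fin.
Qed.

End slot_tonelli.

(** Provides the hypothesis [slot] of [slots] when the superposition is an integral. *)
Lemma slot_tonelli (R : realType) dY dT (Y : measurableType dY) (T : measurableType dT)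
    (nu : {sigma_finite_measure set Y -> \bar R}) (mu : {sigma_finite_measure set T -> \bar R})
    (a b : Y * T -> R) (A B W W' : T -> R) :
  measurable_fun setT a -> measurable_fun setT b ->
  (forall z, 0 <= a z) -> (forall z, 0 <= b z) ->
  (forall v, (A v)%:E = \int[nu]_y (a (y, v))%:E)%E ->
  (forall v, (B v)%:E = \int[nu]_y (b (y, v))%:E)%E ->
  measurable_fun setT W -> measurable_fun setT W' ->
  (forall v, 0 <= W v) -> (forall v, 0 <= W' v) ->
  (forall y, \int[mu]_v (W v * a (y, v))%:E <= \int[mu]_v (W' v * b (y, v))%:E)%E ->
  (\int[mu]_v (W v * A v)%:E <= \int[mu]_v (W' v * B v)%:E)%E.
Proof.
move=> ma mb a0 b0 AE BE mW mW' W0 W0' h.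
have [-> m1] := slot_tonelliE mu ma a0 AE mW W0.
have [-> m2] := slot_tonelliE mu mb b0 BE mW' W0'.
apply: ge0_le_integral => //.
by move=> y _; apply: integral_ge0 => v _; rewrite lee_fin mulr_ge0.
Qed.

Section steiner.
Context (R : realType).
Local Notation mR := (measurableTypeR R).
Local Notation V n := (fvec (measurableTypeR R) 'I_n).
Local Notation leb := (@lebesgue_measure R).

Lemma tonelli_pw2 m (F : V m.+1 -> \bar R) :
  measurable_fun setT F -> (forall x, 0 <= F x)%E ->
  (\int[mun R m.+1]_x F x = \int[mun R m]_y \int[leb]_t F (vcons (t : mR, y)))%E.
Proof.
move=> mF F0; rewrite tonelli_pw//.
rewrite (@fubini_tonelli _ _ _ _ _ leb (mun R m) (fun z => F (vcons z)))//.
by apply: measurableT_comp => //; exact: measurable_vcons.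
Qed.

Definition gker n (s : R) (z : V n * V n) : R := expR (- (s * dotp z.1 z.2 ^+ 2)).

Lemma measurable_gker n s : measurable_fun setT (@gker n s).
Proof.
apply: (@measurableT_comp _ _ _ _ _ _ (@expR R)) => //.
apply: measurableT_comp => //; apply: measurable_funM => //.
by apply: measurable_funX; exact: measurable_dotp.
Qed.

Lemma gker01 n s z : 0 <= s -> 0 <= @gker n s z <= 1.
Proof.
move=> s0; rewrite expR_ge0/= -expR0 ler_expR oppr_le0.
by rewrite mulr_ge0// sqr_ge0.
Qed.

Definition gpsi n s (A : set (V n)) (u : V n) : R := kint (mun R n) (gker s) A u.

(** The functional of the core inequality: it is multilinear in the N sets, coupled only through the
    common variable [u]. *)
Definition gfun n N (de : R) (s : 'I_N -> R) (A : 'I_N -> set (V n)) : \bar R :=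
  (\int[mun R n]_u (gw de u * \prod_k gpsi (s k) (A k) u)%:E)%E.

Definition sec m (A : set (V m.+1)) (y : V m) : set mR := [set t : mR | A (vcons (t, y))].

Lemma measurable_sec m (A : set (V m.+1)) y : measurable A -> measurable (sec A y).
Proof.
move=> mA; rewrite -[X in measurable X]setTI.
have mf : measurable_fun setT (fun t : mR => vcons (t, y)).
  by apply: measurableT_comp; [exact: measurable_vcons|exact: pair2_measurable].
exact: mf.
Qed.

Lemma measurable_leb_sec m (A : set (V m.+1)) : measurable A ->
  measurable_fun setT (fun y => leb (sec A y)).
Proof.
move=> mA.
have mB : measurable (@vcons _ mR m @^-1` A).
  by rewrite -[X in measurable X]setTI; exact: measurable_vcons.
rewrite (_ : (fun y => _) = leb \o ysection (@vcons _ mR m @^-1` A)).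
  exact: measurable_fun_ysection.
apply/funext => y /=; congr (leb _); apply/seteqP; split => t.
  by move=> At; rewrite /ysection/= inE.
by rewrite /ysection/= inE.
Qed.

Lemma mun_sec m (A : set (V m.+1)) : measurable A ->
  mun R m.+1 A = (\int[mun R m]_y leb (sec A y))%E.
Proof.
move=> mA.
transitivity (\int[mun R m.+1]_x (\1_A x)%:E)%E; first by rewrite integral_indic// setIT.
rewrite tonelli_pw2//; last exact/measurable_EFinP.
apply: eq_integral => y _.
transitivity (\int[leb]_t (\1_(sec A y) t)%:E)%E.
  by apply: eq_integral => t _; rewrite !indicE.
by rewrite integral_indic ?setIT//; exact: measurable_sec.
Qed.

(** Symmetrization about the hyperplane orthogonal to the first axis, with open fibres. [fine] would
    send an infinite fibre length to 0; this does not occur for sets inside a ball, to which it is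
    applied. *)
Definition steiner m (A : set (V m.+1)) : set (V m.+1) :=
  [set x : V m.+1 | `|x ord0| < fine (leb (sec A (vtail x))) / 2].

Lemma measurable_steiner m (A : set (V m.+1)) : measurable A -> measurable (steiner A).
Proof.
move=> mA; rewrite -[X in measurable X]setTI.
have m1 : measurable_fun setT (fun x : V m.+1 => `|x ord0|).
  apply: (@measurableT_comp _ _ _ _ _ _ (fun t : R => `|t|)) => //.
  exact: (@measurable_coord _ mR).
have m2 : measurable_fun setT (fun x : V m.+1 => fine (leb (sec A (vtail x))) / 2).
  apply: measurable_funM => //.
  apply: (@measurableT_comp _ _ _ _ _ _ (fun y : V m => fine (leb (sec A y)))).
    by apply: measurableT_comp => //; exact: measurable_leb_sec.
  exact: measurable_vtail.
by apply: measurable_fun_ltr.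
Qed.

Lemma sec_steiner m (A : set (V m.+1)) y : let r := fine (leb (sec A y)) / 2 in
  sec (steiner A) y = `]- r, r[%classic.
Proof.
move=> r; apply/seteqP; split => t; rewrite /sec /steiner/= vcons0 vtail_vcons/= in_itv/= ltr_norml//.
Qed.

Lemma leb_open r : 0 <= r -> leb `]- r, r[%classic = (2 * r)%:E.
Proof.
move=> r0; rewrite lebesgue_measure_itv/= lte_fin.
case: ltP => h; first by rewrite -EFinB; congr EFin; lra.
by congr EFin; lra.
Qed.

Section bounded.
Variables (m : nat) (rho : R).

Lemma sec_sqball (y : V m) : let b := Num.sqrt (Num.max 0 (rho - dotp y y)) in
  sec (@sqball R m.+1 rho) y = `]- b, b[%classic.
Proof.
move=> b; apply/seteqP; split => t; rewrite /sec /sqball/= dotp_vcons in_itv/= -ltr_norml.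
  move=> h; rewrite -sqrtr_sqr ltr_sqrt; last first.
    by rewrite lt_max; apply/orP; right; nra.
  by rewrite lt_max; apply/orP; right; lra.
move=> h.
have b0 : 0 <= b by exact: sqrtr_ge0.
have : `|t| ^+ 2 < b ^+ 2 by rewrite ltr_pXn2r// nnegrE.
rewrite real_normK ?num_real// sqr_sqrtr ?le_max ?lexx// lt_max => /orP[|]; last lra.
by rewrite ltNge sqr_ge0.
Qed.

Lemma sec_bounded (A : set (V m.+1)) y : measurable A -> A `<=` @sqball R m.+1 rho ->
  (leb (sec A y) <= (2 * Num.sqrt (Num.max 0 (rho - dotp y y)))%:E)%E.
Proof.
move=> mA Ab.
have h : sec A y `<=` sec (@sqball R m.+1 rho) y by move=> t; exact: Ab.
have : (leb (sec A y) <= leb (sec (@sqball R m.+1 rho) y))%E.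
  apply: le_measure; rewrite ?inE//; first exact: measurable_sec.
  by apply: measurable_sec; exact: measurable_sqball.
by rewrite sec_sqball leb_open// sqrtr_ge0.
Qed.

Lemma sec_fin (A : set (V m.+1)) y : measurable A -> A `<=` @sqball R m.+1 rho ->
  (leb (sec A y) < +oo)%E.
Proof. by move=> mA Ab; apply: le_lt_trans (sec_bounded y mA Ab) _; rewrite ltry. Qed.

Lemma steiner_bounded (A : set (V m.+1)) : measurable A -> A `<=` @sqball R m.+1 rho ->
  steiner A `<=` @sqball R m.+1 rho.
Proof.
move=> mA Ab x; rewrite /steiner/= => h.
have : sec (@sqball R m.+1 rho) (vtail x) (x ord0).
  rewrite sec_sqball/= in_itv/= -ltr_norml; apply: (lt_le_trans h).
  have := sec_bounded (vtail x) mA Ab.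
  rewrite -(fineK (x := leb _)); last first.
    by rewrite ge0_fin_numE//; exact: sec_fin.
  by rewrite lee_fin; lra.
by rewrite /sec/= vconsK.
Qed.

Lemma leb_sec_steiner (A : set (V m.+1)) y : measurable A -> A `<=` @sqball R m.+1 rho ->
  leb (sec (steiner A) y) = leb (sec A y).
Proof.
move=> mA Ab; rewrite sec_steiner leb_open.
  rewrite mulrC divfK// fineK// ge0_fin_numE//; exact: sec_fin.
by rewrite divr_ge0// fine_ge0.
Qed.

Lemma mun_steiner (A : set (V m.+1)) : measurable A -> A `<=` @sqball R m.+1 rho ->
  mun R m.+1 (steiner A) = mun R m.+1 A.
Proof.
move=> mA Ab; rewrite mun_sec; last exact: measurable_steiner.
rewrite mun_sec//; apply: eq_integral => y _.
exact: leb_sec_steiner.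
Qed.

End bounded.
End steiner.

Section gfun_steiner.
Context (R : realType).
Local Notation mR := (measurableTypeR R).
Local Notation V n := (fvec (measurableTypeR R) 'I_n).
Local Notation leb := (@lebesgue_measure R).
Variables (m N : nat) (de rho : R) (s : 'I_N -> R).
Hypotheses (de0 : 0 < de) (s0 : forall k, 0 <= s k).

(** The contribution to [gpsi] of the fibre over [z] at [u = (w, v)]; integrating it over [z]
    recovers [gpsi] ([gpsi_slice]). *)
Definition slice (w : R) k (B : set (V m.+1)) (z v : V m) : R :=
  psi s w (fun=> z) k (sec B z) v.

Lemma bounded_fin n (B : set (V n)) : measurable B -> B `<=` @sqball R n rho ->
  (mun R n B < +oo)%E.
Proof.
move=> mB Bb; apply: (@le_lt_trans _ _ (mun R n (@sqball R n rho))).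
  by apply: le_measure; rewrite ?inE//; exact: measurable_sqball.
exact: sqball_fin.
Qed.

Section one_set.
Variables (w : R) (k : 'I_N) (B : set (V m.+1)).
Hypotheses (mB : measurable B) (Bb : B `<=` @sqball R m.+1 rho).

Lemma slice_ge0 z v : 0 <= slice w k B z v.
Proof. by apply: kint_ge0 => u; exact: bker01. Qed.

Lemma gkerE (t : R) (z v : V m) : gker (s k) (vcons (t : mR, z), vcons (w : mR, v)) =
  bker s w (fun=> z) k (t, v).
Proof. by rewrite /gker /bker/= dotp_vcons. Qed.

Lemma slice_intE z v : (slice w k B z v)%:E =
  (\int[leb]_t (\1_B (vcons (t : mR, z)) * gker (s k) (vcons (t : mR, z), vcons (w : mR, v)))%:E)%E.
Proof.
rewrite /slice /psi kintE; last first.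
- exact: sec_fin mB Bb.
- exact: measurable_sec.
- by move=> u; exact: bker01.
- exact: measurable_bker.
by apply: eq_integral => t _; rewrite gkerE !indicE.
Qed.

Lemma measurable_slice : measurable_fun setT (fun z : V m * V m => slice w k B z.1 z.2).
Proof.
apply/measurable_EFinP.
rewrite (_ : _ \o _ = fun z : V m * V m => (\int[leb]_t (\1_B (vcons (t : mR, z.1)) *
    gker (s k) (vcons (t : mR, z.1), vcons (w : mR, z.2)))%:E)%E); last first.
  by apply/funext => z; exact: slice_intE.
have m1 : measurable_fun setT (fun x : mR * (V m * V m) => vcons (x.1, x.2.1)).
  apply: measurableT_comp; first exact: measurable_vcons.
  by apply: measurable_fun_pair => //; exact: measurableT_comp.
have m2 : measurable_fun setT (fun x : mR * (V m * V m) => vcons (w : mR, x.2.2)).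
  apply: measurableT_comp; first exact: measurable_vcons.
  by apply: measurable_fun_pair => //; exact: measurableT_comp.
apply: (@measurable_fun_fubini_tonelli_G _ _ _ _ _ leb (fun x : mR * (V m * V m) =>
  (\1_B (vcons (x.1, x.2.1)) * gker (s k) (vcons (x.1, x.2.1), vcons (w : mR, x.2.2)))%:E)).
  apply/measurable_EFinP/measurable_funM.
    by apply: (@measurableT_comp _ _ _ _ _ _ (\1_B : V m.+1 -> R)).
  apply: (measurableT_comp (measurable_gker (s k))).
  exact: measurable_fun_pair.
by move=> x; rewrite lee_fin mulr_ge0// expR_ge0.
Qed.

Lemma gpsi_slice v : (gpsi (s k) B (vcons (w : mR, v)))%:E = (\int[mun R m]_z (slice w k B z v)%:E)%E.
Proof.
have mk := @measurable_gker R m.+1 (s k).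
have k01 (z : V m.+1 * V m.+1) : 0 <= gker (s k) z <= 1 by exact: gker01.
rewrite /gpsi (kintE mk k01 _ mB (bounded_fin mB Bb)) tonelli_pw2; last 2 first.
- exact: (measurable_kind mk _ mB).
- by move=> x; rewrite lee_fin mulr_ge0// expR_ge0.
by apply: eq_integral => z _; rewrite slice_intE.
Qed.

Lemma gpsi_ge0 n (C : set (V n)) u : 0 <= gpsi (s k) C u.
Proof. by apply: kint_ge0 => z; exact: gker01. Qed.

Lemma measurable_gpsi n (C : set (V n)) : measurable C -> measurable_fun setT (gpsi (s k) C).
Proof.
move=> mC; apply: measurable_kint => //; first exact: measurable_gker.
by move=> z; exact: gker01.
Qed.

Lemma measurable_gpsi_vcons : measurable_fun setT (fun v : V m => gpsi (s k) B (vcons (w : mR, v))).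
Proof.
apply: (measurableT_comp (measurable_gpsi mB)).
by apply: measurableT_comp; [exact: measurable_vcons|exact: pair1_measurable].
Qed.

End one_set.

Variable A : 'I_N -> set (V m.+1).
Hypotheses (mA : forall k, measurable (A k)) (Ab : forall k, A k `<=` @sqball R m.+1 rho).

Let mS k : measurable (steiner (A k)). Proof. exact: measurable_steiner. Qed.
Let Sb k : steiner (A k) `<=` @sqball R m.+1 rho. Proof. exact: steiner_bounded. Qed.

(** [bll1d] applied to the fibres over [z_1, ..., z_N]. Its closed centred intervals differ from the
    open fibres of [steiner] only by endpoints. *)
Lemma slice_tuple w (z : 'I_N -> V m) :
  (\int[mun R m]_v (gw de v * \prod_k slice w k (A k) (z k) v)%:E <=
   \int[mun R m]_v (gw de v * \prod_k slice w k (steiner (A k)) (z k) v)%:E)%E.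
Proof.
have mk k := @measurable_bker R m N s w z k.
have k01 k := @bker01 R m N s w z s0 k.
pose r k := fine (leb (sec (A k) (z k))) / 2.
have r0 k : 0 <= r k by rewrite divr_ge0// fine_ge0.
have := bll1d w z de0 s0 (fun k => measurable_sec (z k) (mA k)) (fun k => sec_fin (z k) (mA k) (@Ab k)).
move=> h; apply: (le_trans h).
have mop k : measurable (`]- r k, r k[%classic : set mR) by exact: measurable_itv.
have fop k : (leb `](- r k)%R, r k[%classic < +oo)%E by rewrite leb_open// ltry.
have le k v : psi s w z k (itv 0 (r k)) v <= slice w k (steiner (A k)) (z k) v.
  rewrite /slice sec_steiner -/(r k).
  apply: (le_trans (kint_lip (mk k) (k01 k) v (measurable_itvcr _ _) (mop k) (leb_itv_fin _ _) (fop k))).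
  have n0 : leb (itv 0 (r k) `\` `]- r k, r k[%classic) = 0%E.
    have mD := measurableD (measurable_itvcr 0 (r k)) (mop k).
    rewrite measureD; [|exact: measurable_itvcr|exact: mop|exact: leb_itv_fin].
    rewrite setIidr; last first.
      by move=> t; rewrite /itv/= !in_itv/= => /andP[h1 h2]; apply/andP; split; lra.
    transitivity ((2 * r k)%:E - (2 * r k)%:E)%E; last by rewrite subee.
    by congr (_ - _)%E; [exact: leb_itv|exact: leb_open].
  have aux (x z' : R) : z' = 0 -> x + z' <= x by move=> ->; rewrite addr0.
  exact: (aux _ _ (congr1 fine n0)).
have p0 k v : 0 <= psi s w z k (itv 0 (r k)) v by apply: kint_ge0 => u; exact: bker01.
apply: ge0_le_integral; first exact: measurableT.
- move=> v _; rewrite lee_fin; apply: mulr_ge0; first exact: gw_ge0.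
  by apply: prodr_ge0 => k _; exact: p0.
- apply/measurable_EFinP/measurable_funM; first exact: measurable_gw.
  apply: measurable_prod_cond => k.
  exact: (measurable_kint leb (mk k) (k01 k) (measurable_itvcr _ _)).
- apply/measurable_EFinP/measurable_funM; first exact: measurable_gw.
  apply: measurable_prod_cond => k.
  exact: (measurable_kint leb (@measurable_bker R m N s w (fun=> z k) k)
    (@bker01 R m N s w (fun=> z k) s0 k) (measurable_sec (z k) (mS k))).
- move=> v _; rewrite lee_fin; apply: ler_wpM2l; first exact: gw_ge0.
  by apply: ler_prod => k _; apply/andP; split; [exact: p0|exact: le].
Qed.

(** [slice_tuple] holds for every choice of base points; [slots] integrates them out, one set at a
    time. *)
Lemma gfun_slice w :
  (\int[mun R m]_v (gw de v * \prod_k gpsi (s k) (A k) (vcons (w : mR, v)))%:E <=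
   \int[mun R m]_v (gw de v * \prod_k gpsi (s k) (steiner (A k)) (vcons (w : mR, v)))%:E)%E.
Proof.
have msl k B : measurable B -> B `<=` @sqball R m.+1 rho ->
    forall z, measurable_fun setT (slice w k B z).
  move=> mB Bb z.
  exact: (@measurableT_comp _ _ _ _ _ _ (fun x : V m * V m => slice w k B x.1 x.2) _ (pair z)
    (measurable_slice w k mB Bb) (pair1_measurable z)).
apply: (@slots R _ (V m) (mun R m) N (V m) (fun k z v => slice w k (A k) z v)
  (fun k z v => slice w k (steiner (A k)) z v)
  (fun k v => gpsi (s k) (A k) (vcons (w : mR, v)))
  (fun k v => gpsi (s k) (steiner (A k)) (vcons (w : mR, v)))
  (fun k z v => slice_ge0 w k (A k) z v) (fun k z v => slice_ge0 w k _ z v)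
  (fun k v => gpsi_ge0 k _ _) (fun k v => gpsi_ge0 k _ _)
  (fun k z => msl k _ (mA k) (@Ab k) z) (fun k z => msl k _ (mS k) (@Sb k) z)
  (fun k => measurable_gpsi_vcons w k (mA k)) (fun k => measurable_gpsi_vcons w k (mS k))).
- move=> k W W' mW mW' W0 W0' h.
  exact: (slot_tonelli (measurable_slice w k (mA k) (@Ab k)) (measurable_slice w k (mS k) (@Sb k))
    (fun z => slice_ge0 w k _ z.1 z.2) (fun z => slice_ge0 w k _ z.1 z.2)
    (gpsi_slice w k (mA k) (@Ab k)) (gpsi_slice w k (mS k) (@Sb k)) mW mW' W0 W0' h).
- exact: measurable_gw.
- by move=> v; exact: gw_ge0.
- exact: slice_tuple.
Qed.

Lemma gfun_steiner : (gfun de s A <= gfun de s (fun k => steiner (A k)))%E.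
Proof.
have mF (C : 'I_N -> set (V m.+1)) : (forall k, measurable (C k)) ->
    measurable_fun setT (fun u : V m.+1 => (gw de u * \prod_k gpsi (s k) (C k) u)%:E).
  move=> mC; apply/measurable_EFinP/measurable_funM; first exact: measurable_gw.
  by apply: measurable_prod_cond => k; exact: measurable_gpsi.
have F0 (C : 'I_N -> set (V m.+1)) u : (0 <= (gw de u * \prod_k gpsi (s k) (C k) u)%:E)%E.
  rewrite lee_fin; apply: mulr_ge0; first exact: gw_ge0.
  by apply: prodr_ge0 => k _; exact: gpsi_ge0.
rewrite /gfun (tonelli_pw leb (mF _ mA) (F0 _)) (tonelli_pw leb (mF _ mS) (F0 _)).
have mG (C : 'I_N -> set (V m.+1)) : (forall k, measurable (C k)) ->
    measurable_fun setT (fun t : mR => \int[mun R m]_v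
      (gw de (vcons (t, v)) * \prod_k gpsi (s k) (C k) (vcons (t, v)))%:E)%E.
  move=> mC; apply: (@measurable_fun_fubini_tonelli_F _ _ _ _ _ (mun R m)
    (fun z => (gw de (vcons z) * \prod_k gpsi (s k) (C k) (vcons z))%:E)).
    by apply: (measurableT_comp (mF _ mC)); exact: measurable_vcons.
  by move=> z; exact: F0.
apply: ge0_le_integral; first exact: measurableT.
- by move=> t _; apply: integral_ge0 => v _; exact: F0.
- exact: mG.
- exact: mG.
move=> t _.
have E (C : 'I_N -> set (V m.+1)) : (forall k, measurable (C k)) ->
    (\int[mun R m]_v (gw de (vcons (t, v)) * \prod_k gpsi (s k) (C k) (vcons (t, v)))%:E =
     (expR (- (de * (t : R) ^+ 2)))%:E * \int[mun R m]_v (gw de v * \prod_k gpsi (s k) (C k) (vcons (t, v)))%:E)%E.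
  move=> mC; rewrite -ge0_integralZl.
  - by apply: eq_integral => v _; rewrite gw_vcons -EFinM -mulrA.
  - exact: measurableT.
  - apply/measurable_EFinP/measurable_funM; first exact: measurable_gw.
    by apply: measurable_prod_cond => k; exact: measurable_gpsi_vcons.
  - move=> v _; rewrite lee_fin; apply: mulr_ge0; first exact: gw_ge0.
    by apply: prodr_ge0 => k _; exact: gpsi_ge0.
  - by rewrite lee_fin expR_ge0.
rewrite (E _ mA) (E _ mS); apply: lee_wpmul2l; first by rewrite lee_fin expR_ge0.
exact: gfun_slice.
Qed.

End gfun_steiner.

(** * Reflections, and the gain of volume inside a ball under symmetrization *)

Section householder.
Context (R : realType).
Local Notation mR := (measurableTypeR R).
Local Notation V n := (fvec (measurableTypeR R) 'I_n).
Local Notation leb := (@lebesgue_measure R).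

Lemma dotpC n (x y : V n) : dotp x y = dotp y x.
Proof. by apply: eq_bigr => i _; rewrite mulrC. Qed.

Lemma dotpDl n (x y z : V n) : dotp (vadd x y) z = dotp x z + dotp y z.
Proof. by rewrite /dotp -big_split; apply: eq_bigr => i _ /=; rewrite /vadd mulrDl. Qed.

Lemma dotpZl n c (x z : V n) : dotp (vscale c x) z = c * dotp x z.
Proof. by rewrite /dotp mulr_sumr; apply: eq_bigr => i _ /=; rewrite /vscale mulrA. Qed.

Lemma dotpDr n (x y z : V n) : dotp z (vadd x y) = dotp z x + dotp z y.
Proof. by rewrite dotpC dotpDl !(dotpC z). Qed.

Lemma dotpZr n c (x z : V n) : dotp z (vscale c x) = c * dotp z x.
Proof. by rewrite dotpC dotpZl (dotpC z). Qed.

Lemma dotp_ge0 n (x : V n) : 0 <= dotp x x.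
Proof. by apply: sumr_ge0 => i _; rewrite -expr2 sqr_ge0. Qed.

Lemma dotp_eq0 n (x : V n) : dotp x x = 0 -> forall i, x i = 0.
Proof.
move=> /eqP; rewrite psumr_eq0; last by move=> i _; rewrite -expr2 sqr_ge0.
by move=> /allP h i; apply/eqP; have := h i (mem_index_enum i); rewrite mulf_eq0 orbb.
Qed.

Definition isom n (O : V n -> V n) := lin_isometry O /\ forall x y, dotp (O x) (O y) = dotp x y.

Lemma isom_id n : isom (@id (V n)).
Proof. by split => //; split => //; exact: measurable_id. Qed.

(** Reflect in the hyperplane orthogonal to [h - |h| e_0], or take the identity when this vector
    vanishes. Symmetrization in any direction is thus reduced to the first axis. *)
Lemma householder m (h : V m.+1) :
  exists2 O : V m.+1 -> V m.+1, isom O & exists c : R, O h = vcons (c : mR, (fun=> 0) : V m).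
Proof.
pose c := Num.sqrt (dotp h h).
pose e : V m.+1 := vcons (c : mR, (fun=> 0) : V m).
have ee : dotp e e = dotp h h.
  rewrite dotp_vcons -expr2 sqr_sqrtr ?dotp_ge0//.
  by rewrite [X in _ + X]big1 ?addr0// => i _; rewrite mulr0.
have [d dE] : exists d : V m.+1, d = vadd h (vscale (-1) e) by eexists.
pose q := dotp d d.
have [q0|q0] := eqVneq q 0.
  exists id; first exact: isom_id.
  exists c; apply/funext => i; have := dotp_eq0 q0 i.
  by rewrite dE /vadd /vscale mulN1r => /eqP; rewrite subr_eq0 => /eqP.
pose O (x : V m.+1) : V m.+1 := vadd x (vscale (- (2 * dotp x d / q)) d).
have Oadd x y : O (vadd x y) = vadd (O x) (O y).
  apply/funext => i; rewrite /O /vadd /vscale -/(vadd x y) dotpDl; ring.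
have OO x : O (O x) = x.
  apply/funext => i; rewrite /O.
  set k := - (2 * dotp x d / q).
  have -> : dotp (vadd x (vscale k d)) d = - dotp x d.
    by rewrite dotpDl dotpZl -/q /k; field.
  by rewrite /vadd /vscale /k; field.
have Odot x y : dotp (O x) (O y) = dotp x y.
  rewrite /O !dotpDl !dotpDr !dotpZl !dotpZr -/q (dotpC d y); field => //.
have mO : measurable_fun setT O.
  apply: measurable_fun_vadd; first exact: measurable_id.
  apply: measurable_fvecP => i; apply: measurable_funM => //.
  apply: measurableT_comp => //; apply: measurable_funM => //.
  by apply: measurable_funM => //; exact: measurable_dotpl.
exists O; first by split.
exists c; rewrite -/e /O.
(* Uses that [e] and [h] have the same norm; it says that the reflection subtracts exactly [d] from
   [h]. *)
have qE : q = 2 * dotp h d.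
  by rewrite /q dE !dotpDl !dotpDr !dotpZl !dotpZr ee (dotpC e h); ring.
have -> : 2 * dotp h d / q = 1 by rewrite -qE divff.
by apply/funext => i; rewrite dE /vadd /vscale; ring.
Qed.

Section isom_invariance.
Variables (n N : nat) (de : R) (s : 'I_N -> R) (O : V n -> V n).
Hypotheses (s0 : forall k, 0 <= s k) (hO : isom O).

Lemma measurable_isom_preimage (A : set (V n)) : measurable A -> measurable (O @^-1` A).
Proof. by move=> mA; have [[mO _ _ _] _] := hO; rewrite -[X in measurable X]setTI; exact: mO. Qed.

Lemma sqball_isom r : O @^-1` (@sqball R n r) = sqball r.
Proof. by have [_ h] := hO; apply/seteqP; split => x; rewrite /sqball/= h. Qed.

Lemma gpsi_isom k (A : set (V n)) u : measurable A ->
  gpsi (s k) (O @^-1` A) u = gpsi (s k) A (O u).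
Proof.
move=> mA; rewrite /gpsi /kint; congr fine.
have mk := @measurable_gker R n (s k).
rewrite -[RHS](integral_isometry hO.1); last 2 first.
- exact: (measurable_kind mk _ mA).
- by move=> x; rewrite lee_fin mulr_ge0// expR_ge0.
by apply: eq_integral => x _; rewrite !indicE /gker/= hO.2.
Qed.

Lemma gfun_isom (A : 'I_N -> set (V n)) : (forall k, measurable (A k)) ->
  gfun de s (fun k => O @^-1` A k) = gfun de s A.
Proof.
move=> mA; rewrite /gfun -[RHS](integral_isometry hO.1); last 2 first.
- apply/measurable_EFinP/measurable_funM; first exact: measurable_gw.
  by apply: measurable_prod_cond => k; exact: measurable_gpsi.
- move=> u; rewrite lee_fin; apply: mulr_ge0; first exact: gw_ge0.
  by apply: prodr_ge0 => k _; exact: gpsi_ge0.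
apply: eq_integral => u _; congr (_ * _)%:E; first by rewrite /gw hO.2.
by apply: eq_bigr => k _; exact: gpsi_isom.
Qed.

End isom_invariance.

Section gain.
Variables (m : nat) (rho r : R) (A : set (V m.+1)) (c : R).
Hypotheses (mA : measurable A) (Ab : A `<=` @sqball R m.+1 rho).
Let B := @sqball R m.+1 r.
Let h : V m.+1 := vcons (c : mR, (fun=> 0) : V m).
Let P := A `\` B.
Let Q := B `\` A.
Let H := [set x | P x /\ Q (vadd x h)].

Let mB : measurable B. Proof. exact: measurable_sqball. Qed.
Let mP : measurable P. Proof. exact: measurableD. Qed.
Let mQ : measurable Q. Proof. exact: measurableD. Qed.
Let mH : measurable H.
Proof.
apply: measurableI => //; rewrite -[X in measurable X]setTI.
exact: (measurable_vaddr h).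
Qed.

Lemma leb_shift (E : set mR) (d : R) : measurable E -> leb [set t : mR | E (t + d)] = leb E.
Proof.
move=> mE; have := lebesgue_affine d (ltr01 : 0 < 1 :> R) mE.
rewrite invr1 mul1e => <-; congr (leb _).
by apply/seteqP; split => t /=; rewrite mul1r.
Qed.

(** On a fibre let [a] and [2 b] be the lengths of [A] and of the ball, and [p], [q] those of
    [A \ B] and [B \ A], so [a - 2 b = p - q]. The symmetrized fibre exceeds the ball by
    [max 0 (p - q)]. As [H] lies in the first difference and its shift in the second, it has length
    at most [min p q], and the two sum to at most [p]. *)
Lemma steiner_gain_sec y :
  (leb (sec (steiner A `\` B) y) + leb (sec H y) <= leb (sec P y))%E.
Proof.
have Bb : B `<=` @sqball R m.+1 r by [].
pose a := fine (leb (sec A y)); pose b := Num.sqrt (Num.max 0 (r - dotp y y)).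
have b0 : 0 <= b by exact: sqrtr_ge0.
have aE : leb (sec A y) = a%:E by rewrite fineK// ge0_fin_numE//; exact: sec_fin Ab.
have a0 : 0 <= a by exact: fine_ge0.
have sB : sec B y = `]- b, b[%classic by exact: sec_sqball.
have bE : leb (sec B y) = (2 * b)%:E by rewrite sB leb_open.
have msA := measurable_sec y mA; have msB := measurable_sec y mB.
have sPE : sec P y = sec A y `\` sec B y by [].
have sQE : sec Q y = sec B y `\` sec A y by [].
have fin (E F : set mR) : measurable E -> measurable F -> (leb E < +oo)%E ->
    leb (E `\` F) = (fine (leb (E `\` F)))%:E.
  move=> mE mF Eoo; rewrite fineK// ge0_fin_numE//; apply: le_lt_trans Eoo.
  by apply: le_measure; rewrite ?inE //; exact: measurableD.
pose p := fine (leb (sec P y)); pose q := fine (leb (sec Q y)).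
have pE : leb (sec P y) = p%:E by rewrite /p sPE; apply: fin; rewrite // aE ltry.
have qE : leb (sec Q y) = q%:E by rewrite /q sQE; apply: fin; rewrite // bE ltry.
have abpq : a + q = 2 * b + p.
  have mI := measurableI _ _ msA msB.
  have Aoo : (leb (sec A y) < +oo)%E by rewrite aE ltry.
  have Boo : (leb (sec B y) < +oo)%E by rewrite bE ltry.
  have Ifin : leb (sec A y `&` sec B y) \is a fin_num.
    rewrite ge0_fin_numE//; apply: (@le_lt_trans _ _ (leb (sec A y))).
      by apply: le_measure; rewrite ?inE.
    by rewrite aE ltry.
  have h1' : (p%:E = a%:E - leb (sec A y `&` sec B y))%E.
    by rewrite -pE -aE; exact: (measureD msA msB Aoo).
  have h2' : (q%:E = (2 * b)%:E - leb (sec A y `&` sec B y))%E.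
    by rewrite -qE -bE setIC; exact: (measureD msB msA Boo).
  move: h1' h2'; rewrite -(fineK Ifin) -!EFinB => -[->] [->]; lra.
have q0 : 0 <= q by exact: fine_ge0.
have p0 : 0 <= p by exact: fine_ge0.
have msH := measurable_sec y mH.
have Hp : (leb (sec H y) <= p%:E)%E.
  rewrite -pE; apply: le_measure; rewrite ?inE//; first exact: measurable_sec.
  by move=> t [].
have Hq : (leb (sec H y) <= q%:E)%E.
  rewrite -qE -(leb_shift c (measurable_sec y mQ)).
  apply: le_measure; rewrite ?inE//.
    rewrite -[X in measurable X]setTI.
    have mf : measurable_fun setT (fun t : mR => t + c : mR) by exact: measurable_funD.
    by apply: mf => //; exact: measurable_sec.
  move=> t [_]; rewrite /sec/=.
  have -> // : vadd (vcons (t, y)) h = vcons (t + c : mR, y) :> V m.+1.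
  apply/funext => i; rewrite /vadd /h.
  by case: (unliftP ord0 i) => [j ->|->]; rewrite ?vconsS ?vcons0//= addr0.
have Hfin : leb (sec H y) \is a fin_num.
  by rewrite ge0_fin_numE//; apply: (le_lt_trans Hp); rewrite ltry.
rewrite pE; move: Hp Hq; rewrite -(fineK Hfin) !lee_fin => Hp Hq.
have sSE : sec (steiner A `\` B) y = `]- (a / 2), a / 2[%classic `\` `]- b, b[%classic.
  by rewrite -sB -/a -(sec_steiner A y).
rewrite sSE.
have [ab|ba] := leP (a / 2) b.
  rewrite (_ : _ `\` _ = set0) ?measure0 ?add0e ?lee_fin//.
  apply/seteqP; split => // t [/=]; rewrite !in_itv/= => /andP[t1 t2] [].
  by apply/andP; split; lra.
have sub : `]- b, b[%classic `<=` `](- (a / 2)), (a / 2)[%classic.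
  by move=> t /=; rewrite !in_itv/= => /andP[t1 t2]; apply/andP; split; lra.
have a20 : 0 <= a / 2 by rewrite divr_ge0.
have dE : leb (`]- (a / 2), a / 2[%classic `\` `]- b, b[%classic) = (2 * (a / 2) - 2 * b)%:E.
  have oo : (leb `](- (a / 2))%R, (a / 2)%R[%classic < +oo)%E by rewrite leb_open// ltry.
  apply: (etrans (measureD _ _ oo)); [exact: measurable_itv|exact: measurable_itv|].
  by rewrite (setIidr sub) EFinB; congr (_ - _)%E; exact: leb_open.
by rewrite dE -EFinD lee_fin; lra.
Qed.

Lemma steiner_gain : (mun R m.+1 (steiner A `\` B) + mun R m.+1 H <= mun R m.+1 P)%E.
Proof.
have mSB : measurable (steiner A `\` B) by apply: measurableD => //; exact: measurable_steiner.
rewrite (mun_sec mSB) (mun_sec mH) (mun_sec mP).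
rewrite -ge0_integralD//; [|exact: measurable_leb_sec|exact: measurable_leb_sec].
apply: ge0_le_integral => //.
- by move=> y _; rewrite adde_ge0.
- by apply: emeasurable_funD; exact: measurable_leb_sec.
- exact: measurable_leb_sec.
- by move=> y _; exact: steiner_gain_sec.
Qed.

End gain.
End householder.

                             

(** * Choosing symmetrizations that strictly approach a ball *)

Section convergence.
Context (R : realType).
Local Notation mR := (measurableTypeR R).
Local Notation V n := (fvec (measurableTypeR R) 'I_n).

Lemma measurable_ind n d (T : measurableType d) (f : T -> V n) (C : set (V n)) :
  measurable_fun setT f -> measurable C ->
  measurable_fun setT (fun z : T => (\1_C (f z))%:E : \bar R).
Proof.
move=> mf mC; apply/measurable_EFinP.
by apply: (@measurableT_comp _ _ _ _ _ _ (\1_C : V n -> R)).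
Qed.

Definition meet n (P Q : set (V n)) (h : V n) : set (V n) := [set x | P x /\ Q (vadd x h)].

Lemma measurable_meet n (P Q : set (V n)) h : measurable P -> measurable Q ->
  measurable (meet P Q h).
Proof.
move=> mP mQ; apply: measurableI => //; rewrite -[X in measurable X]setTI.
exact: (measurable_vaddr h).
Qed.

Lemma mun_meetE n (P Q : set (V n)) h : measurable P -> measurable Q ->
  (mun R n (meet P Q h) = \int[mun R n]_x ((\1_P x)%:E * (\1_Q (vadd x h))%:E))%E.
Proof.
move=> mP mQ.
transitivity (\int[mun R n]_x (\1_(meet P Q h) x)%:E)%E.
  by rewrite integral_indic ?setIT//; exact: measurable_meet.
apply: eq_integral => x _; rewrite !indicE -EFinM -natrM mulnb; congr (_%:R%:E).
by congr nat_of_bool; apply/idP/andP; rewrite !inE /meet/=; tauto.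
Qed.

Lemma measurable_indMvadd n (P Q : set (V n)) : measurable P -> measurable Q ->
  measurable_fun setT (fun z : V n * V n => ((\1_P z.2)%:E * (\1_Q (vadd z.2 z.1))%:E : \bar R)%E).
Proof.
move=> mP mQ; apply: emeasurable_funM; apply: measurable_ind => //.
exact: measurable_fun_vadd.
Qed.

(** Tonelli and translation invariance: integrated over all shifts, the overlap is the product of
    the measures. *)
Lemma integral_meet n (P Q : set (V n)) : measurable P -> measurable Q ->
  (\int[mun R n]_h mun R n (meet P Q h) = mun R n P * mun R n Q)%E.
Proof.
move=> mP mQ.
have intI C : measurable C -> (\int[mun R n]_x (\1_C x)%:E = mun R n C)%E.
  by move=> mC; rewrite integral_indic// setIT.
under eq_integral do rewrite mun_meetE//.
rewrite (@fubini_tonelli _ _ _ _ _ (mun R n) (mun R n)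
  (fun z => ((\1_P z.2)%:E * (\1_Q (vadd z.2 z.1))%:E))%E (measurable_indMvadd mP mQ)); last by move=> z; rewrite mule_ge0// lee_fin.
have mPi : measurable_fun setT (fun x : V n => (\1_P x)%:E : \bar R) by exact/measurable_EFinP.
have mQi : measurable_fun setT (fun x : V n => (\1_Q x)%:E : \bar R) by exact/measurable_EFinP.
have mQx x : measurable_fun setT (fun h : V n => (\1_Q (vadd x h))%:E : \bar R).
  exact: (measurable_ind (measurable_fun_vadd (@measurable_cst _ _ _ _ setT x) (@measurable_id _ _ setT)) mQ).
rewrite -(intI _ mP) -ge0_integralZr//.
apply: eq_integral => x _ /=; rewrite ge0_integralZl//; last exact: mQx.
congr (_ * _)%E; rewrite -(intI _ mQ).
rewrite -(integral_vadd x mQi)//.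
apply: eq_integral => h _; congr (\1_Q _)%:E.
by apply/funext => i; rewrite /vadd addrC.
Qed.

Lemma meet_empty n (P Q : set (V n)) rho h : P `<=` sqball rho -> Q `<=` sqball rho ->
  ~ sqball (4 * rho) h -> meet P Q h = set0.
Proof.
move=> Pb Qb hb; apply/seteqP; split => // x [/Pb Px /Qb Qx]; apply: hb.
rewrite /sqball/= in Px Qx *.
apply: (@le_lt_trans _ _ (2 * dotp (vadd x h) (vadd x h) + 2 * dotp x x)); last lra.
rewrite /dotp !mulr_sumr -big_split; apply: ler_sum => i _ /=; rewrite /vadd.
have := sqr_ge0 (2 * x i + h i); nra.
Qed.

(** Overlaps vanish unless the shift lies in a fixed ball ([meet_empty]), so by [integral_meet] some
    shift does at least as well as the average. The [+ 1] keeps the denominator positive and the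
    contradiction strict. *)
Lemma exists_shift n (P Q : set (V n)) rho : measurable P -> measurable Q ->
  P `<=` sqball rho -> Q `<=` sqball rho ->
  exists h, fine (mun R n P) * fine (mun R n Q) / (fine (mun R n (@sqball R n (4 * rho))) + 1) <=
    fine (mun R n (meet P Q h)).
Proof.
move=> mP mQ Pb Qb; apply: contrapT => /forallNP nh.
have Pfin := bounded_fin mP Pb; have Qfin := bounded_fin mQ Qb.
set p := fine (mun R n P) in nh; set q := fine (mun R n Q) in nh.
have pE : mun R n P = p%:E by rewrite fineK// ge0_fin_numE.
have qE : mun R n Q = q%:E by rewrite fineK// ge0_fin_numE.
have p0 : 0 <= p by exact: fine_ge0.
have q0 : 0 <= q by exact: fine_ge0.
set M := fine (mun R n (@sqball R n (4 * rho))) in nh.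
have ME : mun R n (@sqball R n (4 * rho)) = M%:E.
  by rewrite fineK// ge0_fin_numE//; exact: sqball_fin.
have M0 : 0 <= M by exact: fine_ge0.
set ka := p * q / (M + 1) in nh.
have ka0 : 0 <= ka by rewrite divr_ge0 ?addr_ge0// mulr_ge0.
have gE h : mun R n (meet P Q h) = (fine (mun R n (meet P Q h)))%:E.
  rewrite fineK// ge0_fin_numE//; apply: le_lt_trans Pfin.
  apply: le_measure; rewrite ?inE//; [exact: measurable_meet|by move=> x []].
have gka h : (mun R n (meet P Q h) <= ka%:E)%E.
  by rewrite gE lee_fin ltW// ltNge; apply/negP/nh.
have kapos : 0 < ka.
  have := nh (fun=> 0); move/negP; rewrite -ltNge; apply: le_lt_trans.
  exact: fine_ge0.
have le1 : ((p * q)%:E <= (ka * M)%:E)%E.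
  rewrite EFinM -pE -qE -(integral_meet mP mQ) EFinM -ME.
  have mb := @measurable_sqball R n (4 * rho).
  rewrite -[X in (_ * mun R n X)%E]setIT -integral_indic// -ge0_integralZl//; last exact/measurable_EFinP.
  apply: ge0_le_integral => //.
  - have -> : (fun h => mun R n (meet P Q h)) =
        fun h => (\int[mun R n]_x ((\1_P x)%:E * (\1_Q (vadd x h))%:E))%E.
      by apply/funext => h; exact: mun_meetE.
    apply: (@measurable_fun_fubini_tonelli_F _ _ _ _ _ (mun R n) (fun z => ((\1_P z.2)%:E * (\1_Q (vadd z.2 z.1))%:E))%E) => //.
    exact: measurable_indMvadd.
  - by apply: emeasurable_funM => //; exact/measurable_EFinP.
  - move=> h _; rewrite indicE; case: (boolP (h \in _)) => [_|]; first by rewrite mule1.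
    by rewrite notin_setE => /(meet_empty Pb Qb) ->; rewrite measure0 mule0.
move: le1; rewrite lee_fin; have : ka * (M + 1) = p * q by rewrite divfK// gt_eqF// ltr_pwDr.
move=> <-; rewrite mulrDr mulr1; lra.
Qed.

(** Symmetrization in the direction that [O] sends to the first axis: conjugation by [O], its own
    inverse for the isometries at hand. *)
Definition osteiner m (O : V m.+1 -> V m.+1) (A : set (V m.+1)) : set (V m.+1) :=
  O @^-1` steiner (O @^-1` A).

Section osteiner.
Variables (m : nat) (rho : R) (O : V m.+1 -> V m.+1).
Hypothesis hO : isom O.

Lemma preimage_bounded (A : set (V m.+1)) : A `<=` sqball rho -> O @^-1` A `<=` sqball rho.
Proof. by move=> Ab; rewrite -(sqball_isom hO) => x; exact: Ab. Qed.

Variable A : set (V m.+1).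
Hypotheses (mA : measurable A) (Ab : A `<=` sqball rho).

Let mOA : measurable (O @^-1` A). Proof. exact: measurable_isom_preimage. Qed.
Let OAb : O @^-1` A `<=` sqball rho. Proof. exact: preimage_bounded. Qed.

Lemma measurable_osteiner : measurable (osteiner O A).
Proof. by apply: measurable_isom_preimage => //; exact: measurable_steiner. Qed.

Lemma osteiner_bounded : osteiner O A `<=` sqball rho.
Proof. by apply: preimage_bounded; exact: steiner_bounded. Qed.

Lemma mun_osteiner : mun R m.+1 (osteiner O A) = mun R m.+1 A.
Proof.
rewrite /osteiner (mun_isometry hO.1); last exact: measurable_steiner.
by rewrite (mun_steiner mOA OAb) (mun_isometry hO.1).
Qed.

Lemma osteiner_gain (r c : R) (h : V m.+1) : O h = vcons (c : mR, (fun=> 0) : V m) ->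
  (mun R m.+1 (osteiner O A `\` sqball r) + mun R m.+1 (meet (A `\` sqball r) (sqball r `\` A) h)
   <= mun R m.+1 (A `\` sqball r))%E.
Proof.
move=> Oh; have [[mO Oadd OO _] _] := hO.
have mB := @measurable_sqball R m.+1 r.
have sb x : sqball r (O x) = sqball r x := congr1 (fun S => S x) (sqball_isom hO r).
have := steiner_gain r c mOA OAb; rewrite -Oh.
have -> : mun R m.+1 (steiner (O @^-1` A) `\` sqball r) = mun R m.+1 (osteiner O A `\` sqball r).
  rewrite -{2}(sqball_isom hO) /osteiner -[RHS](mun_isometry hO.1); last first.
    apply: measurableD; first exact: measurable_osteiner.
    by rewrite (sqball_isom hO).
  by congr (mun R m.+1 _); apply/seteqP; split => x /=; rewrite OO.
have -> : mun R m.+1 ((O @^-1` A) `\` sqball r) = mun R m.+1 (A `\` sqball r).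
  rewrite -[RHS](mun_isometry hO.1); last exact: measurableD.
  by congr (mun R m.+1 _); apply/seteqP; split => x; rewrite /setD/= sb.
congr (_ + _ <= _)%E.
rewrite -[RHS](mun_isometry hO.1); last by apply: measurable_meet; exact: measurableD.
have e2 x : vadd (O x) h = O (vadd x (O h)) by rewrite Oadd OO.
by congr (mun R m.+1 _); apply/seteqP; split => x; rewrite /meet /setD/= e2 !sb.
Qed.

(** The gain inequality for a zero shift, dropping the overlap term: a symmetrization never
    increases the excess outside a centred ball, so all sets may be symmetrized at once. *)
Lemma osteiner_mono (r : R) :
  (mun R m.+1 (osteiner O A `\` sqball r) <= mun R m.+1 (A `\` sqball r))%E.
Proof.
pose e : V m.+1 := vcons (0 : mR, (fun=> 0) : V m).
have [[_ _ OO _] _] := hO.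
have := @osteiner_gain r 0 (O e) (OO e); apply: le_trans.
by rewrite leeDl.
Qed.

End osteiner.

(** Equal volumes make the excess outside the ball and the deficit inside it equal, so the best
    shift has overlap at least the squared excess over a constant. Symmetrizing along that shift
    removes at least this much. *)
Lemma osteiner_step m (rho r : R) (A : set (V m.+1)) : measurable A -> A `<=` sqball rho ->
  r <= rho -> mun R m.+1 A = mun R m.+1 (sqball r) ->
  exists2 O, isom O & fine (mun R m.+1 (osteiner O A `\` sqball r)) <=
    fine (mun R m.+1 (A `\` sqball r)) -
    fine (mun R m.+1 (A `\` sqball r)) ^+ 2 / (fine (mun R m.+1 (@sqball R m.+1 (4 * rho))) + 1).
Proof.
move=> mA Ab rrho AB.
have mB := @measurable_sqball R m.+1 r.
have Bb : @sqball R m.+1 r `<=` sqball rho.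
  by move=> x; rewrite /sqball/= => /lt_le_trans; exact.
have Afin := bounded_fin mA Ab; have Bfin := bounded_fin mB Bb.
have mP := measurableD mA mB; have mQ := measurableD mB mA.
have Pb : A `\` sqball r `<=` sqball rho by move=> x [/Ab].
have Qb : sqball r `\` A `<=` sqball rho by move=> x [/Bb].
have PQ : mun R m.+1 (A `\` sqball r) = mun R m.+1 (sqball r `\` A).
  rewrite (measureD mA mB Afin) (measureD mB mA Bfin) setIC.
  by congr (_ - _)%E; exact: AB.
have [h hh] := exists_shift mP mQ Pb Qb.
have [U hO [c Oh]] := householder h.
exists U => //.
have := osteiner_gain hO mA Ab r Oh.
move: hh; rewrite -PQ -expr2.
have f1 : mun R m.+1 (osteiner U A `\` sqball r) \is a fin_num.
  rewrite ge0_fin_numE//; apply: (le_lt_trans (osteiner_mono hO mA Ab r)).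
  exact: bounded_fin mP Pb.
have f2 : mun R m.+1 (A `\` sqball r) \is a fin_num.
  by rewrite ge0_fin_numE//; exact: bounded_fin mP Pb.
have f3 : mun R m.+1 (meet (A `\` sqball r) (sqball r `\` A) h) \is a fin_num.
  rewrite ge0_fin_numE//; apply: (bounded_fin (rho := rho) (measurable_meet h mP mQ)).
  by move=> x [/Pb Px _].
by move=> hh; rewrite -(fineK f1) -{1}(fineK f2) -(fineK f3) -EFinD lee_fin; lra.
Qed.

End convergence.

Lemma exists_ge_mean (R : realType) (N : nat) (x : 'I_N -> R) (d : R) :
  0 < d -> d <= \sum_k x k -> exists k, d / N%:R <= x k.
Proof.
case: N x => [|N] x d0 dx.
  by move: dx; rewrite big_ord0 leNgt d0.
apply: contrapT => /forallNP nk.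
have lt k : x k < d / N.+1%:R by rewrite ltNge; apply/negP/nk.
suff : \sum_k x k < \sum_(k < N.+1) (d / N.+1%:R).
  rewrite sumr_const card_ord -(mulr_natr (d / _)) divfK ?pnatr_eq0// => /lt_le_trans/(_ dx).
  by rewrite ltxx.
rewrite big_ord_recl [ltRHS]big_ord_recl; apply: ltr_leD => //.
by apply: ler_sum => k _; exact: ltW.
Qed.

(** * From symmetrizations to balls: the rearrangement inequality for sets *)

Section rearrangement.
Context (R : realType).
Local Notation mR := (measurableTypeR R).
Local Notation V n := (fvec (measurableTypeR R) 'I_n).
Variables (m N : nat) (de : R) (s : 'I_N -> R).
Hypotheses (de0 : 0 < de) (s0 : forall k, 0 <= s k).
Local Notation mu := (mun R m.+1).
Local Notation ball := (@sqball R m.+1).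

Let mker k := @measurable_gker R m.+1 (s k).
Let ker01 k (z : V m.+1 * V m.+1) : 0 <= gker (s k) z <= 1. Proof. exact: gker01. Qed.

Lemma gfun_lip (C : R) (A B : 'I_N -> set (V m.+1)) :
  1 <= C -> (forall k, measurable (A k)) -> (forall k, measurable (B k)) ->
  (forall k, mu (A k) <= C%:E)%E -> (forall k, mu (B k) <= C%:E)%E ->
  (gfun de s A <= gfun de s B +
     (C ^+ N * \sum_k fine (mu (A k `\` B k)))%:E * \int[mu]_u (gw de u)%:E)%E.
Proof.
move=> C1 mA mB AC BC.
have Aoo k : (mu (A k) < +oo)%E by apply: (le_lt_trans (AC k)); rewrite ltry.
have Boo k : (mu (B k) < +oo)%E by apply: (le_lt_trans (BC k)); rewrite ltry.
have bd (E : set (V m.+1)) k u : measurable E -> (mu E <= C%:E)%E -> gpsi (s k) E u <= C.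
  move=> mE EC.
  have Eoo : (mu E < +oo)%E by apply: (le_lt_trans EC); rewrite ltry.
  apply: (le_trans (kint_le (mker k) (ker01 k) u mE Eoo)).
  by rewrite -lee_fin fineK// ge0_fin_numE.
apply: (@integral_prod_lip R _ (V m.+1) mu N C (gw de) (fun k => gpsi (s k) (A k))
  (fun k => gpsi (s k) (B k)) (fun k => fine (mu (A k `\` B k))) C1 (@measurable_gw R m.+1 de)
  (fun u => gw_ge0 de u) (fun k => measurable_gpsi s0 k (mA k)) (fun k => measurable_gpsi s0 k (mB k))).
- by move=> k u; apply/andP; split; [exact: gpsi_ge0|exact: bd].
- by move=> k u; apply/andP; split; [exact: gpsi_ge0|exact: bd].
- by move=> k; exact: fine_ge0.
- by move=> k u; exact: (kint_lip (mker k) (ker01 k) u (mA k) (mB k) (Aoo k) (Boo k)).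
Qed.

Section bounded.
Variables (rho : R) (r : 'I_N -> R) (A : 'I_N -> set (V m.+1)).
Hypotheses (mA : forall k, measurable (A k)) (Ab : forall k, A k `<=` ball rho).
Hypotheses (rrho : forall k, r k <= rho) (Ar : forall k, mu (A k) = mu (ball (r k))).

(** The competitors: families with the right volumes, in the fixed ball, whose functional is at
    least that of [A]. [dist] only counts the excess outside the target balls, and this one-sided
    quantity is what [gfun_lip] needs. *)
Let good (A' : 'I_N -> set (V m.+1)) :=
  [/\ forall k, measurable (A' k), forall k, A' k `<=` ball rho,
      forall k, mu (A' k) = mu (ball (r k)) & (gfun de s A <= gfun de s A')%E].
Let dist (A' : 'I_N -> set (V m.+1)) := \sum_k fine (mu (A' k `\` ball (r k))).

                                                                                                  
                                                                                              
(** The infimum [d] of [dist] over competitors must be 0. Otherwise a competitor within [eta] of [d]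
    has one set with excess at least [d / N]; symmetrizing the whole family in the direction chosen
    for that set lowers its excess by at least [eta] and raises no other, falling below [d]. *)
Lemma symmetrization_sequence (e : R) : 0 < e -> exists2 A', good A' & dist A' < e.
Proof.
move=> e0.
pose X := [set d : R | exists2 A', good A' & d = dist A'].
have dist0 A' : 0 <= dist A' by apply: sumr_ge0 => k _; exact: fine_ge0.
have hX : has_inf X.
  split; first by exists (dist A), A.
  by exists 0 => _ [A' _ ->].
have d0ge : 0 <= inf X.
  by apply: lb_le_inf => [|_ [A' _ ->]]; [exists (dist A), A|exact: dist0].
suff d0 : inf X = 0.
  have [_ [A' gA' ->]] := inf_adherent e0 hX; rewrite d0 add0r => dA'.
  by exists A'.
apply/eqP; rewrite eq_le d0ge andbT leNgt; apply/negP => d0.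
set d := inf X in d0.
pose M := fine (mu (ball (4 * rho))) + 1.
have M0 : 0 < M by rewrite ltr_pwDr// fine_ge0.
(* Positivity of [d] forces the sum defining [dist A] to be nonempty, hence [N > 0]. *)
have dA : d <= dist A by apply: ge_inf; [exact: hX.2|exists A].
have [k0 _] := exists_ge_mean d0 dA.
have N0 : (0 < N)%N := leq_ltn_trans (leq0n k0) (ltn_ord k0).
have N0' : 0 < N%:R :> R by rewrite ltr0n.
pose eta := (d / N%:R) ^+ 2 / M.
have eta0 : 0 < eta by rewrite divr_gt0// exprn_gt0// divr_gt0.
have [_ [A' gA' ->]] := inf_adherent eta0 hX; rewrite -/d => dA'.
have [mA' Ab' Ar' GA'] := gA'.
have dle : d <= dist A' by apply: ge_inf; [exact: hX.2|exists A'].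
have [k hk] := exists_ge_mean d0 dle.
have [U hU step] := osteiner_step (mA' k) (Ab' k) (rrho k) (Ar' k).
pose A2 j := osteiner U (A' j).
have gA2 : good A2.
  split.
  - by move=> j; exact: measurable_osteiner.
  - by move=> j; exact: osteiner_bounded.
  - by move=> j; rewrite (mun_osteiner hU (mA' j) (Ab' j)).
  apply: (le_trans GA').
  rewrite -(gfun_isom de s0 hU mA').
  have mOA j := measurable_isom_preimage hU (mA' j).
  have OAb j := preimage_bounded hU (Ab' j).
  apply: (le_trans (gfun_steiner de0 s0 mOA OAb)).
  have := gfun_isom de s0 hU (fun j => measurable_steiner (mOA j)).
  by move=> <-; exact: lexx.
have : d <= dist A2 by apply: ge_inf; [exact: hX.2|exists A2].
have : dist A2 <= dist A' - eta.
  rewrite /dist (bigD1 k)//= [in leRHS](bigD1 k)//= addrAC lerD//.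
    apply: (le_trans step); rewrite lerD2l lerN2 /eta ler_pM2r ?invr_gt0//.
    by rewrite lerXn2r ?nnegrE ?fine_ge0// divr_ge0// ltW.
  apply: ler_sum => j _; apply: fine_le.
  - rewrite ge0_fin_numE//; apply: (bounded_fin (rho := rho)).
      by apply: measurableD; [exact: measurable_osteiner|exact: measurable_sqball].
    by move=> x [/(osteiner_bounded hU (mA' j) (Ab' j))].
  - rewrite ge0_fin_numE//; apply: (bounded_fin (rho := rho)).
      by apply: measurableD => //; exact: measurable_sqball.
    by move=> x [/Ab'].
  exact: osteiner_mono (Ab' j) _.
lra.
Qed.

Lemma gfun_ball : (gfun de s A <= gfun de s (fun k => ball (r k)))%E.
Proof.
have mb k := @measurable_sqball R m.+1 (r k).
pose C := 1 + \sum_k fine (mu (ball (r k))).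
have S0 k : 0 <= fine (mu (ball (r k))) by exact: fine_ge0.
have C1 : 1 <= C by rewrite lerDl sumr_ge0.
have bC k : (mu (ball (r k)) <= C%:E)%E.
  rewrite -(fineK (x := mu (ball (r k)))); last by rewrite ge0_fin_numE// sqball_fin.
  rewrite lee_fin /C (bigD1 k)//= addrCA lerDl; apply: addr_ge0 => //.
  by apply: sumr_ge0 => j _; exact: S0.
have C0 : 0 <= C := le_trans ler01 C1.
pose I := fine (\int[mu]_u (gw de u)%:E)%E.
have Ige : (0 <= \int[mu]_u (gw de u)%:E)%E.
  by apply: integral_ge0 => v _; rewrite lee_fin; exact: gw_ge0.
have IE : (\int[mu]_u (gw de u)%:E)%E = I%:E by rewrite fineK// ge0_fin_numE//; exact: gw_fin.
have I0 : 0 <= I by exact: fine_ge0.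
have CI : 0 <= C ^+ N * I by rewrite mulr_ge0// exprn_ge0.
apply/lee_addgt0Pr => eta eta0.
have ep0 : 0 < eta / (C ^+ N * I + 1) by rewrite divr_gt0// ltr_pwDr.
have [A' [mA' Ab' Ar' GA'] dA'] := symmetrization_sequence ep0.
apply: (le_trans GA').
apply: (le_trans (gfun_lip C1 mA' mb _ bC)); first by move=> k; rewrite Ar'.
rewrite leeD2l// IE -EFinM lee_fin -/(dist A') mulrAC.
move: dA'; rewrite ltr_pdivlMr; last by rewrite ltr_pwDr.
move=> /ltW; apply: le_trans; rewrite mulrC ler_wpM2l ?lerDl//.
by apply: sumr_ge0 => k _; exact: fine_ge0.
Qed.

End bounded.

Definition om : R := fine (mu (ball 1)).

Lemma om_gt0 : 0 < om.
Proof.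
rewrite -lte_fin fineK ?sqball_gt0//.
by rewrite ge0_fin_numE// sqball_fin.
Qed.

Lemma mun_sqball_sqr (c : R) : 0 < c -> mu (ball (c ^+ 2)) = (c ^+ m.+1 * om)%:E.
Proof.
move=> c0.
have omE : mu (ball 1) = om%:E by rewrite fineK// ge0_fin_numE// sqball_fin.
have cN : c != 0 by rewrite gt_eqF.
have := mun_vscale (n := m.+1) c0 (@measurable_sqball R m.+1 (c ^+ 2)).
have -> : vscale c @^-1` ball (c ^+ 2) = ball 1.
  have c20 : 0 < c ^+ 2 by rewrite exprn_gt0.
  apply/seteqP; split => x; rewrite /sqball/= dotpZl dotpZr mulrA -expr2.
    by rewrite -{2}[c ^+ 2]mulr1 ltr_pM2l.
  by rewrite -{2}[c ^+ 2]mulr1 ltr_pM2l.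
rewrite omE => h.
have -> : mu (ball (c ^+ 2)) = ((c ^+ m.+1)%:E * ((c ^- m.+1)%:E * mu (ball (c ^+ 2))))%E.
  by rewrite muleA -EFinM mulfV ?mul1e// expf_neq0.
by rewrite -h -EFinM.
Qed.

                                              
(** The squared radius of the ball of volume [a], as [sqball] is parametrised by squared radii. *)
Definition brad (a : R) : R := ((a / om) `^ (m.+1%:R^-1)) ^+ 2.

Lemma mun_brad (a : R) : 0 <= a -> mu (ball (brad a)) = a%:E.
Proof.
rewrite le_eqVlt => /orP[/eqP <-|a0].
  rewrite /brad mul0r powR0 ?invr_eq0 ?pnatr_eq0// expr0n/=.
  rewrite (_ : ball 0 = set0) ?measure0//.
  by apply/seteqP; split => // x; rewrite /sqball/= ltNge dotp_ge0.
have ao : 0 < a / om by rewrite divr_gt0// om_gt0.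
rewrite /brad mun_sqball_sqr ?powR_gt0//; congr EFin.
rewrite -powR_mulrn ?powR_ge0// -powRrM mulVf ?pnatr_eq0// powRr1 ?ltW//.
by rewrite divfK// gt_eqF// om_gt0.
Qed.

Lemma brad_ge0 a : 0 <= brad a. Proof. exact: sqr_ge0. Qed.

Lemma brad_le (a b : R) : 0 <= a -> a <= b -> brad a <= brad b.
Proof.
move=> a0 ab; have o0 := om_gt0.
rewrite /brad lerXn2r ?nnegrE ?powR_ge0//.
have aa : a / om <= b / om by rewrite ler_pM2r// invr_gt0.
have a00 : 0 <= a / om by apply: divr_ge0 => //; exact: ltW.
by apply: ge0_ler_powR; rewrite ?nnegrE ?invr_ge0//; exact: le_trans aa.
Qed.

(** Sets of finite measure are truncated to a large ball at a loss of at most [ep] each; [gfun_ball]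
    applies to the truncated sets, and the resulting balls are then enlarged to the full volumes. *)
Lemma gfun_rearr (A : 'I_N -> set (V m.+1)) : (forall k, measurable (A k)) ->
  (forall k, mu (A k) < +oo)%E ->
  (gfun de s A <= gfun de s (fun k => ball (brad (fine (mu (A k))))))%E.
Proof.
move=> mA Aoo.
pose a k := fine (mu (A k)).
have aE k : mu (A k) = (a k)%:E by rewrite fineK// ge0_fin_numE.
have a0 k : 0 <= a k by exact: fine_ge0.
pose C := 1 + \sum_k a k.
have C1 : 1 <= C by rewrite lerDl sumr_ge0.
have C0 : 0 <= C := le_trans ler01 C1.
have aC k : (mu (A k) <= C%:E)%E.
  by rewrite aE lee_fin /C (bigD1 k)//= addrCA lerDl addr_ge0// sumr_ge0.
pose G := fine (\int[mu]_u (gw de u)%:E)%E.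
have Ige : (0 <= \int[mu]_u (gw de u)%:E)%E.
  by apply: integral_ge0 => v _; rewrite lee_fin; exact: gw_ge0.
have IE : (\int[mu]_u (gw de u)%:E)%E = G%:E by rewrite fineK// ge0_fin_numE//; exact: gw_fin.
have G0 : 0 <= G by exact: fine_ge0.
have CI : 0 <= C ^+ N * N%:R * G by rewrite !mulr_ge0// exprn_ge0.
apply/lee_addgt0Pr => eta eta0.
pose ep := eta / (C ^+ N * N%:R * G + 1).
have ep0 : 0 < ep by rewrite divr_gt0// ltr_pwDr.
pose K (j : nat) := ball j%:R.
have mK j : measurable (K j) by exact: measurable_sqball.
have trunc k : \forall j \near \oo, fine (mu (A k `\` K j)) <= ep.
  have : mu (A k `\` K j) @[j --> \oo] --> mu (\bigcap_j (A k `\` K j)).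
    have mD j : measurable (A k `\` K j) by apply: measurableD; [exact: mA|exact: mK].
    apply: nonincreasing_cvg_mu.
    - apply: le_lt_trans (Aoo k).
      by apply: le_measure; rewrite ?inE//; exact: subDsetl.
    - exact: mD.
    - exact: bigcapT_measurable.
    - move=> i j ij; apply/subsetPset => x [Ax nK]; split => // Kx; apply: nK.
      by move: Kx; rewrite /K /sqball/= => /lt_le_trans; apply; rewrite ler_nat.
  rewrite (_ : \bigcap_j _ = set0); last first.
    apply/seteqP; split => // x /(_ (Num.truncn (dotp x x)).+1 I) [_]; apply.
    exact: truncnS_gt.
  rewrite measure0 => /fine_cvgP[_ /cvgrPdist_le/(_ _ ep0)].
  apply: filterS => j /=; rewrite sub0r normrN; apply: le_trans; exact: ler_norm.
have [j hj] : exists j, forall k, fine (mu (A k `\` K j)) <= ep.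
  have : \forall j \near \oo, forall k : 'I_N, fine (mu (A k `\` K j)) <= ep.
    exact: filter_forall trunc.
  by move=> [j _ /(_ j (leqnn j)) h]; exists j.
pose A' k := A k `&` K j.
have mA' k : measurable (A' k) by exact: measurableI.
have A'A k : (mu (A' k) <= mu (A k))%E by apply: le_measure; rewrite ?inE//; exact: subIsetl.
have A'fin k : mu (A' k) = (fine (mu (A' k)))%:E.
  by rewrite fineK// ge0_fin_numE//; exact: le_lt_trans (Aoo k).
pose r k := brad (fine (mu (A' k))).
have Ar k : mu (A' k) = mu (ball (r k)) by rewrite /r mun_brad -?A'fin// fine_ge0.
(* Large enough to contain both the truncated sets and their target balls. *)
pose rho := j%:R + \sum_k r k.
have r0 k : 0 <= r k by exact: brad_ge0.
have rrho k : r k <= rho.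
  by rewrite /rho (bigD1 k)//= addrCA lerDl addr_ge0// sumr_ge0.
have A'b k : A' k `<=` ball rho.
  move=> x [_]; rewrite /K /sqball/= => /lt_le_trans; apply.
  by rewrite lerDl sumr_ge0.
have g1 := gfun_lip C1 mA mA' aC (fun k => le_trans (A'A k) (aC k)).
apply: (le_trans g1).
have g2 := gfun_ball mA' A'b rrho Ar.
have g3 : (gfun de s (fun k => ball (r k)) <= gfun de s (fun k => ball (brad (a k))))%E.
  have rb k : ball (r k) `<=` ball (brad (a k)).
    have ra : r k <= brad (a k).
      by apply: brad_le; [exact: fine_ge0|rewrite -lee_fin -A'fin -aE].
    by move=> x; rewrite /sqball/= => /lt_le_trans; exact.
  apply: ge0_le_integral; first exact: measurableT.
  - move=> u _; rewrite lee_fin; apply: mulr_ge0; first exact: gw_ge0.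
    by apply: prodr_ge0 => k _; exact: gpsi_ge0.
  - apply/measurable_EFinP/measurable_funM; first exact: measurable_gw.
    by apply: measurable_prod_cond => k; apply: measurable_gpsi => //; exact: measurable_sqball.
  - apply/measurable_EFinP/measurable_funM; first exact: measurable_gw.
    by apply: measurable_prod_cond => k; apply: measurable_gpsi => //; exact: measurable_sqball.
  - move=> u _; rewrite lee_fin; apply: ler_wpM2l; first exact: gw_ge0.
    apply: ler_prod => k _; apply/andP; split; first exact: gpsi_ge0.
    exact: (kint_subset (mker k) (ker01 k) u (measurable_sqball _) (measurable_sqball _) (sqball_fin _ _) (@rb k)).
apply: leeD; first exact: le_trans g2 g3.
rewrite IE -EFinM lee_fin.
have sle : \sum_k fine (mu (A k `\` A' k)) <= N%:R * ep.
  have -> : N%:R * ep = \sum_(k < N) ep by rewrite sumr_const card_ord mulr_natl.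
  apply: ler_sum => k _.
  have -> : A k `\` A' k = A k `\` K j by rewrite /A' setDIr setDv set0U.
  exact: hj.
apply: (@le_trans _ _ (C ^+ N * (N%:R * ep) * G)).
  by rewrite ler_wpM2r// ler_wpM2l// exprn_ge0.
have -> : C ^+ N * (N%:R * ep) * G = ep * (C ^+ N * N%:R * G) by ring.
rewrite /ep mulrAC ler_pdivrMr; last by rewrite ltr_pwDr.
by rewrite ler_wpM2l ?lerDl// ltW.
Qed.

End rearrangement.

                              

(** * From sets to densities, and from Gaussians to their mixtures *)

Section layers.
Context (R : realType).
Local Notation mR := (measurableTypeR R).
Local Notation V n := (fvec (measurableTypeR R) 'I_n).
Local Notation leb := (@lebesgue_measure R).

Definition cint n (f : V n -> R) (phi : R -> R) (u : V n) : R :=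
  fine (\int[mun R n]_x (f x * phi (dotp x u))%:E)%E.

(** The clause [0 < t] empties the layers of nonpositive level, so that integrating over the whole
    line gives [f] back ([layer_integral]). *)
Definition layer n (f : V n -> R) (t : R) : set (V n) := [set x | 0 < t < f x].

Definition gaussian (s t : R) : R := expR (- (s * t ^+ 2)).

Section one_function.
Variables (n : nat) (f : V n -> R).
Local Notation mu := (mun R n).
Hypotheses (mf : measurable_fun setT f) (f0 : forall x, 0 <= f x).
Hypothesis ioo : (\int[mu]_x (f x)%:E < +oo)%E.

Lemma measurable_layers : measurable [set z : mR * V n | layer f z.1 z.2].
Proof.
have -> : [set z : mR * V n | layer f z.1 z.2] =
    [set z | ((fun=> 0) z < z.1%:E)%E] `&` [set z : mR * V n | (z.1%:E < (f z.2)%:E)%E].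
  apply/seteqP; split => z; rewrite /layer/=; first by move=> /andP[? ?]; rewrite !lte_fin.
  by rewrite !lte_fin => -[-> ->].
have m1 : measurable_fun setT (fun z : mR * V n => z.1%:E : \bar R).
  by apply/measurable_EFinP; exact: measurable_fst.
apply: measurableI; apply: measurable_superlevel => //.
by apply/measurable_EFinP; apply: measurableT_comp => //; exact: measurable_snd.
Qed.

Lemma measurable_layer t : measurable (layer f t).
Proof.
have m := @pair2_measurable _ _ mR (V n).
have -> : layer f t = setT `&` (fun x => (t : mR, x)) @^-1` [set z : mR * V n | layer f z.1 z.2].
  by rewrite setTI.
have h : measurable_fun setT (fun x : V n => (t : mR, x)) by exact: pair1_measurable.
by apply: h => //; exact: measurable_layers.
Qed.

(** Markov's inequality. *)
Lemma layer_fin t : (mu (layer f t) < +oo)%E.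
Proof.
have [t0|t0] := ltP 0 t; last first.
  by rewrite (_ : layer f t = set0) ?measure0// /layer; apply/seteqP; split => // x/=; rewrite ltNge t0.
have ml := measurable_layer t.
suff : (t%:E * mu (layer f t) <= \int[mu]_x (f x)%:E)%E.
  move=> /le_lt_trans/(_ ioo); rewrite !ltey; apply: contra => /eqP ->.
  by rewrite gt0_muley ?lte_fin.
rewrite -[X in mu X]setIT -integral_indic//.
rewrite -ge0_integralZl//.
- apply: ge0_le_integral => //.
  + by move=> x _; apply: mule_ge0; rewrite ?lee_fin// ltW.
  + apply: emeasurable_funM => //; apply/measurable_EFinP => //.
  + exact/measurable_EFinP.
  + move=> x _; rewrite -EFinM lee_fin indicE; have [h|h] := pselect (layer f t x).
      by rewrite mem_set// mulr1; case/andP: h => _ /ltW.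
    by rewrite memNset// mulr0.
- exact/measurable_EFinP.
- by rewrite lee_fin ltW.
Qed.

Lemma layer_integral x : (\int[leb]_t (\1_(layer f t) x)%:E = (f x)%:E :> \bar R)%E.
Proof.
transitivity (\int[leb]_t (\1_(`]0%R, f x[%classic : set mR) t)%:E : \bar R)%E.
  by apply: eq_integral => t _; rewrite !indicE; congr (nat_of_bool _)%:R%:E; apply/idP/idP; rewrite !inE/= in_itv.
rewrite integral_indic// setIT.
transitivity (if ((0 : R)%:E < (f x)%:E)%E then (f x)%:E - (0 : R)%:E else 0 : \bar R)%E.
  by have := @lebesgue_measure_itv R `]0%R, f x[.
rewrite lte_fin; by case: ltP (f0 x) => [|h h']; [rewrite sube0|congr EFin; apply/eqP; rewrite eq_le h h'].
Qed.

Lemma cintE (phi : R -> R) (u : V n) (C : R) : measurable_fun setT phi -> (forall t, 0 <= phi t <= C) ->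
  (cint f phi u)%:E = (\int[mu]_x (f x * phi (dotp x u))%:E)%E.
Proof.
move=> mphi phi01; rewrite fineK// ge0_fin_numE; last first.
  apply: integral_ge0 => x _; rewrite lee_fin mulr_ge0//.
  by have /andP[] := phi01 (dotp x u).
apply: (@le_lt_trans _ _ (\int[mu]_x (C%:E * (f x)%:E))%E).
  apply: ge0_le_integral => //.
  - by move=> x _; rewrite lee_fin mulr_ge0//; have /andP[] := phi01 (dotp x u).
  - apply/measurable_EFinP/measurable_funM => //.
    by apply: measurableT_comp => //; exact: measurable_dotpl.
  - by apply: emeasurable_funM => //; apply/measurable_EFinP.
  - move=> x _; rewrite -EFinM lee_fin mulrC ler_wpM2r//.
    by have /andP[] := phi01 (dotp x u).
have C0 : 0 <= C by have /andP[h /(le_trans h)] := phi01 0.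
rewrite ge0_integralZl//; first exact: lte_mul_pinfty.
- exact/measurable_EFinP.
- by move=> x _; rewrite lee_fin.
Qed.

Lemma cint_ge0 (phi : R -> R) (u : V n) : (forall t, 0 <= phi t) -> 0 <= cint f phi u.
Proof.
move=> phi0; apply: fine_ge0; apply: integral_ge0 => x _.
by rewrite lee_fin mulr_ge0.
Qed.

Lemma measurable_cint (phi : R -> R) : measurable_fun setT phi -> (forall t, 0 <= phi t) ->
  measurable_fun setT (cint f phi).
Proof.
move=> mphi phi0; apply: (@measurableT_comp _ _ _ _ _ _ (@fine R)) => //.
apply: (@measurable_fun_fubini_tonelli_G _ _ _ _ _ mu (fun z : V n * V n => (f z.1 * phi (dotp z.1 z.2))%:E)).
  apply/measurable_EFinP/measurable_funM.
    by apply: measurableT_comp => //; exact: measurable_fst.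
  by apply: measurableT_comp => //; exact: measurable_dotp.
by move=> z; rewrite lee_fin mulr_ge0.
Qed.

Lemma gaussian01 (s t : R) : 0 <= s -> 0 <= gaussian s t <= 1.
Proof.
move=> s0; rewrite expR_ge0/= -expR0 ler_expR oppr_le0.
by rewrite mulr_ge0// sqr_ge0.
Qed.

Lemma measurable_gaussian (s : R) : measurable_fun setT (gaussian s).
Proof.
apply: (@measurableT_comp _ _ _ _ _ _ (@expR R)) => //.
by apply: measurableT_comp => //; apply: measurable_funM => //.
Qed.

Variable (s : R).
Hypothesis s0 : 0 <= s.

Let F (z : (mR * V n) * V n) : \bar R :=
  (\1_(layer f z.1.1) z.2 * gaussian s (dotp z.2 z.1.2))%:E.

Let mF : measurable_fun setT F.
Proof.
apply/measurable_EFinP/measurable_funM.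
  rewrite (_ : (fun x => _) = \1_([set z : mR * V n | layer f z.1 z.2]) \o
      (fun z : (mR * V n) * V n => (z.1.1, z.2))); last first.
    by apply/funext => z; rewrite /= !indicE; congr (nat_of_bool _)%:R; apply/idP/idP; rewrite !inE.
  apply: measurableT_comp; first exact: measurable_indic measurable_layers.
  apply: measurable_fun_pair; last exact: measurable_snd.
  by apply: measurableT_comp; exact: measurable_fst.
apply: measurableT_comp; first exact: measurable_gaussian.
have m2 : measurable_fun setT (fun z : (mR * V n) * V n => (z.2, z.1.2)).
  apply: measurable_fun_pair; first exact: measurable_snd.
  by apply: measurableT_comp; [exact: measurable_snd|exact: measurable_fst].
exact: (measurableT_comp (@measurable_dotp R n) m2).
Qed.

Let F0 z : (0 <= F z)%E. Proof. by rewrite lee_fin mulr_ge0// expR_ge0. Qed.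

Let gpsiE t u : (gpsi s (layer f t) u)%:E = (\int[mu]_x F ((t, u), x))%E.
Proof.
rewrite kintE//; [exact: measurable_gker|by move=> z; exact: gker01|exact: measurable_layer|exact: layer_fin].
Qed.

Lemma measurable_gpsi_layer :
  measurable_fun setT (fun z : mR * V n => gpsi s (layer f z.1) z.2).
Proof.
apply/measurable_EFinP.
rewrite (_ : _ \o _ = fun z : mR * V n => (\int[mu]_x F (z, x))%E); last first.
  by apply/funext => -[t u]; exact: gpsiE.
exact: measurable_fun_fubini_tonelli_F.
Qed.

(** Presents [cint] as a superposition of the set functionals [gpsi] of the layers, the form that
    [slot_tonelli] consumes. *)
Lemma cint_gaussian u :
  (cint f (gaussian s) u)%:E = (\int[leb]_t (gpsi s (layer f t) u)%:E)%E.
Proof.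
rewrite (@cintE _ _ 1); last 2 first.
- exact: measurable_gaussian.
- by move=> t; exact: gaussian01.
under [RHS]eq_integral do rewrite gpsiE.
pose G (z : mR * V n) := F ((z.1, u), z.2).
have mG : measurable_fun setT G.
  apply: (measurableT_comp mF).
  apply: measurable_fun_pair; last exact: measurable_snd.
  by apply: measurable_fun_pair => //; exact: measurable_fst.
rewrite (@fubini_tonelli _ _ _ _ _ leb mu G mG (fun z => F0 _)).
apply: eq_integral => x _.
rewrite EFinM -layer_integral -ge0_integralZr//.
- have m1 : measurable_fun setT (fun t : mR => (t, x)) by exact: pair2_measurable.
  apply/measurable_EFinP.
  rewrite (_ : (fun t => _) = \1_([set z : mR * V n | layer f z.1 z.2]) \o (fun t : mR => (t, x))).
    by apply: measurableT_comp => //; exact: measurable_indic measurable_layers.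
  by apply/funext => t; rewrite /= !indicE; congr (nat_of_bool _)%:R; apply/idP/idP; rewrite !inE.
- by rewrite lee_fin expR_ge0.
Qed.

End one_function.
End layers.

Section gaussian_mixtures.
Context (R : realType).
Local Notation mR := (measurableTypeR R).
Local Notation V n := (fvec (measurableTypeR R) 'I_n).
Local Notation leb := (@lebesgue_measure R).

(** The absolute values make every list of pairs a mixture with nonnegative weights and exponents,
    so no side condition is carried along. *)
Definition gmix (l : seq (R * R)) (t : R) : R :=
  \sum_(z <- l) `|z.1| * gaussian `|z.2| t.

Lemma gmix_ge0 l t : 0 <= gmix l t.
Proof. by apply: sumr_ge0 => z _; rewrite mulr_ge0// expR_ge0. Qed.

Lemma gmix_le l t : gmix l t <= \sum_(z <- l) `|z.1|.
Proof.
apply: ler_sum => z _; rewrite ler_piMr//.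
by have /andP[] := gaussian01 t (normr_ge0 z.2).
Qed.

Lemma measurable_gmix l : measurable_fun setT (gmix l).
Proof.
apply: measurable_sum => z.
by apply: measurable_funM => //; exact: measurable_gaussian.
Qed.

Section cint_gmix.
Variables (n : nat) (f : V n -> R).
Local Notation mu := (mun R n).
Hypotheses (mf : measurable_fun setT f) (f0 : forall x, 0 <= f x).
Hypothesis ioo : (\int[mu]_x (f x)%:E < +oo)%E.

Lemma cint_gmix l (u : V n) :
  cint f (gmix l) u = \sum_(z <- l) `|z.1| * cint f (gaussian `|z.2|) u.
Proof.
have ga s t := gaussian01 t (normr_ge0 (s : R)).
have mg (s : R) := @measurable_gaussian R `|s|.
have md : measurable_fun setT (fun x : V n => dotp x u) by exact: measurable_dotpl.
apply: EFin_inj.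
have lb t : 0 <= gmix l t <= \sum_(z <- l) `|z.1| by rewrite gmix_ge0 gmix_le.
rewrite (cintE mf f0 ioo u (measurable_gmix l) lb).
transitivity (\int[mu]_x (\sum_(z <- l) (`|z.1| * (f x * gaussian `|z.2| (dotp x u)))%:E))%E.
  apply: eq_integral => x _; rewrite sumEFin; congr EFin; rewrite mulr_sumr.
  by apply: eq_bigr => z _; rewrite mulrCA.
have mh (s : R) : measurable_fun setT (fun x : V n => f x * gaussian `|s| (dotp x u)).
  by apply: measurable_funM => //; apply: measurableT_comp.
have h0 (s : R) (x : V n) : 0 <= f x * gaussian `|s| (dotp x u) by rewrite mulr_ge0// expR_ge0.
rewrite ge0_integral_sum//; last 2 first.
- by move=> z; apply/measurable_EFinP; apply: measurable_funM => //; exact: mh.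
- by move=> z x _; rewrite lee_fin mulr_ge0.
rewrite -sumEFin; apply: eq_bigr => z _.
under eq_integral do rewrite EFinM.
rewrite ge0_integralZl//; last 2 first.
- by apply/measurable_EFinP; exact: mh.
- by move=> x _; rewrite lee_fin; exact: h0.
by rewrite EFinM (cintE mf f0 ioo u (mg z.2) (ga z.2)).
Qed.

End cint_gmix.

Section rearranged.
Variables (m N : nat) (de : R) (f g : V m.+1 -> R).
Hypothesis de0 : 0 < de.
Local Notation mu := (mun R m.+1).
Hypotheses (mf : measurable_fun setT f) (f0 : forall x, 0 <= f x).
Hypotheses (mg : measurable_fun setT g) (g0 : forall x, 0 <= g x).
Hypothesis fi : (\int[mu]_x (f x)%:E < +oo)%E.
Hypothesis gi : (\int[mu]_x (g x)%:E < +oo)%E.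
Hypothesis fg : forall t, layer g t = @sqball R m.+1 (brad m (fine (mu (layer f t)))).

Lemma wint_le (w : R) (F G : V m.+1 -> R) : 0 <= w ->
  measurable_fun setT F -> measurable_fun setT G ->
  (forall v, 0 <= F v) -> (forall v, 0 <= G v) ->
  (\int[mu]_v (F v)%:E <= \int[mu]_v (G v)%:E)%E ->
  (\int[mu]_v (w * F v)%:E <= \int[mu]_v (w * G v)%:E)%E.
Proof.
move=> w0 mF mG F0 G0 FG.
have E (H : V m.+1 -> R) : measurable_fun setT H -> (forall v, 0 <= H v) ->
    (\int[mu]_v (w * H v)%:E = w%:E * \int[mu]_v (H v)%:E)%E.
  move=> mH H0; under eq_integral do rewrite EFinM.
  by rewrite ge0_integralZl//; [exact/measurable_EFinP|move=> x _; rewrite lee_fin].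
by rewrite !E// lee_wpmul2l.
Qed.

(** The pieces of each factor are pairs (exponent, level). [slots] undoes both the sum over the
    mixture and the integral over the levels, leaving [gfun_rearr] for layers; by [fg] the balls it
    produces are the layers of [g]. *)
Lemma gmix_rearr l :
  (\int[mu]_u (gw de u * \prod_(k < N) cint f (gmix l) u)%:E <=
   \int[mu]_u (gw de u * \prod_(k < N) cint g (gmix l) u)%:E)%E.
Proof.
have n0 (s : R) := normr_ge0 s.
pose a (k : 'I_N) (z : R * R) (v : V m.+1) := gpsi `|z.1| (layer f z.2) v.
pose b (k : 'I_N) (z : R * R) (v : V m.+1) := gpsi `|z.1| (layer g z.2) v.
have gp0 (s : R) (A : set (V m.+1)) v : 0 <= gpsi `|s| A v.
  by apply: kint_ge0 => z; exact: gker01.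
have mgp (s : R) (A : set (V m.+1)) : measurable A -> measurable_fun setT (gpsi `|s| A).
  by move=> mA; apply: measurable_kint => //; [exact: measurable_gker|move=> z; exact: gker01].
have cg0 (h : V m.+1 -> R) (h0 : forall x, 0 <= h x) phi u : (forall t, 0 <= phi t) -> 0 <= cint h phi u.
  by move=> ?; exact: cint_ge0.
apply: (@slots R _ _ mu N (R * R)%type a b (fun k => cint f (gmix l)) (fun k => cint g (gmix l))).
- by move=> k z v; exact: gp0.
- by move=> k z v; exact: gp0.
- by move=> k v; apply: cint_ge0 => // t; exact: gmix_ge0.
- by move=> k v; apply: cint_ge0 => // t; exact: gmix_ge0.
- by move=> k z; apply: mgp; exact: measurable_layer.
- by move=> k z; apply: mgp; exact: measurable_layer.
- by move=> k; apply: measurable_cint => //; [exact: measurable_gmix|exact: gmix_ge0].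
- by move=> k; apply: measurable_cint => //; [exact: measurable_gmix|exact: gmix_ge0].
- move=> k W W' mW mW' W0 W'0 h.
  have slot1 (s : R) : (\int[mu]_v (W v * cint f (gaussian `|s|) v)%:E <=
                  \int[mu]_v (W' v * cint g (gaussian `|s|) v)%:E)%E.
    apply: (@slot_tonelli R _ _ mR (V m.+1) leb mu (fun z => gpsi `|s| (layer f z.1) z.2)
      (fun z => gpsi `|s| (layer g z.1) z.2)); [| | | | | |exact: mW|exact: mW'|exact: W0|exact: W'0|].
    + exact: (measurable_gpsi_layer mf f0 fi (n0 s)).
    + exact: (measurable_gpsi_layer mg g0 gi (n0 s)).
    + by move=> v; exact: gp0.
    + by move=> v; exact: gp0.
    + by move=> v; exact: (cint_gaussian mf f0 fi (n0 s)).
    + by move=> v; exact: (cint_gaussian mg g0 gi (n0 s)).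
    + by move=> t; exact: (h (s, t)).
  have E (h' W1 : V m.+1 -> R) : measurable_fun setT h' -> (forall x, 0 <= h' x) ->
      (\int[mu]_x (h' x)%:E < +oo)%E -> measurable_fun setT W1 -> (forall v, 0 <= W1 v) ->
    (\int[mu]_v (W1 v * cint h' (gmix l) v)%:E =
     \sum_(z <- l) \int[mu]_v (`|z.1| * (W1 v * cint h' (gaussian `|z.2|) v))%:E)%E.
    move=> mh h0 hi mW1 W10; rewrite -ge0_integral_sum//; last 2 first.
    + move=> z; apply/measurable_EFinP; apply: measurable_funM => //; apply: measurable_funM => //.
      by apply: measurable_cint => //; [exact: measurable_gaussian|move=> t; exact: expR_ge0].
    + move=> z v _; rewrite lee_fin; apply: mulr_ge0 => //; apply: mulr_ge0 => //.
      by apply: cint_ge0 => // t; exact: expR_ge0.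
    apply: eq_integral => v _; rewrite sumEFin cint_gmix// mulr_sumr; congr EFin.
    by apply: eq_bigr => z _; rewrite mulrCA.
  rewrite (E f W mf f0 fi mW W0) (E g W' mg g0 gi mW' W'0).
  apply: lee_sum => z _; apply: wint_le; [exact: n0| | | | |exact: slot1].
  + apply: measurable_funM => //.
    by apply: measurable_cint => //; [exact: measurable_gaussian|move=> t; exact: expR_ge0].
  + apply: measurable_funM => //.
    by apply: measurable_cint => //; [exact: measurable_gaussian|move=> t; exact: expR_ge0].
  + by move=> v; apply: mulr_ge0 => //; apply: cint_ge0 => // t; exact: expR_ge0.
  + by move=> v; apply: mulr_ge0 => //; apply: cint_ge0 => // t; exact: expR_ge0.
- exact: measurable_gw.
- by move=> v; exact: gw_ge0.
- move=> z.
  have := @gfun_rearr R m N de (fun k => `|(z k).1|) de0 (fun k => n0 _)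
    (fun k => layer f (z k).2) (fun k => measurable_layer mf _) (fun k => layer_fin mf f0 fi _).
  have -> : (fun k => @sqball R m.+1 (brad m (fine (mu (layer f (z k).2))))) =
    (fun k => layer g (z k).2) by apply/funext => k; rewrite fg.
  exact: id.
Qed.

End rearranged.
End gaussian_mixtures.

Lemma real_dominated_cvg (R : realType) d (T : measurableType d) (mu : {measure set T -> \bar R})
    (h : nat -> T -> R) (h' G : T -> R) :
  (forall k, measurable_fun setT (h k)) -> measurable_fun setT G ->
  (forall k x, `|h k x| <= G x) -> (\int[mu]_x (G x)%:E < +oo)%E ->
  (forall x, h k x @[k --> \oo] --> h' x) ->
  (\int[mu]_x (h k x)%:E @[k --> \oo] --> \int[mu]_x (h' x)%:E)%E.
Proof.
move=> mh mG hG Goo hc.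
have G0 x : 0 <= G x := le_trans (normr_ge0 _) (hG 0%N x).
apply: (@dominated_cvg _ _ _ mu setT measurableT (fun k x => (h k x)%:E) _ (fun x => (G x)%:E)).
- by move=> k; apply/measurable_EFinP.
- by move=> x _; apply: cvg_EFin (hc x); exact: nearW.
- by [].
- apply/integrableP; split; first exact/measurable_EFinP.
  by under eq_integral do rewrite gee0_abs ?lee_fin//.
- by move=> k x _; rewrite lee_fin.
Qed.

Lemma lee_cvg (R : realType) (u v : nat -> \bar R) (a b : \bar R) :
  u k @[k --> \oo] --> a -> v k @[k --> \oo] --> b -> (forall k, u k <= v k)%E -> (a <= b)%E.
Proof.
move=> ua vb uv; rewrite -(cvg_lim _ ua)// -(cvg_lim _ vb)//.
apply: lee_lim; [by apply/cvg_ex; exists a|by apply/cvg_ex; exists b|exact: nearW].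
Qed.

(** * Profiles satisfying the inequality are closed under pointwise limits *)

Section admissible.
Context (R : realType).
Local Notation mR := (measurableTypeR R).
Local Notation V n := (fvec (measurableTypeR R) 'I_n).
Local Notation leb := (@lebesgue_measure R).

Lemma cint_cvg n (f : V n -> R) (phi_ : nat -> R -> R) (phi : R -> R) (u : V n) :
  measurable_fun setT f -> (forall x, 0 <= f x) -> (\int[mun R n]_x (f x)%:E < +oo)%E ->
  (forall k, measurable_fun setT (phi_ k)) -> (forall k t, 0 <= phi_ k t <= 1) ->
  (forall t, phi_ k t @[k --> \oo] --> phi t) ->
  cint f (phi_ k) u @[k --> \oo] --> cint f phi u.
Proof.
move=> mf f0 fi mphi phi01 cphi.
have phi'01 t : 0 <= phi t <= 1.
  have cv : cvgn (phi_^~ t) by apply/cvg_ex; exists (phi t).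
  rewrite -(cvg_lim _ (cphi t))//; apply/andP; split.
    by apply: limr_ge => //; apply: nearW => k; have /andP[] := phi01 k t.
  by apply: limr_le => //; apply: nearW => k; have /andP[] := phi01 k t.
have mphi' : measurable_fun setT phi by apply: (measurable_fun_cvg mphi) => t _; exact: cphi.
have md : measurable_fun setT (fun x : V n => dotp x u) by exact: measurable_dotpl.
suff : ((cint f (phi_ k) u)%:E @[k --> \oo] --> (cint f phi u)%:E)%E by move/fine_cvg.
rewrite (cintE mf f0 fi u mphi' phi'01).
under eq_cvg do rewrite (cintE mf f0 fi u (mphi _) (phi01 _)).
apply: (@real_dominated_cvg R _ (V n) (mun R n) (fun k x => f x * phi_ k (dotp x u)) _ f).
- by move=> k; apply: measurable_funM => //; apply: measurableT_comp.
- by [].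
- move=> k x; have /andP[h0 h1] := phi01 k (dotp x u).
  by rewrite ger0_norm ?mulr_ge0// ler_piMr.
- by [].
- by move=> x; apply: cvgM; [exact: cvg_cst|exact: cphi].
Qed.

Lemma cint_le n (f : V n -> R) (phi : R -> R) (u : V n) :
  measurable_fun setT f -> (forall x, 0 <= f x) -> (\int[mun R n]_x (f x)%:E < +oo)%E ->
  measurable_fun setT phi -> (forall t, 0 <= phi t <= 1) ->
  cint f phi u <= fine (\int[mun R n]_x (f x)%:E)%E.
Proof.
move=> mf f0 fi mphi phi01.
have md : measurable_fun setT (fun x : V n => dotp x u) by exact: measurable_dotpl.
have fi0 : (0 <= \int[mun R n]_x (f x)%:E)%E by apply: integral_ge0 => x _; rewrite lee_fin.
rewrite -lee_fin (cintE mf f0 fi u mphi phi01) fineK ?ge0_fin_numE//.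
apply: ge0_le_integral => //.
- by move=> x _; rewrite lee_fin mulr_ge0//; have /andP[] := phi01 (dotp x u).
- by apply/measurable_EFinP/measurable_funM => //; apply: measurableT_comp.
- exact/measurable_EFinP.
- by move=> x _; rewrite lee_fin ler_piMr//; have /andP[] := phi01 (dotp x u).
Qed.

Definition jfun n N (de : R) (f : V n -> R) (phi : R -> R) : \bar R :=
  (\int[mun R n]_u (gw de u * cint f phi u ^+ N)%:E)%E.

Lemma jfun_cvg n N de (f : V n -> R) (phi_ : nat -> R -> R) (phi : R -> R) : 0 < de ->
  measurable_fun setT f -> (forall x, 0 <= f x) -> (\int[mun R n]_x (f x)%:E < +oo)%E ->
  (forall k, measurable_fun setT (phi_ k)) -> (forall k t, 0 <= phi_ k t <= 1) ->
  (forall t, phi_ k t @[k --> \oo] --> phi t) ->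
  jfun N de f (phi_ k) @[k --> \oo] --> jfun N de f phi.
Proof.
move=> de0 mf f0 fi mphi phi01 cphi.
pose M := fine (\int[mun R n]_x (f x)%:E)%E.
have M0 : 0 <= M by apply: fine_ge0; apply: integral_ge0 => x _; rewrite lee_fin.
have c0 k u : 0 <= cint f (phi_ k) u.
  by apply: cint_ge0 => // t; have /andP[] := phi01 k t.
apply: (@real_dominated_cvg R _ (V n) (mun R n) (fun k u => gw de u * cint f (phi_ k) u ^+ N) _
  (fun u => M ^+ N * gw de u)).
- move=> k; apply: measurable_funM; first exact: measurable_gw.
  by apply: measurable_funX; apply: measurable_cint => // t; have /andP[] := phi01 k t.
- by apply: measurable_funM => //; exact: measurable_gw.
- move=> k u; rewrite ger0_norm ?mulr_ge0 ?exprn_ge0 ?gw_ge0// mulrC ler_wpM2r ?gw_ge0//.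
  by apply: lerXn2r; rewrite ?nnegrE//; exact: cint_le.
- under eq_integral do rewrite EFinM.
  rewrite ge0_integralZl//; last 3 first.
  + by apply/measurable_EFinP; exact: measurable_gw.
  + by move=> u _; rewrite lee_fin gw_ge0.
  + by rewrite lee_fin exprn_ge0.
  by apply: lte_mul_pinfty; rewrite ?lee_fin ?exprn_ge0//; exact: gw_fin.
- move=> u; apply: cvgM; first exact: cvg_cst.
  have h : cint f (phi_ k) u @[k --> \oo] --> cint f phi u by exact: cint_cvg.
  exact: (cvg_comp _ _ h (@exprn_continuous R N (cint f phi u))).
Qed.

Section closure.
Variables (m N : nat) (de : R) (f g : V m.+1 -> R).
Hypothesis de0 : 0 < de.
Local Notation mu := (mun R m.+1).
Hypotheses (mf : measurable_fun setT f) (f0 : forall x, 0 <= f x).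
Hypotheses (mg : measurable_fun setT g) (g0 : forall x, 0 <= g x).
Hypothesis fi : (\int[mu]_x (f x)%:E < +oo)%E.
Hypothesis gi : (\int[mu]_x (g x)%:E < +oo)%E.
Hypothesis fg : forall t, layer g t = @sqball R m.+1 (brad m (fine (mu (layer f t)))).

(** The bounds on [phi] supply the dominating functions for passing to pointwise limits, both in
    [cint] and in the outer integral. *)
Definition adm (phi : R -> R) :=
  [/\ measurable_fun setT phi, forall t, 0 <= phi t <= 1 & (jfun N de f phi <= jfun N de g phi)%E].

Lemma adm_gmix l : (forall t, gmix l t <= 1) -> adm (gmix l).
Proof.
move=> l1; split; first exact: measurable_gmix.
  by move=> t; rewrite gmix_ge0 l1.
have := gmix_rearr N de0 mf f0 mg g0 fi gi fg l.
have E (h : V m.+1 -> R) u : \prod_(k < N) cint h (gmix l) u = cint h (gmix l) u ^+ N.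
  by rewrite prodr_const card_ord.
by under eq_integral do rewrite E; under [leRHS]eq_integral do rewrite E.
Qed.

Lemma adm_lim (phi_ : nat -> R -> R) (phi : R -> R) : (forall k, adm (phi_ k)) ->
  (forall t, phi_ k t @[k --> \oo] --> phi t) -> adm phi.
Proof.
move=> ha cphi.
have mphi k : measurable_fun setT (phi_ k) by have [] := ha k.
have phi01 k t : 0 <= phi_ k t <= 1 by have [_ /(_ t)] := ha k.
split.
- by apply: (measurable_fun_cvg mphi) => t _; exact: cphi.
- move=> t; have cv : cvgn (phi_^~ t) by apply/cvg_ex; exists (phi t).
  rewrite -(cvg_lim _ (cphi t))//; apply/andP; split.
    by apply: limr_ge => //; apply: nearW => k; have /andP[] := phi01 k t.
  by apply: limr_le => //; apply: nearW => k; have /andP[] := phi01 k t.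
have c1 := jfun_cvg (N := N) de0 mf f0 fi mphi phi01 cphi.
have c2 := jfun_cvg (N := N) de0 mg g0 gi mphi phi01 cphi.
by apply: (lee_cvg c1 c2) => k; have [] := ha k.
Qed.

End closure.
End admissible.

(** * Stable profiles as limits of Gaussian mixtures *)

Section mixture_closure.
Context (R : realType).

Definition ismix (phi : R -> R) := exists l, phi = gmix l.

Lemma ismix_gaussian (c s : R) : 0 <= c -> 0 <= s -> ismix (fun t => c * gaussian s t).
Proof.
move=> c0 s0; exists [:: (c, s)]; apply/funext => t.
by rewrite /gmix big_seq1/= !ger0_norm.
Qed.

Lemma ismix_cst (c : R) : 0 <= c -> ismix (fun=> c).
Proof.
move=> c0; have [l hl] := ismix_gaussian c0 (lexx 0); exists l; rewrite -hl.
by apply/funext => t; rewrite /gaussian mul0r oppr0 expR0 mulr1.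
Qed.

Lemma ismixD (f g : R -> R) : ismix f -> ismix g -> ismix (fun t => f t + g t).
Proof.
by move=> [l ->] [k ->]; exists (l ++ k); apply/funext => t; rewrite /gmix big_cat.
Qed.

Lemma ismixM (f g : R -> R) : ismix f -> ismix g -> ismix (fun t => f t * g t).
Proof.
move=> [l ->] [k ->].
exists [seq (x.1 * y.1, `|x.2| + `|y.2|) | x <- l, y <- k].
apply/funext => t; rewrite /gmix big_allpairs_dep/= mulr_suml; apply: eq_bigr => x _.
rewrite mulr_sumr; apply: eq_bigr => y _.
rewrite normrM (ger0_norm (addr_ge0 _ _))// /gaussian mulrDl opprD expRD.
by rewrite mulrACA.
Qed.

Lemma ismixX (f : R -> R) k : ismix f -> ismix (fun t => f t ^+ k).
Proof.
move=> mf; elim: k => [|k ih].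
  have [l hl] := ismix_cst ler01; exists l; rewrite -hl.
  by apply/funext => t; rewrite expr0.
have [l hl] := ismixM mf ih; exists l; rewrite -hl.
by apply/funext => t; rewrite exprS.
Qed.

Lemma ismix_sum k (f : nat -> R -> R) : (forall i, ismix (f i)) ->
  ismix (fun t => \sum_(0 <= i < k) f i t).
Proof.
move=> mf; elim: k => [|k ih].
  have [l hl] := ismix_cst (lexx 0); exists l; rewrite -hl.
  by apply/funext => t; rewrite big_geq.
have [l hl] := ismixD ih (mf k); exists l; rewrite -hl.
by apply/funext => t; rewrite big_nat_recr.
Qed.

Variable P : (R -> R) -> Prop.
Hypothesis Pmix : forall l, (forall t, gmix l t <= 1) -> P (gmix l).
Hypothesis Plim : forall (phi_ : nat -> R -> R) (phi : R -> R), (forall k, P (phi_ k)) ->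
  (forall t, phi_ k t @[k --> \oo] --> phi t) -> P phi.

                                                                                                      
(** The limit of the partial sums of the exponential series. These are Gaussian mixtures, since
    Gaussians multiply by adding exponents, and the factor [expR (- W)] keeps them below 1. *)
Lemma closure_exp (g : R -> R) (W : R) : ismix g -> (forall t, g t <= W) ->
  P (fun t => expR (g t - W)).
Proof.
move=> mg gW.
have g0 t : 0 <= g t by case: mg => l ->; exact: gmix_ge0.
pose phi K t := \sum_(0 <= i < K) expR (- W) * (i`!%:R^-1 * g t ^+ i).
have phiE K t : phi K t = expR (- W) * series (exp_coeff (g t)) K.
  rewrite /phi -mulr_sumr; congr *%R; apply: eq_bigr => i _.
  by rewrite exp_coeffE.
have cv t := @is_cvg_series_exp_coeff R (g t).
have le K t : series (exp_coeff (g t)) K <= expR (g t).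
  apply: nondecreasing_cvgn_le (cv t) K.
  by apply: nondecreasing_series => i _ _; exact: exp_coeff_ge0.
apply: (Plim (phi_ := phi)) => [K|t].
  have [l hl] : ismix (phi K).
    apply: ismix_sum => i; apply: ismixM; first exact/ismix_cst/expR_ge0.
    by apply: ismixM; [apply: ismix_cst; rewrite invr_ge0|exact: ismixX].
  rewrite hl; apply: Pmix => t; rewrite -hl phiE.
  apply: (@le_trans _ _ (expR (- W) * expR (g t))); first by rewrite ler_wpM2l ?expR_ge0.
  by rewrite -expRD -expR0 ler_expR addrC subr_le0.
rewrite addrC expRD; under eq_cvg do rewrite phiE.
by apply: cvgM; [exact: cvg_cst|exact: cv].
Qed.

(** The exponent is a Gaussian mixture minus its total weight, so [closure_exp] applies. These are
    the exponentials of minus the simplest Bernstein functions of [t^2]. *)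
Lemma closure_bernstein k (w s : nat -> R) : (forall i, 0 <= w i) -> (forall i, 0 <= s i) ->
  P (fun t => expR (- \sum_(0 <= i < k) w i * (1 - gaussian (s i) t))).
Proof.
move=> w0 s0.
have := @closure_exp (fun t => \sum_(0 <= i < k) w i * gaussian (s i) t) (\sum_(0 <= i < k) w i).
set h := (fun t : R => expR (_ - _)).
have -> : h = (fun t => expR (- \sum_(0 <= i < k) w i * (1 - gaussian (s i) t))).
  apply/funext => t; rewrite /h -sumrB -sumrN; congr expR; apply: eq_bigr => i _.
  by rewrite mulrBr mulr1 opprB.
apply; first by apply: ismix_sum => i; exact: ismix_gaussian.
move=> t; apply: ler_sum => i _; rewrite ler_piMr//.
by have /andP[] := gaussian01 t (s0 i).
Qed.

Section power.
Variable q : R.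
Hypothesis q01 : 0 < q < 1.
Let q0 : 0 < q. Proof. by case/andP: q01. Qed.
Let q1 : 0 < 1 - q. Proof. by rewrite subr_gt0; case/andP: q01. Qed.

                                                                                                           
                                                                         
Section dyadic.
Variable h : R.
Hypothesis h0 : 0 < h.

(** Discretises a Bernstein representation: [z^q] is proportional to the integral of
    [(1 - exp(-z s)) s^(-1-q)] over s > 0, which for [s = exp x] is the integral of [tau x z] over
    the line. [term] pairs the indices i and -(i+1), so that one series runs over all multiples of
    [h]. *)
Let tau (x z : R) : R := expR (- (q * x)) * (1 - expR (- (z * expR x))).
Let term z (i : nat) := tau (i%:R * h) z + tau (- (i.+1%:R * h)) z.

Let tau_ge0 x z : 0 <= z -> 0 <= tau x z.
Proof.
move=> z0; rewrite mulr_ge0 ?expR_ge0// subr_ge0 -expR0 ler_expR oppr_le0.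
by rewrite mulr_ge0// expR_ge0.
Qed.

Let tau_homo x z z' : z <= z' -> tau x z <= tau x z'.
Proof.
move=> zz; rewrite ler_wpM2l ?expR_ge0// lerD2l lerN2 ler_expR lerN2.
by rewrite ler_wpM2r ?expR_ge0.
Qed.

Let tau_le1 x z : tau x z <= expR (- (q * x)).
Proof. by rewrite ler_piMr ?expR_ge0// lerBlDr lerDl expR_ge0. Qed.

Let tau_le2 x z : tau x z <= z * expR ((1 - q) * x).
Proof.
have -> : z * expR ((1 - q) * x) = expR (- (q * x)) * (z * expR x).
  by rewrite mulrCA -expRD; congr (_ * expR _); ring.
rewrite ler_wpM2l ?expR_ge0//.
by have := expR_ge1Dx (- (z * expR x)); lra.
Qed.

Let tau_shift x z : tau x (expR h * z) = expR (q * h) * tau (x + h) z.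
Proof.
rewrite /tau mulrA -expRD; congr (expR _ * (1 - expR (- _))); first by ring.
by rewrite mulrC mulrA mulrC -expRD.
Qed.

Let a := expR (- (q * h)).
Let b := expR (- ((1 - q) * h)).

Let geo_lt1 c : 0 < c -> `|expR (- (c * h))| < 1.
Proof. by move=> c0; rewrite ger0_norm ?expR_ge0// expR_lt1 oppr_lt0 mulr_gt0. Qed.

Let tau_up i z : tau (i%:R * h) z <= geometric 1 a i.
Proof.
apply: (le_trans (tau_le1 _ _)); rewrite /geometric/= mul1r /a -expRM_natl.
by rewrite ler_expR; lra.
Qed.

Let tau_down i z : 0 <= z -> tau (- (i%:R * h)) z <= geometric z b i.
Proof.
move=> z0; apply: (le_trans (tau_le2 _ _)); rewrite /geometric/= /b -expRM_natl.
by rewrite ler_wpM2l// ler_expR; lra.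
Qed.

Let tau_up_cvg z : 0 <= z -> tau (i%:R * h) z @[i --> \oo] --> 0.
Proof.
move=> z0; apply: (squeeze_cvgr (f := fun=> 0) (h := geometric 1 a)).
- by apply: nearW => i; rewrite tau_ge0// tau_up.
- exact: cvg_cst.
- by apply: cvg_geometric; exact: geo_lt1.
Qed.

Let tau_down_cvg z : 0 <= z -> tau (- (i%:R * h)) z @[i --> \oo] --> 0.
Proof.
move=> z0; apply: (squeeze_cvgr (f := fun=> 0) (h := geometric z b)).
- by apply: nearW => i; rewrite tau_ge0// tau_down.
- exact: cvg_cst.
- by apply: cvg_geometric; exact: geo_lt1.
Qed.

Let T z := limn (series (term z)).

Let T_cvg z : 0 <= z -> series (term z) i @[i --> \oo] --> T z.
Proof.
move=> z0.
suff : cvgn (series (term z)) by [].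
apply: (@series_le_cvg _ _ (fun i => geometric 1 a i + geometric (z * b) b i)).
- by move=> i; rewrite addr_ge0// tau_ge0.
- by move=> i; rewrite addr_ge0// ?mulr_ge0 ?exprn_ge0// ?expR_ge0.
- move=> i; apply: lerD; first exact: tau_up.
  apply: (le_trans (tau_down i.+1 z0)).
  by rewrite /geometric/= exprS mulrA.
- apply: is_cvg_seriesD; apply: is_cvg_geometric_series; exact: geo_lt1.
Qed.

(** Multiplying [z] by [exp h] moves the two-sided sum by one step. On partial sums this leaves two
    boundary terms, which tend to 0. The exact scaling takes the place of an evaluation of the
    integral. *)
Let T_shift z : 0 <= z -> T (expR h * z) = expR (q * h) * T z.
Proof.
move=> z0.
have z'0 : 0 <= expR h * z by rewrite mulr_ge0// expR_ge0.
have E M : series (term (expR h * z)) M =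
    expR (q * h) * (series (term z) M + (tau (M%:R * h) z - tau (- (M%:R * h)) z)).
  elim: M => [|M ih].
    by rewrite /series/= !big_geq// mul0r oppr0 subrr addr0 mulr0.
  rewrite (seriesSr (term (expR h * z))) (seriesSr (term z)) ih /term.
  rewrite (tau_shift (M%:R * h)) (tau_shift (- _)).
  have -> : M%:R * h + h = M.+1%:R * h by rewrite -natr1; ring.
  have -> : - (M.+1%:R * h) + h = - (M%:R * h) by rewrite -natr1; ring.
  move: (series _ M) (tau _ _) (tau _ _) (tau _ _) (tau _ _) => x1 x2 x3 x4 x5.
  ring.
suff c1 : series (term (expR h * z)) M @[M --> \oo] --> expR (q * h) * T z.
  exact: (cvg_unique _ (T_cvg z'0) c1).
under eq_cvg do rewrite E.
apply: cvgM; first exact: cvg_cst.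
rewrite -[X in _ --> X]addr0.
apply: cvgD; first exact: T_cvg.
rewrite -[X in _ --> X](subrr 0).
by apply: cvgB; [exact: tau_up_cvg|exact: tau_down_cvg].
Qed.

Let T_homo z z' : 0 <= z -> z <= z' -> T z <= T z'.
Proof.
move=> z0 zz; have z'0 := le_trans z0 zz.
apply: (ler_cvg_to (T_cvg z0) (T_cvg z'0)); apply: nearW => M.
by apply: ler_sum => i _; rewrite lerD// tau_homo.
Qed.

Let T1_gt0 : 0 < T 1.
Proof.
apply: (@lt_le_trans _ _ (series (term 1) 1)).
  rewrite /series/= big_nat1 /term mul0r ltr_pwDl ?tau_ge0//.
  by rewrite /tau mulr_gt0 ?expR_gt0// subr_gt0 expR0 mulr1 expR_lt1 oppr_lt0.
have cv : cvgn (series (term 1)) by apply/cvg_ex; exists (T 1); exact: T_cvg.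
apply: nondecreasing_cvgn_le cv 1%N.
by apply: nondecreasing_series => i _ _; rewrite addr_ge0// tau_ge0.
Qed.

Let T_int (k : nat) z : 0 <= z -> T (expR (k%:R * h) * z) = expR (q * (k%:R * h)) * T z.
Proof.
move=> z0; elim: k => [|k ih]; first by rewrite mul0r mulr0 expR0 !mul1r.
have -> : expR (k.+1%:R * h) * z = expR h * (expR (k%:R * h) * z).
  by rewrite mulrA -expRD; congr (expR _ * _); rewrite -natr1; ring.
have z1 : 0 <= expR (k%:R * h) * z by rewrite mulr_ge0 ?expR_ge0.
rewrite (T_shift z1) ih mulrA -expRD; congr (expR _ * _).
by rewrite -natr1; ring.
Qed.

Let T_exp (k : int) : T (expR (k%:~R * h)) = expR (q * (k%:~R * h)) * T 1.
Proof.
case: k => k; first by have := T_int k ler01; rewrite mulr1.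
rewrite NegzE mulrNz.
have e0 : 0 <= expR (- k.+1%:~R * h) by exact: expR_ge0.
have := T_int k.+1 e0.
rewrite -expRD (_ : _ + _ = 0) ?expR0; last by rewrite -pmulrn; ring.
move=> ->; rewrite mulrA -expRD (_ : _ + _ = 0) ?expR0 ?mul1r//.
by rewrite -pmulrn; ring.
Qed.

Let ratio z := T z / T 1.

(** On the grid [z = exp (k h)] the ratio is exactly [z^q] ([T_exp]); between grid points
    monotonicity costs at most a factor [exp (q h)]. *)
Lemma dyadic_ratio z : 0 < z ->
  expR (- (q * h)) * z `^ q <= ratio z <= expR (q * h) * z `^ q.
Proof.
move=> z0.
pose k := Num.floor (ln z / h).
have /andP[k1 k2] := floor_itv (ln z / h).
rewrite -/k in k1 k2.
have {}k1 : k%:~R * h <= ln z by rewrite -ler_pdivlMr.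
have {}k2 : ln z <= (k + 1)%:~R * h by apply: ltW; rewrite -ltr_pdivrMr.
have zE : z = expR (ln z) by rewrite lnK.
have zq : z `^ q = expR (q * ln z) by rewrite {1}zE -expRM mulrC.
have T1 : T (expR (k%:~R * h)) <= T z by apply: T_homo; rewrite ?expR_ge0// zE ler_expR.
have T2 : T z <= T (expR ((k + 1)%:~R * h)) by apply: T_homo; [exact: ltW|rewrite zE ler_expR].
rewrite T_exp in T1; rewrite T_exp in T2.
rewrite /ratio ler_pdivlMr// ler_pdivrMr// zq -!expRD; apply/andP; split.
  apply: le_trans T1; rewrite ler_wpM2r ?(ltW T1_gt0)// ler_expR.
  move: k2; rewrite intrD mulrDl mul1r => k2; have := ler_wpM2l (ltW q0) k2; lra.
apply: (le_trans T2); rewrite ler_wpM2r ?(ltW T1_gt0)// ler_expR.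
by rewrite intrD mulrDl mul1r mulrDr addrC lerD2l ler_pM2l.
Qed.

Lemma dyadic_ratio0 : ratio 0 = 0.
Proof.
rewrite /ratio /T (_ : series (term 0) = fun=> 0) ?lim_cst ?mul0r//.
apply/funext => M; rewrite /series/= big1// => i _.
by rewrite /term /tau !mul0r oppr0 expR0 subrr !mulr0 addr0.
Qed.

Lemma closure_dyadic (c : R) : 0 <= c -> P (fun t => expR (- (c * ratio (t ^+ 2)))).
Proof.
move=> c0.
apply: (Plim (phi_ := fun M t => expR (- (c / T 1 * series (term (t ^+ 2)) M)))) => [M|t]; last first.
  apply: continuous_cvg; first exact: continuous_expR.
  have -> : c * ratio (t ^+ 2) = c / T 1 * T (t ^+ 2) by rewrite /ratio mulrA mulrAC.
  apply: cvgN; apply: cvgM; first exact: cvg_cst.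
  by apply: T_cvg; exact: sqr_ge0.
pose w (i : nat) := c / T 1 * expR (- (q * (i%:R * h))).
pose w' (i : nat) := c / T 1 * expR (- (q * (- (i.+1%:R * h)))).
(* Even indices carry the terms at [i h], odd ones those at [-(i+1) h]: a partial sum of M paired
   terms is one Bernstein sum of length [M.*2]. *)
pose x (i : nat) := if odd i then w' i./2 else w i./2.
pose y (i : nat) := if odd i then expR (- (i./2.+1%:R * h)) else expR (i./2%:R * h).
have cT : 0 <= c / T 1 by rewrite divr_ge0// ltW.
have x0 i : 0 <= x i by rewrite /x; case: ifP => _; rewrite mulr_ge0// expR_ge0.
have y0 i : 0 <= y i by rewrite /y; case: ifP => _; rewrite expR_ge0.
have := closure_bernstein (M.*2) x0 y0.
suff -> : (fun t => expR (- \sum_(0 <= i < M.*2) x i * (1 - gaussian (y i) t))) =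
    (fun t => expR (- (c / T 1 * series (term (t ^+ 2)) M))) by [].
apply/funext => t; congr (expR (- _)).
elim: M => [|M ih]; first by rewrite /series/= !big_geq// mulr0.
rewrite doubleS !big_nat_recr//= ih (seriesSr (term (t ^+ 2))) [in RHS]mulrDr -addrA.
congr (_ + _).
have xe : x M.*2 = w M by rewrite /x odd_double doubleK.
have ye : y M.*2 = expR (M%:R * h) by rewrite /y odd_double doubleK.
have xo : x M.*2.+1 = w' M by rewrite /x/= odd_double/= uphalf_double.
have yo : y M.*2.+1 = expR (- (M.+1%:R * h)) by rewrite /y/= odd_double/= uphalf_double.
rewrite xe ye xo yo /gaussian [in RHS]mulrDr /w /w' /tau !(mulrC (t ^+ 2)).
by congr (_ + _); exact: esym (mulrA _ _ _).
Qed.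

End dyadic.

(** Let the grid step 1/(k+1) tend to 0 in [dyadic_ratio]; at [t = 0] all the ratios vanish. *)
Lemma closure_power (c : R) : 0 <= c -> P (fun t => expR (- (c * (t ^+ 2) `^ q))).
Proof.
move=> c0.
have h0 (k : nat) : 0 < (k.+1%:R^-1 : R) by rewrite invr_gt0.
apply: (Plim (fun k => closure_dyadic (h0 k) c0)) => t.
apply: continuous_cvg; first exact: continuous_expR.
apply: cvgN; apply: cvgM; first exact: cvg_cst.
have [->|t0] := eqVneq t 0.
  rewrite expr0n/= powR0 ?gt_eqF//; under eq_cvg do rewrite dyadic_ratio0//.
  exact: cvg_cst.
have t20 : 0 < t ^+ 2 by rewrite lt_def sqrf_eq0 t0 sqr_ge0.
have hc : (k.+1%:R^-1 : R) @[k --> \oo] --> 0 by exact: cvg_harmonic.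
have qc : q * k.+1%:R^-1 @[k --> \oo] --> (0 : R).
  by rewrite -(mulr0 q); exact: (cvgM (cvg_cst q) hc).
have nqc : (- q) * k.+1%:R^-1 @[k --> \oo] --> (0 : R).
  by rewrite -(mulr0 (- q)); exact: (cvgM (cvg_cst (- q)) hc).
have lim (v : nat -> R) : v k @[k --> \oo] --> (0 : R) ->
    expR (v k) * (t ^+ 2) `^ q @[k --> \oo] --> (t ^+ 2) `^ q.
  move=> v0; have := cvgM (continuous_cvg _ (@continuous_expR R 0) v0) (cvg_cst ((t ^+ 2) `^ q)).
  by rewrite expR0 mul1r; apply.
have ec := lim _ qc; have ec' := lim _ nqc.
apply: squeeze_cvgr ec' ec; apply: nearW => k.
by rewrite mulNr; exact: dyadic_ratio.
Qed.

End power.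

Lemma closure_stable (c p : R) : 0 <= c -> 0 < p < 2 -> P (fun t => expR (- (c * `|t| `^ p))).
Proof.
move=> c0 /andP[p0 p2].
have q01 : 0 < p / 2 < 1 by apply/andP; split; lra.
have := closure_power q01 c0; congr P; apply/funext => t; congr (expR (- (c * _))).
rewrite -real_normK ?num_real// -powR_mulrn// -powRrM; congr powR.
by rewrite mulrC divfK.
Qed.

End mixture_closure.

                                   

(** * Removing the Gaussian weight, and the limit of large samples *)

Section nexp.
Context (R : realType).

(** [exp (- x)] with value 0 at infinity, because the p-th moment of a density may be infinite. *)
Definition nexp (x : \bar R) : R := if x == +oo%E then 0 else expR (- fine x).

Lemma nexpE (r : R) : nexp r%:E = expR (- r). Proof. by []. Qed.

Lemma nexp_ge0 x : 0 <= nexp x.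
Proof. by rewrite /nexp; case: ifP => // _; exact: expR_ge0. Qed.

Lemma measurable_nexp d (T : measurableType d) (h : T -> \bar R) :
  measurable_fun setT h -> measurable_fun setT (fun u => nexp (h u)).
Proof.
move=> mh; rewrite /nexp; apply: measurable_fun_ifT => //.
- apply: (@measurable_fun_eqe _ _ _ _ h (fun=> +oo%E)) => //.
- apply: measurableT_comp => //; apply: measurableT_comp => //.
  exact: measurableT_comp.
Qed.

Lemma nexp_cvg (a : nat -> R) (x : \bar R) : (0 <= x)%E ->
  (a k)%:E @[k --> \oo] --> x -> expR (- a k) @[k --> \oo] --> nexp x.
Proof.
case: x => [r| |] // _ h; last first.
  rewrite /nexp eqxx; apply: (cvg_comp _ _ _ (@cvgr_expR R)).
  exact/cvgeryP.
rewrite nexpE; apply: continuous_cvg; first exact: continuous_expR.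
by apply: cvgN; exact: (fine_cvg h).
Qed.

End nexp.

Section gauss_removal.
Context (R : realType).
Local Notation V n := (fvec (measurableTypeR R) 'I_n).

Lemma gw_cvg n (h : V n -> R) : measurable_fun setT h -> (forall u, 0 <= h u) ->
  (\int[mun R n]_u (gw k.+1%:R^-1 u * h u)%:E @[k --> \oo] --> \int[mun R n]_u (h u)%:E)%E.
Proof.
move=> mh h0.
pose F k (u : V n) := (gw k.+1%:R^-1 u * h u)%:E.
have c u : F k u @[k --> \oo] --> (h u)%:E.
  apply: cvg_EFin; first exact: nearW.
  have c1 : - (k.+1%:R^-1 * dotp u u) @[k --> \oo] --> - (0 * dotp u u).
    by apply: cvgN; apply: cvgM; [exact: cvg_harmonic|exact: cvg_cst].
  have c2 : gw k.+1%:R^-1 u @[k --> \oo] --> expR (- (0 * dotp u u)).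
    by apply: continuous_cvg c1; exact: continuous_expR.
  have : gw k.+1%:R^-1 u * h u @[k --> \oo] --> expR (- (0 * dotp u u)) * h u.
    by apply: cvgM; [exact: c2|exact: cvg_cst].
  by rewrite mul0r oppr0 expR0 mul1r.
have -> : (\int[mun R n]_u (h u)%:E = \int[mun R n]_u limn (F^~ u))%E.
  by apply: eq_integral => u _; rewrite (cvg_lim _ (c u)).
apply: (@cvg_monotone_convergence _ _ _ (mun R n) setT measurableT F).
- by move=> k; apply/measurable_EFinP/measurable_funM => //; exact: measurable_gw.
- by move=> k u _; rewrite lee_fin mulr_ge0// gw_ge0.
- move=> u _ i j ij; rewrite lee_fin ler_wpM2r// ler_expR lerN2 ler_wpM2r ?dotp_ge0//.
  by rewrite lef_pV2 ?posrE// ler_nat.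
Qed.

Lemma gw_le n (h h' : V n -> R) : measurable_fun setT h -> (forall u, 0 <= h u) ->
  measurable_fun setT h' -> (forall u, 0 <= h' u) ->
  (forall de : R, (0 < de)%R -> \int[mun R n]_u (gw de u * h u)%:E <= \int[mun R n]_u (gw de u * h' u)%:E)%E ->
  (\int[mun R n]_u (h u)%:E <= \int[mun R n]_u (h' u)%:E)%E.
Proof.
move=> mh h0 mh' h0' H; apply: (lee_cvg (gw_cvg mh h0) (gw_cvg mh' h0')) => k.
by apply: H; rewrite invr_gt0.
Qed.

End gauss_removal.

Section stable.
Context (R : realType).
Local Notation mR := (measurableTypeR R).
Local Notation V n := (fvec (measurableTypeR R) 'I_n).
Variables (m : nat) (f g : V m.+1 -> R) (p : R).
Hypothesis p02 : 0 < p < 2.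
Local Notation mu := (mun R m.+1).
Hypotheses (mf : measurable_fun setT f) (f0 : forall x, 0 <= f x).
Hypotheses (mg : measurable_fun setT g) (g0 : forall x, 0 <= g x).
Hypothesis fi : (\int[mu]_x (f x)%:E = 1)%E.
Hypothesis gi : (\int[mu]_x (g x)%:E = 1)%E.
Hypothesis fg : forall t, layer g t = @sqball R m.+1 (brad m (fine (mu (layer f t)))).

Let fi' : (\int[mu]_x (f x)%:E < +oo)%E. Proof. by rewrite fi ltry. Qed.
Let gi' : (\int[mu]_x (g x)%:E < +oo)%E. Proof. by rewrite gi ltry. Qed.

Definition stable (c t : R) : R := expR (- (c * `|t| `^ p)).

Lemma stable01 (c t : R) : 0 <= c -> 0 <= stable c t <= 1.
Proof.
move=> c0; rewrite expR_ge0/= -expR0 ler_expR oppr_le0 mulr_ge0//.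
Qed.

Lemma measurable_stable (c : R) : measurable_fun setT (stable c).
Proof.
apply: measurableT_comp => //; apply: measurableT_comp => //; apply: measurable_funM => //.
apply: (@measurableT_comp _ _ _ _ _ _ (fun x : R => x `^ p)); first exact: measurable_powR.
exact: normr_measurable.
Qed.

Lemma jfun_stable N (c de : R) : 0 <= c -> 0 < de ->
  (jfun N de f (stable c) <= jfun N de g (stable c))%E.
Proof.
move=> c0 de0.
have := @closure_stable R (adm N de f g) (adm_gmix N de0 mf f0 mg g0 fi' gi' fg)
  (adm_lim de0 mf f0 mg g0 fi' gi') c p c0 p02.
by case.
Qed.

Let s0 c t : 0 <= c -> 0 <= stable c t. Proof. by move=> /(stable01 t)/andP[]. Qed.

Lemma stable_rearr N (c : R) : 0 <= c ->
  (\int[mu]_u (cint f (stable c) u ^+ N)%:E <= \int[mu]_u (cint g (stable c) u ^+ N)%:E)%E.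
Proof.
move=> c0; apply: gw_le.
- by apply: measurable_funX; apply: measurable_cint => //; [exact: measurable_stable|move=> t; exact: s0].
- by move=> u; apply: exprn_ge0; apply: cint_ge0 => // t; exact: s0.
- by apply: measurable_funX; apply: measurable_cint => //; [exact: measurable_stable|move=> t; exact: s0].
- by move=> u; apply: exprn_ge0; apply: cint_ge0 => // t; exact: s0.
- by move=> de de0; exact: jfun_stable.
Qed.

Definition pmoment (h : V m.+1 -> R) (u : V m.+1) : \bar R :=
  (\int[mu]_x (`|dotp x u| `^ p * h x)%:E)%E.

Lemma measurable_pmoment_fun (h : V m.+1 -> R) (u : V m.+1) : measurable_fun setT h ->
  measurable_fun setT (fun x : V m.+1 => `|dotp x u| `^ p * h x).
Proof.
move=> mh; apply: measurable_funM => //.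
apply: (@measurableT_comp _ _ _ _ _ _ (fun x : R => x `^ p)); first exact: measurable_powR.
by apply: measurableT_comp => //; exact: measurable_dotpl.
Qed.

Lemma pmoment_ge0 (h : V m.+1 -> R) u : (forall x, 0 <= h x) -> (0 <= pmoment h u)%E.
Proof. by move=> h0; apply: integral_ge0 => x _; rewrite lee_fin mulr_ge0// powR_ge0. Qed.

Lemma measurable_pmoment (h : V m.+1 -> R) : measurable_fun setT h -> (forall x, 0 <= h x) ->
  measurable_fun setT (pmoment h).
Proof.
move=> mh h0.
apply: (@measurable_fun_fubini_tonelli_G _ _ _ _ _ mu
  (fun z : V m.+1 * V m.+1 => (`|dotp z.1 z.2| `^ p * h z.1)%:E)).
  apply/measurable_EFinP/measurable_funM; last by apply: measurableT_comp => //; exact: measurable_fst.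
  apply: (@measurableT_comp _ _ _ _ _ _ (fun x : R => x `^ p)); first exact: measurable_powR.
  by apply: measurableT_comp => //; exact: measurable_dotp.
by move=> z; rewrite lee_fin mulr_ge0// powR_ge0.
Qed.

(** Jensen's inequality for the probability density [f]: the tangent line of the exponential at the
    mean exponent is integrated. An infinite moment makes the left side 0. *)
Lemma jensen_nexp N u : (0 < N)%N -> nexp (pmoment f u) <= cint f (stable N%:R^-1) u ^+ N.
Proof.
move=> N0; have c0 : 0 <= cint f (stable N%:R^-1) u.
  by apply: cint_ge0 => // t; apply: s0; rewrite invr_ge0.
have N0' : 0 < N%:R :> R by rewrite ltr0n.
have M0 := pmoment_ge0 u f0.
have [M|] := ltP (pmoment f u) +oo%E; last first.
  by rewrite leye_eq => /eqP ->; rewrite /nexp eqxx exprn_ge0.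
have ME : pmoment f u = (fine (pmoment f u))%:E by rewrite fineK// ge0_fin_numE.
set A := fine _ in ME; rewrite ME nexpE.
have A0 : 0 <= A by exact: fine_ge0.
pose a := A / N%:R.
have a0 : 0 <= a by rewrite divr_ge0// ltW.
have -> : expR (- A) = expR (- a) ^+ N.
  by rewrite -expRM_natl; congr expR; rewrite mulrN /a mulrCA divff ?mulr1// gt_eqF.
apply: lerXn2r; rewrite ?nnegrE ?expR_ge0//.
(* The tangent bound [exp(-a) (1 + a) <= exp(-y/N) + exp(-a) y/N] integrated against [f], arranged
   without subtraction so that nonnegative integrals suffice. *)
suff : ((expR (- a) * (1 + a))%:E <= (cint f (stable N%:R^-1) u)%:E + (expR (- a) * a)%:E)%E.
  by rewrite -EFinD lee_fin; lra.
rewrite (cintE mf f0 fi' u (measurable_stable _) (fun t => stable01 t _)); last by rewrite invr_ge0.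
pose b := expR (- a) / N%:R.
have b0 : 0 <= b by rewrite divr_ge0 ?expR_ge0// ltW.
have e1 : 0 <= expR (- a) * (1 + a) by rewrite mulr_ge0 ?expR_ge0// addr_ge0.
have -> : ((expR (- a) * a)%:E = \int[mu]_x (b * (`|dotp x u| `^ p * f x))%:E)%E.
  under eq_integral do rewrite EFinM.
  rewrite ge0_integralZl//; last 2 first.
  - by apply/measurable_EFinP; exact: measurable_pmoment_fun.
  - by move=> x _; rewrite lee_fin mulr_ge0// powR_ge0.
  by rewrite -/(pmoment f u) ME -EFinM; congr EFin; rewrite /b /a; ring.
have -> : ((expR (- a) * (1 + a))%:E = \int[mu]_x (expR (- a) * (1 + a) * f x)%:E)%E.
  under eq_integral do rewrite EFinM.
  rewrite ge0_integralZl//; last 2 first.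
  - exact/measurable_EFinP.
  - by move=> x _; rewrite lee_fin.
  by rewrite fi mule1.
have ms : measurable_fun setT (fun x : V m.+1 => f x * stable N%:R^-1 (dotp x u)).
  apply: measurable_funM => //; apply: measurableT_comp; first exact: measurable_stable.
  exact: measurable_dotpl.
have mY := measurable_pmoment_fun u mf.
rewrite -ge0_integralD//; last 4 first.
- by move=> x _; rewrite lee_fin mulr_ge0// expR_ge0.
- exact/measurable_EFinP.
- by move=> x _; rewrite lee_fin !mulr_ge0// powR_ge0.
- by apply/measurable_EFinP; apply: measurable_funM.
apply: ge0_le_integral => //.
- by move=> x _; rewrite lee_fin mulr_ge0.
- by apply/measurable_EFinP; apply: measurable_funM.
- by apply: emeasurable_funD; apply/measurable_EFinP => //; apply: measurable_funM.
move=> x _; rewrite -EFinD lee_fin.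
set y := `|_| `^ p.
have -> : f x * stable N%:R^-1 (dotp x u) + b * (y * f x) =
  (stable N%:R^-1 (dotp x u) + b * y) * f x by ring.
rewrite ler_wpM2r//.
have -> : stable N%:R^-1 (dotp x u) = expR (- a) * expR (a - y / N%:R).
  by rewrite -expRD /stable -/y; congr expR; ring.
have -> : expR (- a) * expR (a - y / N%:R) + b * y =
  expR (- a) * (expR (a - y / N%:R) + y / N%:R) by rewrite /b; ring.
rewrite ler_wpM2l ?expR_ge0//.
by have := expR_ge1Dx (a - y / N%:R); lra.
Qed.

                                                                                                            
Let N2 k : R := (2 ^ k)%:R.
Let N2_gt0 k : 0 < N2 k. Proof. by rewrite ltr0n expn_gt0. Qed.
(** A bounded approximation of [y], increasing to it with k. Along N = 2^k monotonicity reduces to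
    [0 <= (1 - e)^2]. *)
Let em k (y : R) := N2 k * (1 - expR (- (y / N2 k))).

Let em_ge0 k y : 0 <= y -> 0 <= em k y.
Proof.
move=> y0; rewrite mulr_ge0 ?(ltW (N2_gt0 k))// subr_ge0 -expR0 ler_expR oppr_le0.
by rewrite divr_ge0// ltW.
Qed.

Let em_homo y : {homo em ^~ y : i j / (i <= j)%N >-> i <= j}.
Proof.
apply/nondecreasing_seqP => k; rewrite /em.
have -> : N2 k.+1 = 2 * N2 k by rewrite /N2 expnS natrM.
have -> : expR (- (y / N2 k)) = expR (- (y / (2 * N2 k))) ^+ 2.
  by rewrite -expRM_natl; congr expR; field; rewrite gt_eqF.
set e := expR _.
have -> : 2 * N2 k * (1 - e) = N2 k * (2 * (1 - e)) by ring.
rewrite ler_wpM2l ?(ltW (N2_gt0 k))// -subr_ge0.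
have -> : 2 * (1 - e) - (1 - e ^+ 2) = (1 - e) ^+ 2 by ring.
exact: sqr_ge0.
Qed.

Let em_cvg y : 0 <= y -> em k y @[k --> \oo] --> y.
Proof.
move=> y0.
have up k : em k y <= y.
  have h := expR_ge1Dx (- (y / N2 k)).
  have yE : N2 k * (y / N2 k) = y by rewrite mulrCA divff ?mulr1// gt_eqF.
  by rewrite /em -[leRHS]yE ler_wpM2l ?(ltW (N2_gt0 k))//; lra.
have lo k : y - y ^+ 2 / N2 k <= em k y.
  set x := y / N2 k.
  have x0 : 0 <= x by rewrite divr_ge0// ltW.
  have e1 : 1 + x <= expR x by exact: expR_ge1Dx.
  have e2 : expR (- x) * (1 + x) <= 1.
    by rewrite -[leRHS](expRxMexpNx_1 x) [leRHS]mulrC ler_wpM2l ?expR_ge0.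
  have -> : y - y ^+ 2 / N2 k = N2 k * (x - x ^+ 2).
    by rewrite /x; field; rewrite gt_eqF.
  rewrite /em -/x ler_wpM2l ?(ltW (N2_gt0 k))//.
  have x1 : 0 < 1 + x by rewrite ltr_pwDl.
  have x3 : 0 <= x ^+ 3 by rewrite exprn_ge0.
  rewrite -subr_ge0 -(pmulr_lge0 _ x1).
  have -> : (1 - expR (- x) - (x - x ^+ 2)) * (1 + x) = (1 - expR (- x) * (1 + x)) + x ^+ 3 by ring.
  by rewrite addr_ge0// subr_ge0.
apply: (squeeze_cvgr (f := fun k => y - y ^+ 2 / N2 k) (h := fun=> y)).
- by apply: nearW => k; rewrite lo up.
- have c0 : y ^+ 2 / N2 k @[k --> \oo] --> 0.
    have := @cvg_geometric R (y ^+ 2) (2^-1).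
    under eq_cvg do rewrite /geometric/= exprVn -natrX.
    by apply; rewrite ger0_norm ?invr_ge0// invf_lt1// ltr1n.
  have : y - y ^+ 2 / N2 k @[k --> \oo] --> y - 0 by apply: cvgB; [exact: cvg_cst|exact: c0].
  by rewrite subr0.
- exact: cvg_cst.
Qed.

Let hem k (u : V m.+1) : R := fine (\int[mu]_x (em k (`|dotp x u| `^ p) * g x)%:E)%E.

Let y0 x (u : V m.+1) : 0 <= `|dotp x u| `^ p. Proof. exact: powR_ge0. Qed.

Let mem_fun k (u : V m.+1) : measurable_fun setT (fun x : V m.+1 => em k (`|dotp x u| `^ p) * g x).
Proof.
apply: measurable_funM => //; apply: measurable_funM => //; apply: measurable_funB => //.
apply: measurableT_comp => //; apply: measurableT_comp => //; apply: measurable_funM => //.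
apply: (@measurableT_comp _ _ _ _ _ _ (fun x : R => x `^ p)); first exact: measurable_powR.
by apply: measurableT_comp => //; exact: measurable_dotpl.
Qed.

Let hemE k u : (hem k u)%:E = (\int[mu]_x (em k (`|dotp x u| `^ p) * g x)%:E)%E.
Proof.
rewrite fineK// ge0_fin_numE; last first.
  by apply: integral_ge0 => x _; rewrite lee_fin mulr_ge0// em_ge0.
apply: (@le_lt_trans _ _ (\int[mu]_x ((N2 k)%:E * (g x)%:E))%E); last first.
  rewrite ge0_integralZl//; last 3 first.
  - exact/measurable_EFinP.
  - by move=> x _; rewrite lee_fin.
  - by rewrite lee_fin ltW.
  by rewrite gi mule1 ltry.
apply: ge0_le_integral => //.
- by move=> x _; rewrite lee_fin mulr_ge0// em_ge0.
- by apply/measurable_EFinP; exact: mem_fun.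
- by apply: emeasurable_funM => //; apply/measurable_EFinP.
- move=> x _; rewrite -EFinM lee_fin ler_wpM2r// /em.
  by apply: ler_piMr; [exact: ltW|rewrite lerBlDr lerDl expR_ge0].
Qed.

Let hem_cvg u : (hem k u)%:E @[k --> \oo] --> pmoment g u.
Proof.
under eq_cvg do rewrite hemE.
pose F k (x : V m.+1) := (em k (`|dotp x u| `^ p) * g x)%:E.
have c x : F k x @[k --> \oo] --> (`|dotp x u| `^ p * g x)%:E.
  apply: cvg_EFin; first exact: nearW.
  by apply: cvgM; [exact: em_cvg|exact: cvg_cst].
have -> : (pmoment g u = \int[mu]_x limn (F^~ x))%E.
  by apply: eq_integral => x _; rewrite (cvg_lim _ (c x)).
apply: (@cvg_monotone_convergence _ _ _ mu setT measurableT F).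
- by move=> k; apply/measurable_EFinP; exact: mem_fun.
- by move=> k x _; rewrite lee_fin mulr_ge0// em_ge0.
- by move=> x _ i j ij; rewrite lee_fin ler_wpM2r//; exact: em_homo.
Qed.

(** As [g] has mass 1, [cint g] is [1 - hem / N], and [1 + x <= exp x]. *)
Let cint_hem k u : cint g (stable (N2 k)^-1) u ^+ (2 ^ k) <= expR (- hem k u).
Proof.
have c1 : 0 <= (N2 k)^-1 by rewrite invr_ge0 ltW.
have c0 : 0 <= cint g (stable (N2 k)^-1) u by apply: cint_ge0 => // t; apply: s0.
have -> : expR (- hem k u) = expR (- (hem k u / N2 k)) ^+ (2 ^ k).
  by rewrite -expRM_natl; congr expR; rewrite -/(N2 k) mulrN mulrCA divff ?mulr1// gt_eqF.
apply: lerXn2r; rewrite ?nnegrE ?expR_ge0//.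
suff -> : cint g (stable (N2 k)^-1) u = 1 - hem k u / N2 k by exact: expR_ge1Dx.
suff : cint g (stable (N2 k)^-1) u + hem k u / N2 k = 1 by lra.
apply: EFin_inj; rewrite EFinD (cintE mg g0 gi' u (measurable_stable _) (fun t => stable01 t c1)).
rewrite mulrC EFinM hemE -ge0_integralZl//; last 2 first.
- by apply/measurable_EFinP; exact: mem_fun.
- by move=> x _; rewrite lee_fin mulr_ge0// em_ge0.
rewrite -ge0_integralD//; last 4 first.
- by move=> x _; rewrite lee_fin mulr_ge0// expR_ge0.
- apply/measurable_EFinP/measurable_funM => //; apply: measurableT_comp; first exact: measurable_stable.
  exact: measurable_dotpl.
- by move=> x _; apply: mule_ge0; rewrite lee_fin// mulr_ge0// em_ge0.
- by apply: emeasurable_funM => //; apply/measurable_EFinP; exact: mem_fun.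
rewrite -gi; apply: eq_integral => x _; rewrite -EFinM -EFinD; congr EFin.
by rewrite /em /stable (mulrC (N2 k)^-1 (_ `^ _)); field; rewrite gt_eqF.
Qed.

(** For N = 2^k three bounds are chained: [jensen_nexp] for [f], the rearrangement inequality
    [jfun_stable], and [cint_hem] for [g]. Only the last expression depends on k at the two ends of
    the chain; it converges by domination under the Gaussian weight. *)
Theorem moment_rearr : (\int[mu]_u (nexp (pmoment f u))%:E <= \int[mu]_u (nexp (pmoment g u))%:E)%E.
Proof.
have mnf := measurable_nexp (measurable_pmoment mf f0).
have mng := measurable_nexp (measurable_pmoment mg g0).
apply: (gw_le mnf (fun u => nexp_ge0 _) mng (fun u => nexp_ge0 _)).
move=> de de0.
have mhem k : measurable_fun setT (hem k).
  apply: (@measurableT_comp _ _ _ _ _ _ (@fine R)) => //.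
  apply: (@measurable_fun_fubini_tonelli_G _ _ _ _ _ mu
    (fun z : V m.+1 * V m.+1 => (em k (`|dotp z.1 z.2| `^ p) * g z.1)%:E)).
    apply/measurable_EFinP/measurable_funM; last by apply: measurableT_comp => //; exact: measurable_fst.
    apply: measurable_funM => //; apply: measurable_funB => //.
    apply: measurableT_comp => //; apply: measurableT_comp => //; apply: measurable_funM => //.
    apply: (@measurableT_comp _ _ _ _ _ _ (fun x : R => x `^ p)); first exact: measurable_powR.
    by apply: measurableT_comp => //; exact: measurable_dotp.
  by move=> z; rewrite lee_fin mulr_ge0// em_ge0.
have hem0 k u : 0 <= hem k u.
  by apply: fine_ge0; apply: integral_ge0 => x _; rewrite lee_fin mulr_ge0// em_ge0.
have mE k : measurable_fun setT (fun u => expR (- hem k u)).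
  by apply: measurableT_comp => //; apply: measurableT_comp.
have mgw := @measurable_gw R m.+1 de.
have cv : (\int[mu]_u (gw de u * expR (- hem k u))%:E @[k --> \oo] -->
    \int[mu]_u (gw de u * nexp (pmoment g u))%:E)%E.
  apply: (@real_dominated_cvg R _ _ mu _ _ (gw de)) => //.
  - by move=> k; apply: measurable_funM; [exact: mgw|exact: mE].
  - move=> k u; rewrite (ger0_norm (mulr_ge0 (gw_ge0 de u) (expR_ge0 _))).
    apply: ler_piMr; first exact: gw_ge0.
    by rewrite -[leRHS]expR0 ler_expR oppr_le0; exact: hem0.
  - exact: gw_fin.
  - move=> u; apply: cvgM; first exact: cvg_cst.
    by apply: nexp_cvg; [exact: pmoment_ge0|exact: hem_cvg].
apply: (lee_cvg (cvg_cst _) cv) => k.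
have k0 : (0 < 2 ^ k)%N by rewrite expn_gt0.
have c1 : 0 <= (N2 k)^-1 by rewrite invr_ge0 ltW.
have mc (h : V m.+1 -> R) : measurable_fun setT h -> (forall x, 0 <= h x) ->
    measurable_fun setT (fun u => gw de u * cint h (stable (N2 k)^-1) u ^+ (2 ^ k)).
  move=> mh h0; apply: measurable_funM => //; apply: measurable_funX; apply: measurable_cint => //.
    exact: measurable_stable.
  by move=> t; exact: s0.
have pos (h : V m.+1 -> R) u : (forall x, 0 <= h x) ->
    0 <= gw de u * cint h (stable (N2 k)^-1) u ^+ (2 ^ k).
  move=> h0; rewrite mulr_ge0 ?gw_ge0// exprn_ge0//; apply: cint_ge0 => // t; exact: s0.
apply: (@le_trans _ _ (jfun (2 ^ k) de f (stable (N2 k)^-1))).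
  apply: ge0_le_integral; first exact: measurableT.
  - by move=> u _; rewrite lee_fin; apply: mulr_ge0; [exact: gw_ge0|exact: nexp_ge0].
  - by apply/measurable_EFinP/measurable_funM; [exact: mgw|exact: mnf].
  - by apply/measurable_EFinP; exact: mc.
  - move=> u _; rewrite lee_fin; apply: ler_wpM2l; [exact: gw_ge0|exact: jensen_nexp].
apply: (le_trans (jfun_stable _ c1 de0)).
apply: ge0_le_integral; first exact: measurableT.
- by move=> u _; rewrite lee_fin; exact: pos.
- by apply/measurable_EFinP; exact: mc.
- by apply/measurable_EFinP/measurable_funM; [exact: mgw|exact: mE].
- move=> u _; rewrite lee_fin; apply: ler_wpM2l; [exact: gw_ge0|exact: cint_hem].
Qed.

End stable.

                                              

(** * Volumes of star-shaped sets as volumes of sublevel sets *)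

Section shells.
Context (R : realType).

Definition shell (h : R) (k : nat) : set R := [set r | k%:R * h < r <= k.+1%:R * h].

Definition upto (s : R) : set R := [set r | 0 < r <= s].

Lemma measurable_oc (a b : R) : measurable ([set r | a < r <= b] : set (measurableTypeR R)).
Proof.
rewrite (_ : [set r | _] = `]a, b]%classic); first exact: measurable_itv.
by apply/seteqP; split => r; rewrite /= in_itv.
Qed.

Lemma shell_cover (h : R) : 0 < h -> \bigcup_k shell h k = [set r | 0 < r].
Proof.
move=> h0; apply/seteqP; split => [r [k _ /andP[kr _]]|r /= r0].
  by apply: le_lt_trans kr; rewrite mulr_ge0// ltW.
have ex : exists k, r <= k.+1%:R * h.
  exists (Num.truncn (r / h)); rewrite -ler_pdivrMr//.
  exact: ltW (truncnS_gt _).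
have ex' : exists k, (fun k => r <= k.+1%:R * h) k by exact: ex.
case: (ex_minnP ex') => k kr kmin; exists k => //; rewrite /shell/= kr andbT.
case: k kr kmin => [|k] kr kmin; first by rewrite mul0r.
by rewrite ltNge; apply/negP => /kmin; rewrite ltnn.
Qed.

Lemma shell_disj (h : R) (i j : nat) (r : R) : 0 < h -> shell h i r -> shell h j r -> i = j.
Proof.
move=> h0 /andP[i1 i2] /andP[j1 j2]; apply/eqP; rewrite eqn_leq.
have := lt_le_trans i1 j2; have := lt_le_trans j1 i2.
by rewrite !ltr_pM2r// !ltr_nat !ltnS => -> ->.
Qed.

(** When one series is dominated by the shift of another, only the first term is lost; for shells
    that term is of order [h]. *)
Lemma series_shift_le (u v : nat -> \bar R) (c : \bar R) :
  (forall k, 0 <= u k)%E -> (u 0%N <= c)%E -> (forall k, u k.+1 <= v k)%E ->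
  (\sum_(0 <= k <oo) u k <= c + \sum_(0 <= k <oo) v k)%E.
Proof.
move=> u0 uc uv; rewrite nneseries_recl//; apply: leeD => //.
have -> : (\sum_(1 <= k <oo) u k = \sum_(0 <= k <oo) u k.+1)%E.
  rewrite -(nneseries_addn 1 u0).
  by apply: eq_eseriesr => k _; rewrite addn1.
by apply: lee_nneseries => // k _ _.
Qed.

End shells.

Section polar.
Context (R : realType).
Local Notation mR := (measurableTypeR R).
Local Notation V n := (fvec (measurableTypeR R) 'I_n).
Local Notation leb := (@lebesgue_measure R).
Variables (m : nat) (q : R) (M : V m.+1 -> \bar R).
Local Notation mu := (mun R m.+1).
Hypothesis q0 : 0 < q.
Hypothesis mM : measurable_fun setT M.
Hypothesis Mhom : forall c x, 0 < c -> M (vscale c x) = (((c ^+ m.+1) `^ q)%:E * M x)%E.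

(** The n-th power of the norm, n being [m.+1]: volumes of truncated cones are linear in it
    ([cone_ball]). *)
Definition nrm (x : V m.+1) : R := enorm x ^+ m.+1.

Lemma nrm_ge0 x : 0 <= nrm x. Proof. by rewrite exprn_ge0// sqrtr_ge0. Qed.

Lemma nrm_vscale (c : R) x : 0 < c -> nrm (vscale c x) = c ^+ m.+1 * nrm x.
Proof.
move=> c0; rewrite /nrm /enorm dotpZl dotpZr mulrA -expr2 sqrtrM ?sqr_ge0//.
by rewrite sqrtr_sqr gtr0_norm// exprMn.
Qed.

Lemma measurable_nrm : measurable_fun setT nrm.
Proof.
apply: measurable_funX; apply: (@measurableT_comp _ _ _ _ _ _ (@Num.sqrt R)).
  exact: continuous_measurable_fun (@sqrt_continuous R).
exact: measurable_dotpp.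
Qed.

Lemma nrm_preimage (A : set mR) : measurable A -> measurable (nrm @^-1` A).
Proof. by move=> mA; rewrite -[X in measurable X]setTI; exact: measurable_nrm. Qed.

(** The cone of the directions where the n-th power of the radial function exceeds [r]
    ([cone_starE]). The homogeneous form makes its invariance under dilations visible. *)
Definition ccone (r : R) : set (V m.+1) := [set x | (M x < ((nrm x / r) `^ q)%:E)%E].

Lemma measurable_ccone r : measurable (ccone r).
Proof.
apply: measurable_superlevel => //; apply/measurable_EFinP.
apply: (@measurableT_comp _ _ _ _ _ _ (fun x : R => x `^ q)); first exact: measurable_powR.
by apply: measurable_funM => //; exact: measurable_nrm.
Qed.

Definition cvol (A : set (V m.+1)) (I : set R) : \bar R := mu (A `&` nrm @^-1` I).

Lemma nrm_fin (s : R) : (mu (nrm @^-1` upto s) < +oo)%E.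
Proof.
apply: (@le_lt_trans _ _ (mu (@sqball R m.+1 ((s + 1) ^+ 2)))); last exact: sqball_fin.
apply: le_measure; rewrite ?inE.
- by apply: nrm_preimage; exact: measurable_oc.
- exact: measurable_sqball.
move=> x /= /andP[x0 xs]; rewrite /sqball/=.
have s0 : 0 < s := lt_le_trans x0 xs.
have e1 : enorm x < s + 1.
  have [x1|x1] := leP (enorm x) 1; first by apply: (le_lt_trans x1); rewrite ltrDr.
  apply: (@le_lt_trans _ _ s); last by rewrite ltrDl.
  by apply: le_trans xs; rewrite /nrm ler_eXnr// ltW.
have d0 := dotp_ge0 x.
rewrite -(sqr_sqrtr d0) ltr_pXn2r// ?nnegrE ?sqrtr_ge0//.
by rewrite addr_ge0// ltW.
Qed.

Lemma cone_ball (A : set (V m.+1)) (s : R) : measurable A ->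
  (forall c x, 0 < c -> A (vscale c x) = A x) -> 0 < s ->
  cvol A (upto s) = (s%:E * cvol A (upto 1))%E.
Proof.
move=> mA hA s0.
pose c := s `^ m.+1%:R^-1.
have c0 : 0 < c by exact: powR_gt0.
have cs : c ^+ m.+1 = s.
  by rewrite -powR_mulrn ?ltW// -powRrM mulVf ?pnatr_eq0// powRr1// ltW.
have mA' : measurable (A `&` nrm @^-1` upto s).
  by apply: measurableI => //; apply: nrm_preimage; exact: measurable_oc.
have := mun_vscale c0 mA'.
have -> : vscale c @^-1` (A `&` nrm @^-1` upto s) = A `&` nrm @^-1` upto 1.
  have E2 x : (0 < nrm (vscale c x) <= s) = (0 < nrm x <= 1).
    by rewrite (nrm_vscale x c0) cs pmulr_rgt0// -{2}[s]mulr1 ler_pM2l.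
  by apply/seteqP; split => x; rewrite /upto /= (hA c x c0) E2.
rewrite cs /cvol => ->.
by rewrite muleA -EFinM divff ?mul1e// gt_eqF.
Qed.

Lemma cvol_ball r (s : R) : 0 < r -> 0 < s ->
  cvol (ccone r) (upto s) = (s%:E * cvol (ccone r) (upto 1))%E.
Proof.
move=> r0; apply: cone_ball; first exact: measurable_ccone.
move=> c x c0.
have sq0 : 0 < (c ^+ m.+1) `^ q by rewrite powR_gt0// exprn_gt0.
have nr0 : 0 <= nrm x / r by apply: divr_ge0; [exact: nrm_ge0|exact: ltW].
have cm0 : 0 <= c ^+ m.+1 by rewrite exprn_ge0// ltW.
have E : (M (vscale c x) < ((nrm (vscale c x) / r) `^ q)%:E)%E = (M x < ((nrm x / r) `^ q)%:E)%E.
  by rewrite (Mhom x c0) (nrm_vscale x c0) -mulrA (powRM q cm0 nr0) EFinM lte_pmul2l.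
by rewrite /ccone/= E.
Qed.

Let a r : \bar R := cvol (ccone r) (upto 1).

Let a_fin r : (a r < +oo)%E.
Proof.
apply: le_lt_trans (nrm_fin 1); apply: le_measure; rewrite ?inE.
- by apply: measurableI; [exact: measurable_ccone|apply: nrm_preimage; exact: measurable_oc].
- by apply: nrm_preimage; exact: measurable_oc.
- exact: subIsetr.
Qed.

Let mcap r (s t : R) : measurable (ccone r `&` nrm @^-1` [set x | s < x <= t]).
Proof.
by apply: measurableI; [exact: measurable_ccone|apply: nrm_preimage; exact: measurable_oc].
Qed.

Lemma cvol_shell r h k : 0 < r -> 0 < h ->
  cvol (ccone r) (shell h k) = (h%:E * a r)%E.
Proof.
move=> r0 h0; case: k => [|k].
  rewrite -cvol_ball//; congr cvol; apply/seteqP.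
  by split => x; rewrite /shell /upto/= mul0r mul1r.
have s0 : 0 < k.+1%:R * h by rewrite mulr_gt0.
have t0 : 0 < k.+2%:R * h by rewrite mulr_gt0.
have E : cvol (ccone r) (upto (k.+2%:R * h)) =
    (cvol (ccone r) (upto (k.+1%:R * h)) + cvol (ccone r) (shell h k.+1))%E.
  rewrite /cvol -measureU; [|exact: mcap|exact: mcap|]; last first.
    apply/seteqP; split => // x [[_ /andP[_ h1]] [_ /andP[h2 _]]].
    by have := lt_le_trans h2 h1; rewrite ltxx.
  congr (mu _); rewrite -setIUr; congr (_ `&` _); apply/seteqP; split => x.
    rewrite /upto /shell/= => /andP[x0 x1].
    by have [xs|xs] := leP (nrm x) (k.+1%:R * h); [left; rewrite x0|right; rewrite x1].
  rewrite /upto /shell/= => -[/andP[-> xs]|/andP[xs ->]].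
    by apply: (le_trans xs); rewrite ler_wpM2r ?ler_nat// ltW.
  by rewrite (lt_trans s0).
have [A aE] : exists A, a r = A%:E.
  by exists (fine (a r)); rewrite fineK// ge0_fin_numE//; exact: a_fin.
have b0 : (0 <= cvol (ccone r) (shell h k.+1))%E by exact: measure_ge0.
move: E; rewrite (cvol_ball r0 t0) (cvol_ball r0 s0) -/(a r) aE -!EFinM.
case: (cvol _ _) b0 => [b| |] // _ /eqP.
rewrite -EFinD eqe => /eqP E; congr EFin.
have -> : b = (k.+1%:R * h * A + b) - k.+1%:R * h * A by ring.
by rewrite -E -[k.+2%:R]natr1; ring.
Qed.

Let K : set (V m.+1) := [set x | (M x < 1)%E].
Let mK : measurable K. Proof. exact: measurable_superlevel. Qed.

Let p1 : 1 `^ q = 1. Proof. by rewrite powR1. Qed.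

Let K_shell_le h k : 0 < h -> (cvol K (shell h k.+1) <= h%:E * a (k.+1%:R * h))%E.
Proof.
move=> h0; have s0 : 0 < k.+1%:R * h by rewrite mulr_gt0.
rewrite -(cvol_shell k.+1 s0 h0); apply: le_measure; rewrite ?inE.
- by apply: measurableI => //; apply: nrm_preimage; exact: measurable_oc.
- exact: mcap.
move=> x [Kx hx]; split => //; rewrite /ccone/=; apply: (lt_le_trans Kx).
case/andP: hx => hx _; rewrite lee_fin -[X in X <= _]p1.
have h1 : 1 <= nrm x / (k.+1%:R * h) by rewrite ler_pdivlMr// mul1r ltW.
by apply: ge0_ler_powR; rewrite ?nnegrE ?(ltW q0)//; exact: le_trans h1.
Qed.

Let K_shell_ge h k : 0 < h -> (h%:E * a (k.+1%:R * h) <= cvol K (shell h k))%E.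
Proof.
move=> h0; have s0 : 0 < k.+1%:R * h by rewrite mulr_gt0.
rewrite -(cvol_shell k s0 h0); apply: le_measure; rewrite ?inE.
- exact: mcap.
- by apply: measurableI => //; apply: nrm_preimage; exact: measurable_oc.
move=> x [Cx hx]; split => //; apply: (lt_le_trans Cx).
case/andP: hx => _ hx; rewrite lee_fin -[X in _ <= X]p1.
have h1 : nrm x / (k.+1%:R * h) <= 1 by rewrite ler_pdivrMr// mul1r.
by apply: ge0_ler_powR; rewrite ?nnegrE ?(ltW q0)// divr_ge0 ?nrm_ge0// ltW.
Qed.

Let a_homo r s : 0 < r -> r <= s -> (a s <= a r)%E.
Proof.
move=> r0 rs; have s0 := lt_le_trans r0 rs.
apply: le_measure; rewrite ?inE; [exact: mcap|exact: mcap|].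
move=> x [Cx hx]; split => //; apply: (lt_le_trans Cx); rewrite lee_fin.
apply: ge0_ler_powR; rewrite ?nnegrE ?(ltW q0)//.
- by rewrite divr_ge0 ?nrm_ge0// ltW.
- by rewrite divr_ge0 ?nrm_ge0// ltW.
- by rewrite ler_wpM2l ?nrm_ge0// lef_pV2 ?posrE.
Qed.

Let a0 : \bar R := mu (nrm @^-1` upto 1).

Let a_le r : (a r <= a0)%E.
Proof.
apply: le_measure; rewrite ?inE; [exact: mcap| |exact: subIsetr].
by apply: nrm_preimage; exact: measurable_oc.
Qed.

Lemma measurable_cvol : measurable_fun [set r : mR | 0 < r] a.
Proof.
pose S := [set z : mR * V m.+1 | (M z.2 < ((nrm z.2 * z.1 `^ (- 1)) `^ q)%:E)%E] `&` [set z | upto 1 (nrm z.2)].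
pose F (z : mR * V m.+1) : \bar R := (\1_S z)%:E.
have mn2 : measurable_fun setT (fun z : mR * V m.+1 => nrm z.2).
  by apply: measurableT_comp; [exact: measurable_nrm|exact: measurable_snd].
have mS : measurable S.
  apply: measurableI.
    apply: measurable_superlevel; first by apply: measurableT_comp => //; exact: measurable_snd.
    apply/measurable_EFinP.
    apply: (@measurableT_comp _ _ _ _ _ _ (fun x : R => x `^ q)); first exact: measurable_powR.
    apply: measurable_funM => //.
    apply: (@measurableT_comp _ _ _ _ _ _ (fun x : R => x `^ (- 1))); first exact: measurable_powR.
    exact: measurable_fst.
  rewrite -[X in measurable X]setTI; exact: (mn2 measurableT _ (measurable_oc 0 1)).
have mF : measurable_fun setT F by apply/measurable_EFinP; exact: measurable_indic.
apply: (@eq_measurable_fun _ _ _ _ _ (fun r => \int[mu]_x F (r, x))%E).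
  move=> r; rewrite inE/= => r0; symmetry.
  transitivity (\int[mu]_x (\1_(ccone r `&` nrm @^-1` upto 1) x)%:E)%E.
    by rewrite integral_indic ?setIT//; exact: mcap.
  apply: eq_integral => x _; rewrite /F !indicE; congr (nat_of_bool _)%:R%:E.
  by apply/idP/idP; rewrite !inE /S/= powR_inv1// ltW.
apply: (@measurable_funS _ _ _ _ setT) => //.
by apply: measurable_fun_fubini_tonelli_F => // z; rewrite lee_fin.
Qed.

Let ia h k : \bar R := (\int[leb]_(r in shell h k) a r)%E.

Let mshell h k : measurable (shell h k : set mR). Proof. exact: measurable_oc. Qed.

Let leb_shell h k : 0 < h -> leb (shell h k : set mR) = h%:E.
Proof.
move=> h0.
have -> : shell h k = `]k%:R * h, k.+1%:R * h]%classic.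
  by apply/seteqP; split => r; rewrite /= in_itv.
have := @lebesgue_measure_itv R `]k%:R * h, k.+1%:R * h].
rewrite /= lte_fin ltr_pM2r// ltr_nat ltnSn => ->.
by rewrite -EFinD; congr EFin; rewrite -natr1; ring.
Qed.

Let shell_sub h k : 0 < h -> shell h k `<=` [set r : R | 0 < r].
Proof. by move=> h0; rewrite -(shell_cover h0) => r kr; exists k. Qed.

Let ma h k : 0 < h -> measurable_fun (shell h k : set mR) a.
Proof.
move=> h0; apply: measurable_funS measurable_cvol; last exact: shell_sub.
rewrite (_ : [set r : R | 0 < r] = `]0, +oo[%classic); first exact: measurable_itv.
by apply/seteqP; split => r; rewrite /= in_itv/= andbT.
Qed.

Let ishell_cst h k (c : \bar R) : 0 < h -> (\int[leb]_(r in shell h k) c = h%:E * c)%E.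
Proof.
move=> h0; rewrite [LHS](integral_cst leb (mshell h k) c) muleC; congr (_ * _)%E.
exact: leb_shell.
Qed.

Let a_ge0 r : (0 <= a r)%E. Proof. exact: measure_ge0. Qed.

Let ia_ge h k : 0 < h -> (h%:E * a (k.+1%:R * h) <= ia h k)%E.
Proof.
move=> h0; rewrite -(ishell_cst k (a _) h0).
apply: ge0_le_integral; [exact: mshell|by move=> r _; exact: a_ge0|exact: measurable_cst|exact: ma|].
move=> r kr; have r0 := shell_sub h0 kr.
by apply: a_homo; [exact: r0|case/andP: kr].
Qed.

Let ia_le h k : 0 < h -> (ia h k.+1 <= h%:E * a (k.+1%:R * h))%E.
Proof.
move=> h0; rewrite -(ishell_cst k.+1 (a _) h0).
apply: ge0_le_integral; [exact: mshell|by move=> r _; exact: a_ge0|exact: ma|exact: measurable_cst|].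
move=> r kr; apply: a_homo; first by rewrite mulr_gt0.
by case/andP: kr => /ltW.
Qed.

Let ia_le0 h : 0 < h -> (ia h 0 <= h%:E * a0)%E.
Proof.
move=> h0; rewrite -(ishell_cst 0 a0 h0).
apply: ge0_le_integral; [exact: mshell|by move=> r _; exact: a_ge0|exact: ma|exact: measurable_cst|].
by move=> r _; exact: a_le.
Qed.

Let K_le0 h : 0 < h -> (cvol K (shell h 0) <= h%:E * a0)%E.
Proof.
move=> h0.
have -> : (h%:E * a0 = cvol setT (upto h))%E.
  by rewrite (@cone_ball setT h measurableT _ h0)// /cvol setTI.
apply: le_measure; rewrite ?inE.
- by apply: measurableI => //; apply: nrm_preimage; exact: measurable_oc.
- by rewrite setTI; apply: nrm_preimage; exact: measurable_oc.
by move=> x [_]; rewrite /shell /upto/= mul0r mul1r.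
Qed.

                                                                                                  
                                                                                      
(** Polar integration without polar coordinates. Cut by shells of [nrm] of width [h]: the volume of
    [K] in a shell is squeezed between [h * a] at consecutive grid points, and so is the integral of
    the decreasing function [a]. The two series interlace with a shift of one index, hence differ by
    at most [h * a0], and [h] is arbitrary. *)
Theorem cone_volume : mu (K `&` nrm @^-1` [set r : R | 0 < r]) = (\int[leb]_(r in [set r : R | (0 < r)%R]) a r)%E.
Proof.
have E1 h : 0 < h -> mu (K `&` nrm @^-1` [set r : R | 0 < r]) = (\sum_(0 <= k <oo) cvol K (shell h k))%E.
  move=> h0; rewrite -(shell_cover h0) preimage_bigcup setI_bigcupr.
  rewrite measure_semi_bigcup//.
  - by move=> k; apply: measurableI => //; apply: nrm_preimage; exact: measurable_oc.
  - by move=> i j _ _ [x [[_ xi] [_ xj]]]; exact: shell_disj xi xj.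
  - apply: bigcup_measurable => k _.
    by apply: measurableI => //; apply: nrm_preimage; exact: measurable_oc.
have E2 h : 0 < h -> (\int[leb]_(r in [set r : R | (0 < r)%R]) a r = \sum_(0 <= k <oo) ia h k)%E.
  move=> h0; rewrite -(shell_cover h0) ge0_integral_bigcup.
  - by [].
  - by move=> k; exact: mshell.
  - by rewrite (shell_cover h0); exact: measurable_cvol.
  - by move=> r _; exact: a_ge0.
  - by move=> i j _ _ [x [xi xj]]; exact: shell_disj xi xj.
have a0ge : (0 <= a0)%E by exact: measure_ge0.
have a0fin : a0 = (fine a0)%:E by rewrite fineK// (ge0_fin_numE a0ge); exact: nrm_fin.
have a00 : 0 <= fine a0 by exact: fine_ge0.
have small (X Y : \bar R) : (forall h, (0 < h)%R -> X <= h%:E * a0 + Y)%E -> (X <= Y)%E.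
  move=> H; apply/lee_addgt0Pr => e e0.
  have h0 : 0 < e / (fine a0 + 1) by rewrite divr_gt0// ltr_pwDr.
  apply: (le_trans (H _ h0)); rewrite addeC leeD2l// a0fin -EFinM lee_fin.
  by rewrite mulrAC ler_pdivrMr ?ltr_pwDr// ler_wpM2l ?lerDl// ltW.
apply/eqP; rewrite eq_le; apply/andP; split; apply: small => h h0.
  rewrite (E1 h h0) (E2 h h0); apply: series_shift_le.
  - by move=> k; exact: measure_ge0.
  - exact: K_le0.
  - by move=> k; apply: le_trans (ia_ge _ h0); exact: K_shell_le.
rewrite (E1 h h0) (E2 h h0); apply: series_shift_le.
- by move=> k; apply: integral_ge0 => r _; exact: a_ge0.
- exact: ia_le0.
- by move=> k; apply: le_trans (K_shell_ge _ h0); exact: ia_le.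
Qed.

End polar.

Section starvol.
Context (R : realType).
Local Notation mR := (measurableTypeR R).
Local Notation V n := (fvec (measurableTypeR R) 'I_n).
Local Notation leb := (@lebesgue_measure R).
Variable m : nat.
Local Notation mu := (mun R m.+1).

Lemma powR_invl (t q : R) : 0 <= t -> (t^-1) `^ q = (t `^ q)^-1.
Proof. by move=> t0; rewrite -powR_inv1// -powRrM mulN1r powRN. Qed.

Lemma lt_powR (x y q : R) : 0 < q -> 0 <= x -> 0 <= y -> (x `^ q < y `^ q) = (x < y).
Proof.
move=> q0 x0 y0; apply/idP/idP; last by apply: gt0_ltr_powR; rewrite ?nnegrE.
by apply: contraLR; rewrite -!leNgt; apply: ge0_ler_powR; rewrite ?nnegrE// ltW.
Qed.

Lemma omegaE : @omega R 'I_m.+1 = (om R m)%:E.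
Proof.
rewrite /omega (_ : [set x | _] = @sqball R m.+1 1); last first.
  have E (x : 'I_m.+1 -> R) : (enorm x < 1) = (dotp x x < 1).
    by rewrite /enorm -[in LHS](@sqrtr1 R) ltr_sqrt.
  by apply/seteqP; split => x; rewrite /sqball/= E.
rewrite (leb_outer_mun ord0); last exact: measurable_sqball.
by rewrite fineK// ge0_fin_numE// sqball_fin.
Qed.

(** Inverts [rho^(-p) = M] on superlevel sets. The conventions of [rad_of] at [M = 0] and at
    infinity are what keeps the equivalence valid there. *)
Lemma rad_of_gt (p t : R) (M : \bar R) : 0 < p -> 0 < t -> (0 <= M)%E ->
  (t%:E < rad_of p M ^+ m.+1)%E = (M < ((t^-1) `^ (p / m.+1%:R))%:E)%E.
Proof.
move=> p0 t0; set q := p / _.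
have q0 : 0 < q by rewrite divr_gt0.
case: M => [r| |] //; last first.
  by move=> _; rewrite /rad_of expeS mul0e lte_fin ltNge (ltW t0)/= ltNge leey.
rewrite lee_fin le_eqVlt /rad_of => /orP[/eqP <-|r0].
  have oo k : ((+oo : \bar R) ^+ k.+1 = +oo)%E by elim: k => [//|k ih]; rewrite expeS ih mulyy.
  by rewrite eqxx oo ltry lte_fin powR_gt0// invr_gt0.
rewrite gt_eqF// -EFin_expe !lte_fin.
have yE : ((r `^ (- p^-1)) ^+ m.+1) `^ q = r^-1.
  rewrite -powR_mulrn ?powR_ge0// -!powRrM -[RHS]powR_inv1 ?ltW//; congr powR.
  have n0 : (m.+1%:R : R) != 0 by rewrite pnatr_eq0.
  have p0' : p != 0 by rewrite gt_eqF.
  by move: n0; rewrite /q; move: m.+1%:R => n n0; field; rewrite n0 p0'.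
have y0 : 0 <= (r `^ (- p^-1)) ^+ m.+1 by rewrite exprn_ge0// powR_ge0.
rewrite -(lt_powR q0 (ltW t0) y0) yE (powR_invl _ (ltW t0)).
by rewrite -[in RHS](invrK r) ltf_pV2 ?posrE ?invr_gt0 ?powR_gt0.
Qed.

Section homogeneous.
Variables (p : R) (M : V m.+1 -> \bar R).
Hypothesis p0 : 0 < p.
Hypothesis mM : measurable_fun setT M.
Hypothesis M0 : forall x, (0 <= M x)%E.
Hypothesis Mhom : forall c x, 0 < c -> M (vscale c x) = ((c `^ p)%:E * M x)%E.

Let q := p / m.+1%:R.
Let q0 : 0 < q. Proof. by rewrite divr_gt0. Qed.

Let Mhom' c x : 0 < c -> M (vscale c x) = (((c ^+ m.+1) `^ q)%:E * M x)%E.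
Proof.
move=> c0; rewrite Mhom//; congr (_%:E * _)%E.
by rewrite -powR_mulrn ?ltW// -powRrM /q mulrCA divff ?mulr1 ?pnatr_eq0.
Qed.

Lemma cone_starE t : 0 < t ->
  cone ([set u : 'I_m.+1 -> R | (t%:E < rad_of p (M u) ^+ #|'I_m.+1|)%E] `&` @sphere R 'I_m.+1) =
  ccone q M t `&` @nrm R m @^-1` upto 1.
Proof.
move=> t0; rewrite card_ord; apply/seteqP; split => [x [c [u [/andP[c0 c1]]]]|x [Cx /andP[x0 x1]]].
  rewrite /sphere/= => -[tu u1] ->; rewrite -[fun i => _]/(vscale c (u : V m.+1)).
  have nu : nrm (u : V m.+1) = 1 by rewrite /nrm u1 expr1n.
  have cm0 : 0 < c ^+ m.+1 by rewrite exprn_gt0.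
  split; last by rewrite /upto/= nrm_vscale// nu mulr1 cm0/= exprn_ile1// ltW.
  rewrite /ccone/= Mhom'// nrm_vscale// nu mulr1 powRM ?invr_ge0 ?ltW// EFinM.
  by rewrite lte_pmul2l ?lte_fin ?powR_gt0// -rad_of_gt.
have c0 : 0 < enorm x.
  rewrite lt_neqAle sqrtr_ge0 andbT eq_sym; apply/eqP => e0.
  by move: x0; rewrite /nrm e0 expr0n/= ltxx.
have cm0 : 0 < enorm x ^+ m.+1 by rewrite exprn_gt0.
have xE : x = vscale (enorm x) (vscale (enorm x)^-1 x).
  by apply/funext => i; rewrite /vscale mulrA divff ?mul1r// gt_eqF.
exists (enorm x), (vscale (enorm x)^-1 x); split => //.
  rewrite c0/= leNgt; apply/negP => e1; move: x1.
  by rewrite /nrm leNgt exprn_egt1.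
have ie : 0 < (enorm x)^-1 by rewrite invr_gt0.
split.
  rewrite /= rad_of_gt// -/q; move: Cx; rewrite /ccone/= {1}xE Mhom'//.
  rewrite [nrm x]/(enorm x ^+ m.+1) powRM ?invr_ge0 ?ltW// EFinM.
  by rewrite lte_pmul2l// lte_fin powR_gt0.
rewrite /sphere/= /enorm dotpZl dotpZr mulrA -expr2 sqrtrM ?sqr_ge0//.
by rewrite sqrtr_sqr gtr0_norm// -/(enorm x) mulVf// gt_eqF.
Qed.

Lemma nrm0_null : mu (@nrm R m @^-1` [set 0]) = 0%E.
Proof.
have mN : measurable (@nrm R m @^-1` [set 0 : mR]) by apply: nrm_preimage.
apply/eqP; rewrite eq_le measure_ge0 andbT; apply/lee_addgt0Pr => e e0.
rewrite add0e -(mun_brad m (ltW e0)); apply: le_measure; rewrite ?inE//.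
  exact: measurable_sqball.
move=> x; rewrite /sqball/= /nrm => /eqP; rewrite expf_eq0/= sqrtr_eq0 => d0.
apply: (le_lt_trans d0); rewrite /brad exprn_gt0// powR_gt0// divr_gt0//.
exact: om_gt0.
Qed.

(** The spherical integral of the definition is an integral over levels of volumes of truncated
    cones, which [cone_volume] evaluates. The factor [omega] cancels the normalisation of [sigma],
    and the origin is a null set. *)
Lemma starvolE : starvol (fun u : 'I_m.+1 -> R => rad_of p (M u)) = mu [set x | (M x < 1)%E].
Proof.
have o0 := om_gt0 R m.
have mc t : measurable (ccone q M t `&` @nrm R m @^-1` upto 1).
  by apply: measurableI; [exact: measurable_ccone|apply: nrm_preimage; exact: measurable_oc].
rewrite /starvol /sphint omegaE.
transitivity ((om R m)%:E * \int[leb]_(t in [set t : R | (0 < t)%R])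
    (((om R m)^-1)%:E * cvol (ccone q M t) (upto 1)))%E.
  congr (_ * _)%E; apply: eq_integral => t; rewrite inE/= => t0.
  rewrite /sigma cone_starE// omegaE/= muleC; congr (_ * _)%E.
  exact: (leb_outer_mun ord0 (mc t)).
have m0 : measurable ([set r : mR | 0 < r]).
  rewrite (_ : [set r : R | 0 < r] = `]0, +oo[%classic); first exact: measurable_itv.
  by apply/seteqP; split => r; rewrite /= in_itv/= andbT.
rewrite ge0_integralZl; [|exact: m0|exact: measurable_cvol|by move=> t _; exact: measure_ge0|]; last first.
  by rewrite lee_fin invr_ge0 ltW.
rewrite muleA -EFinM divff ?gt_eqF// mul1e -(cone_volume q0 mM Mhom').
have mK : measurable [set x | (M x < 1)%E] by apply: measurable_superlevel.
apply/eqP; rewrite eq_le; apply/andP; split.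
  apply: le_measure; [|by rewrite inE; exact: mK|exact: subIsetl].
  by rewrite inE; apply: measurableI; [exact: mK|exact: nrm_preimage].
pose A : set (V m.+1) := [set x | (M x < 1)%E] `&` @nrm R m @^-1` [set r : R | 0 < r].
pose N : set (V m.+1) := @nrm R m @^-1` [set 0 : mR].
have mN : measurable N by apply: nrm_preimage.
have mA : measurable A by apply: measurableI; [exact: mK|exact: nrm_preimage].
have N0 : mu N = 0%E := nrm0_null.
have e : (mu A + mu N <= mu A)%E by rewrite N0 adde0.
apply: (le_trans _ (le_trans (measureU2 mu mA mN) e)).
apply: le_measure; [by rewrite inE; exact: mK| |].
  rewrite inE; apply: measurableU; last exact: mN.
  exact: mA.
move=> x Kx; have := nrm_ge0 x; rewrite le_eqVlt => /orP[/eqP n0|n0]; first by right.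
by left.
Qed.

End homogeneous.
End starvol.

(** * Exponential integrals and the volume of a sublevel set *)

Section exponential.
Context (R : realType).
Local Notation mR := (measurableTypeR R).
Local Notation leb := (@lebesgue_measure R).

Lemma integral_translate (c : R) (F : mR -> \bar R) :
  measurable_fun setT F -> (forall x, 0 <= F x)%E ->
  (\int[leb]_x F ((x : R) + c)%R = \int[leb]_x F x)%E.
Proof.
move=> mF F0.
have mh : measurable_fun setT (fun x : mR => 1 * x + c : mR).
  by apply: measurable_funD => //; exact: measurable_funM.
transitivity (\int[leb]_x (F \o (fun x : mR => (1 * x + c)%R : mR)) x)%E.
  by apply: eq_integral => x _; rewrite /= mul1r.
rewrite -(@ge0_integral_pushforward _ _ _ _ _ _ mh leb setT F)//.
apply: eq_measure_integral => A mA _.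
by rewrite [LHS](lebesgue_affine c ltr01 mA) invr1 mul1e.
Qed.

Definition etail (r s : R) : R := if r < s then expR (- s) else 0.

Lemma etail_ge0 r s : 0 <= etail r s.
Proof. by rewrite /etail; case: ifP => // _; exact: expR_ge0. Qed.

Lemma measurable_etail r : measurable_fun setT (etail r : mR -> R).
Proof.
apply: measurable_fun_ifT => //; first exact: measurable_fun_ltr.
by apply: measurableT_comp => //; exact: measurableT_comp.
Qed.

Definition epos (a s : R) : R := if 0 < s then expR (- (a * s)) else 0.

Lemma epos_ge0 a s : 0 <= epos a s.
Proof. by rewrite /epos; case: ifP => // _; exact: expR_ge0. Qed.

Lemma measurable_epos a : measurable_fun setT (epos a : mR -> R).
Proof.
apply: measurable_fun_ifT => //; first exact: measurable_fun_ltr.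
by apply: measurableT_comp => //; apply: measurableT_comp => //; exact: measurable_funM.
Qed.

(** Read off from the total mass of the exponential law, whose density differs from [a * epos a]
    only at 0. *)
Lemma integral_exp_pos (a : R) : 0 < a ->
  (\int[leb]_s (epos a s)%:E = (a^-1)%:E)%E.
Proof.
move=> a0.
have := integral_exponential_pdf a0.
have -> : (\int[leb]_s (exponential_pdf a s)%:E =
    a%:E * \int[leb]_s (epos a s)%:E)%E.
  rewrite -ge0_integralZl//; last 3 first.
  - by apply/measurable_EFinP; exact: measurable_epos.
  - by move=> s _; rewrite lee_fin epos_ge0.
  - by rewrite lee_fin ltW.
  apply: ae_eq_integral => //.
  - apply/measurable_EFinP; exact: measurable_exponential_pdf.
  - by apply: emeasurable_funM => //; apply/measurable_EFinP; exact: measurable_epos.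
  exists [set 0]; split => //; first exact: lebesgue_measure_set1.
  move=> s /= /not_implyP[_ h]; apply: contrapT => s0; apply: h.
  rewrite /epos /exponential_pdf patchE mem_setE in_itv/= andbT.
  have [s1|s1] := ltP 0 s; first by rewrite (ltW s1) -EFinM mulNr.
  by rewrite leNgt lt_neqAle s1 andbT -EFinM mulr0; case: eqP.
move=> h; have aV : (1 = (a^-1)%:E * a%:E :> \bar R)%E by rewrite -EFinM mulVf// gt_eqF.
by rewrite -[LHS]mul1e aV -muleA h mule1.
Qed.

Lemma integral_etail r : (\int[leb]_s (etail r s)%:E = (expR (- r))%:E)%E.
Proof.
rewrite -(integral_translate r); last 2 first.
- by apply/measurable_EFinP; exact: measurable_etail.
- by move=> s; rewrite lee_fin etail_ge0.
transitivity (\int[leb]_s ((expR (- r))%:E * (epos 1 s)%:E))%E.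
  apply: eq_integral => s _; rewrite -EFinM /etail /epos ltrDr mul1r; congr EFin.
  by case: ifP => _; rewrite ?mulr0// -expRD; congr expR; ring.
rewrite ge0_integralZl//.
- by rewrite integral_exp_pos// invr1 mule1.
- by apply/measurable_EFinP; exact: measurable_epos.
- by move=> s _; rewrite lee_fin epos_ge0.
Qed.

                                                                       
(** This is [Gamma(w + 1)]. Finiteness and positivity let it be cancelled at the end. *)
Definition gamma_int (w : R) : \bar R := (\int[leb]_s (s `^ w * etail 0 s)%:E)%E.

Let measurable_gi (w : R) : measurable_fun setT (fun s : mR => s `^ w * etail 0 s).
Proof.
apply: measurable_funM; first exact: measurable_powR.
exact: measurable_etail.
Qed.

Lemma gamma_int_fin (w : R) : 0 < w -> (gamma_int w < +oo)%E.
Proof.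
move=> w0.
have h0 : 0 < 2^-1 :> R by rewrite invr_gt0.
apply: (@le_lt_trans _ _ (\int[leb]_s (((2 * w) `^ w)%:E * (epos 2^-1 s)%:E))%E).
  apply: ge0_le_integral => //.
  - by move=> s _; rewrite lee_fin mulr_ge0 ?powR_ge0 ?etail_ge0.
  - by apply/measurable_EFinP; exact: measurable_gi.
  - by apply: emeasurable_funM => //; apply/measurable_EFinP; exact: measurable_epos.
  move=> s _; rewrite -EFinM lee_fin /etail /epos; case: ifP => s0; last by rewrite !mulr0.
  have w2 : 0 < 2 * w by rewrite mulr_gt0.
  (* From [x <= exp x] at [x = s / (2 w)]; raised to the power [w] it gives
     [s^w <= (2 w)^w exp(s / 2)], leaving half of the exponential decay. *)
  have sle : s <= 2 * w * expR (s / (2 * w)).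
    rewrite -ler_pdivrMl// mulrC; apply: le_trans (expR_ge1Dx _).
    by rewrite lerDr.
  have : s `^ w <= (2 * w * expR (s / (2 * w))) `^ w.
    have e0 : 0 <= 2 * w * expR (s / (2 * w)) by rewrite mulr_ge0 ?expR_ge0// ltW.
    by apply: (ge0_ler_powR (ltW w0)) sle; rewrite nnegrE// ltW.
  rewrite powRM ?expR_ge0 ?(ltW w2)// -expRM => h.
  apply: (le_trans (ler_wpM2r (expR_ge0 (- s)) h)).
  rewrite -[leLHS]mulrA; apply: ler_wpM2l; first exact: powR_ge0.
  rewrite -expRD ler_expR.
  have -> : s / (2 * w) * w = s / 2 by field; rewrite gt_eqF.
  lra.
rewrite ge0_integralZl//.
- by rewrite integral_exp_pos// -EFinM ltry.
- by apply/measurable_EFinP; exact: measurable_epos.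
- by move=> s _; rewrite lee_fin epos_ge0.
- by rewrite lee_fin powR_ge0.
Qed.

Lemma gamma_int_gt0 (w : R) : 0 < w -> (0 < gamma_int w)%E.
Proof.
move=> w0; apply: (@lt_le_trans _ _ (\int[leb]_s (etail 1 s)%:E)%E).
  by rewrite integral_etail lte_fin expR_gt0.
apply: ge0_le_integral => //.
- by move=> s _; rewrite lee_fin etail_ge0.
- by apply/measurable_EFinP; exact: measurable_etail.
- by apply/measurable_EFinP; exact: measurable_gi.
move=> s _; rewrite lee_fin /etail; case: ifP => [s1|_]; last first.
  by case: ifP => _; rewrite mulr_ge0 ?powR_ge0 ?expR_ge0.
rewrite (lt_trans ltr01 s1) ler_peMl ?expR_ge0//.
have p1 : 1 `^ w = 1 by rewrite powR1.
rewrite -[X in X <= _]p1; apply: (ge0_ler_powR (ltW w0)) (ltW s1); rewrite nnegrE//.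
exact: ltW (lt_trans ltr01 s1).
Qed.

End exponential.

Section nexp_volume.
Context (R : realType).
Local Notation mR := (measurableTypeR R).
Local Notation V n := (fvec (measurableTypeR R) 'I_n).
Local Notation leb := (@lebesgue_measure R).
Variables (m : nat) (p : R) (M : V m.+1 -> \bar R).
Local Notation mu := (mun R m.+1).
Hypothesis p0 : 0 < p.
Hypothesis mM : measurable_fun setT M.
Hypothesis M0 : forall x, (0 <= M x)%E.
Hypothesis Mhom : forall c x, 0 < c -> M (vscale c x) = ((c `^ p)%:E * M x)%E.

Lemma sublevel_volume (s : R) : 0 < s ->
  mu [set x | (M x < s%:E)%E] = ((s `^ (m.+1%:R / p))%:E * mu [set x | (M x < 1)%E])%E.
Proof.
move=> s0.
pose c := s `^ p^-1.
have c0 : 0 < c by exact: powR_gt0.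
have mA : measurable [set x | (M x < s%:E)%E] by apply: measurable_superlevel.
have := mun_vscale c0 mA.
have -> : vscale c @^-1` [set x | (M x < s%:E)%E] = [set x | (M x < 1)%E].
  have E x : (M (vscale c x) < s%:E)%E = (M x < 1)%E.
    rewrite (Mhom x c0) /c -powRrM mulVf ?gt_eqF// powRr1 ?ltW//.
    by rewrite -{2}[s]mulr1 EFinM lte_pmul2l.
  by apply/seteqP; split => x; rewrite /= E.
have cm : c ^+ m.+1 = s `^ (m.+1%:R / p).
  by rewrite -powR_mulrn ?ltW// -powRrM mulrC.
rewrite -cm => ->.
by rewrite muleA -EFinM divff ?mul1e// gt_eqF// exprn_gt0.
Qed.

(** Write [exp (- M x)] as the integral of [exp (- s)] over [s > M x], exchange the integrals, and
    scale [{M < s}] to [{M < 1}] by homogeneity. Points where [M] is infinite contribute 0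
    throughout. *)
Lemma nexp_volume :
  (\int[mu]_x (nexp (M x))%:E = gamma_int (m.+1%:R / p) * mu [set x | (M x < 1)%E])%E.
Proof.
pose F (z : V m.+1 * mR) : \bar R := (\1_[set z : V m.+1 * mR | (M z.1 < z.2%:E)%E] z * etail 0 z.2)%:E.
have mS : measurable [set z : V m.+1 * mR | (M z.1 < z.2%:E)%E].
  apply: measurable_superlevel; first by apply: measurableT_comp => //; exact: measurable_fst.
  by apply/measurable_EFinP; exact: measurable_snd.
have mF : measurable_fun setT F.
  apply/measurable_EFinP/measurable_funM; first exact: measurable_indic.
  by apply: measurableT_comp; [exact: measurable_etail|exact: measurable_snd].
have F0 z : (0 <= F z)%E by rewrite lee_fin mulr_ge0// etail_ge0.
transitivity (\int[mu]_x \int[leb]_s F (x, s))%E.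
  apply: eq_integral => x _.
  transitivity (\int[leb]_s (if M x == +oo%E then 0 else etail (fine (M x)) s)%:E)%E.
    rewrite /nexp; case: ifP => h; first by rewrite integral0.
    by rewrite integral_etail.
  apply: eq_integral => s _; rewrite /F indicE; congr EFin.
  have := M0 x; case E : (M x) => [r| |] //=.
    rewrite lee_fin => r0; rewrite /etail; have [rs|rs] := ltP r s.
      by rewrite mem_set ?mul1r ?(le_lt_trans r0)//= E lte_fin.
    by rewrite memNset ?mul0r//= E lte_fin => /(le_lt_trans rs); rewrite ltxx.
  by move=> _; rewrite memNset ?mul0r//= E; apply/negP; rewrite -leNgt leey.
rewrite (@fubini_tonelli _ _ _ _ _ mu leb F mF F0).
have mg : measurable_fun setT (fun s : mR => (s `^ (m.+1%:R / p) * etail 0 s)%:E).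
  apply/measurable_EFinP/measurable_funM; first exact: measurable_powR.
  exact: measurable_etail.
have g0 (s : mR) : setT s -> (0 <= (s `^ (m.+1%:R / p) * etail 0 s)%:E)%E.
  by move=> _; rewrite lee_fin mulr_ge0 ?powR_ge0 ?etail_ge0.
rewrite /gamma_int muleC -(ge0_integralZl leb measurableT mg g0 (measure_ge0 mu _)).
apply: eq_integral => s _.
have mA : measurable [set x | (M x < s%:E)%E] by apply: measurable_superlevel.
transitivity (\int[mu]_x ((\1_[set x : V m.+1 | (M x < s%:E)%E] x)%:E * (etail 0 s)%:E))%E.
  apply: eq_integral => x _; rewrite -EFinM /F !indicE.
  suff -> : ((x, s) \in [set z : V m.+1 * mR | (M z.1 < z.2%:E)%E]) =
    (x \in [set x : V m.+1 | (M x < s%:E)%E]) by [].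
  by apply/idP/idP; rewrite !inE.
rewrite ge0_integralZr//; last 2 first.
- by apply/measurable_EFinP; exact: measurable_indic.
- by rewrite lee_fin etail_ge0.
have [s0|s0] := ltP 0 s; last by rewrite /etail ltNge s0/= !(mulr0, mule0).
rewrite EFinM muleA [in RHS](muleC (mu _)) -(sublevel_volume s0); congr (_ * _)%E.
by rewrite integral_indic// setIT.
Qed.

End nexp_volume.

                                            

(** * The symmetric decreasing rearrangement and its layers *)

Section sdr.
Context (R : realType).
Local Notation mR := (measurableTypeR R).
Local Notation V n := (fvec (measurableTypeR R) 'I_n).
Local Notation leb := (@lebesgue_measure R).
Variables (m : nat) (g : V m.+1 -> R) (M : R).
Local Notation mu := (mun R m.+1).
Hypotheses (mg : measurable_fun setT g) (g0 : forall x, 0 <= g x).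
Hypothesis gi : (\int[mu]_x (g x)%:E = 1)%E.
Hypothesis gM : mu [set x | M < g x] = 0%E.

Let gi' : (\int[mu]_x (g x)%:E < +oo)%E. Proof. by rewrite gi ltry. Qed.
Let o0 : 0 < om R m. Proof. exact: om_gt0. Qed.

Lemma layer_gt (t : R) : 0 < t -> layer g t = [set x | t < g x].
Proof. by move=> t0; apply/seteqP; split => x; rewrite /layer/= t0. Qed.

Let phi (t : R) : \bar R := mu [set x | t < g x].

Lemma measurable_gt t : measurable [set x | t < g x].
Proof.
rewrite (_ : [set x | _] = [set x | (t%:E < (g x)%:E)%E]); last first.
  by apply/seteqP; split => x; rewrite /= lte_fin.
by apply: measurable_superlevel => //; exact/measurable_EFinP.
Qed.

Let phi_homo s t : s <= t -> (phi t <= phi s)%E.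
Proof.
move=> st; apply: le_measure; rewrite ?inE; [exact: measurable_gt|exact: measurable_gt|].
by move=> x /=; exact: le_lt_trans.
Qed.

(** Right continuity of the distribution function: [{g > t}] is the increasing union of the sets
    [{g > t + 1/(k+1)}]. *)
Let phi_right t (v : \bar R) : (v < phi t)%E -> exists2 t', t < t' & (v < phi t')%E.
Proof.
move=> vt.
pose F (k : nat) := [set x | t + k.+1%:R^-1 < g x].
have mF k : measurable (F k) by exact: measurable_gt.
have UF : \bigcup_k F k = [set x | t < g x].
  apply/seteqP; split => [x [k _]|x /= tx].
    by rewrite /F/=; apply: lt_trans; rewrite ltrDl invr_gt0.
  have d0 : 0 < g x - t by rewrite subr_gt0.
  exists (Num.truncn (g x - t)^-1) => //; rewrite /F/= -ltrBrDl.
  rewrite -[ltRHS]invrK ltf_pV2 ?posrE ?invr_gt0//; exact: truncnS_gt.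
have ndF : nondecreasing_seq F.
  move=> i j ij; apply/subsetPset => x; rewrite /F/=; apply: le_lt_trans.
  by rewrite lerD2l lef_pV2 ?posrE// ler_nat ltnS.
have cv : mu (F k) @[k --> \oo] --> phi t.
  rewrite /phi -UF; apply: nondecreasing_cvg_mu => //; exact: bigcupT_measurable.
have [k kv] : exists k, (v < mu (F k))%E.
  apply: contrapT => /forallNP nv.
  have : (phi t <= v)%E.
    apply: (lee_cvg cv (cvg_cst v)) => k.
    by rewrite leNgt; apply/negP/nv.
  by rewrite leNgt vt.
by exists (t + k.+1%:R^-1) => //; rewrite ltrDl invr_gt0.
Qed.

Lemma ball_rearrE (t : R) (x : V m.+1) :
  ball_rearr [set y | t < g y] x = ((om R m * nrm x)%:E < phi t)%E.
Proof.
rewrite /ball_rearr/= omegaE card_ord -EFinM; congr is_true; congr (_ < _)%E.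
exact: (leb_outer_mun ord0 (measurable_gt t)).
Qed.

(** For fixed [x] the levels counted in [sdr g x] form an interval []0, b[]: it is open on the right
    by [phi_right] and bounded by the essential bound [M]. The integral is therefore [b], and [fine]
    loses nothing. *)
Lemma sdr_gt (t : R) (x : V m.+1) : 0 < t ->
  (t < sdr g x) = ((om R m * nrm x)%:E < phi t)%E.
Proof.
move=> t0; set v := om R m * nrm x.
have v0 : 0 <= v by rewrite mulr_ge0 ?nrm_ge0// ltW.
pose T := [set s : R | 0 < s /\ (v%:E < phi s)%E].
have [mT lebT] : measurable (T : set mR) /\ (t < fine (leb (T : set mR))) = (v%:E < phi t)%E.
  have [[s0 s0T]|T0] := pselect (exists s, T s); last first.
    have -> : T = set0 by apply/seteqP; split => // s Ts; apply: T0; exists s.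
    split => //; rewrite measure0/= ltNge (ltW t0)/=; apply/esym/negP => vt.
    by apply: T0; exists t.
  have TM : ubound T M.
    move=> s [_ vs]; rewrite leNgt; apply/negP => /ltW/phi_homo; rewrite /phi gM => h.
    by have := lt_le_trans vs h; rewrite lte_fin ltNge v0.
  have hT : has_sup T by split; [exists s0|exists M].
  pose b := sup T.
  have TE : T = `]0, b[%classic.
    apply/seteqP; split => s; rewrite /= in_itv/=.
      move=> [s1 vs]; rewrite s1/=; have [t' st vt'] := phi_right vs.
      apply: (lt_le_trans st); apply: ub_le_sup; first exact: hT.2.
      by split => //; exact: lt_trans st.
    move=> /andP[s1 ss]; split => //.
    have d0 : 0 < sup T - s by rewrite subr_gt0.
    have [t' [t'0 vt']] := sup_adherent d0 hT; rewrite subKr => st.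
    by apply: (lt_le_trans vt'); apply: phi_homo; exact: ltW.
  have sT0 : 0 < b.
    by have : T s0 by []; rewrite TE /= in_itv/= => /andP[h1 h2]; exact: lt_trans h1 h2.
  split; first by rewrite TE; exact: measurable_itv.
  have -> : fine (leb (T : set mR)) = b.
    have := @lebesgue_measure_itv R `]0, b[.
    rewrite /= lte_fin sT0 sube0 => h; rewrite TE.
    by transitivity (fine b%:E); [congr fine|].
  apply/idP/idP => h.
    have : T t by rewrite TE/= in_itv/= t0.
    by case.
  have : T t by []; by rewrite TE /= in_itv/= => /andP[].
rewrite -lebT /sdr; congr (_ < fine _).
rewrite integral_mkcond.
transitivity (\int[leb]_s (\1_(T : set mR) s)%:E)%E; last by rewrite integral_indic// setIT.
apply: eq_integral => s _; rewrite patchE.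
have [s0|s0] := boolP (s \in [set t : R | 0 < t]).
  rewrite !indicE; congr (nat_of_bool _)%:R%:E; apply/idP/idP.
    by rewrite !inE ball_rearrE; rewrite inE in s0.
  by rewrite !inE ball_rearrE => -[].
by rewrite indicE memNset// => -[s1 _]; move: s0; rewrite notin_setE.
Qed.

Lemma sdr_ge0 x : 0 <= sdr g x.
Proof. by apply: fine_ge0; apply: integral_ge0 => t _; rewrite lee_fin. Qed.

(** Both sides say that the centred ball through [x] has volume below that of the layer. This
    supplies the hypothesis [fg] of the rearrangement inequalities. *)
Lemma layer_sdr (t : R) : layer (sdr g) t = @sqball R m.+1 (brad m (fine (mu (layer g t)))).
Proof.
have [t0|t0] := ltP 0 t; last first.
  have e (h : V m.+1 -> R) : layer h t = set0.
    by apply/seteqP; split => // x; rewrite /layer/= ltNge t0.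
  rewrite !e measure0/= /brad mul0r powR0 ?invr_eq0 ?pnatr_eq0// expr0n/=.
  by apply/seteqP; split => // x; rewrite /sqball/= ltNge dotp_ge0.
have lf := layer_fin mg g0 gi' t.
rewrite (layer_gt t0) in lf *.
have aE : phi t = (fine (phi t))%:E by rewrite fineK// ge0_fin_numE.
set a := fine (phi t) in aE *.
have a0 : 0 <= a by exact: fine_ge0.
have E (x : V m.+1) : (dotp x x < brad m a) = (om R m * nrm x < a).
  have d0 := dotp_ge0 x.
  have b0 : 0 <= (a / om R m) `^ (m.+1%:R^-1) by exact: powR_ge0.
  have ao : 0 <= a / om R m by rewrite divr_ge0// ltW.
  rewrite -(sqr_sqrtr d0) /brad ltr_pXn2r// ?nnegrE ?sqrtr_ge0// -/(enorm x).
  have -> : enorm x = nrm x `^ m.+1%:R^-1.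
    have e0 : 0 <= enorm x by exact: sqrtr_ge0.
    by rewrite -[nrm x]/(enorm x ^+ m.+1) -(powR_mulrn m.+1 e0) -powRrM mulfV ?pnatr_eq0// powRr1.
  by rewrite lt_powR ?invr_gt0 ?nrm_ge0// ltr_pdivlMr// mulrC.
apply/seteqP; split => x; rewrite /layer /sqball/= t0/= sdr_gt// E aE lte_fin//.
Qed.

Lemma measurable_phi : measurable_fun setT (phi : mR -> \bar R).
Proof.
pose S := [set z : mR * V m.+1 | (z.1%:E < (g z.2)%:E)%E].
have mS : measurable S.
  apply: measurable_superlevel; first by apply/measurable_EFinP; exact: measurable_fst.
  by apply/measurable_EFinP; apply: measurableT_comp => //; exact: measurable_snd.
have -> : phi = (fun t => \int[mu]_x (\1_S (t, x))%:E)%E.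
  apply/funext => t.
  transitivity (\int[mu]_x (\1_[set x | t < g x] x)%:E)%E.
    by rewrite integral_indic ?setIT//; exact: measurable_gt.
  apply: eq_integral => x _; rewrite !indicE.
  by congr (nat_of_bool _)%:R%:E; apply/idP/idP; rewrite !inE /S/= lte_fin.
apply: (@measurable_fun_fubini_tonelli_F _ _ _ _ _ mu (fun z => (\1_S z)%:E)).
  by apply/measurable_EFinP; exact: measurable_indic.
by move=> z; rewrite lee_fin.
Qed.

Lemma measurable_sdr : measurable_fun setT (sdr g : V m.+1 -> R).
Proof.
apply: (@measurableT_comp _ _ _ _ _ _ (@fine R)) => //.
pose S := [set z : mR * V m.+1 | ((fun=> 0) z < z.1%:E)%E] `&`
  [set z : mR * V m.+1 | ((om R m * nrm z.2)%:E < phi z.1)%E].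
have mS : measurable S.
  apply: measurableI; apply: measurable_superlevel => //.
  - by apply/measurable_EFinP; exact: measurable_fst.
  - apply/measurable_EFinP/measurable_funM => //.
    by apply: measurableT_comp; [exact: measurable_nrm|exact: measurable_snd].
  - by apply: (measurableT_comp measurable_phi); exact: measurable_fst.
rewrite (_ : (fun x => _) = (fun x : V m.+1 => \int[leb]_t (\1_S (t, x))%:E)%E); last first.
  apply/funext => x; rewrite integral_mkcond; apply: eq_integral => s _; rewrite patchE.
  have [s0|s0] := boolP (s \in [set t : R | 0 < t]).
    rewrite !indicE; congr (nat_of_bool _)%:R%:E; apply/idP/idP.
      by rewrite !inE ball_rearrE /S/= lte_fin; rewrite inE in s0.
    by rewrite !inE ball_rearrE => -[].
  by rewrite indicE memNset// => -[/=]; rewrite lte_fin => s1 _; move: s0; rewrite notin_setE.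
apply: (@measurable_fun_fubini_tonelli_G _ _ _ _ _ leb (fun z => (\1_S z)%:E)).
  by apply/measurable_EFinP; exact: measurable_indic.
by move=> z; rewrite lee_fin.
Qed.

Lemma integral_sdr : (\int[mu]_x (sdr g x)%:E = 1)%E.
Proof.
have ms : measurable_fun setT (fun x : V m.+1 => (sdr g x)%:E).
  by apply/measurable_EFinP; exact: measurable_sdr.
have s0 (x : V m.+1) : (0 <= (sdr g x)%:E)%E by rewrite lee_fin; exact: sdr_ge0.
have mg' : measurable_fun setT (fun x : V m.+1 => (g x)%:E) by exact/measurable_EFinP.
have g0' (x : V m.+1) : (0 <= (g x)%:E)%E by rewrite lee_fin.
rewrite -gi (layer_cake mu ms s0) (layer_cake mu mg' g0').
apply: eq_integral => t; rewrite inE/= => t0.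
have E (h : V m.+1 -> R) : [set x | (t%:E < (h x)%:E)%E] = layer h t.
  by apply/seteqP; split => x; rewrite /layer/= lte_fin t0.
rewrite !E layer_sdr mun_brad ?fine_ge0// fineK// ge0_fin_numE//.
exact: layer_fin.
Qed.

End sdr.

                                                        

(** * Replacing a Lebesgue measurable density by a Borel one *)

Section hull.
Context (R : realType) (I : finType) (i0 : I).
Local Notation V := (fvec (measurableTypeR R) I).

(** Intersect open covers whose volume exceeds that of [A] by at most 1/(k+1). *)
Lemma leb_hull (A : set V) : (leb_outer A < +oo)%E ->
  exists B : set V, [/\ measurable B, A `<=` B & leb_outer B = leb_outer A].
Proof.
move=> Aoo.
have A0 : (0 <= leb_outer A)%E.
  apply: le_ereal_inf_tmp => _ [a [b [ab _ ->]]]; apply: nneseries_ge0 => k _ _.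
  by rewrite lee_fin boxvol_ge0.
have fA : leb_outer A \is a fin_num by rewrite ge0_fin_numE.
have ex (k : nat) : exists B : set V, [/\ measurable B, A `<=` B &
    (leb_outer B <= leb_outer A + (k.+1%:R^-1)%:E)%E].
  have k0 : 0 < (k.+1%:R^-1 : R) by rewrite invr_gt0.
  have [s [a [b [ab Aab sE]]] hs] := lb_ereal_inf_adherent k0 fA.
  exists (\bigcup_j obox (a j) (b j)); split => //.
    by apply: bigcupT_measurable => j; exact: measurable_obox.
  apply: (@le_trans _ _ s); last exact: ltW.
  by apply: ereal_inf_lbound; exists a, b; split.
have [B hB] := choice ex.
exists (\bigcap_k B k); split.
- by apply: bigcapT_measurable => k; have [] := hB k.
- by move=> x Ax k _; have [_ /(_ x Ax)] := hB k.
apply/eqP; rewrite eq_le; apply/andP; split; last first.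
  by apply: le_leb_outer => x Ax k _; have [_ /(_ x Ax)] := hB k.
apply/lee_addgt0Pr => e e0.
pose k := Num.truncn e^-1.
have ke : k.+1%:R^-1 <= e.
  by rewrite -[leRHS]invrK lef_pV2 ?posrE ?invr_gt0// ltW// truncnS_gt.
have [_ _ hk] := hB k.
apply: (@le_trans _ _ (leb_outer (B k))).
  by apply: le_leb_outer => x; apply.
by apply: (le_trans hk); rewrite leeD2l// lee_fin.
Qed.

Lemma leb_outer_null (Z A B : set V) : measurable Z -> leb_outer Z = 0%E ->
  (forall x, ~ Z x -> A x <-> B x) -> leb_outer A = leb_outer B.
Proof.
move=> mZ Z0 AB.
have cZ := lmeasurable_borel i0 mZ.
have E (X : set V) : leb_outer X = leb_outer (X `&` ~` Z).
  have h : leb_outer X = (leb_outer (X `&` Z) + leb_outer (X `&` ~` Z))%E := cZ X.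
  have n0 : leb_outer (X `&` Z) = 0%E.
    apply/eqP; rewrite eq_le; apply/andP; split.
      by rewrite -Z0; apply: le_leb_outer; exact: subIsetr.
    apply: le_ereal_inf_tmp => _ [a [b [ab _ ->]]]; apply: nneseries_ge0 => k _ _.
    by rewrite lee_fin boxvol_ge0.
  by rewrite h n0 add0e.
rewrite (E A) (E B); congr leb_outer; apply/seteqP; split => x [xA nZ]; split => //; exact/(AB _ nZ).
Qed.

End hull.

Section borel_version.
Context (R : realType).
Local Notation mR := (measurableTypeR R).
Local Notation V n := (fvec (measurableTypeR R) 'I_n).
Variables (m : nat).
Local Notation mu := (mun R m.+1).

Lemma measurable_fun_gt d (T : measurableType d) (g : T -> R) :
  (forall t, measurable [set x | t < g x]) -> measurable_fun setT g.
Proof.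
move=> h; apply: (measurability _ (RGenOInfty.measurableE R)) => _ [_ [t ->] <-].
rewrite setTI (_ : _ @^-1` _ = [set x | t < g x])//.
by apply/seteqP; split => x; rewrite /= in_itv/= andbT.
Qed.

(** Inside a ball outer measures are finite, so the Caratheodory equation can be cancelled: a Borel
    hull of the truncated set exceeds [A] by an outer null set, which itself has a Borel null
    hull. *)
Lemma lmeasurable_piece (A : set (V m.+1)) (k : nat) : lmeasurable A ->
  exists P : set (V m.+1) * set (V m.+1), [/\ measurable P.1, measurable P.2, mu P.2 = 0%E,
    A `&` @sqball R m.+1 k%:R `<=` P.1 & P.1 `<=` A `|` P.2].
Proof.
move=> lA; pose K := @sqball R m.+1 k%:R.
have mK : measurable K by exact: measurable_sqball.
have fin (X : set (V m.+1)) : X `<=` K -> (leb_outer X < +oo)%E.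
  move=> XK; apply: (@le_lt_trans _ _ (leb_outer K)); first exact: le_leb_outer.
  by rewrite (leb_outer_mun ord0 mK) sqball_fin.
have [B' [mB' AB' EB']] := leb_hull (fin _ (@subIsetr _ A K)).
pose B := B' `&` K.
have mB : measurable B by exact: measurableI.
have AB : A `&` K `<=` B by move=> x AKx; split; [exact: AB'|case: AKx].
have EB : leb_outer B = leb_outer (A `&` K).
  apply/eqP; rewrite eq_le (le_leb_outer AB) andbT -EB'.
  by apply: le_leb_outer; exact: subIsetl.
have BA : B `&` A = A `&` K.
  apply/seteqP; split => x; first by move=> [[_ Kx] Ax].
  by move=> h; split; [exact: AB|case: h].
have n0 (X : set (V m.+1)) : (0 <= leb_outer X)%E.
  apply: le_ereal_inf_tmp => _ [a [b [ab _ ->]]]; apply: nneseries_ge0 => j _ _.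
  by rewrite lee_fin boxvol_ge0.
have D0 : leb_outer (B `&` ~` A) = 0%E.
  have f1 := fin _ (@subIsetr _ A K).
  move: (lA B); rewrite BA EB.
  case: (leb_outer (A `&` K)) f1 (n0 (A `&` K)) => [r| |] // _ _.
  case: (leb_outer (B `&` ~` A)) => [s| |] //; rewrite -EFinD => -[] rs; congr EFin.
  by apply: (addrI r); rewrite addr0 -rs.
have [Z [mZ DZ EZ]] : exists Z : set (V m.+1),
    [/\ measurable Z, B `&` ~` A `<=` Z & leb_outer Z = leb_outer (B `&` ~` A)].
  by apply: leb_hull; rewrite D0.
exists (B, Z); split => //=.
  by rewrite -(leb_outer_mun ord0 mZ) EZ.
by move=> x Bx; have [Ax|nAx] := pselect (A x); [left|right; apply: DZ].
Qed.

                                                                                                           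
(** Take such pieces for all rational levels and all balls of integer squared radius, collect their
    null parts in [Z], and set [g] to 0 on [Z]. Superlevel sets at nonnegative levels are then
    countable unions of Borel pieces outside [Z]. *)
Lemma borel_version (f : V m.+1 -> R) : (forall x, 0 <= f x) -> lmeasurable_fun f ->
  exists (g : V m.+1 -> R) (Z : set (V m.+1)), [/\ measurable_fun setT g, forall x, 0 <= g x,
    measurable Z, mu Z = 0%E & forall x, ~ Z x -> g x = f x].
Proof.
move=> f0 mf.
(* Enumerates the rationals; an index coding no rational gives the level 0, which does no harm since
   every level has its pieces. *)
pose d (i : nat) : R := if unpickle i is Some q then ratr (q : rat) else 0.
have ex (z : nat * nat) := lmeasurable_piece z.2 (mf (d z.1)).
have [P hP] := choice ex.
pose Z := \bigcup_i \bigcup_k (P (i, k)).2.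
have mZ' i : measurable (\bigcup_k (P (i, k)).2).
  by apply: bigcupT_measurable => k; have [] := hP (i, k).
have mZ : measurable Z by exact: bigcupT_measurable.
have null (F : nat -> set (V m.+1)) : (forall i, measurable (F i)) -> (forall i, mu (F i) = 0%E) ->
    mu (\bigcup_i F i) = 0%E.
  move=> mF F0; apply/eqP; rewrite eq_le measure_ge0 andbT.
  apply: (@le_trans _ _ (\sum_(0 <= i <oo) mu (F i))%E).
    by apply: measure_sigma_subadditive => //; exact: bigcupT_measurable.
  by rewrite eseries0// => i _ _; exact: F0.
have Z0 : mu Z = 0%E.
  apply: (null _ mZ') => i; apply: (null (fun k => (P (i, k)).2)) => k; by have [] := hP (i, k).
pose g x : R := if x \in Z then 0 else f x.
exists g, Z; split => //; last first.
- by move=> x nZ; rewrite /g memNset.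
- by move=> x; rewrite /g; case: ifP.
apply: measurable_fun_gt => t.
have [t0|t0] := ltP t 0.
  rewrite (_ : [set x | _] = setT) //; apply/seteqP; split => // x _ /=.
  by apply: (lt_le_trans t0); rewrite /g; case: ifP.
pose B i := (\bigcup_k (P (i, k)).1) `\` Z.
have mB i : measurable (B i).
  by apply: measurableD => //; apply: bigcupT_measurable => k; have [] := hP (i, k).
have -> : [set x | t < g x] = \bigcup_(i in [set i | t < d i]) B i.
  apply/seteqP; split => x /=.
    rewrite /g; case: ifPn => [_|]; first by rewrite ltNge t0.
    rewrite notin_setE => nZ tf.
    have [q] := rat_in_itvoo tf; rewrite in_itv/= => /andP[tq qf].
    exists (pickle q); first by rewrite /= /d pickleK.
    split => //; pose k := (Num.truncn (dotp x x)).+1.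
    exists k => //; have [_ _ _ + _] := hP (pickle q, k); apply; split.
      by rewrite /d pickleK.
    by rewrite /sqball/= truncnS_gt.
  move=> [i /= ti [[k _ Px] nZ]]; rewrite /g memNset//; apply: (lt_trans ti).
  have [_ _ _ _ /(_ x Px)[//|Z2]] := hP (i, k).
  by exfalso; apply: nZ; exists i => //; exists k.
by apply: bigcup_measurable => i _; exact: mB.
Qed.

End borel_version.

                               

(** * The two volumes as exponential integrals *)

Lemma integral_pw_prod d (T : measurableType d) (R : realType)
    (mu : {sigma_finite_measure set T -> \bar R}) (h : T -> R) (c : R) N :
  measurable_fun setT h -> (forall x, 0 <= h x) -> (\int[mu]_x (h x)%:E = c%:E)%E ->
  (\int[pw mu N]_Y (\prod_(k < N) h (Y k))%:E = (c ^+ N)%:E)%E.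
Proof.
move=> mh h0 hc.
have mprod n : measurable_fun setT (fun Y : fvec T 'I_n => (\prod_(k < n) h (Y k))%:E).
  apply/measurable_EFinP/measurable_prod_cond => k.
  by apply: measurableT_comp => //; exact: measurable_coord.
have prod0 n (Y : fvec T 'I_n) : (0 <= (\prod_(k < n) h (Y k))%:E)%E.
  by rewrite lee_fin prodr_ge0.
elim: N => [|N ih].
  rewrite /= integral_dirac//; last exact: mprod.
  by rewrite diracT mul1e big_ord0 expr0.
have c0 : 0 <= c by rewrite -lee_fin -hc integral_ge0// => x _; rewrite lee_fin.
rewrite tonelli_pw//.
transitivity (\int[mu]_t ((c ^+ N)%:E * (h t)%:E))%E.
  apply: eq_integral => t _; rewrite -ih muleC.
  have ht : (0 <= (h t)%:E)%E by rewrite lee_fin.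
  rewrite -(ge0_integralZl (pw mu N) measurableT (mprod N) (fun Z _ => prod0 N Z) ht).
  apply: eq_integral => y _; rewrite -EFinM big_ord_recl vcons0; congr (_ * _)%:E.
  by apply: eq_bigr => k _; rewrite vconsS.
rewrite ge0_integralZl//.
- by rewrite hc -EFinM exprS mulrC.
- exact/measurable_EFinP.
- by move=> x _; rewrite lee_fin.
- by rewrite lee_fin exprn_ge0.
Qed.

Section functionals.
Context (R : realType).
Local Notation mR := (measurableTypeR R).
Local Notation V n := (fvec (measurableTypeR R) 'I_n).
Local Notation leb := (@lebesgue_measure R).
Variables (m : nat) (p : R).
Hypothesis p0 : 0 < p.
Local Notation mu := (mun R m.+1).

Lemma lint_mun (h : V m.+1 -> \bar R) : measurable_fun setT h -> (forall x, 0 <= h x)%E ->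
  (lint h = \int[mu]_x h x)%E.
Proof.
move=> mh h0; rewrite (layer_cake mu mh h0); apply: eq_integral => t _.
by rewrite (leb_outer_mun ord0)//; exact: measurable_superlevel.
Qed.

Lemma dotp_vscale (c : R) (x u : V m.+1) : 0 < c ->
  `|dotp x (vscale c u)| `^ p = c `^ p * `|dotp x u| `^ p.
Proof. by move=> c0; rewrite dotpZr normrM gtr0_norm// powRM// ltW. Qed.

Section first.
Variable g : V m.+1 -> R.
Hypotheses (mg : measurable_fun setT g) (g0 : forall x, 0 <= g x).

Lemma pmoment_hom c u : 0 < c -> pmoment p g (vscale c u) = ((c `^ p)%:E * pmoment p g u)%E.
Proof.
move=> c0; rewrite /pmoment -ge0_integralZl//.
- by apply: eq_integral => x _; rewrite -EFinM dotp_vscale// mulrA.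
- by apply/measurable_EFinP; exact: measurable_pmoment_fun.
- by move=> x _; rewrite lee_fin mulr_ge0// powR_ge0.
- by rewrite lee_fin powR_ge0.
Qed.

Lemma Zp_volE : (gamma_int (m.+1%:R / p) * Zp_vol p g = \int[mu]_u (nexp (pmoment p g u))%:E)%E.
Proof.
have M0 u := pmoment_ge0 p u g0.
have mM := measurable_pmoment p mg g0.
rewrite (nexp_volume p0 mM M0 pmoment_hom) -(starvolE p0 mM M0 pmoment_hom).
congr (_ * starvol _)%E; apply/funext => u; congr rad_of.
rewrite lint_mun//.
- by apply/measurable_EFinP; exact: measurable_pmoment_fun.
- by move=> x; rewrite lee_fin mulr_ge0// powR_ge0.
Qed.

End first.

Section second.
Variables (N : nat) (g : V m.+1 -> R).
Hypothesis N0 : (0 < N)%N.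
Hypotheses (mg : measurable_fun setT g) (g0 : forall x, 0 <= g x).
Hypothesis gi : (\int[mu]_x (g x)%:E < +oo)%E.
Local Notation T := (fvec mR ('I_N * 'I_m.+1)%type).
Local Notation Y := (fvec (V m.+1) 'I_N).

Let M (X : T) (u : V m.+1) : R := N%:R^-1 * \sum_(k < N) `|dotp (row_of X k) u| `^ p.

Let mrow k : measurable_fun setT (fun X : T => row_of X k : V m.+1).
Proof. by apply: measurable_fvecP => i; exact: measurable_coord. Qed.

Let mM2 : measurable_fun setT (fun z : T * V m.+1 => M z.1 z.2).
Proof.
apply: measurable_funM => //; apply: measurable_sum => k.
apply: (@measurableT_comp _ _ _ _ _ _ (fun x : R => x `^ p)); first exact: measurable_powR.
apply: measurableT_comp => //.
have mz : measurable_fun setT (fun z : T * V m.+1 => (row_of z.1 k : V m.+1, z.2)).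
  apply: measurable_fun_pair; last exact: measurable_snd.
  by apply: (measurableT_comp (mrow k)); exact: measurable_fst.
exact: (measurableT_comp (@measurable_dotp R m.+1) mz).
Qed.

Let mM X : measurable_fun setT (fun u : V m.+1 => (M X u)%:E).
Proof.
apply/measurable_EFinP.
have mX : measurable_fun setT (fun u : V m.+1 => (X, u)) by exact: pair1_measurable.
exact: (measurableT_comp mM2 mX).
Qed.

Let M0 X u : (0 <= (M X u)%:E)%E.
Proof.
rewrite lee_fin mulr_ge0 ?invr_ge0// sumr_ge0// => k _; exact: powR_ge0.
Qed.

Let Mhom X c u : 0 < c -> (M X (vscale c u))%:E = ((c `^ p)%:E * (M X u)%:E)%E.
Proof.
move=> c0; rewrite -EFinM; congr EFin; rewrite /M mulrCA; congr (_ * _).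
by rewrite mulr_sumr; apply: eq_bigr => k _; rewrite dotp_vscale.
Qed.

Let vol (X : T) : \bar R := mu [set u | ((M X u)%:E < 1)%E].

Let ZpN_volE X : ZpN_vol p X = vol X.
Proof. exact: (starvolE p0 (mM X) (M0 X) (@Mhom X)). Qed.

Let mvol : measurable_fun setT vol.
Proof.
pose S := [set z : T * V m.+1 | ((M z.1 z.2)%:E < 1)%E].
have mS : measurable S by apply: measurable_superlevel => //; exact/measurable_EFinP.
have -> : vol = (fun X => \int[mu]_u (\1_S (X, u))%:E)%E.
  apply/funext => X.
  transitivity (\int[mu]_u (\1_[set u : V m.+1 | ((M X u)%:E < 1)%E] u)%:E)%E.
    by rewrite integral_indic ?setIT//; apply: measurable_superlevel; [exact: mM|].
  apply: eq_integral => u _; rewrite !indicE.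
  by congr (nat_of_bool _)%:R%:E; apply/idP/idP; rewrite !inE.
apply: (@measurable_fun_fubini_tonelli_F _ _ _ _ _ mu (fun z => (\1_S z)%:E)).
  by apply/measurable_EFinP; exact: measurable_indic.
by move=> z; rewrite lee_fin.
Qed.

Let dens (X : T) : R := \prod_(k < N) g (row_of X k).

Let mdens : measurable_fun setT dens.
Proof. by apply: measurable_prod_cond => k; apply: (measurableT_comp mg); exact: mrow. Qed.

Let dens0 X : 0 <= dens X. Proof. exact: prodr_ge0. Qed.

Let P := pw mu N.

Let H (X : T) : \bar R := (vol X * (dens X)%:E)%E.

Let mH : measurable_fun setT H.
Proof. by apply: emeasurable_funM => //; exact/measurable_EFinP. Qed.

Let H0 X : (0 <= H X)%E.
Proof. by apply: mule_ge0; [exact: measure_ge0|rewrite lee_fin]. Qed.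

Lemma EZpN_vol_pw : (EZpN_vol p N g = \int[P]_Y H (uncur Y))%E.
Proof.
have mHu : measurable_fun setT (fun Z : Y => H (uncur Z)).
  by apply: (measurableT_comp mH); exact: measurable_uncur.
rewrite (layer_cake P mHu (fun Z => H0 _)).
apply: eq_integral => t _.
have -> : [set X : 'I_N * 'I_m.+1 -> R | (t%:E < ZpN_vol p X * (\prod_(k < N) g (row_of X k))%:E)%E] =
    [set X : T | (t%:E < H X)%E] by apply/seteqP; split => X; rewrite /= ZpN_volE.
rewrite (leb_outer_pw (Ordinal N0) ord0)//.
exact: measurable_superlevel.
Qed.

Let c (u : V m.+1) := cint g (stable p N%:R^-1) u.

(** [nexp_volume] for each sample, then Tonelli: for fixed [u] the exponential of minus the average
    of the p-th powers is a product over the sample, so its integral against the product density is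
    an N-th power. *)
Lemma EZpN_volE :
  (gamma_int (m.+1%:R / p) * EZpN_vol p N g = \int[mu]_u (c u ^+ N)%:E)%E.
Proof.
have N0' : 0 < N%:R :> R by rewrite ltr0n.
have iN0 : 0 <= (N%:R^-1 : R) by rewrite invr_ge0.
pose F (z : Y * V m.+1) : \bar R :=
  (\prod_(k < N) (g (z.1 k) * stable p N%:R^-1 (dotp (z.1 k) z.2)))%:E.
have FE Z u : F (Z, u) = ((nexp (M (uncur Z) u)%:E)%:E * (dens (uncur Z))%:E)%E.
  rewrite /F /= big_split/= -EFinM mulrC nexpE; congr ((_ * _)%:E).
  rewrite -expR_sum; congr expR; rewrite /M mulr_sumr -sumrN.
  exact: eq_bigr.
have mc k : measurable_fun setT (fun Z : Y => Z k) by exact: measurable_coord.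
have ms := measurable_stable p (N%:R^-1).
have mF : measurable_fun setT F.
  apply/measurable_EFinP/measurable_prod_cond => k; apply: measurable_funM.
    by apply: (measurableT_comp mg); apply: (measurableT_comp (mc k)); exact: measurable_fst.
  apply: (measurableT_comp ms).
  have mz : measurable_fun setT (fun z : Y * V m.+1 => (z.1 k, z.2)).
    apply: measurable_fun_pair; last exact: measurable_snd.
    by apply: (measurableT_comp (mc k)); exact: measurable_fst.
  exact: (measurableT_comp (@measurable_dotp R m.+1) mz).
have F0 z : (0 <= F z)%E.
  by rewrite lee_fin prodr_ge0// => k _; rewrite mulr_ge0// expR_ge0.
have mHu : measurable_fun setT (fun Z : Y => H (uncur Z)).
  by apply: (measurableT_comp mH); exact: measurable_uncur.
have gam0 : (0 <= gamma_int (m.+1%:R / p) :> \bar R)%E.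
  by apply: ltW; apply: gamma_int_gt0; rewrite divr_gt0.
rewrite EZpN_vol_pw -(ge0_integralZl P measurableT mHu (fun Z _ => H0 _) gam0).
transitivity (\int[P]_Z \int[mu]_u F (Z, u))%E.
  apply: eq_integral => Z _; rewrite /H muleA.
  rewrite -(nexp_volume p0 (mM (uncur Z)) (M0 (uncur Z)) (@Mhom (uncur Z))).
  rewrite -ge0_integralZr//.
  - by apply: eq_integral => u _; rewrite FE.
  - by apply/measurable_EFinP; exact: (measurable_nexp (mM (uncur Z))).
  - by move=> u _; rewrite lee_fin nexp_ge0.
  - by rewrite lee_fin.
rewrite (@fubini_tonelli _ _ _ _ _ P mu F mF F0).
apply: eq_integral => u _.
have mh : measurable_fun setT (fun x : V m.+1 => g x * stable p N%:R^-1 (dotp x u)).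
  by apply: measurable_funM => //; apply: (measurableT_comp ms); exact: measurable_dotpl.
apply: (integral_pw_prod N mh).
- by move=> x; rewrite mulr_ge0// expR_ge0.
- by rewrite (cintE mg g0 gi u ms (fun t => stable01 p t iN0)).
Qed.

End second.
End functionals.

(** * Passing between almost everywhere equal densities, and the conclusion *)

Section transfer.
Context (R : realType).
Local Notation mR := (measurableTypeR R).
Local Notation V n := (fvec (measurableTypeR R) 'I_n).
Variables (m : nat) (f g : V m.+1 -> R) (Z : set (V m.+1)).
Local Notation mu := (mun R m.+1).
Hypotheses (mZ : measurable Z) (Z0 : mu Z = 0%E) (gf : forall x, ~ Z x -> g x = f x).

Let lZ0 : leb_outer Z = 0%E. Proof. by rewrite (leb_outer_mun ord0 mZ). Qed.

Lemma leb_outer_gt t : leb_outer [set x | t < f x] = leb_outer [set x | t < g x].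
Proof. by apply: (leb_outer_null ord0 mZ lZ0) => x nZ; rewrite /= gf. Qed.

Lemma sdr_ae : sdr f = sdr g.
Proof.
apply/funext => x; rewrite /sdr; congr fine; apply: eq_integral => t _.
by rewrite /ball_rearr leb_outer_gt.
Qed.

Lemma lint_ae (h : V m.+1 -> R -> \bar R) : lint (fun x => h x (f x)) = lint (fun x => h x (g x)).
Proof.
apply: eq_integral => t _.
by apply: (leb_outer_null ord0 mZ lZ0) => x nZ; rewrite /= gf.
Qed.

Lemma Zp_vol_ae p : Zp_vol p f = Zp_vol p g.
Proof.
rewrite /Zp_vol; congr starvol; apply/funext => u; congr rad_of.
exact: (lint_ae (fun x y => ((`|dotp x u| `^ p) * y)%:E)).
Qed.

(** The product densities can differ only when some sample vector falls in [Z], which describes a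
    null set of samples. *)
Lemma EZpN_vol_ae p N : (0 < N)%N -> EZpN_vol p N f = EZpN_vol p N g.
Proof.
move=> N0.
pose W := \bigcup_(k in [set: 'I_N]) [set X : fvec mR ('I_N * 'I_m.+1)%type | Z (row_of X k)].
have mW : measurable W.
  apply: fin_bigcup_measurable => [|k _]; first exact: finite_finset.
  have mr : measurable_fun setT (fun X : fvec mR ('I_N * 'I_m.+1)%type => row_of X k : V m.+1).
    by apply: measurable_fvecP => i; exact: measurable_coord.
  by rewrite -[X in measurable X]setTI; exact: mr.
have W0 : leb_outer W = 0%E.
  rewrite (leb_outer_pw (Ordinal N0) ord0 mW).
  have mk k : measurable [set Y : fvec (V m.+1) 'I_N | Z (Y k)].
    rewrite -[X in measurable X]setTI; exact: (measurable_coord k).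
  have null k : pw mu N [set Y : fvec (V m.+1) 'I_N | Z (Y k)] = 0%E.
    pose B (j : 'I_N) : set (V m.+1) := if j == k then Z else setT.
    have mB j : measurable (B j) by rewrite /B; case: ifP.
    have -> : [set Y : fvec (V m.+1) 'I_N | Z (Y k)] = [set Y | forall j, B j (Y j)].
      apply/seteqP; split => Y /= h; last by have := h k; rewrite /B eqxx.
      by move=> j; rewrite /B; case: ifP => // /eqP ->.
    rewrite pw_box// (bigD1 k)//= {1}/B eqxx.
    by rewrite [X in (X * _)%E](Z0 : mu Z = 0%E) mul0e.
  apply/eqP; rewrite eq_le measure_ge0 andbT.
  have -> : @uncur R N m.+1 @^-1` W = \big[setU/set0]_(k < N) [set Y : fvec (V m.+1) 'I_N | Z (Y k)].
    rewrite -bigcup_seq; apply/seteqP; split => Y /=.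
      by move=> [k _ h]; exists k => //=; rewrite mem_index_enum.
    by move=> [k _ h]; exists k.
  suff [] : measurable (\big[setU/set0]_(k < N) [set Y : fvec (V m.+1) 'I_N | Z (Y k)]) /\
    (pw mu N (\big[setU/set0]_(k < N) [set Y : fvec (V m.+1) 'I_N | Z (Y k)]) <= 0)%E by [].
  apply: (big_ind (fun S : set (fvec (V m.+1) 'I_N) => measurable S /\ (pw mu N S <= 0)%E)).
  - by split; [exact: measurable0|rewrite measure0].
  - move=> A B [mA A0] [mB B0]; split; first exact: measurableU.
    by apply: (le_trans (measureU2 (pw mu N) mA mB)); rewrite -(adde0 0%E); exact: leeD.
  - by move=> k _; split; [exact: mk|rewrite null].
apply: eq_integral => t _.
apply: (leb_outer_null (Ordinal N0, ord0) mW W0) => X nW /=.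
suff -> : \prod_(k < N) f (row_of X k) = \prod_(k < N) g (row_of X k) by [].
by apply: eq_bigr => k _; rewrite gf// => Zk; apply: nW; exists k.
Qed.

End transfer.

Theorem theorem2p1 (R : realType) (n N : nat) (p : R)
    (f : ('I_n -> R) -> R) :
  (0 < n)%N -> Pdens f -> 0 < p < 1 -> (n < N)%N ->
  (Zp_vol p f <= Zp_vol p (sdr f))%E /\
  (EZpN_vol p N f <= EZpN_vol p N (sdr f))%E.
Proof.
case: n f => [f|m f _ [f0 mf fi [M fM]] /andP[p0 p1] nN]; first by rewrite ltnn.
have N0 : (0 < N)%N by exact: leq_ltn_trans nN.
(* From here on [f] is replaced by a Borel version [g]; neither the volumes nor the rearrangement
   change. *)
have [g [Z [mg g0 mZ Z0 gf]]] := borel_version f0 mf.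
have mE (h : fvec (measurableTypeR R) 'I_m.+1 -> R) : measurable_fun setT h ->
  measurable_fun setT (fun x => (h x)%:E) by move=> ?; exact/measurable_EFinP.
have gi : (\int[mun R m.+1]_x (g x)%:E = 1)%E.
  rewrite -(lint_mun (mE _ mg)); last by move=> x; rewrite lee_fin.
  by rewrite -fi (lint_ae mZ Z0 gf (fun _ y => y%:E)).
have gM : mun R m.+1 [set x | M < g x] = 0%E.
  by rewrite -(leb_outer_mun ord0 (measurable_gt mg M)) -(leb_outer_gt mZ Z0 gf).
rewrite (sdr_ae mZ Z0 gf) (Zp_vol_ae mZ Z0 gf) (EZpN_vol_ae mZ Z0 gf p N0).
have ms := measurable_sdr mg.
have s0 := sdr_ge0 g.
have si := integral_sdr mg g0 gi gM.
have ls := layer_sdr mg g0 gi gM.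
have p02 : 0 < p < 2 by rewrite p0/=; lra.
have w0 : 0 < m.+1%:R / p by rewrite divr_gt0.
have G0 := gamma_int_gt0 w0.
have Gf : gamma_int (m.+1%:R / p) \is a fin_num.
  by rewrite ge0_fin_numE ?ltW//; exact: gamma_int_fin.
have fin (h : fvec (measurableTypeR R) 'I_m.+1 -> R) :
  (\int[mun R m.+1]_x (h x)%:E = 1 -> \int[mun R m.+1]_x (h x)%:E < +oo)%E by move=> ->; rewrite ltry.
have H1 : (gamma_int (m.+1%:R / p) * Zp_vol p g <= gamma_int (m.+1%:R / p) * Zp_vol p (sdr g))%E.
  have E1 := Zp_volE p0 mg g0.
  have E2 := Zp_volE p0 ms s0.
  have H := moment_rearr p02 mg g0 ms s0 gi si ls.
  rewrite -E1 -E2 in H; exact: H.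
have H2 : (gamma_int (m.+1%:R / p) * EZpN_vol p N g <= gamma_int (m.+1%:R / p) * EZpN_vol p N (sdr g))%E.
  have E1 := EZpN_volE p0 N0 mg g0 (fin _ gi).
  have E2 := EZpN_volE p0 N0 ms s0 (fin _ si).
  have N1 : 0 <= (N%:R^-1 : R) by rewrite invr_ge0.
  have H := stable_rearr p02 mg g0 ms s0 gi si ls N N1.
  rewrite -E1 -E2 in H; exact: H.
(* The common constant is positive and finite, so it cancels even if the volumes are infinite. *)
by split; rewrite -(lee_pmul2l Gf G0).
Qed.
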